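(* Let $\Sigma_1$ and $\Sigma_2$ be spherically symmetric spacelike hypersurfaces in the exterior region of the Schwarzschild spacetime such that $\Sigma_2$ lies in the future of $\Sigma_1$ and $\Sigma_2\cup -\Sigma_1$ is the oriented boundary of a spacetime region $\Omega$. If the real $2$-form $F_{ab}=F_{[ab]}$ is a (smooth) solution of the Maxwell equations $$\nabla^a F_{ab}=0,\qquad \nabla_{[c}F_{ab]}=0$$ on the Schwarzschild exterior, and $Z_{ab}$, $\beta_a$ are the fields defined from $F_{ab}$ in the context, then $$E_{\xi}(\Sigma_2)=E_{\xi}(\Sigma_1),$$ $$\int_{\Omega} \Big(\vert \beta_{a}\vert^2_{1,\mathrm{deg}}+\frac{2 M}{25 r^4}\vert Z_{ab}\vert^2_{2}\Big)\, d\mu_{\Omega}\leq \frac{72}{5}E_{\xi}(\Sigma_1),$$ where $$\vert \beta_{a}\vert^2_{1,\mathrm{deg}}=\frac{(r - 3 M)^2}{r^3}\bigl(|\beta_{\widehat X}|^2 + |\beta_{\widehat Y}|^2\bigr)+ \frac{M(r - 2 M)}{r^3}|\beta_{\widehat Z}|^2+ \frac{M(r - 3 M)^2 (r - 2 M)}{r^5}|\beta_{\widehat T}|^2,$$ $$\vert Z_{ab}\vert^2_{2}= \frac{r - 2 M}{r}\, \mathbf{W}_{\widehat T\widehat T}.$$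
   Context: The Schwarzschild exterior ($M>0$) is $\{(t,r,\theta,\phi)\in \mathbb{R}\times(2M,\infty)\times[0,\pi]\times[0,2\pi)\}$ with metric $$g_{ab}dx^adx^b=(1-2M/r)dt^2-(1-2M/r)^{-1}dr^2-r^2(d\theta^2+\sin^2\theta\, d\phi^2)$$ (signature $+---$; timelike means $v^av_a>0$), time-oriented by $\partial_t$. All fields are assumed smooth. $\xi^a=(\partial_t)^a$. Orthonormal frame: $\widehat T^a=(1-2M/r)^{-1/2}(\partial_t)^a$, $\widehat X^a=r^{-1}(\partial_\theta)^a$, $\widehat Y^a=r^{-1}\csc\theta(\partial_\phi)^a$, $\widehat Z^a=(1-2M/r)^{1/2}(\partial_r)^a$. For a $1$-form $\beta_a$ write $\beta_\nu=\beta_a\nu^a$, and for a $2$-tensor $\mathbf{W}_{\widehat T\widehat T}=\mathbf{W}_{ab}\widehat T^a\widehat T^b$. Let $*$ denote the Hodge dual on $2$-forms, ${*}F_{ab}=\tfrac12\epsilon_{abcd}F^{cd}$ (the quantities $\mathbf{H}_{ab},\mathbf{W}_{ab}$ below do not depend on the choice of orientation). Square and round brackets on indices denote (normalized) antisymmetrization and symmetrization. Put $$Y_{ab}=-2r^3\sin\theta\, d\theta_{[a}d\phi_{b]},\qquad U_a=-r^{-1}\nabla_a r,\qquad Z_{ab}=-\tfrac43\,{*}F_{[a}{}^{c}Y_{b]c},$$ $$\beta_a=-\tfrac12U^bZ_{ab}-\tfrac12 i\,U^b\,{*}Z_{ab}-\tfrac12\nabla_bZ_a{}^b-\tfrac12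 i\,\nabla_b{*}Z_a{}^b,$$ $$\mathbf{H}_{ab}=\beta_{(a}\bar\beta_{b)}-\tfrac12g_{ab}\beta^c\bar\beta_c,\qquad \mathbf{W}_{ab}=-\tfrac12Z_a{}^cZ_{bc}+\tfrac18g_{ab}Z_{cd}Z^{cd}.$$ For a spacelike hypersurface $\Sigma$ with future-directed unit normal $N^a$ and induced volume element $d\mu_\Sigma$, $$E_\xi(\Sigma)=\int_\Sigma \mathbf{H}_{ab}\xi^bN^a\,d\mu_\Sigma.$$ $d\mu_\Omega$ is the spacetime volume element.
   Formalization: The boundary of Ω is required to be Σ1 and Σ2 also in the Penrose compactification, so no part of the horizon or null infinity bounds Ω; otherwise energy could leak (e.g. Σ2 hyperboloidal) and E(Σ2)=E(Σ1) would fail. *)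

(* Defs.v *)
From HB Require Import structures.
From mathcomp Require Import all_boot all_order all_algebra.
From mathcomp Require Import all_classical all_reals all_analysis.
From mathcomp Require Import complex.

Set Implicit Arguments.
Unset Strict Implicit.
Unset Printing Implicit Defensive.

Import Order.TTheory GRing.Theory Num.Theory.
Import numFieldNormedType.Exports.

Local Open Scope classical_set_scope.
Local Open Scope ring_scope.

Definition i0 : 'I_4 := Ordinal (isT : (0 < 4)%N).
Definition i1 : 'I_4 := Ordinal (isT : (1 < 4)%N).
Definition i2 : 'I_4 := Ordinal (isT : (2 < 4)%N).
Definition i3 : 'I_4 := Ordinal (isT : (3 < 4)%N).

Section Calculus.
Variable R : realType.

Definition point4 (x0 x1 x2 x3 : R) : 'rV[R]_4 :=
  \row_(j < 4) [:: x0; x1; x2; x3]`_j.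

Definition vector4 (x0 x1 x2 x3 : R) : 'I_4 -> R :=
  fun a => [:: x0; x1; x2; x3]`_a.

Definition partial (k : 'I_4) (f : 'rV[R]_4 -> R) : 'rV[R]_4 -> R :=
  fun x => 'D_(delta_mx 0 k) f x.

(* C^oo on an open set A: all iterated partial derivatives are (Frechet)
   differentiable at every point of A. *)
Definition smooth_on (A : set 'rV[R]_4) (f : 'rV[R]_4 -> R) : Prop :=
  forall (ks : seq 'I_4) (x : 'rV[R]_4),
    A x -> differentiable (foldr partial f ks) x.

Definition smooth1 (f : R -> R) : Prop :=
  forall (n : nat) (s : R), derivable (derive1n n f) s 1.

(* Covariant tensor fields are given by their components in a coordinate
   system; index positions are recorded in the names only. *)
Definition tensor1 := 'rV[R]_4 -> 'I_4 -> R.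
Definition tensor2 := 'rV[R]_4 -> 'I_4 -> 'I_4 -> R.
Definition tensor3 := 'rV[R]_4 -> 'I_4 -> 'I_4 -> 'I_4 -> R.

Definition alt2 (T : 'I_4 -> 'I_4 -> R) (a b : 'I_4) : R :=
  (T a b - T b a) / 2.

Definition alt3 (T : 'I_4 -> 'I_4 -> 'I_4 -> R) (a b c : 'I_4) : R :=
  (T a b c + T b c a + T c a b - T a c b - T c b a - T b a c) / 6.

(* Levi-Civita symbol, [0123] = 1. *)
Definition perm_symbol (a b c d : 'I_4) : R :=
  \det (\matrix_(i < 4, j < 4) ((nth i0 [:: a; b; c; d] i == j)%:R : R)).

End Calculus.

Section Geometry.
Variables (R : realType) (M : R).
Implicit Types (p : 'rV[R]_4) (F Z : tensor2 R).

(* The manifold R x (2M, oo) x S^2 is the open subset |x| > 2M of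
   R^4 = {(t, x)}, x = r (sin th cos ph, sin th sin ph, cos th).  Smoothness,
   at the poles in particular, refers to this global chart; all the other
   definitions use the coordinates (t, r, th, ph) on 0 < th < pi. *)
Definition exterior : set 'rV[R]_4 :=
  [set y | 2 * M < Num.sqrt (y 0 i1 ^+ 2 + y 0 i2 ^+ 2 + y 0 i3 ^+ 2)].

Definition spherical : set 'rV[R]_4 :=
  [set p | 2 * M < p 0 i1 /\ 0 < p 0 i2 < pi].

Definition cartesian (p : 'rV[R]_4) : 'rV[R]_4 :=
  point4 (p 0 i0)
         (p 0 i1 * sin (p 0 i2) * cos (p 0 i3))
         (p 0 i1 * sin (p 0 i2) * sin (p 0 i3))
         (p 0 i1 * cos (p 0 i2)).

Definition smooth_2form (G : tensor2 R) : Prop :=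
  (forall a b, smooth_on exterior (fun y => G y a b)) /\
  (forall y a b, exterior y -> G y b a = - G y a b).

(* Spherical components of the 2-form with components G in the global chart. *)
Definition pullback (G : tensor2 R) : tensor2 R := fun p a b =>
  \sum_(c < 4) \sum_(d < 4)
    partial a (fun q => cartesian q 0 c) p *
    partial b (fun q => cartesian q 0 d) p * G (cartesian p) c d.

Definition lapse2 (r : R) : R := 1 - 2 * M / r.

Definition metric (p : 'rV[R]_4) : 'M[R]_4 :=
  diag_mx (point4 (lapse2 (p 0 i1)) (- (lapse2 (p 0 i1))^-1)
                  (- p 0 i1 ^+ 2) (- (p 0 i1 ^+ 2 * sin (p 0 i2) ^+ 2))).

Definition g p (a b : 'I_4) : R := metric p a b.
Definition ginv p (a b : 'I_4) : R := invmx (metric p) a b.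

Definition inner p (v w : 'I_4 -> R) : R :=
  \sum_(a < 4) \sum_(b < 4) g p a b * v a * w b.

(* christoffel p c a b is Gamma^c_ab. *)
Definition christoffel p (c a b : 'I_4) : R :=
  2^-1 * \sum_(d < 4) ginv p c d *
    (partial a (fun q => g q d b) p + partial b (fun q => g q d a) p
     - partial d (fun q => g q a b) p).

(* nabla Z p c a b is nabla_c Z_ab. *)
Definition nabla (Z : tensor2 R) : tensor3 R := fun p c a b =>
  partial c (fun q => Z q a b) p
  - \sum_(d < 4) christoffel p d c a * Z p d b
  - \sum_(d < 4) christoffel p d c b * Z p a d.

Definition divergence (Z : tensor2 R) : tensor1 R := fun p a =>
  \sum_(b < 4) \sum_(c < 4) ginv p b c * nabla Z p b a c.

Definition epsilon p (a b c d : 'I_4) : R :=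
  Num.sqrt `|\det (metric p)| * perm_symbol R a b c d.

Definition raise2 (Z : tensor2 R) : tensor2 R := fun p c d =>
  \sum_(a < 4) \sum_(b < 4) ginv p c a * ginv p d b * Z p a b.

(* raise_snd Z p a c is Z_a^c. *)
Definition raise_snd (Z : tensor2 R) : tensor2 R := fun p a c =>
  \sum_(d < 4) Z p a d * ginv p d c.

Definition hodge (Z : tensor2 R) : tensor2 R := fun p a b =>
  2^-1 * \sum_(c < 4) \sum_(d < 4) epsilon p a b c d * raise2 Z p c d.

Definition maxwell (F : tensor2 R) : Prop :=
  forall p, spherical p ->
    (forall b, \sum_(a < 4) \sum_(c < 4) ginv p a c * nabla F p c a b = 0) /\
    (forall c a b, alt3 (nabla F p) c a b = 0).

Definition Y : tensor2 R := fun p a b =>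
  - 2 * p 0 i1 ^+ 3 * sin (p 0 i2) *
  alt2 (fun c d => (c == i2)%:R * (d == i3)%:R) a b.

Definition U : tensor1 R := fun p a =>
  - (p 0 i1)^-1 * partial a (fun q => q 0 i1) p.

Definition Uup : tensor1 R := fun p b => \sum_(a < 4) ginv p b a * U p a.

Definition Zfield (F : tensor2 R) : tensor2 R := fun p a b =>
  - (4 / 3) *
  alt2 (fun a' b' => \sum_(c < 4) raise_snd (hodge F) p a' c * Y p b' c) a b.

(* x +i* y is the complex number x + i y. *)
Definition beta (F : tensor2 R) (p : 'rV[R]_4) (a : 'I_4) : R[i] :=
  let Z := Zfield F in
  ((- 2^-1 * (\sum_(b < 4) Uup p b * Z p a b) - 2^-1 * divergence Z p a)
   +i*
   (- 2^-1 * (\sum_(b < 4) Uup p b * hodge Z p a b)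
    - 2^-1 * divergence (hodge Z) p a))%C.

(* H_ab is real; it is kept R[i]-valued. *)
Definition Hfield (F : tensor2 R) (p : 'rV[R]_4) (a b : 'I_4) : R[i] :=
  (2^-1 * (beta F p a * conjc (beta F p b) + beta F p b * conjc (beta F p a))
   - 2^-1 * (g p a b)%:C *
     \sum_(c < 4) \sum_(d < 4)
       (ginv p c d)%:C * beta F p c * conjc (beta F p d))%C.

Definition Wfield (F : tensor2 R) : tensor2 R := fun p a b =>
  let Z := Zfield F in
  - 2^-1 * (\sum_(c < 4) raise_snd Z p a c * Z p b c)
  + 8^-1 * g p a b * (\sum_(c < 4) \sum_(d < 4) Z p c d * raise2 Z p c d).

Definition xi : 'I_4 -> R := vector4 1 0 0 0.
Definition That p := vector4 (Num.sqrt (lapse2 (p 0 i1)))^-1 0 0 0.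
Definition Xhat p := vector4 0 0 (p 0 i1)^-1 0.
Definition Yhat p := vector4 0 0 0 ((p 0 i1)^-1 * (sin (p 0 i2))^-1).
Definition Zhat p := vector4 0 (Num.sqrt (lapse2 (p 0 i1))) 0 0.

Definition sqmod (z : R[i]) : R := complex.Re z ^+ 2 + complex.Im z ^+ 2.

(* |beta_nu|^2 *)
Definition beta2 (F : tensor2 R) p (nu : 'I_4 -> R) : R :=
  sqmod (\sum_(a < 4) beta F p a * ((nu a)%:C)%C).

Definition beta_deg (F : tensor2 R) p : R :=
  let r := p 0 i1 in
  (r - 3 * M) ^+ 2 / r ^+ 3 * (beta2 F p (Xhat p) + beta2 F p (Yhat p))
  + M * (r - 2 * M) / r ^+ 3 * beta2 F p (Zhat p)
  + M * (r - 3 * M) ^+ 2 * (r - 2 * M) / r ^+ 5 * beta2 F p (That p).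

Definition Z2 (F : tensor2 R) p : R :=
  (p 0 i1 - 2 * M) / p 0 i1 *
  \sum_(a < 4) \sum_(b < 4) Wfield F p a b * That p a * That p b.

End Geometry.

(* A (connected) spherically symmetric hypersurface: the union of the orbit
   spheres over a curve s |-> (t, r) = (curve_t s, curve_r s), s in R. *)
Record sph_surface (R : realType) := SphSurface {
  curve_t : R -> R;
  curve_r : R -> R }.

Section Surfaces.
Variables (R : realType) (M : R).
Implicit Types (S : sph_surface R).

Definition embed S (s th ph : R) : 'rV[R]_4 :=
  point4 (curve_t S s) (curve_r S s) th ph.

(* Tangent vectors d/ds, d/dth, d/dph of the embedding. *)
Definition tangent S (s : R) (i : 'I_3) : 'I_4 -> R :=
  nth (vector4 0 0 0 0)
    [:: vector4 (derive1 (curve_t S) s) (derive1 (curve_r S) s) 0 0;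
        vector4 0 0 1 0; vector4 0 0 0 1] i.

Definition induced_metric S (s th ph : R) : 'M[R]_3 :=
  \matrix_(i < 3, j < 3)
    inner M (embed S s th ph) (tangent S s i) (tangent S s j).

Definition spacelike_surface S : Prop :=
  [/\ smooth1 (curve_t S), smooth1 (curve_r S),
      forall s, 2 * M < curve_r S s &
      forall s th ph (v : 'rV[R]_3), 0 < th < pi -> v != 0 ->
        (v *m induced_metric S s th ph *m v^T) 0 0 < 0].

Definition future_unit_normal S (N : R -> R -> R -> 'I_4 -> R) : Prop :=
  forall s th ph, 0 < th < pi ->
    let p := embed S s th ph in
    [/\ inner M p (N s th ph) (N s th ph) = 1,
        forall i, inner M p (N s th ph) (tangent S s i) = 0 &
        0 < inner M p (N s th ph) (xi R)].

Local Notation mu := (@lebesgue_measure R).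

Definition energy (F : tensor2 R) S (N : R -> R -> R -> 'I_4 -> R) : \bar R :=
  (\int[mu]_(s in [set: R]) \int[mu]_(th in `]0%R, pi[%classic)
   \int[mu]_(ph in `[0%R, (2 * pi)%R[%classic)
     (complex.Re (\sum_(a < 4) \sum_(b < 4)
         Hfield M F (embed S s th ph) a b *
         ((xi R b)%:C)%C * ((N s th ph a)%:C)%C)
      * Num.sqrt `|\det (induced_metric S s th ph)|)%R%:E)%E.

Definition tortoise (r : R) : R := r + 2 * M * ln (r / (2 * M) - 1).
Definition null_u (q : R * R) : R := q.1 - tortoise q.2.
Definition null_v (q : R * R) : R := q.1 + tortoise q.2.

Definition curve S (s : R) : R * R := (curve_t S s, curve_r S s).

(* S2 is contained in J^+(S1): in the orbit space, with metric
   (1 - 2M/r) du dv and u, v increasing to the future, q is in J^+(q') iff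
   u(q') <= u(q) and v(q') <= v(q). *)
Definition in_future S1 S2 : Prop :=
  forall s2, exists s1,
    null_u (curve S1 s1) <= null_u (curve S2 s2) /\
    null_v (curve S1 s1) <= null_v (curve S2 s2).

(* The Penrose diagram: (t, r) |-> (atan u, atan v) maps the orbit space of
   the exterior onto an open square, whose edges represent the horizons and
   null infinity and whose corners include the bifurcation sphere and i^0. *)
Definition penrose (q : R * R) : R * R := (atan (null_u q), atan (null_v q)).

(* Omega is an (open) region of the orbit space standing for its preimage in
   the exterior.  Its boundary is taken in the closed Penrose square: besides
   S1 and S2 it may contain only their end points.  In the exterior itself,
   i.e. without the ideal points, the condition would allow Omega to be bounded
   by portions of null infinity or of the horizon, through which energy
   escapes.  The orientation of the boundary is that given by in_future. *)
Definition region_between (Omega : set (R * R)) S1 S2 : Prop :=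
  [/\ open Omega,
      Omega `<=` [set q | 2 * M < q.2] &
      closure (penrose @` Omega) `\` interior (penrose @` Omega) =
      closure (range (penrose \o curve S1)) `|`
      closure (range (penrose \o curve S2))].

Definition bulk (F : tensor2 R) (Omega : set (R * R)) : \bar R :=
  (\int[mu]_(t in [set: R]) \int[mu]_(r in xsection Omega t)
   \int[mu]_(th in `]0%R, pi[%classic)
   \int[mu]_(ph in `[0%R, (2 * pi)%R[%classic)
     (let p := point4 t r th ph in
      (beta_deg M F p + 2 * M / (25 * r ^+ 4) * Z2 M F p)
      * Num.sqrt `|\det (metric M p)|)%R%:E)%E.

End Surfaces.

(* Main.v *)
Require Import Defs.
From HB Require Import structures.
From mathcomp Require Import all_boot all_order all_algebra.
From mathcomp Require Import all_classical all_reals all_analysis.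
From mathcomp Require Import complex measurable_realfun.
From mathcomp Require Import ring lra.

Set Implicit Arguments.
Unset Strict Implicit.
Unset Printing Implicit Defensive.

Import Order.TTheory GRing.Theory Num.Theory.
Import numFieldNormedType.Exports.

Local Open Scope classical_set_scope.
Local Open Scope ring_scope.

(** Write f = 1 - 2M/r, x for the tortoise coordinate (f dx = dr) and V = f/r^2. In
    a frame whose angular directions have unit length on the unit sphere, F has the
    radial electric and magnetic components E/r^2 and B/r^2, and four components
    with one index on the sphere, called a, b, c, d after rescaling. The field Z consists of the latter, and by Maxwell's equations beta is
    the differential of E + iB divided by 3r ([beta_frame]). So H is, up to the
    factor 1/(9 r^2), the energy-momentum tensor of the scalars psi = E, B. Each is
    the potential of a first-order system ([psi_system]): there are one-forms X, Y
    on the sphere with psi_t = - div X, psi_x = - div Y and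
    X_t - Y_x = - V grad psi, whence psi_tt - psi_xx = V Laplacian psi ([wave]).

    Energy. Integration over the spheres leaves a current (e, p) on the plane of
    (t, r), with e_t = p_x and |p| <= e. Hence p dt + e dx is the differential of a
    function Q ([potential]), which increases outwards along every null or spacelike
    direction ([potential_spacelike]), and the energy of a surface is 1/9 of the
    total increment of Q along its curve ([energyE], [energy_ge], [energy_le]).
    In the closed Penrose square the region has no boundary besides the two
    surfaces, and this forces them to have the same ends: a point of the closure
    that is extremal to one side lies on both ([far_point]). Every piece of either
    surface is therefore overtaken by a piece of the other ([reach_both]), and the
    two energies bound each other.

    Bulk. Let j = A psi_t psi_x + q grad psi . X + 2h X . Y and
    k = A (psi_t^2 + psi_x^2 - V |grad psi|^2)/2 + q grad psi . Y + h (|X|^2 + |Y|^2),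
    integrated over the sphere and summed over psi = E, B, except that the terms in
    h, which are equal for E and B, are taken once; here A = 5 (1 - 3M/r), and
    q and h are explicit functions of r ([wA], [wq], [wh]). The balance laws give
    k_x - j_t as a diagonal quadratic form. Its coefficient on |X|^2 + |Y|^2 is not
    positive everywhere, but a Poincare inequality for one-forms on the sphere
    ([poincare]) bounds 2 (|X|^2 + |Y|^2) by the kinetic terms of E and B together,
    and then k_x - j_t dominates 9 times the integrand of the bulk term with respect
    to dt dx ([bulk_algebra]).
    Similarly |j + k| <= C (e + p) and |j - k| <= C (e - p) with C = 36/5
    ([multiplier_bounds], [boundary_algebra]); see [currents].

    Consider a piece of the first surface and the triangle over it whose other two
    sides are null lines. Each side has flux of (j, k) bounded by C times the
    increment of Q along it. The null sides together have the same increment of Q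
    as the base, so the integral over the triangle is at most 2C times the energy
    of the piece ([triangle_bound]), which is where 72/5 comes from. As the second
    surface has the ends of the first, such triangles exhaust a set that contains
    the region ([triangle_cover]). *)
(** * Integrals depending on a parameter *)

Section ParamIntegral.
Context {R : realType}.
Local Notation mu := (@lebesgue_measure R).

Definition integ (a b : R) (f : R -> R) : R := \int[mu]_(x in `[a, b]) f x.

Lemma within_of_for (f : R -> R) (A : set R) :
  (forall x, A x -> {for x, continuous f}) -> {within A, continuous f}.
Proof.
by move=> cf; apply: continuous_in_subspaceT => x /set_mem; exact: cf.
Qed.

Lemma integrable_seg a b (f : R -> R) :
  {within `[a, b], continuous f} -> mu.-integrable `[a, b] (EFin \o f).
Proof.
move=> cf; apply: continuous_compact_integrable => //.
exact: segment_compact.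
Qed.

Lemma integ_EFin a b (f : R -> R) : {within `[a, b], continuous f} ->
  (integ a b f)%:E = (\int[mu]_(x in `[a, b]) (f x)%:E)%E.
Proof.
move=> /integrable_seg fi; rewrite /integ /Rintegral fineK//.
exact: integrable_fin_num.
Qed.

Lemma integD a b (f g : R -> R) :
  {within `[a, b], continuous f} -> {within `[a, b], continuous g} ->
  integ a b (fun x => f x + g x) = integ a b f + integ a b g.
Proof. by move=> ? ?; rewrite /integ RintegralD//; by apply: integrable_seg. Qed.

Lemma integB a b (f g : R -> R) :
  {within `[a, b], continuous f} -> {within `[a, b], continuous g} ->
  integ a b (fun x => f x - g x) = integ a b f - integ a b g.
Proof. by move=> ? ?; rewrite /integ RintegralB//; by apply: integrable_seg. Qed.

Lemma integZ a b k (f : R -> R) : {within `[a, b], continuous f} ->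
  integ a b (fun x => k * f x) = k * integ a b f.
Proof. by move=> ?; rewrite /integ RintegralZl//; by apply: integrable_seg. Qed.

Lemma le_integ a b (f g : R -> R) :
  {within `[a, b], continuous f} -> {within `[a, b], continuous g} ->
  (forall x : R, a <= x <= b -> f x <= g x) -> integ a b f <= integ a b g.
Proof.
move=> /integrable_seg cf /integrable_seg cg fg; exact: le_Rintegral.
Qed.

Lemma integ_ge0 a b (f : R -> R) :
  (forall x : R, a <= x <= b -> 0 <= f x) -> 0 <= integ a b f.
Proof.
by move=> f0; apply: Rintegral_ge0 => x; rewrite /= in_itv/= => /f0.
Qed.

Lemma eq_integ a b (f g : R -> R) :
  (forall x : R, a <= x <= b -> f x = g x) -> integ a b f = integ a b g.
Proof.
by move=> fg; apply: eq_Rintegral => x /set_mem; rewrite /= in_itv/= => /fg.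
Qed.

Lemma integ_cst a b (k : R) : a <= b -> integ a b (fun=> k) = k * (b - a).
Proof.
move=> ab; rewrite /integ Rintegral_cst//.
have E : mu `[a, b]%classic = (b - a)%:E.
  rewrite lebesgue_measure_itv/= lte_fin.
  by case: ltgtP ab => // -> _; rewrite subrr.
by rewrite -[b - a]/(fine (b - a)%:E) -E.
Qed.

Lemma is_derive_continuous (f : R -> R) (x l : R) :
  is_derive x 1 f l -> {for x, continuous f}.
Proof.
by move=> [df _]; apply: differentiable_continuous; apply/derivable1_diffP.
Qed.

Section Derive1.
Variables (f g : R -> R) (x df dg : R).
Hypotheses (fd : is_derive x 1 f df) (gd : is_derive x 1 g dg).

Lemma derive1_add : is_derive x 1 (fun y => f y + g y) (df + dg).
Proof. exact: is_deriveD fd gd. Qed.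

Lemma derive1_opp : is_derive x 1 (fun y => - f y) (- df).
Proof. exact: is_deriveN fd. Qed.

Lemma derive1_sub : is_derive x 1 (fun y => f y - g y) (df - dg).
Proof. exact: is_deriveB fd gd. Qed.

Lemma derive1_mul : is_derive x 1 (fun y => f y * g y) (df * g x + f x * dg).
Proof.
rewrite addrC [df * _]mulrC; exact: is_deriveM fd gd.
Qed.

Lemma derive1_scale k : is_derive x 1 (fun y => k * f y) (k * df).
Proof. exact: (@is_deriveZ _ _ _ f k x 1 df fd). Qed.

Lemma derive1_eq df' : df = df' -> is_derive x 1 f df'.
Proof. by move=> <-. Qed.
End Derive1.

Lemma derive1_comp (f g : R -> R) (x df dg : R) :
  is_derive (g x) 1 f df -> is_derive x 1 g dg ->
  is_derive x 1 (fun y => f (g y)) (df * dg).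
Proof. by move=> fd gd; exact: (@is_derive1_comp _ f g). Qed.

Lemma derive1_inv (f : R -> R) (x df : R) : f x != 0 -> is_derive x 1 f df ->
  is_derive x 1 (fun y => (f y)^-1) (- df / f x ^+ 2).
Proof.
move=> f0 fd; have <- : - f x ^- 2 *: df = - df / f x ^+ 2.
  by rewrite [_ *: _]mulrC mulrN mulNr.
exact: is_deriveV.
Qed.

Lemma integ_FTC2 (a b : R) (f df : R -> R) : a <= b ->
  (forall x : R, a <= x <= b -> is_derive x 1 f (df x)) ->
  (forall x : R, a <= x <= b -> {for x, continuous df}) ->
  integ a b df = f b - f a.
Proof.
move=> ab fd cd.
case: ltgtP ab => // [ab _|-> _]; last first.
  by rewrite /integ set_itv1 Rintegral_set1 subrr.
have cw : {within `[a, b], continuous df}.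
  by apply: within_of_for => x; rewrite /= in_itv/=; exact: cd.
apply: EFin_inj; rewrite integ_EFin// EFinB.
apply: continuous_FTC2 => //.
  split.
  - move=> x; rewrite in_itv/= => /andP[ax xb].
    by have [] : is_derive x 1 f (df x) by apply: fd; rewrite !ltW.
  - apply: cvg_at_right_filter; apply: is_derive_continuous.
    by apply: fd; rewrite lexx ltW.
  - apply: cvg_at_left_filter; apply: is_derive_continuous.
    by apply: fd; rewrite lexx ltW.
move=> x; rewrite in_itv/= => /andP[ax xb]; rewrite derive1E.
by have [_ ->] : is_derive x 1 f (df x) by apply: fd; rewrite !ltW.
Qed.

Lemma integ_FTC1 (a b : R) (f : R -> R) (x : R) : a < x < b ->
  (forall y, a <= y <= b -> {for y, continuous f}) ->
  is_derive x 1 (fun z => integ a z f) (f x).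
Proof.
move=> /andP[ax xb] cf.
have fi : mu.-integrable `[a, b] (EFin \o f).
  by apply/integrable_seg/within_of_for => y; rewrite /= in_itv/=; exact: cf.
have cx : {for x, continuous f} by apply: cf; rewrite !ltW.
have [dF F'] := continuous_FTC1_closed xb fi ax cx.
by split; [exact: dF|rewrite -derive1E].
Qed.

Section Param.
Variables (T : topologicalType) (z : T) (a b : R).
Hypothesis ab : a <= b.

(** The tube lemma: joint continuity on a compact segment is uniform in the
    parameter. *)
Lemma uniform_in_parameter (f : T -> R -> R) (e : R) : 0 < e ->
  (forall y, a <= y <= b -> {for (z, y), continuous (fun p => f p.1 p.2)}) ->
  \forall z' \near z, forall y : R, a <= y <= b -> `|f z' y - f z y| < e.
Proof.
move=> e0 cf.
have e20 : 0 < e / 2 by rewrite divr_gt0.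
have /compact_near_coveringP K := @segment_compact R a b.
have H : \forall z' \near z,
    `[a, b] `<=` (fun y => `|f z' y - f z y| < e).
  apply: K => y; rewrite /= in_itv/= => yab.
  have /cvgrPdist_lt/(_ _ e20) := cf y yab.
  move=> /= [[A B] /= [Az By] AB].
  exists (B, A) => //= -[y' z'] /= [By' Az'].
  rewrite (splitr e) (le_lt_trans (ler_distD (f z y) _ _))//.
  have := AB (z', y') (conj Az' By').
  have := AB (z, y') (conj (nbhs_singleton Az) By').
  by move=> /= H1 H2; apply: ltrD => //; rewrite distrC.
by apply: filterS H => z' H y yab; apply: H; rewrite /= in_itv.
Qed.

Let section_cont (f : T -> R -> R) z' :
  (forall y, a <= y <= b -> {for (z', y), continuous (fun p => f p.1 p.2)}) ->
  {within `[a, b], continuous (f z')}.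
Proof.
move=> cf; apply: within_of_for => y; rewrite /= in_itv/= => /cf cy.
apply: (@continuous_comp _ _ _ (fun y => (z', y)) (fun p => f p.1 p.2)) => //.
exact: (@cvg_pair _ _ _ (nbhs y) (nbhs z') (nbhs y) _ _ _ (cst z') id (cvg_cst z') cvg_id).
Qed.

Lemma integ_continuous (f : T -> R -> R) :
  (\forall z' \near z, forall y : R, a <= y <= b ->
     {for (z', y), continuous (fun p => f p.1 p.2)}) ->
  {for z, continuous (fun z' => integ a b (f z'))}.
Proof.
move=> cf; have cfz := section_cont (nbhs_singleton cf).
apply/cvgrPdist_lt => e e0.
have d0 : 0 < e / (b - a + 1) by rewrite divr_gt0//; move: ab; lra.
have u := uniform_in_parameter d0 (nbhs_singleton cf).
near=> z'.
have cfz' : {within `[a, b], continuous (f z')}.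
  by apply: section_cont; near: z'.
have U : forall y, a <= y <= b -> `|f z' y - f z y| < e / (b - a + 1).
  by near: z'.
have cd : {within `[a, b], continuous (fun y => f z' y - f z y)}.
  by move=> y; apply: cvgB; [exact: cfz'|exact: cfz].
have K d : {within `[a, b], continuous (fun=> d : R)}.
  by apply: continuous_subspaceT => ?; exact: cvg_cst.
have D : `|integ a b (f z') - integ a b (f z)| <= e / (b - a + 1) * (b - a).
  rewrite -integB// ler_norml -mulNr -!integ_cst//.
  by apply/andP; split; apply: le_integ => // y /U;
    rewrite ltr_norml => /andP[/ltW + /ltW].
rewrite distrC (le_lt_trans D)// mulrAC ltr_pdivrMr; last by move: ab; lra.
by rewrite ltr_pM2l//; lra.
Unshelve. all: end_near. Qed.

End Param.

Lemma section_continuous (T : topologicalType) (f : T -> R -> R) z y :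
  {for (z, y), continuous (fun p => f p.1 p.2)} ->
  {for y, continuous (f z)} /\ {for z, continuous (f ^~ y)}.
Proof.
move=> cf; split.
  apply: (@continuous_comp _ _ _ (fun y => (z, y)) (fun p => f p.1 p.2)) => //.
  exact: (@cvg_pair _ _ _ (nbhs y) (nbhs z) (nbhs y) _ _ _ (cst z) id (cvg_cst z) cvg_id).
apply: (@continuous_comp _ _ _ (fun z => (z, y)) (fun p => f p.1 p.2)) => //.
exact: (@cvg_pair _ _ _ (nbhs z) (nbhs z) (nbhs y) _ _ _ id (cst y) cvg_id (cvg_cst y)).
Qed.

(** Differentiation under the integral sign over a compact segment; the
    dominating function comes from the uniformity in the parameter. *)
Lemma integ_is_derive (z a b : R) (f df : R -> R -> R) : a <= b ->
  (\forall z' \near z, forall y : R, a <= y <= b ->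
     {for y, continuous (f z')}) ->
  (\forall z' \near z, forall y : R, a <= y <= b ->
     is_derive (z' : R) 1 (f ^~ y) (df z' y)) ->
  (forall y : R, a <= y <= b -> {for (z, y), continuous (fun p => df p.1 p.2)}) ->
  is_derive z 1 (fun z' => integ a b (f z')) (integ a b (df z)).
Proof.
move=> ab cf fd cdf.
have u := uniform_in_parameter ltr01 cdf.
have [e /= e0 He] : nbhs z (fun z' : R => [/\
    forall y : R, a <= y <= b -> {for y, continuous (f z')},
    forall y : R, a <= y <= b -> is_derive (z' : R) 1 (f ^~ y) (df z' y) &
    forall y : R, a <= y <= b -> `|df z' y - df z y| < 1]).
  by near=> z'; split; near: z'.
have I z' : z' \in `]z - e, z + e[ -> ball_ [eta Num.Def.normr] z e z'.
  by rewrite in_itv/= -ltr_distlC.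
pose G (y : R) := `|df z y| + 1.
have cdz : {within `[a, b], continuous (df z)}.
  by apply: within_of_for => y; rewrite /= in_itv/= => /cdf/section_continuous[].
have zI : `]z - e, z + e[%classic z by rewrite /= in_itv/= ltrBlDr ltrDl e0.
have iF x : `]z - e, z + e[%classic x -> mu.-integrable `[a, b] (EFin \o f x).
  move=> /I/He[H _ _]; apply/integrable_seg/within_of_for => y.
  by rewrite /= in_itv/=; exact: H.
have dF x y : `]z - e, z + e[%classic x -> `[a, b]%classic y ->
    derivable (f ^~ y) x 1.
  by move=> /I/He[_ H _]; rewrite /= in_itv/= => /H[].
have G0 y : 0 <= G y by rewrite addr_ge0.
have iG : mu.-integrable `[a, b] (EFin \o G).
  apply: integrable_seg => y; apply: cvgD; last exact: cvg_cst.
  by apply: cvg_norm; exact: cdz.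
have GU x y : `]z - e, z + e[%classic x -> `[a, b]%classic y ->
    `|partial1of2 f x y| <= G y.
  move=> /I/He[_ H1 H2]; rewrite /= in_itv/= => yab.
  rewrite partial1of2E; have [_ ->] := H1 _ yab.
  have := H2 _ yab; rewrite /G -lerBlDl => /ltW; apply: le_trans.
  exact: lerB_dist.
have mI : measurable (`[a, b]%classic : set R) by exact: measurable_itv.
split.
  exact: (@derivable_under_integral _ _ _ mu f `[a, b]%classic mI z (z - e) (z + e) zI iF dF G G0 iG GU).
rewrite -derive1E; transitivity (integ a b (fun y => partial1of2 f z y)).
  exact: (@differentiation_under_integral _ _ _ mu f `[a, b]%classic mI z (z - e) (z + e) zI iF dF G G0 iG GU).
apply: eq_integ => y yab; rewrite partial1of2E.
have [_ H _] := He z (I z zI).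
by have [_ ->] := H _ yab.
Unshelve. all: end_near. Qed.

End ParamIntegral.

(** * Functions of class C^n on an open set of R^4 *)

Section Calculus4.
Context {R : realType}.
Local Notation rV := 'rV[R]_4.
Implicit Types (f g : rV -> R) (A : set rV) (k : 'I_4) (p : rV).

Lemma cvg_rV (T : Type) (F : set_system T) (M : T -> rV) (l : rV) :
  Filter F -> (forall j, (fun x => M x 0 j) @ F --> l 0 j) -> M @ F --> l.
Proof.
move=> FF Ml; apply/cvgrPdist_le => /= e e0.
near=> x.
rewrite /Num.Def.normr/= mx_normrE (bigmax_le _ (ltW e0))//= => -[i j] _ /=.
rewrite !mxE ord1; move: j; near: x; apply: filter_forall => j.
by move/cvgrPdist_le : (Ml j); exact.
Unshelve. all: end_near. Qed.

Lemma line_is_derive f (c : R -> rV) v (s : R) :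
  (forall h, c (h + s) = h *: v + c s) -> derivable f (c s) v ->
  is_derive s 1 (f \o c) ('D_v f (c s)).
Proof.
move=> cv df.
have E : (fun h : R => h^-1 *: (((f \o c) \o shift s) (h *: 1) - (f \o c) s)) =
         (fun h : R => h^-1 *: ((f \o shift (c s)) (h *: v) - f (c s))).
  by apply/funext => h /=; rewrite [h *: 1]mulr1 cv.
by split; rewrite /derivable /derive E.
Qed.

Lemma line_derive f (c : R -> rV) v (s : R) :
  (forall h, c (h + s) = h *: v + c s) -> 'D_v f (c s) = 'D_1 (f \o c) s.
Proof.
move=> cv; rewrite /derive; congr (lim (_ @ 0^')).
by apply/funext => h /=; rewrite [h *: 1]mulr1 cv.
Qed.

Lemma comp_is_derive g (c : R -> rV) (dc : rV) (s : R) :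
  (forall j, is_derive s 1 (fun h => c h 0 j) (dc 0 j)) ->
  differentiable g (c s) ->
  is_derive s 1 (g \o c) (\sum_j dc 0 j * partial j g (c s)).
Proof.
move=> cd dg.
have dcs : derivable c s 1 by apply/derivable_mxP => i j; rewrite ord1; case: (cd j).
have dcs' : differentiable c s by apply/derivable1_diffP.
have dgc : differentiable (g \o c) s by exact: differentiable_comp.
split; first by apply/derivable1_diffP.
rewrite deriveE// diff_comp//.
rewrite [LHS]/= -[X in 'd g _ X]deriveE// derive_mx//.
rewrite [X in 'd _ _ X]row_sum_delta linear_sum; apply: eq_bigr => j _ /=.
rewrite linearZ/= mxE /partial (deriveE _ dg).
by case: (cd j) => _ <-.
Qed.

(** Recursive in n, so that closure under sums and products goes by induction;
    [smooth_on] asks for Frechet differentiability instead, and [ck_comp] passes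
    from the one to the other. *)
Fixpoint ck A (n : nat) f : Prop :=
  (forall p, A p -> f @ p --> f p) /\
  if n is m.+1 then
    (forall k p, A p -> derivable f p (delta_mx 0 k)) /\
    (forall k, ck A m (partial k f))
  else True.

Lemma ck0 A f : ck A 0 f <-> forall p, A p -> f @ p --> f p.
Proof. by split=> [[]|]. Qed.

Lemma ckS A n f : ck A n.+1 f <->
  [/\ forall p, A p -> f @ p --> f p,
      forall k p, A p -> derivable f p (delta_mx 0 k) &
      forall k, ck A n (partial k f)].
Proof. by split=> [[? []]|[]]. Qed.

Lemma ckS_derivable A n f k p : ck A n.+1 f -> A p ->
  derivable f p (delta_mx 0 k).
Proof. by move=> /ckS[_ + _]; exact. Qed.

Section Open.
Variable A : set rV.
Hypothesis oA : open A.

Lemma ck_cont n f : ck A n f -> forall p, A p -> {for p, continuous f}.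
Proof. by case: n => [|n] []. Qed.

Lemma ckW n f : ck A n.+1 f -> ck A n f.
Proof.
elim: n f => [|n IH] f; first by case.
by move=> /ckS[cf df pf]; apply/ckS; split=> // k; apply: IH.
Qed.

Lemma ck_partial n k f : ck A n.+1 f -> ck A n (partial k f).
Proof. by move=> /ckS[_ _ +]; exact. Qed.

Lemma near_eq_on f g : (forall p, A p -> f p = g p) ->
  forall p, A p -> \near p, f p = g p.
Proof.
by move=> fg p Ap; have := open_nbhs_nbhs (conj oA Ap); exact: filterS.
Qed.

Lemma partial_ext f g k p : (forall p, A p -> f p = g p) -> A p ->
  partial k f p = partial k g p.
Proof. by move=> fg Ap; apply: near_eq_derive; exact: near_eq_on. Qed.

Lemma cvg_on f g p : (forall p, A p -> f p = g p) -> A p ->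
  f @ p --> f p -> g @ p --> g p.
Proof.
move=> fg Ap; rewrite -fg// => cf P /cf fP.
by apply: (@filterS2 _ (nbhs p) _ _ _ _ _ (near_eq_on fg Ap) fP) => q /= <-.
Qed.

Lemma ck_ext n f g : (forall p, A p -> f p = g p) -> ck A n f -> ck A n g.
Proof.
elim: n f g => [|n IH] f g fg.
  by move=> [cf _]; split=> // p Ap; apply: (cvg_on fg) => //; exact: cf.
move=> /ckS[cf df pf]; apply/ckS; split.
- by move=> p Ap; apply: (cvg_on fg) => //; exact: cf.
- move=> k p Ap; apply: near_eq_derivable (df k p Ap).
  exact: near_eq_on.
- by move=> k; apply: (IH (partial k f)) => // p Ap; exact: partial_ext.
Qed.

Lemma ck_cst n (c : R) : ck A n (fun=> c).
Proof.
elim: n c => [|n IH] c; first by apply/ck0 => p _ P; exact: (@cvg_cst _ c _ (nbhs p) _ P).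
apply/ckS; split; first by move=> p _ P; exact: (@cvg_cst _ c _ (nbhs p) _ P).
  by move=> k p _; exact: derivable_cst.
move=> k; apply: (@ck_ext _ (fun=> 0)) => // p _.
by rewrite /partial derive_cst.
Qed.

Lemma partialD f g k p : derivable f p (delta_mx 0 k) ->
  derivable g p (delta_mx 0 k) ->
  partial k (fun q => f q + g q) p = partial k f p + partial k g p.
Proof. by move=> ? ?; rewrite /partial -deriveD. Qed.

Lemma partialM f g k p : derivable f p (delta_mx 0 k) ->
  derivable g p (delta_mx 0 k) ->
  partial k (fun q => f q * g q) p = f p * partial k g p + partial k f p * g p.
Proof.
move=> df dg; rewrite /partial; apply: (etrans (deriveM df dg)).
by congr (_ + _); exact: mulrC.
Qed.

Lemma ckD n f g : ck A n f -> ck A n g -> ck A n (fun q => f q + g q).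
Proof.
elim: n f g => [|n IH] f g.
  by move=> [cf _] [cg _]; split=> [p Ap|//]; exact: (cvgD (cf p Ap) (cg p Ap)).
move=> /ckS[cf df pf] /ckS[cg dg pg]; apply/ckS; split.
- by move=> p Ap; exact: (cvgD (cf p Ap) (cg p Ap)).
- by move=> k p Ap; apply: derivableD; [exact: df|exact: dg].
- move=> k; apply: (@ck_ext _ (fun q => partial k f q + partial k g q)).
    by move=> p Ap; rewrite partialD//; [exact: df|exact: dg].
  exact: IH.
Qed.

Lemma ckM n f g : ck A n f -> ck A n g -> ck A n (fun q => f q * g q).
Proof.
elim: n f g => [|n IH] f g.
  by move=> [cf _] [cg _]; split=> [p Ap|//]; exact: (cvgM (cf p Ap) (cg p Ap)).
move=> /[dup] /ckW cf0 /ckS[cf df pf] /[dup] /ckW cg0 /ckS[cg dg pg].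
apply/ckS; split.
- by move=> p Ap; exact: (cvgM (cf p Ap) (cg p Ap)).
- by move=> k p Ap; apply: derivableM; [exact: df|exact: dg].
- move=> k; apply: (@ck_ext _
      (fun q => f q * partial k g q + partial k f q * g q)).
    by move=> p Ap; rewrite partialM//; [exact: df|exact: dg].
  by apply: ckD; apply: IH.
Qed.

Lemma ckN n f : ck A n f -> ck A n (fun q => - f q).
Proof.
move=> cf; apply: (@ck_ext _ (fun q => (-1) * f q)).
  by move=> p _; rewrite mulN1r.
by apply: ckM => //; exact: ck_cst.
Qed.

Lemma ckB n f g : ck A n f -> ck A n g -> ck A n (fun q => f q - g q).
Proof. by move=> cf cg; apply: ckD => //; exact: ckN. Qed.

Lemma ck_sum n (I : Type) (s : seq I) (F : I -> rV -> R) :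
  (forall i, ck A n (F i)) -> ck A n (fun q => \sum_(i <- s) F i q).
Proof.
move=> cF; elim: s => [|i s IH].
  by apply: (@ck_ext _ (fun=> 0)); [move=> *; rewrite big_nil|exact: ck_cst].
apply: (@ck_ext _ (fun q => F i q + \sum_(j <- s) F j q)).
  by move=> *; rewrite big_cons.
exact: ckD.
Qed.

Lemma coord_line k j p (h : R) :
  (h *: delta_mx 0 k + p : rV) 0 j = h * (j == k)%:R + p 0 j.
Proof. by rewrite !mxE/=; case: (j == k). Qed.

(** A coordinate is affine along each coordinate line, so this needs only the
    one-dimensional chain rule. *)
Lemma partial_fun1 (phi : R -> R) (dphi : R) i k (p : rV) :
  is_derive (p 0 i) (1 : R) phi dphi ->
  derivable (fun q : rV => phi (q 0 i)) p (delta_mx 0 k) /\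
  partial k (fun q : rV => phi (q 0 i)) p = (i == k)%:R * dphi.
Proof.
move=> dphiP; pose c (h : R) : rV := h *: delta_mx 0 k + p.
have c0 : c 0 = p by rewrite /c scale0r add0r.
have D : is_derive (0 : R) (1 : R) (fun h => phi (c h 0 i)) ((i == k)%:R * dphi).
  have -> : (fun h => phi (c h 0 i)) = phi \o (fun h => (i == k)%:R * h + p 0 i).
    by apply/funext => h /=; rewrite /c coord_line mulrC.
  rewrite mulrC; apply: is_derive1_comp; first by rewrite mulr0 add0r.
  by apply: is_derive_eq; rewrite addr0 [_ *: _]mulr1.
split; first by apply/derivable1P; case: D.
rewrite /partial -{1}c0 (@line_derive (fun q : rV => phi (q 0 i)) c).
  by case: D.
by move=> h; rewrite c0 /c addr0.
Qed.

Lemma coord_cont i (p : rV) : (fun q : rV => q 0 i) @ p --> p 0 i.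
Proof. exact: coord_continuous. Qed.

Lemma ck_coord n i : ck A n (fun q => q 0 i).
Proof.
have D k p := @partial_fun1 id 1 i k p (@is_derive_id R R^o (p 0 i) 1).
case: n => [|n]; first by apply/ck0 => p _; exact: coord_cont.
apply/ckS; split; first by move=> p _; exact: coord_cont.
  by move=> k p _; case: (D k p).
move=> k; apply: (@ck_ext _ (fun=> (i == k)%:R * 1)); last exact: ck_cst.
by move=> p _; case: (D k p) => _ ->.
Qed.

Lemma ck_sincos n i :
  ck A n (fun q => sin (q 0 i)) /\ ck A n (fun q => cos (q 0 i)).
Proof.
have Ds k p := @partial_fun1 sin _ i k p (is_derive_sin (p 0 i)).
have Dc k p := @partial_fun1 cos _ i k p (is_derive_cos (p 0 i)).
have cs p : (fun q : rV => sin (q 0 i)) @ p --> sin (p 0 i).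
  by apply: continuous_comp; [exact: coord_cont|exact: continuous_sin].
have cc p : (fun q : rV => cos (q 0 i)) @ p --> cos (p 0 i).
  by apply: continuous_comp; [exact: coord_cont|exact: continuous_cos].
elim: n => [|n [IHs IHc]]; first by [].
split; apply/ckS; split=> //; [by move=> k p _; case: (Ds k p)| | by move=> k p _; case: (Dc k p)|]; move=> k.
  apply: (@ck_ext _ (fun q => (i == k)%:R * cos (q 0 i))).
    by move=> p _; case: (Ds k p) => _ ->.
  by apply: ckM => //; exact: ck_cst.
apply: (@ck_ext _ (fun q => (i == k)%:R * (- sin (q 0 i)))).
  by move=> p _; case: (Dc k p) => _ ->.
by apply: ckM; [exact: ck_cst|exact: ckN].
Qed.

Lemma ck_coordV n i : (forall p, A p -> p 0 i != 0) ->
  ck A n (fun q => (q 0 i)^-1).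
Proof.
move=> A0.
have D k p : A p -> _ := fun Ap => @partial_fun1 GRing.inv _ i k p
  (@is_deriveV _ id (p 0 i) 1 1 (A0 p Ap) (@is_derive_id R R^o (p 0 i) 1)).
have cV p : A p -> (fun q : rV => (q 0 i)^-1) @ p --> (p 0 i)^-1.
  by move=> Ap; exact: (cvgV (A0 p Ap) (@coord_cont i p)).
elim: n => [|n IH]; first by [].
apply/ckS; split=> //; first by move=> k p Ap; case: (D k p Ap).
move=> k; apply: (@ck_ext _ (fun q => (i == k)%:R * (- ((q 0 i)^-1 * (q 0 i)^-1)))).
  move=> p Ap; case: (D k p Ap) => _ ->.
  by rewrite -expr2 exprVn [_ *: _]mulr1.
by apply: ckM; [exact: ck_cst|apply: ckN; exact: ckM].
Qed.

End Open.

(** On a coordinate line psi is a curve whose components have derivatives, and the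
    chain rule for curves applies. *)
Lemma ck_comp A (B : set rV) n g (psi : rV -> rV) : open A ->
  (forall p, A p -> B (psi p)) -> smooth_on B g ->
  (forall m j, ck A m (fun q => psi q 0 j)) ->
  ck A n (fun q => g (psi q)) /\
  forall p k, A p -> partial k (fun q => g (psi q)) p =
    \sum_j partial k (fun q => psi q 0 j) p * partial j g (psi p).
Proof.
move=> oA AB sg cpsi.
have D (h : rV -> R) p k : smooth_on B h -> A p ->
  derivable (fun q => h (psi q)) p (delta_mx 0 k) /\
  partial k (fun q => h (psi q)) p =
    \sum_j partial k (fun q => psi q 0 j) p * partial j h (psi p).
  move=> sh Ap; pose c (s : R) : rV := s *: delta_mx 0 k + p.
  have c0 : c 0 = p by rewrite /c scale0r add0r.
  have cl s : c (s + 0) = s *: delta_mx 0 k + c 0 by rewrite c0 /c addr0.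
  have dh : differentiable h ((psi \o c) 0).
    by rewrite /= c0; apply: (sh [::]); exact: AB.
  have dpsi j : is_derive (0 : R) (1 : R) (fun s => (psi \o c) s 0 j)
      ((\row_j partial k (fun q => psi q 0 j) p) 0 j).
    rewrite mxE /partial -{1}c0.
    apply: (@line_is_derive (fun q => psi q 0 j) c) => //; rewrite c0.
    exact: ckS_derivable (cpsi 1%N j) Ap.
  have := comp_is_derive dpsi dh; rewrite /= c0 => H.
  split; first by apply/derivable1P; case: H.
  rewrite /partial -{1}c0 (@line_derive (fun q => h (psi q)) c)//.
  by case: H => _ ->; apply: eq_bigr => j _; rewrite mxE.
have C (h : rV -> R) p : smooth_on B h -> A p -> h (psi q) @[q --> p] --> h (psi p).
  move=> sh Ap; apply: (@continuous_comp _ _ _ psi h).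
    by apply: (@cvg_rV _ (nbhs p)) => j; case: (cpsi 0%N j) => H _; exact: H.
  by apply: differentiable_continuous; apply: (sh [::]); exact: AB.
split; last by move=> p k Ap; case: (D g p k sg Ap).
elim: n g sg => [|n IH] g sg; first by apply/ck0 => p Ap; exact: C.
apply/ckS; split; first by move=> p Ap; exact: C.
  by move=> k p Ap; case: (D g p k sg Ap).
move=> k; apply: (@ck_ext _ oA _ (fun q =>
    \sum_j partial k (fun q => psi q 0 j) q * partial j g (psi q))).
  by move=> p Ap; case: (D g p k sg Ap) => _ ->.
apply: ck_sum => // j; apply: ckM => //.
  by apply: ck_partial; exact: cpsi.
by apply: IH => ks x Bx; have := sg (rcons ks j) x Bx; rewrite foldr_rcons.
Qed.

End Calculus4.

(** The second difference of a function over a small square is the square of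
    the side times an iterated partial derivative inside the square; since it
    is symmetric in the two variables, the two iterated derivatives take a
    common value. *)
Section SecondDifference.
Context {R : realType}.

Lemma second_difference (phi phix phixy : R -> R -> R) (h : R) : 0 < h ->
  (forall x y, 0 <= x <= h -> 0 <= y <= h ->
     is_derive x 1 (phi ^~ y) (phix x y)) ->
  (forall x y, 0 <= x <= h -> 0 <= y <= h ->
     is_derive y 1 (phix x) (phixy x y)) ->
  exists x y, [/\ 0 <= x <= h, 0 <= y <= h &
    phi h h - phi h 0 - (phi 0 h - phi 0 0) = h ^+ 2 * phixy x y].
Proof.
move=> h0 dphi dphix.
have h0h : 0 <= h <= h by rewrite lexx ltW.
have oh : (0 : R) <= 0 <= h by rewrite lexx ltW.
pose psi x := phi x h - phi x 0.
have psiD (x : R) : 0 <= x <= h -> is_derive x 1 psi (phix x h - phix x 0).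
  by move=> xh; exact: (derive1_sub (dphi x h xh h0h) (dphi x 0 xh oh)).
have [||x xh E1] := @MVT _ psi (fun x => phix x h - phix x 0) 0 h h0.
- by move=> x; rewrite in_itv/= => /andP[/ltW ? /ltW ?]; apply: psiD; apply/andP.
- apply: within_of_for => x; rewrite /= in_itv/= => /psiD.
  exact: is_derive_continuous.
have {}xh : 0 <= x <= h by move: xh; rewrite in_itv/= => /andP[/ltW -> /ltW ->].
have [||y yh E2] := @MVT _ (phix x) (phixy x) 0 h h0.
- by move=> y; rewrite in_itv/= => /andP[/ltW ? /ltW ?]; apply: dphix => //; apply/andP.
- apply: within_of_for => y; rewrite /= in_itv/= => yh.
  exact: is_derive_continuous (dphix _ _ xh yh).
exists x, y; split => //.
  by move: yh; rewrite in_itv/= => /andP[/ltW -> /ltW ->].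
by move: E1; rewrite /psi E2 => ->; ring.
Qed.

Lemma mixed_derivatives_meet (phi phix phiy phixy phiyx : R -> R -> R) (h : R) :
  0 < h ->
  (forall x y, 0 <= x <= h -> 0 <= y <= h ->
     is_derive x 1 (phi ^~ y) (phix x y)) ->
  (forall x y, 0 <= x <= h -> 0 <= y <= h ->
     is_derive y 1 (phix x) (phixy x y)) ->
  (forall x y, 0 <= x <= h -> 0 <= y <= h ->
     is_derive y 1 (phi x) (phiy x y)) ->
  (forall x y, 0 <= x <= h -> 0 <= y <= h ->
     is_derive x 1 (phiy ^~ y) (phiyx x y)) ->
  exists x y x' y', [/\ 0 <= x <= h, 0 <= y <= h, 0 <= x' <= h, 0 <= y' <= h &
    phixy x y = phiyx x' y'].
Proof.
move=> h0 d1 d2 d3 d4.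
have [x [y [xh yh E1]]] := second_difference h0 d1 d2.
have [y' [x' [yh' xh' E2]]] := @second_difference (fun y x => phi x y)
  (fun y x => phiy x y) (fun y x => phiyx x y) h h0
  (fun y x yh xh => d3 x y xh yh) (fun y x yh xh => d4 x y xh yh).
exists x, y, x', y'; split => //.
have h20 : h ^+ 2 != 0 by rewrite expf_neq0// gt_eqF.
by apply: (mulfI h20); rewrite -E1 -E2; ring.
Qed.

End SecondDifference.

Lemma dist_half (R : realType) (eps a b c : R) :
  `|a - c| < eps / 2 -> `|b - c| < eps / 2 -> `|a - b| <= eps.
Proof.
by rewrite !ltr_norml ler_norml => /andP[? ?] /andP[? ?]; apply/andP; split; lra.
Qed.

Section Clairaut.
Context {R : realType}.
Local Notation rV := 'rV[R]_4.
Local Notation e := (fun k : 'I_4 => delta_mx 0 k : rV).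
Variable A : set rV.
Hypothesis oA : open A.

Lemma partialC (f : rV -> R) i j (p : rV) : ck A 2 f -> A p ->
  partial i (partial j f) p = partial j (partial i f) p.
Proof.
move=> cf Ap; apply/eqP; rewrite -subr_eq0 -normr_le0; apply/ler_addgt0Pl => eps eps0.
rewrite addr0.
have eps20 : 0 < eps / 2 by rewrite divr_gt0.
have C i' j' : \forall q \near p, `|partial i' (partial j' f) p - partial i' (partial j' f) q| < eps / 2.
  have /ck_cont/(_ p Ap)/cvgrPdist_lt : ck A 0 (partial i' (partial j' f)).
    by do 2 apply: ck_partial.
  exact.
have /nbhs_ballP[d /= d0 dP] : nbhs p (fun q => [/\ A q,
    `|partial i (partial j f) p - partial i (partial j f) q| < eps / 2 &
    `|partial j (partial i f) p - partial j (partial i f) q| < eps / 2]).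
  have H0 : \forall q \near p, A q by apply: open_nbhs_nbhs.
  have H1 := C i j; have H2 := C j i.
  by apply: (@filterS3 _ (nbhs p) _ _ _ _ _ _ H0 H1 H2) => q.
pose h := d / 4.
have h0 : 0 < h by rewrite divr_gt0.
have N (k : 'I_4) : `|e k| <= 1.
  rewrite /Num.Def.normr/= mx_normrE; apply: bigmax_le => // -[u v] _ /=.
  by rewrite mxE/=; case: (_ && _); rewrite ?normr1 ?normr0.
have B x y (a b : 'I_4) : 0 <= x <= h -> 0 <= y <= h ->
    ball p d (x *: e a + y *: e b + p).
  move=> xh yh; suff : `|p - (x *: e a + y *: e b + p)| < d by rewrite mx_norm_ball.
  rewrite opprD addrCA subrr addr0 normrN.
  rewrite (le_lt_trans (ler_normD _ _))// !normrZ.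
  have X : `|x| * `|e a| <= h * 1.
    by apply: ler_pM => //; case/andP: xh => x0 xh; rewrite ger0_norm.
  have Y : `|y| * `|e b| <= h * 1.
    by apply: ler_pM => //; case/andP: yh => x0 yh; rewrite ger0_norm.
  by rewrite (le_lt_trans (lerD X Y))// mulr1 /h; move: d0; clear; lra.
have L (g : rV -> R) (x y : R) : ck A 1 g -> 0 <= x <= h -> 0 <= y <= h ->
    is_derive x 1 (fun x => g (x *: e i + y *: e j + p))
      (partial i g (x *: e i + y *: e j + p)).
  move=> cg xh yh.
  apply: (@line_is_derive _ g (fun x => x *: e i + y *: e j + p)).
    by move=> b; rewrite scalerDl !addrA.
  by apply: ckS_derivable cg _; case: (dP _ (B x y i j xh yh)).
have L' (g : rV -> R) (x y : R) : ck A 1 g -> 0 <= x <= h -> 0 <= y <= h ->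
    is_derive y 1 (fun y => g (x *: e i + y *: e j + p))
      (partial j g (x *: e i + y *: e j + p)).
  move=> cg xh yh.
  apply: (@line_is_derive _ g (fun y => x *: e i + y *: e j + p)).
    by move=> b; rewrite scalerDl !addrA (addrC (x *: _)).
  by apply: ckS_derivable cg _; case: (dP _ (B x y i j xh yh)).
have cf1 : ck A 1 f by exact: ckW.
have cfi : ck A 1 (partial i f) by apply: ck_partial.
have cfj : ck A 1 (partial j f) by apply: ck_partial.
have [x [y [x' [y' [xh yh xh' yh' E]]]]] := mixed_derivatives_meet h0
  (fun x y => L f x y cf1) (fun x y => L' _ x y cfi)
  (fun x y => L' f x y cf1) (fun x y => L _ x y cfj).
have [_ _ D1] := dP _ (B _ _ i j xh yh).
have [_ D2 _] := dP _ (B _ _ i j xh' yh').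
by apply: dist_half D2 _; rewrite -E; exact: D1.
Qed.

End Clairaut.

(** The increment of Q is split into one in r at fixed t and one in t, which the mean
    value theorem and the continuity of Qt compare with Qt at the base point. *)
Lemma chain2 {R : realType} (Q Qt Qr : R -> R -> R) (t r : R -> R) (s dt dr : R)
    (D : set (R * R)) : open D -> D (t s, r s) ->
  (forall x y, D (x, y) -> is_derive x 1 (Q ^~ y) (Qt x y)) ->
  is_derive (r s) 1 (Q (t s)) (Qr (t s) (r s)) ->
  {for (t s, r s), continuous (fun p : R * R => Qt p.1 p.2)} ->
  is_derive s 1 t dt -> is_derive s 1 r dr ->
  is_derive s 1 (fun s => Q (t s) (r s))
    (Qt (t s) (r s) * dt + Qr (t s) (r s) * dr).
Proof.
move=> oD Ds dQt dQr cQt tD rD.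
have ct : {for s, continuous t} := is_derive_continuous tD.
have cr : {for s, continuous r} := is_derive_continuous rD.
have QrD : is_derive s 1 (fun s' => Q (t s) (r s')) (Qr (t s) (r s) * dr).
  exact: (@is_derive1_comp _ (Q (t s)) r).
suff QtD : is_derive s 1 (fun s' => Q (t s') (r s') - Q (t s) (r s')) (Qt (t s) (r s) * dt).
  have -> : (fun s => Q (t s) (r s)) = (fun s' => (Q (t s') (r s') - Q (t s) (r s')) + Q (t s) (r s')).
    by apply/funext => s'; rewrite subrK.
  exact: is_deriveD.
suff H : (fun h => h^-1 *: ((Q (t (h + s)) (r (h + s)) - Q (t s) (r (h + s))) -
     (Q (t s) (r s) - Q (t s) (r s)))) @ 0^' --> Qt (t s) (r s) * dt.
  have E : (fun h : R => h^-1 *: (((fun s' => Q (t s') (r s') - Q (t s) (r s')) \o shift s) (h *: 1) -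
     (Q (t s) (r s) - Q (t s) (r s)))) = (fun h : R => h^-1 *: ((Q (t (h + s)) (r (h + s)) - Q (t s) (r (h + s))) -
     (Q (t s) (r s) - Q (t s) (r s)))).
    by apply/funext => h /=; rewrite [h *: 1]mulr1.
  split; first by apply/cvg_ex; exists (Qt (t s) (r s) * dt); rewrite E.
  by rewrite /derive E; apply/cvg_lim.
have dtE : (fun h => h^-1 *: (t (h + s) - t s)) @ 0^' --> dt.
  have [/cvg_ex[l tl] tE] := tD.
  have E : (fun h : R => h^-1 *: ((t \o shift s) (h *: 1) - t s)) = (fun h : R => h^-1 *: (t (h + s) - t s)).
    by apply/funext => h /=; rewrite [h *: 1]mulr1.
  by move: tl tE; rewrite /derive E => /[dup] ? /cvg_lim ->// <-.
have cs0 : (fun h : R => h + s) @ 0 --> s.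
  rewrite -[X in _ --> X]add0r; apply: cvgD; [exact: cvg_id|exact: cvg_cst].
have ct0 : (fun h => t (h + s)) @ 0 --> t s by apply: cvg_comp cs0 ct.
have cr0 : (fun h => r (h + s)) @ 0 --> r s by apply: cvg_comp cs0 cr.
apply/cvgrPdist_le => e e0.
pose eps := e / 2 / (`|dt| + 1).
have dt0 : 0 < `|dt| + 1 by rewrite ltr_wpDl.
have eps0 : 0 < eps by rewrite !divr_gt0.
pose q1 := e / 2 / (`|Qt (t s) (r s)| + 1).
have qt0 : 0 < `|Qt (t s) (r s)| + 1 by rewrite ltr_wpDl.
have q10 : 0 < q1 by rewrite !divr_gt0.
have [[U V] /= [/nbhs_ballP[d /= d0 dU] nV] UV] : nbhs (t s, r s)
    [set p | D p /\ `|Qt (t s) (r s) - Qt p.1 p.2| < eps].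
  apply: filterI; first exact: open_nbhs_nbhs.
  by move/cvgrPdist_lt : cQt; exact.
have M x y : `|x - t s| < d -> V y ->
    `|Q x y - Q (t s) y - Qt (t s) (r s) * (x - t s)| <= eps * `|x - t s|.
  move=> xd Vy.
  have DQ z : `|z - t s| < d -> is_derive z 1 (Q ^~ y) (Qt z y) /\
      `|Qt (t s) (r s) - Qt z y| < eps.
    move=> zd; have [|Dz Bz] := UV (z, y).
      by split=> //; apply: dU; rewrite /ball/= distrC.
    by split=> //; exact: dQt.
  have B z a b : a <= z <= b -> `|a - t s| < d -> `|b - t s| < d -> `|z - t s| < d.
    by move=> /andP[az zb]; rewrite !ltr_norml => /andP[? ?] /andP[? ?]; lra.
  have ts : `|t s - t s| < d by rewrite subrr normr0.
  have E a b : a <= b -> `|a - t s| < d -> `|b - t s| < d ->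
      `|Q b y - Q a y - Qt (t s) (r s) * (b - a)| <= eps * `|b - a|.
    move=> ab ad bd.
    have [] := @MVT_segment _ (Q ^~ y) (Qt ^~ y) a b ab.
    - move=> z; rewrite in_itv/= => /andP[/ltW az /ltW zb].
      by apply: (DQ z _).1; apply: (B z a b) => //; apply/andP.
    - apply: within_of_for => z; rewrite /= in_itv/= => zab.
      have [H _] := DQ z (B _ _ _ zab ad bd).
      exact: is_derive_continuous H.
    - move=> z; rewrite in_itv/= => zab ->; rewrite -mulrBl normrM ler_wpM2r//.
      by have [_ /ltW] := DQ z (B _ _ _ zab ad bd); rewrite distrC.
  have [xt|/ltW xt] := leP (t s) x; first exact: E.
  have := E x (t s) xt xd ts.
  rewrite -normrN [X in _ <= _ * X -> _]distrC.
  by congr (`|_| <= _); ring.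
near=> h.
have th : `|t (h + s) - t s| < d.
  rewrite distrC; near: h; apply: nbhs_dnbhs.
  by move/cvgrPdist_lt : ct0; exact.
have Vh : V (r (h + s)) by near: h; apply: nbhs_dnbhs; exact: cr0.
have h0 : h != 0 by near: h; exact: nbhs_dnbhs_neq.
have Th : `|dt - h^-1 *: (t (h + s) - t s)| < q1.
  by near: h; move/cvgrPdist_lt : dtE; exact.
have Th1 : `|dt - h^-1 *: (t (h + s) - t s)| < 1.
  by near: h; move/cvgrPdist_lt : dtE; exact.
have Mh := M _ _ th Vh.
rewrite subrr subr0.
set T := h^-1 *: _ in Th Th1; set X := Q _ _ - _ in Mh *.
have Th' : `|dt - T| <= e / 2 / (`|Qt (t s) (r s)| + 1) by rewrite ltW.
move: (Qt (t s) (r s)) Mh qt0 Th' => q0 Mh qt0 Th'.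
have -> : q0 * dt - h^-1 *: X = q0 * (dt - T) - h^-1 *: (X - q0 * (t (h + s) - t s)).
  by rewrite /T /GRing.scale/=; ring.
rewrite (le_trans (ler_normB _ _))// (splitr e) lerD//.
  rewrite normrM (le_trans (ler_wpM2l _ Th'))//.
  rewrite mulrCA ger_pMr; last by rewrite divr_gt0.
  by rewrite ler_pdivrMr// mul1r lerDl.
rewrite normrZ (le_trans (ler_wpM2l _ Mh))// mulrCA -normrZ -/T.
rewrite /eps -[_ / _ * _]mulrA ger_pMr; last by rewrite divr_gt0.
rewrite ler_pdivrMl// mulr1.
have := ler_normB dt (dt - T); rewrite opprB addrC subrK => /le_trans; apply.
by rewrite lerD2l ltW.
Unshelve. all: end_near. Qed.

(** * The Schwarzschild connection on 2-forms *)

Lemma I4_ind (P : 'I_4 -> Prop) : P i0 -> P i1 -> P i2 -> P i3 ->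
  forall i, P i.
Proof.
move=> P0 P1 P2 P3 [[|[|[|[|//]]]] hi].
- by rewrite (_ : Ordinal hi = i0)//; apply: val_inj.
- by rewrite (_ : Ordinal hi = i1)//; apply: val_inj.
- by rewrite (_ : Ordinal hi = i2)//; apply: val_inj.
- by rewrite (_ : Ordinal hi = i3)//; apply: val_inj.
Qed.

Lemma sum4 (V : nmodType) (F : 'I_4 -> V) :
  \sum_(i < 4) F i = F i0 + F i1 + F i2 + F i3.
Proof.
rewrite !big_ord_recl big_ord0 addr0 !addrA.
by do !congr (_ + _); congr F; apply: val_inj.
Qed.

Section Connection.
Variables (R : realType) (M : R).
Hypothesis hM : 0 < M.
Implicit Types (p q : 'rV[R]_4).

Lemma spherical_r0 p : spherical M p -> p 0 i1 != 0.
Proof. by move=> [h _]; rewrite gt_eqF//; move: h hM; lra. Qed.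

Lemma lapse2_gt0 r : 2 * M < r -> 0 < lapse2 M r.
Proof.
move=> h; have r0 : 0 < r by move: h hM; lra.
by rewrite /lapse2 subr_gt0 ltr_pdivrMr// mul1r.
Qed.

Lemma lapse2_neq0 r : 2 * M < r -> lapse2 M r != 0.
Proof. by move=> /lapse2_gt0; apply: lt0r_neq0. Qed.

Lemma sphericalP p : spherical M p ->
  [/\ p 0 i1 != 0, lapse2 M (p 0 i1) != 0 & sin (p 0 i2) != 0].
Proof.
move=> sp; split; first exact: spherical_r0.
  by case: sp => h _; exact: lapse2_neq0.
by case: sp => _ h; rewrite gt_eqF// sin_gt0_pi.
Qed.

Lemma lapse2_is_derive (r : R) : r != 0 ->
  is_derive r 1 (lapse2 M) (2 * M / r ^+ 2).
Proof.
move=> r0.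
have D := derive1_sub (is_derive_cst (1 : R) r 1)
  (derive1_scale (derive1_inv r0 (is_derive_id r 1)) (2 * M)).
have <- : 0 - 2 * M * (- 1 / r ^+ 2) = 2 * M / r ^+ 2 by field.
exact: D.
Qed.

(** Indices in nat, here and below, let the components compute by matching. *)
Definition gdiag p (a : nat) : R :=
  nth 0 [:: lapse2 M (p 0 i1); - (lapse2 M (p 0 i1))^-1; - p 0 i1 ^+ 2;
            - (p 0 i1 ^+ 2 * sin (p 0 i2) ^+ 2)] a.

Lemma gE p a b : g M p a b = (a == b)%:R * gdiag p a.
Proof. by rewrite /g /metric !mxE; case: eqVneq; rewrite ?mulr1n ?mulr0n ?mul1r ?mul0r. Qed.

Lemma gdiag_neq0 p (a : 'I_4) : spherical M p -> gdiag p a != 0.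
Proof.
move=> /sphericalP[r0 f0 s0]; move: a; apply: I4_ind;
  by rewrite /gdiag/= ?oppr_eq0 ?invr_eq0 ?mulf_neq0 ?expf_neq0.
Qed.

Lemma ginvE p a b : spherical M p -> ginv M p a b = (a == b)%:R * (gdiag p a)^-1.
Proof.
move=> sp.
have H : metric M p *m diag_mx (\row_j (gdiag p j)^-1) = 1%:M.
  apply/matrixP => i j; rewrite mul_mx_diag !mxE.
  have [<-|ij] := eqVneq i j; last by rewrite mulr0n mul0r.
  by rewrite mulr1n -[X in X / _]/(gdiag p i) divff// gdiag_neq0.
have [u _] := mulmx1_unit H.
rewrite /ginv -[invmx _]mulmx1 -H mulmxA mulVmx// mul1mx !mxE.
by case: eqVneq => [->|_]; rewrite ?mulr1n ?mulr0n ?mul1r ?mul0r.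
Qed.

Definition dgdiag p (c a : nat) : R :=
  let r := p 0 i1 in let s := sin (p 0 i2) in
  match c, a with
  | 1%N, 0%N => 2 * M / r ^+ 2
  | 1%N, 1%N => 2 * M / r ^+ 2 / lapse2 M r ^+ 2
  | 1%N, 2%N => - (2 * r)
  | 1%N, 3%N => - (2 * r * s ^+ 2)
  | 2%N, 3%N => - (2 * r ^+ 2 * s * cos (p 0 i2))
  | _, _ => 0
  end.

Lemma partial_cst (x : R) c p : partial c (fun=> x) p = 0.
Proof. by rewrite /partial derive_cst. Qed.

Lemma partial_g c a b p : spherical M p ->
  partial c (fun q => g M q a b) p = (a == b)%:R * dgdiag p c a.
Proof.
move=> /sphericalP[r0 f0 s0].
have [<-|ab] := eqVneq a b; last first.
  have -> : (fun q => g M q a b) = (fun=> 0).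
    by apply/funext => q; rewrite gE (negbTE ab) mul0r.
  by rewrite partial_cst mul0r.
have -> : (fun q => g M q a a) = (fun q => gdiag q a).
  by apply/funext => q; rewrite gE eqxx mul1r.
rewrite mul1r.
have D1 := @partial_fun1 _ (lapse2 M) _ i1 c p (lapse2_is_derive r0).
have D2 := @partial_fun1 _ (fun x => - (lapse2 M x)^-1) _ i1 c p
  (derive1_opp (derive1_inv f0 (lapse2_is_derive r0))).
have Dr := derive1_opp (derive1_mul (is_derive_id (p 0 i1) 1) (is_derive_id (p 0 i1) 1)).
have Ds := derive1_mul (is_derive_sin (p 0 i2)) (is_derive_sin (p 0 i2)).
have D3 := @partial_fun1 _ _ _ i1 c p Dr.
have D4 := @partial_fun1 _ _ _ i2 c p Ds.
move: a; apply: I4_ind.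
- by rewrite /gdiag/=; case: D1 => _ ->; move: c {D2 D3 D4}; apply: I4_ind;
    rewrite /dgdiag/= ?mul0r ?mul1r.
- rewrite /gdiag/=; case: D2 => _ ->; move: c {D1 D3 D4}; apply: I4_ind;
    by rewrite /dgdiag/= ?mul0r ?mul1r// mulNr opprK.
- rewrite /gdiag/=; under eq_fun do rewrite expr2.
  case: D3 => _ ->; move: c {D1 D2 D4}; apply: I4_ind;
    by rewrite /dgdiag/= ?mul0r ?mul1r ?mulr1 //; ring.
- rewrite /gdiag/=.
  under eq_fun do rewrite -mulNr !expr2.
  case: D3 => d3 D3; case: D4 => d4 D4.
  rewrite (partialM d3 d4) D3 D4; move: c {D1 D2 D3 D4 d3 d4}; apply: I4_ind;
    by rewrite /dgdiag/= ?mul0r ?mul1r ?mulr1 ?mulr0 ?addr0 ?add0r //; ring.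
Qed.

Definition Gam p (d a b : nat) : R :=
  let r := p 0 i1 in let s := sin (p 0 i2) in let co := cos (p 0 i2) in
  let f := lapse2 M r in
  match d, a, b with
  | 0%N, 0%N, 1%N | 0%N, 1%N, 0%N => M / r ^+ 2 / f
  | 1%N, 0%N, 0%N => f * M / r ^+ 2
  | 1%N, 1%N, 1%N => - (M / r ^+ 2 / f)
  | 1%N, 2%N, 2%N => - (r * f)
  | 1%N, 3%N, 3%N => - (r * f * s ^+ 2)
  | 2%N, 1%N, 2%N | 2%N, 2%N, 1%N | 3%N, 1%N, 3%N | 3%N, 3%N, 1%N => r^-1
  | 2%N, 3%N, 3%N => - (s * co)
  | 3%N, 2%N, 3%N | 3%N, 3%N, 2%N => co / s
  | _, _, _ => 0
  end.

Lemma christoffelE p d a b : spherical M p -> christoffel M p d a b = Gam p d a b.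
Proof.
move=> sp; have [r0 f0 s0] := sphericalP sp.
have -> : christoffel M p d a b = 2^-1 * ((gdiag p d)^-1 *
  ((d == b)%:R * dgdiag p a d + (d == a)%:R * dgdiag p b d - (a == b)%:R * dgdiag p d a)).
  rewrite /christoffel; congr (_ * _).
  rewrite (bigD1 d)//= big1 ?addr0.
    by rewrite ginvE// eqxx mul1r !partial_g.
  by move=> i id; rewrite ginvE// eq_sym (negbTE id) !mul0r.
move: r0 f0 s0; rewrite /gdiag /dgdiag /Gam.
move: (lapse2 M (p 0 i1)) (p 0 i1) (sin (p 0 i2)) (cos (p 0 i2)) => f r s co r0 f0 s0.
move: d; apply: I4_ind; move: a; apply: I4_ind; move: b; apply: I4_ind;
  rewrite /= ?mul0r ?mul1r ?addr0 ?add0r ?subr0 ?mulr0 ?oppr0 ?mulr0 //; field;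
  by rewrite ?r0 ?f0 ?s0.
Qed.

(** The coordinate expression of the divergence of a 2-form; it is an identity
    in the components and their first derivatives at the point. *)
Lemma divergenceE (T : tensor2 R) p : spherical M p ->
  (forall a b, T p a b = - T p b a) ->
  let r := p 0 i1 in let s := sin (p 0 i2) in let co := cos (p 0 i2) in
  let f := lapse2 M r in
  let D c a b := partial c (fun q => T q a b) p in
  (forall c a b, D c a b = - D c b a) ->
  [/\ divergence M T p i0 = - f * D i1 i0 i1 - 2 * f / r * T p i0 i1
        - (D i2 i0 i2 + co / s * T p i0 i2) / r ^+ 2
        - D i3 i0 i3 / (r ^+ 2 * s ^+ 2),
      divergence M T p i1 = - D i0 i0 i1 / f
        - (D i2 i1 i2 + co / s * T p i1 i2) / r ^+ 2
        - D i3 i1 i3 / (r ^+ 2 * s ^+ 2),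
      divergence M T p i2 = - D i0 i0 i2 / f
        + f * D i1 i1 i2 + 2 * M / r ^+ 2 * T p i1 i2
        - D i3 i2 i3 / (r ^+ 2 * s ^+ 2) &
      divergence M T p i3 = - D i0 i0 i3 / f
        + f * D i1 i1 i3 + 2 * M / r ^+ 2 * T p i1 i3
        + (D i2 i2 i3 - co / s * T p i2 i3) / r ^+ 2].
Proof.
move=> sp Ta r s co f D Da; have [r0 f0 s0] := sphericalP sp.
have E a : divergence M T p a = \sum_(b < 4) (gdiag p b)^-1 *
    (D b a b - \sum_(d < 4) Gam p d b a * T p d b
             - \sum_(d < 4) Gam p d b b * T p a d).
  rewrite /divergence; apply: eq_bigr => b _.
  rewrite (bigD1 b)//= big1 ?addr0.
    rewrite ginvE// eqxx mul1r /nabla; congr (_ * (_ - _ - _)).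
      by apply: eq_bigr => d _; rewrite christoffelE.
    by apply: eq_bigr => d _; rewrite christoffelE.
  by move=> c cb; rewrite ginvE// eq_sym (negbTE cb) !mul0r.
have T00 a : T p a a = 0 by have := Ta a a; lra.
have D00 c a : D c a a = 0 by have := Da c a a; lra.
have hf : M = (r - f * r) / 2 by rewrite /f /lapse2; field.
rewrite !{}E !sum4 /gdiag /Gam /= -/r -/f -/s -/co hf.
rewrite !T00 !D00 (Ta i1 i0) (Ta i2 i0) (Ta i3 i0) (Ta i2 i1) (Ta i3 i1) (Ta i3 i2).
rewrite (Da i0 i1 i0) (Da i0 i2 i0) (Da i0 i3 i0) (Da i1 i2 i1) (Da i1 i3 i1) (Da i2 i3 i2).
move: (D i1 i0 i1) (D i2 i0 i2) (D i3 i0 i3) (D i0 i0 i1) (D i2 i1 i2)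
 (D i3 i1 i3) (D i0 i0 i2) (D i1 i1 i2) (D i3 i2 i3) (D i0 i0 i3) (D i1 i1 i3) (D i2 i2 i3).
move: (T p i0 i1) (T p i0 i2) (T p i0 i3) (T p i1 i2) (T p i1 i3) (T p i2 i3).
move=> *; have {}s0 : s != 0 by [].
have {}f0 : f != 0 by [].
have {}r0 : r != 0 by [].
clear Da D00 D hf; clearbody f; clearbody r s co; clear Ta T00 sp.
by split; field; rewrite ?r0 ?f0 ?s0.
Qed.

(** The Levi-Civita connection is torsion free, so the exterior derivative of
    a 2-form is the antisymmetrized partial derivative. *)
Lemma alt3_nablaE (T : tensor2 R) p c a b : spherical M p ->
  (forall a b, T p a b = - T p b a) ->
  alt3 (nabla M T p) c a b =
  alt3 (fun c a b => partial c (fun q => T q a b) p) c a b.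
Proof.
move=> sp Ta.
have S d x y : christoffel M p d x y = christoffel M p d y x.
  rewrite !christoffelE//; move: d; apply: I4_ind; move: x; apply: I4_ind;
  by move: y; apply: I4_ind.
have N x y z : nabla M T p x y z = partial x (fun q => T q y z) p
    - \sum_(d < 4) christoffel M p d x y * T p d z
    + \sum_(d < 4) christoffel M p d x z * T p d y.
  rewrite /nabla -sumrN; congr (_ + _); rewrite -sumrN.
  by apply: eq_bigr => d _; rewrite (Ta y d) mulrN opprK.
have SS x y z : \sum_(d < 4) christoffel M p d x y * T p d z =
                \sum_(d < 4) christoffel M p d y x * T p d z.
  by apply: eq_bigr => d _; rewrite S.
rewrite /alt3 !N (SS b c a) (SS a c b) (SS b a c).
move: (\sum_(d < 4) christoffel M p d c b * T p d a)
  (\sum_(d < 4) christoffel M p d c a * T p d b)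
  (\sum_(d < 4) christoffel M p d a b * T p d c) => x y z.
by move: (partial c _ p) (partial a _ p) (partial b _ p) (partial c _ p) (partial b _ p) (partial a _ p) => *; ring.
Qed.

End Connection.

(** * The one-form beta *)

Section Determinant.

(** Laplace expansion along the first row, on matrices given by a function of
    natural numbers, so that it computes. *)
Fixpoint detn (R : pzRingType) (n : nat) (m : nat -> nat -> R) : R :=
  if n is n'.+1 then
    foldr (fun j x => m 0%N j * ((-1) ^+ j * detn n' (fun i k => m i.+1 (bump j k))) + x)
      0 (iota 0 n)
  else 1.

Lemma detnE (R : comNzRingType) n (m : nat -> nat -> R) :
  \det (\matrix_(i < n, j < n) m i j) = detn n m.
Proof.
elim: n m => [|n IH] m; first by rewrite det_mx00.
rewrite (expand_det_row _ ord0).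
have F (s : seq nat) (h : nat -> R) : foldr (fun j x => h j + x) 0 s = \sum_(j <- s) h j.
  by elim: s => [|j s IHs] /=; rewrite ?big_nil// big_cons IHs.
transitivity (\sum_(0 <= j < n.+1) m 0%N j * ((-1) ^+ j * detn n (fun i k => m i.+1 (bump j k)))); last by rewrite -F.
rewrite big_mkord.
apply: eq_bigr => j _; rewrite mxE /cofactor add0n -IH; congr (_ * (_ * \det _)).
by apply/matrixP => i k; rewrite !mxE.
Qed.

Definition psym (a b c d : nat) : int :=
  detn 4 (fun i j => (nth 0%N [:: a; b; c; d] i == j)%:R).

(* Kept as a match so that the values 0, 1 and -1 reduce without casts. *)
Definition sgnR (R : pzRingType) (z : int) : R :=
  match z with Posz 0 => 0 | Posz 1 => 1 | Negz 0 => -1 | _ => z%:~R end.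

Lemma perm_symbolE (R : realType) a b c d :
  perm_symbol R a b c d = sgnR R (psym a b c d).
Proof.
have -> z : sgnR R z = z%:~R by case: z => [[|[|n]]|[|n]].
rewrite /psym -detnE -[RHS]/(intmul 1 _) -(det_map_mx intr).
congr (\det _); apply/matrixP => i j; rewrite !mxE.
rewrite -[LHS]/((nth i0 [:: a; b; c; d] i == j)%:R) rmorph_nat; congr (_%:R).
by case: i => [[|[|[|[|//]]]] hi].
Qed.

End Determinant.

Ltac eval_psym :=
  repeat match goal with |- context [sgnR ?R (psym ?a ?b ?c ?d)] =>
    let v := eval vm_compute in (psym a b c d) in
    change (sgnR R (psym a b c d)) with (sgnR R v) end; rewrite /sgnR /=.

Section Hodge.
Variables (R : realType) (M : R).
Hypothesis hM : 0 < M.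
Implicit Types (p q : 'rV[R]_4).

Lemma volume_element p : spherical M p ->
  Num.sqrt `|\det (metric M p)| = p 0 i1 ^+ 2 * sin (p 0 i2).
Proof.
move=> sp; have [r0 f0 s0] := sphericalP hM sp; case: (sp) => _ /sin_gt0_pi s1.
rewrite /metric det_diag big_ord_recl !big_ord_recr big_ord0 /= !mxE /= mul1r.
rewrite (_ : _ * _ = - (p 0 i1 ^+ 2 * sin (p 0 i2)) ^+ 2); last first.
  by field; exact: f0.
rewrite normrN ger0_norm ?sqr_ge0// sqrtr_sqr ger0_norm//.
by rewrite mulr_ge0 ?sqr_ge0// ltW.
Qed.

Lemma raise2E (T : tensor2 R) p c d : spherical M p ->
  raise2 M T p c d = (gdiag M p c)^-1 * (gdiag M p d)^-1 * T p c d.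
Proof.
move=> sp; rewrite /raise2 (bigD1 c)//= [X in _ + X]big1 ?addr0; last first.
  move=> i ic; apply: big1 => j _.
  by rewrite ginvE// eq_sym (negbTE ic) !mul0r.
rewrite (bigD1 d)//= big1 ?addr0; last first.
  by move=> j jd; rewrite [ginv M p d j]ginvE// eq_sym (negbTE jd) mul0r mulr0 mul0r.
by rewrite !ginvE// !eqxx !mul1r.
Qed.

Lemma raise_sndE (T : tensor2 R) p a c : spherical M p ->
  raise_snd M T p a c = T p a c / gdiag M p c.
Proof.
move=> sp; rewrite /raise_snd (bigD1 c)//= big1 ?addr0.
  by rewrite ginvE// eqxx mul1r.
by move=> i ic; rewrite ginvE// (negbTE ic) mul0r mulr0.
Qed.

Lemma hodgeE (T : tensor2 R) p : spherical M p ->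
  (forall a b, T p a b = - T p b a) ->
  let r := p 0 i1 in let s := sin (p 0 i2) in let f := lapse2 M r in
  [/\ forall a b, hodge M T p a b = - hodge M T p b a,
      hodge M T p i0 i1 = T p i2 i3 / (r ^+ 2 * s) /\
      hodge M T p i2 i3 = - (r ^+ 2 * s * T p i0 i1),
      hodge M T p i0 i2 = - (f * T p i1 i3 / s) /\
      hodge M T p i0 i3 = s * f * T p i1 i2 &
      hodge M T p i1 i2 = - (T p i0 i3 / (f * s)) /\
      hodge M T p i1 i3 = s * T p i0 i2 / f].
Proof.
move=> sp Ta r s f; have [r0 f0 s0] := sphericalP hM sp.
have E a b : hodge M T p a b = 2^-1 * \sum_(c < 4) \sum_(d < 4)
    r ^+ 2 * s * sgnR R (psym a b c d) * ((gdiag M p c)^-1 * (gdiag M p d)^-1 * T p c d).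
  congr (_ * _); apply: eq_bigr => c _; apply: eq_bigr => d _.
  by rewrite /epsilon volume_element// perm_symbolE raise2E.
have T00 a : T p a a = 0 by have := Ta a a; lra.
split.
- move=> a b; rewrite !E -mulrN; congr (_ * _).
  rewrite -sumrN; apply: eq_bigr => c _; rewrite -sumrN; apply: eq_bigr => d _.
  rewrite -mulNr; congr (_ * _); rewrite -mulrN; congr (_ * _).
  by move: a b c d; do 4![apply: I4_ind]; eval_psym; rewrite ?oppr0 ?opprK.
- rewrite !E !sum4; eval_psym; rewrite /gdiag /= !T00 (Ta i1 i0) (Ta i3 i2).
  rewrite -/r -/f -/s.
  move: (T p i0 i1) (T p i2 i3) => x y; clear E; split; field; by rewrite ?r0 ?f0 ?s0.
- rewrite !E !sum4; eval_psym; rewrite /gdiag /= !T00 (Ta i2 i1) (Ta i3 i1).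
  rewrite -/r -/f -/s.
  move: (T p i1 i2) (T p i1 i3) => x y; clear E; split; field; by rewrite ?r0 ?f0 ?s0.
- rewrite !E !sum4; eval_psym; rewrite /gdiag /= !T00 (Ta i2 i0) (Ta i3 i0).
  rewrite -/r -/f -/s.
  move: (T p i0 i2) (T p i0 i3) => x y; clear E; split; field; by rewrite ?r0 ?f0 ?s0.
Qed.

Lemma ZfieldE (F : tensor2 R) p : spherical M p ->
  (forall a b, F p a b = - F p b a) ->
  let r := p 0 i1 in let s := sin (p 0 i2) in let f := lapse2 M r in
  [/\ forall a b, Zfield M F p a b = - Zfield M F p b a,
      Zfield M F p i0 i1 = 0 /\ Zfield M F p i2 i3 = 0,
      Zfield M F p i0 i2 = - (2 / 3) * r * f * F p i1 i2 /\
      Zfield M F p i0 i3 = - (2 / 3) * r * f * F p i1 i3 &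
      Zfield M F p i1 i2 = - (2 / 3) * r * F p i0 i2 / f /\
      Zfield M F p i1 i3 = - (2 / 3) * r * F p i0 i3 / f].
Proof.
move=> sp Fa r s f; have [r0 f0 s0] := sphericalP hM sp.
have [Ha _ [H02 H03] [H12 H13]] := hodgeE sp Fa.
have H00 a : hodge M F p a a = 0 by have := Ha a a; lra.
split; first by move=> a b; rewrite /Zfield /alt2; ring.
all: rewrite /Zfield /alt2 !sum4 !raise_sndE// /Y /alt2 /gdiag /= !H00 ?(Ha i2 i3) ?H02 ?H03 ?H12 ?H13 ?(Ha i1 i0) ?(Ha i3 i0) ?(Ha i2 i0) ?(Ha i2 i1) ?(Ha i3 i1).
all: rewrite -/r -/s -/f ?H02 ?H03 ?H12 ?H13 -/r -/s -/f; clear Ha H02 H03 H12 H13 H00.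
all: move: (F p i0 i2) (F p i0 i3) (F p i1 i2) (F p i1 i3) (hodge M F p i2 i3) (hodge M F p i0 i1) => *.
all: split; field; by rewrite ?r0 ?f0 ?s0.
Qed.

End Hodge.

(** * Maxwell's equations and beta in the frame *)

Lemma I4_lt_ind (P : 'I_4 -> 'I_4 -> Prop) :
  P i0 i1 -> P i0 i2 -> P i0 i3 -> P i1 i2 -> P i1 i3 -> P i2 i3 ->
  forall a b : 'I_4, (a < b)%N -> P a b.
Proof. by move=> H1 H2 H3 H4 H5 H6; apply: I4_ind; apply: I4_ind. Qed.

Lemma cyclic_sum0 (R : realFieldType) (x y z : R) :
  (x + y + z - - x - - z - - y) / 6 = 0 -> x + y + z = 0.
Proof. lra. Qed.

Section Orbital.
Variables (R : realType) (M : R).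
Hypothesis hM : 0 < M.
Implicit Types (p q : 'rV[R]_4) (X Y E B : 'rV[R]_4 -> R).

(** The angular coordinates range over the whole plane here: the components
    below extend smoothly across the poles. *)
Definition chart : set 'rV[R]_4 := [set p | 2 * M < p 0 i1].

Lemma open_chart : open chart.
Proof.
rewrite (_ : chart = (fun p => p 0 i1) @^-1` [set x | 2 * M < x])//.
by apply: open_comp; [move=> p _; exact: coord_continuous|exact: open_gt].
Qed.

Lemma open_spherical : open (spherical M).
Proof.
rewrite (_ : spherical M = chart `&` ((fun p => p 0 i2) @^-1` `]0, pi[)).
  apply: openI; first exact: open_chart.
  by apply: open_comp; [move=> p _; exact: coord_continuous|exact: itv_open].
by apply/seteqP; split=> p [] /=; rewrite in_itv.
Qed.

Lemma spherical_chart p : spherical M p -> chart p. Proof. by case. Qed.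

Lemma chart_r_gt0 p : chart p -> 0 < p 0 i1.
Proof. by rewrite /chart/=; move: hM; lra. Qed.

(** 2-forms with one index along the orbit space and one along the sphere. The
    weights are those of Z; the literal factors 1 and s give the four components
    the common form of [weighted_component]. *)
Definition orbital (W : tensor2 R) (X1 X2 Y1 Y2 : 'rV[R]_4 -> R) :=
  forall q, spherical M q ->
  let r := q 0 i1 in let s := sin (q 0 i2) in
  [/\ forall a b, W q a b = - W q b a, W q i0 i1 = 0 /\ W q i2 i3 = 0,
      W q i0 i2 = (- (2 / 3) * r) * 1 * X1 q /\
      W q i0 i3 = (- (2 / 3) * r) * s * X2 q &
      W q i1 i2 = (- (2 / 3) * r / lapse2 M r) * 1 * Y1 q /\
      W q i1 i3 = (- (2 / 3) * r / lapse2 M r) * s * Y2 q].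

Lemma partial_weight (alpha bet : R -> R) (da db : R) X k p :
  is_derive (p 0 i1) 1 alpha da -> is_derive (p 0 i2) 1 bet db ->
  derivable X p (delta_mx 0 k) ->
  let W := fun q => alpha (q 0 i1) * bet (q 0 i2) * X q in
  derivable W p (delta_mx 0 k) /\
  partial k W p =
  (i1 == k)%:R * da * bet (p 0 i2) * X p +
  (i2 == k)%:R * alpha (p 0 i1) * db * X p +
  alpha (p 0 i1) * bet (p 0 i2) * partial k X p.
Proof.
move=> aD bD dX W.
have [d1 D1] := @partial_fun1 _ alpha da i1 k p aD.
have [d2 D2] := @partial_fun1 _ bet db i2 k p bD.
split; first exact: (derivableM (derivableM d1 d2) dX).
have := partialM (derivableM d1 d2) dX; rewrite -[LHS]/(partial k W p) => ->.
rewrite (partialM d1 d2) D1 D2.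
rewrite -[(_ * _) p]/(alpha (p 0 i1) * bet (p 0 i2)).
by move: (partial k X p) (X p) => *; ring.
Qed.

Lemma partial_spherical_ext (f g : 'rV[R]_4 -> R) k p : spherical M p ->
  (forall q, spherical M q -> f q = g q) -> partial k f p = partial k g p.
Proof. by move=> sp fg; exact: (partial_ext open_spherical). Qed.

Lemma derivable_spherical_ext (f g : 'rV[R]_4 -> R) v p : spherical M p ->
  (forall q, spherical M q -> f q = g q) -> derivable f p v -> derivable g p v.
Proof.
by move=> sp fg; apply: near_eq_derivable; exact: (near_eq_on open_spherical).
Qed.

Lemma partial_antisym (W : tensor2 R) p k : spherical M p ->
  (forall q a b, spherical M q -> W q a b = - W q b a) ->
  (forall a b : 'I_4, (a < b)%N -> derivable (fun q => W q a b) p (delta_mx 0 k)) ->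
  forall a b, partial k (fun q => W q a b) p = - partial k (fun q => W q b a) p.
Proof.
move=> sp Wa dW.
have H (a b : 'I_4) : (a < b)%N -> partial k (fun q => W q b a) p = - partial k (fun q => W q a b) p.
  move=> ab; rewrite (@partial_spherical_ext _ (fun q => - W q a b))//.
    by rewrite /partial [LHS](deriveN (dW a b ab)).
  by move=> q; exact: Wa.
move=> a b; have [ab|ba|ab] := ltngtP a b.
- by rewrite (H a b)// opprK.
- exact: H.
- have -> : a = b by exact: val_inj.
  rewrite (@partial_spherical_ext _ (fun=> 0)) ?partial_cst ?oppr0// => q sq.
  by have := Wa q b b sq; lra.
Qed.

Lemma weighted_component (h : 'rV[R]_4 -> R) (alpha bet : R -> R) (da db : R) X p :
  spherical M p ->
  (forall q, spherical M q -> h q = alpha (q 0 i1) * bet (q 0 i2) * X q) ->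
  is_derive (p 0 i1) 1 alpha da -> is_derive (p 0 i2) 1 bet db ->
  (forall k, derivable X p (delta_mx 0 k)) ->
  (forall k, derivable h p (delta_mx 0 k)) /\
  forall k, partial k h p =
    (i1 == k)%:R * da * bet (p 0 i2) * X p +
    (i2 == k)%:R * alpha (p 0 i1) * db * X p +
    alpha (p 0 i1) * bet (p 0 i2) * partial k X p.
Proof.
move=> sp hE aD bD dX.
have H k := partial_weight aD bD (dX k).
split=> k; last by rewrite (partial_spherical_ext _ sp hE); exact: (H k).2.
by apply: derivable_spherical_ext sp _ (H k).1 => q /hE.
Qed.

Lemma is_derive_orbital_weight r : 2 * M < r ->
  is_derive r 1 (fun r : R => - (2 / 3) * r / lapse2 M r)
    (- (2 / 3) / lapse2 M r + (2 / 3) * r * (2 * M / r ^+ 2) / lapse2 M r ^+ 2).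
Proof.
move=> hr; have r0 : r != 0 by rewrite gt_eqF//; move: hr hM; lra.
have f0 := lapse2_neq0 hM hr.
have D := derive1_mul (derive1_scale (is_derive_id r 1) (- (2 / 3)))
  (derive1_inv f0 (lapse2_is_derive M r0)).
have <- : - (2 / 3) * 1 / lapse2 M r +
    - (2 / 3) * r * (- (2 * M / r ^+ 2) / lapse2 M r ^+ 2) =
  - (2 / 3) / lapse2 M r + (2 / 3) * r * (2 * M / r ^+ 2) / lapse2 M r ^+ 2.
  by field; rewrite r0 f0.
exact: D.
Qed.

Lemma UupE p a : spherical M p -> Uup M p a = (a == i1)%:R * (lapse2 M (p 0 i1) / p 0 i1).
Proof.
move=> sp; have [r0 f0 s0] := sphericalP hM sp.
have D k : partial k (fun q : 'rV[R]_4 => q 0 i1) p = (i1 == k)%:R * 1.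
  by case: (@partial_fun1 _ id 1 i1 k p (is_derive_id (p 0 i1) 1)).
rewrite /Uup (bigD1 a)//= big1 ?addr0; last first.
  by move=> i ia; rewrite ginvE// eq_sym (negbTE ia) !mul0r.
rewrite ginvE// eqxx mul1r /U D; move: a; apply: I4_ind;
  rewrite /gdiag/= ?mul0r ?mulr0 //.
by field; rewrite r0 f0.
Qed.

Definition beta_part (W : tensor2 R) p a : R :=
  - 2^-1 * (\sum_(b < 4) Uup M p b * W p a b) - 2^-1 * divergence M W p a.

(** The term in U cancels the derivative of the weight r, so that only divergences
    and curls on the sphere and on the orbit space remain. *)
Lemma beta_orbital W X1 X2 Y1 Y2 p : orbital W X1 X2 Y1 Y2 ->
  ck chart 1 X1 -> ck chart 1 X2 -> ck chart 1 Y1 -> ck chart 1 Y2 ->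
  spherical M p ->
  let r := p 0 i1 in let s := sin (p 0 i2) in let co := cos (p 0 i2) in
  let f := lapse2 M r in
  [/\ beta_part W p i0 =
        - (s * partial i2 X1 p + co * X1 p + partial i3 X2 p) / (3 * r * s),
      beta_part W p i1 =
        - (s * partial i2 Y1 p + co * Y1 p + partial i3 Y2 p) / (3 * r * s * f),
      beta_part W p i2 = - (r / (3 * f)) * (partial i0 X1 p - f * partial i1 Y1 p) &
      beta_part W p i3 = - (r * s / (3 * f)) * (partial i0 X2 p - f * partial i1 Y2 p)].
Proof.
move=> oW cX1 cX2 cY1 cY2 sp r s co f; have [r0 f0 s0] := sphericalP hM sp.
have cp := spherical_chart sp.
have [Wa [W01 W23] [W02 W03] [W12 W13]] := oW p sp.
have dd (h : 'rV[R]_4 -> R) k : ck chart 1 h -> derivable h p (delta_mx 0 k).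
  by move=> cf; exact: ckS_derivable cf cp.
have D1 := derive1_scale (is_derive_id r 1) (- (2 / 3)).
have D2 := is_derive_orbital_weight cp.
have D0 := is_derive_cst (1 : R) (p 0 i2) 1.
have D3 := is_derive_sin (p 0 i2).
have Z a b : (forall q, spherical M q -> W q a b = 0) ->
    forall k, derivable (fun q => W q a b) p (delta_mx 0 k) /\
      partial k (fun q => W q a b) p = 0.
  move=> H k; split; last by rewrite (@partial_spherical_ext _ (fun=> 0)) ?partial_cst.
  by apply: (@derivable_spherical_ext (fun=> 0)) => // q /H.
have Z01 := Z i0 i1 (fun q sq => let: And4 _ (conj H _) _ _ := oW q sq in H).
have Z23 := Z i2 i3 (fun q sq => let: And4 _ (conj _ H) _ _ := oW q sq in H).
have [d02 P02] := @weighted_component (fun q => W q i0 i2) (fun r => - (2 / 3) * r) (fun=> 1) _ _ X1 p sp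
  (fun q sq => let: And4 _ _ (conj H _) _ := oW q sq in H) D1 D0 (fun k => dd _ k cX1).
have [d03 P03] := @weighted_component (fun q => W q i0 i3) (fun r => - (2 / 3) * r) sin _ _ X2 p sp
  (fun q sq => let: And4 _ _ (conj _ H) _ := oW q sq in H) D1 D3 (fun k => dd _ k cX2).
have [d12 P12] := @weighted_component (fun q => W q i1 i2) (fun r => - (2 / 3) * r / lapse2 M r) (fun=> 1) _ _ Y1 p sp
  (fun q sq => let: And4 _ _ _ (conj H _) := oW q sq in H) D2 D0 (fun k => dd _ k cY1).
have [d13 P13] := @weighted_component (fun q => W q i1 i3) (fun r => - (2 / 3) * r / lapse2 M r) sin _ _ Y2 p sp
  (fun q sq => let: And4 _ _ _ (conj _ H) := oW q sq in H) D2 D3 (fun k => dd _ k cY2).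
have Da : forall k a b, partial k (fun q => W q a b) p = - partial k (fun q => W q b a) p.
  move=> k; apply: partial_antisym => //; first by move=> q a b /oW[].
  exact: (I4_lt_ind (Z01 k).1 (d02 k) (d03 k) (d12 k) (d13 k) (Z23 k).1).
have [E0 E1 E2 E3] := divergenceE hM sp Wa Da.
rewrite /beta_part {}E0 {}E1 {}E2 {}E3 !sum4 !UupE//=.
rewrite !(proj2 (Z01 _)) !(proj2 (Z23 _)) !P02 !P03 !P12 !P13 /=.
have W11 : W p i1 i1 = 0 by have := Wa i1 i1; clear; lra.
rewrite (Wa i2 i1) (Wa i3 i1) W11 W01 W23 W02 W03 W12 W13.
have hf : M = (r - f * r) / 2 by rewrite /f /lapse2; field.
have -> : 2 * M / p 0 i1 ^+ 2 = (1 - f) / r.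
  by rewrite hf /r; field.
rewrite -/r -/f -/s -/co.
have {}r0 : r != 0 by [].
have {}f0 : f != 0 by [].
have {}s0 : s != 0 by [].
move: (partial i0 X1 p) (partial i0 X2 p) (partial i1 Y1 p) (partial i1 Y2 p)
  (partial i2 X1 p) (partial i3 X2 p) (partial i2 Y1 p) (partial i3 Y2 p)
  (partial i0 Y1 p) (partial i0 Y2 p) (partial i1 X1 p) (partial i1 X2 p).
move: (X1 p) (X2 p) (Y1 p) (Y2 p) (W p i0 i0).
split; field; by rewrite ?r0 ?f0 ?s0.
Qed.

Lemma beta_parts (F : tensor2 R) p a :
  beta M F p a = ((beta_part (Zfield M F) p a) +i*
                  (beta_part (hodge M (Zfield M F)) p a))%C.
Proof. by []. Qed.

(** The components of a 2-form in the frame with the angular directions scaled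
    to unit length; in terms of these the frame singularities at the poles
    disappear. *)
Definition frame_comps (F : tensor2 R) (E B a b c d : 'rV[R]_4 -> R) :=
  forall q, spherical M q ->
  let r := q 0 i1 in let s := sin (q 0 i2) in let f := lapse2 M r in
  [/\ forall i j, F q i j = - F q j i,
      F q i0 i1 = E q / r ^+ 2 /\ F q i2 i3 = s * B q,
      F q i0 i2 = a q /\ F q i0 i3 = s * b q &
      F q i1 i2 = c q / f /\ F q i1 i3 = s * d q / f].

Section Frame.
Variables (F : tensor2 R) (E B a b c d : 'rV[R]_4 -> R).
Hypothesis Fc : frame_comps F E B a b c d.

Lemma orbital_Zfield : orbital (Zfield M F) c d a b.
Proof.
move=> q sq r s; have [Fa _ [F02 F03] [F12 F13]] := Fc sq.
have [r0 f0 s0] := sphericalP hM sq.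
have [Za Z0 [Z02 Z03] [Z12 Z13]] := ZfieldE hM sq Fa.
rewrite {}/r {}/s; split=> //.
  by rewrite Z02 Z03 F12 F13; split; field; exact: f0.
by rewrite Z12 Z13 F02 F03; split; field; exact: f0.
Qed.

(** The dual of Z has the same shape, with the roles of the electric and
    magnetic parts exchanged. *)
Lemma orbital_hodge_Zfield :
  orbital (hodge M (Zfield M F)) (fun q => - b q) a (fun q => - d q) c.
Proof.
move=> q sq r s; have [Za [Z01 Z23] [Z02 Z03] [Z12 Z13]] := orbital_Zfield sq.
have [r0 f0 s0] := sphericalP hM sq.
have [Ha [H01 H23] [H02 H03] [H12 H13]] := hodgeE hM sq Za.
rewrite {}/r {}/s; split=> //; first by rewrite H01 H23 Z01 Z23 mul0r mulr0 oppr0.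
  by rewrite H02 H03 Z12 Z13; split; field; rewrite ?s0 ?f0.
by rewrite H12 H13 Z02 Z03; split; field; rewrite ?s0 ?f0.
Qed.

Hypothesis ckF : forall n, [/\ ck chart n E, ck chart n B,
  ck chart n a /\ ck chart n b & ck chart n c /\ ck chart n d].
Hypothesis mF : maxwell M F.

(** The factor sin th is kept where the equation would otherwise be singular at the
    poles: the two first pairs determine dE and dB through the divergence and the
    curl of the one-forms (a, b) and (c, d) on the sphere. *)
Lemma maxwell_frame p : spherical M p ->
  let r := p 0 i1 in let s := sin (p 0 i2) in let co := cos (p 0 i2) in
  let f := lapse2 M r in let V := f / r ^+ 2 in
  [/\ s * partial i0 E p = - (s * partial i2 c p + co * c p + partial i3 d p) /\
      s * (f * partial i1 E p) = - (s * partial i2 a p + co * a p + partial i3 b p),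
      s * partial i0 B p = s * partial i2 b p + co * b p - partial i3 a p /\
      s * (f * partial i1 B p) = s * partial i2 d p + co * d p - partial i3 c p,
      partial i0 c p - f * partial i1 a p = - V * partial i2 E p /\
      s * (partial i0 d p - f * partial i1 b p) = - V * partial i3 E p &
      partial i0 b p - f * partial i1 d p = V * partial i2 B p /\
      s * (partial i0 a p - f * partial i1 c p) = - V * partial i3 B p].
Proof.
move=> sp r s co f V; have [r0 f0 s0] := sphericalP hM sp.
have cp := spherical_chart sp.
have [cE cB [ca cb] [cc cd]] := ckF 1.
have dd (h : 'rV[R]_4 -> R) : ck chart 1 h -> forall k, derivable h p (delta_mx 0 k).
  by move=> ch k; exact: ckS_derivable ch cp.
have D1 := is_derive_cst (1 : R) (p 0 i1) 1.
have D2 := is_derive_cst (1 : R) (p 0 i2) 1.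
have Ds := is_derive_sin (p 0 i2).
have rr0 : p 0 i1 * p 0 i1 != 0 by rewrite mulf_neq0.
have Dr := @derive1_inv _ (fun r => r * r) _ _ rr0 (derive1_mul (is_derive_id (p 0 i1) 1) (is_derive_id (p 0 i1) 1)).
have Df := derive1_inv f0 (lapse2_is_derive M r0).
have Q01 q : spherical M q -> F q i0 i1 = (fun r => (r * r)^-1) (q 0 i1) * (fun=> 1) (q 0 i2) * E q.
  by move=> /Fc[_ [-> _] _ _]; rewrite -expr2 mulr1 mulrC.
have [d01 P01] := @weighted_component (fun q => F q i0 i1) (fun r => (r * r)^-1) (fun=> 1) _ _ E p sp Q01 Dr D2 (dd _ cE).
have Q23 q : spherical M q -> F q i2 i3 = (fun=> 1) (q 0 i1) * sin (q 0 i2) * B q.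
  by move=> /Fc[_ [_ ->] _ _]; rewrite mul1r.
have [d23 P23] := @weighted_component (fun q => F q i2 i3) (fun=> 1) sin _ _ B p sp Q23 D1 Ds (dd _ cB).
have Q02 q : spherical M q -> F q i0 i2 = (fun=> 1) (q 0 i1) * (fun=> 1) (q 0 i2) * a q.
  by move=> /Fc[_ _ [-> _] _]; rewrite !mul1r.
have [d02 P02] := @weighted_component (fun q => F q i0 i2) (fun=> 1) (fun=> 1) _ _ a p sp Q02 D1 D2 (dd _ ca).
have Q03 q : spherical M q -> F q i0 i3 = (fun=> 1) (q 0 i1) * sin (q 0 i2) * b q.
  by move=> /Fc[_ _ [_ ->] _]; rewrite mul1r.
have [d03 P03] := @weighted_component (fun q => F q i0 i3) (fun=> 1) sin _ _ b p sp Q03 D1 Ds (dd _ cb).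
have Q12 q : spherical M q -> F q i1 i2 = (fun r => (lapse2 M r)^-1) (q 0 i1) * (fun=> 1) (q 0 i2) * c q.
  by move=> /Fc[_ _ _ [-> _]]; rewrite mulr1 mulrC.
have [d12 P12] := @weighted_component (fun q => F q i1 i2) (fun r => (lapse2 M r)^-1) (fun=> 1) _ _ c p sp Q12 Df D2 (dd _ cc).
have Q13 q : spherical M q -> F q i1 i3 = (fun r => (lapse2 M r)^-1) (q 0 i1) * sin (q 0 i2) * d q.
  by move=> /Fc[_ _ _ [_ ->]]; rewrite mulrC mulrA.
have [d13 P13] := @weighted_component (fun q => F q i1 i3) (fun r => (lapse2 M r)^-1) sin _ _ d p sp Q13 Df Ds (dd _ cd).
have [Fa [F01 F23] [F02 F03] [F12 F13]] := Fc sp.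
have Da : forall k a b, partial k (fun q => F q a b) p = - partial k (fun q => F q b a) p.
  move=> k; apply: partial_antisym => //; first by move=> q i j /Fc[].
  exact: (I4_lt_ind (d01 k) (d02 k) (d03 k) (d12 k) (d13 k) (d23 k)).
have [divF dF] := mF sp.
have Na x y z : nabla M F p x y z = - nabla M F p x z y.
  rewrite /nabla Da !opprD !opprK -!addrA; congr (_ + _); rewrite addrC -!sumrN.
  by congr (_ + _); apply: eq_bigr => i _; rewrite [F p i _]Fa mulrN ?opprK.
have dv x : divergence M F p x = 0.
  apply: oppr_inj; rewrite oppr0 -(divF x) /divergence -sumrN.
  apply: eq_bigr => i _; rewrite -sumrN; apply: eq_bigr => j _.
  rewrite ginvE//; have [<-|_] := eqVneq i j; last by rewrite !mul0r oppr0.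
  by rewrite Na mulrN opprK.
have [E0 E1 E2 E3] := divergenceE hM sp Fa Da.
have cyc x y z : partial x (fun q => F q y z) p + partial y (fun q => F q z x) p
    + partial z (fun q => F q x y) p = 0.
  have := dF x y z; rewrite alt3_nablaE// /alt3.
  rewrite (Da x z y) (Da z y x) (Da y x z).
  exact: cyclic_sum0.
have C1 := cyc i0 i1 i2; have C2 := cyc i0 i1 i3.
have C3 := cyc i0 i2 i3; have C4 := cyc i1 i2 i3.
move: {cyc} C1 C2 C3 C4; rewrite (Da i1 i2 i0) (Da i1 i3 i0) (Da i2 i3 i0) (Da i2 i3 i1).
move: E0 E1 E2 E3; rewrite !dv !P01 !P23 !P02 !P03 !P12 !P13 /= ?F01 ?F23 ?F02 ?F03 ?F12 ?F13.
clear Q01 Q23 Q02 Q03 Q12 Q13 dF divF Fa Da Na dv P01 P23 P02 P03 P12 P13 d01 d23 d02 d03 d12 d13 F01 F23 F02 F03 F12 F13.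
have hf : M = (r - f * r) / 2 by rewrite /f /lapse2; field.
have -> : 2 * M / p 0 i1 ^+ 2 = (1 - f) / r by rewrite hf /r; field.
rewrite -/r -/f -/s -/co {}/V.
have {}r0 : r != 0 by []. have {}f0 : f != 0 by []. have {}s0 : s != 0 by [].
move: (partial i0 E p) (partial i1 E p) (partial i2 E p) (partial i3 E p)
 (partial i0 B p) (partial i1 B p) (partial i2 B p) (partial i3 B p)
 (partial i0 a p) (partial i1 a p) (partial i2 a p) (partial i3 a p)
 (partial i0 b p) (partial i1 b p) (partial i2 b p) (partial i3 b p)
 (partial i0 c p) (partial i1 c p) (partial i2 c p) (partial i3 c p)
 (partial i0 d p) (partial i1 d p) (partial i2 d p) (partial i3 d p) => 
 E0 E1 E2 E3 B0 B1 B2 B3 a0 a1 a2 a3 b0 b1 b2 b3 c0 c1 c2 c3 d0 d1 d2 d3.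
move: (E p) (B p) (a p) (b p) (c p) (d p) => Ep Bp ap bp cp' dp.
clear D1 D2 Ds rr0 Dr Df dd cE cB ca cb cc cd cp.
clearbody f; clearbody r s co; clear - r0 f0 s0.
move=> H0 H1 H2 H3 H4 H5 H6 H7.
have Z (x y z k : R) : z = 0 -> x - y = k * z -> x = y.
  by move=> -> /eqP; rewrite mulr0 subr_eq0 => /eqP.
move/esym in H0; move/esym in H1; move/esym in H2; move/esym in H3.
split; split.
- by apply: (Z _ _ _ (- (r ^+ 2 * s * f)) H1); field; rewrite ?r0 ?f0 ?s0.
- by apply: (Z _ _ _ (- (r ^+ 2 * s)) H0); field; rewrite ?r0 ?f0 ?s0.
- by apply: (Z _ _ _ 1 H6); field; rewrite ?r0 ?f0 ?s0.
- by apply: (Z _ _ _ f H7); field; rewrite ?r0 ?f0 ?s0.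
- by apply: (Z _ _ _ f H4); field; rewrite ?r0 ?f0 ?s0.
- by apply: (Z _ _ _ f H5); field; rewrite ?r0 ?f0 ?s0.
- by apply: (Z _ _ _ (- (f / s)) H3); field; rewrite ?r0 ?f0 ?s0.
- by apply: (Z _ _ _ (- (f * s)) H2); field; rewrite ?r0 ?f0 ?s0.
Qed.

(** The divergences and curls in [beta_orbital] are, by Maxwell's equations, the
    derivatives of E for Z and those of B for its dual. *)
Lemma beta_frame p k : spherical M p ->
  beta M F p k = ((partial k E p / (3 * p 0 i1)) +i* (partial k B p / (3 * p 0 i1)))%C.
Proof.
move=> sp; rewrite beta_parts; have [r0 f0 s0] := sphericalP hM sp.
have [cE cB [ca cb] [cc cd]] := ckF 1.
have cp := spherical_chart sp.
have Nck h : ck chart 1 h -> ck chart 1 (fun q => - h q).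
  by move=> ?; exact: (ckN open_chart).
have PN h : ck chart 1 h -> forall j, partial j (fun q => - h q) p = - partial j h p.
  by move=> ch j; rewrite /partial [LHS](deriveN (@ckS_derivable _ _ _ _ j _ ch cp)).
have [R0 R1 R2 R3] := beta_orbital orbital_Zfield cc cd ca cb sp.
have [I0 I1 I2 I3] := beta_orbital orbital_hodge_Zfield (Nck _ cb) ca (Nck _ cd) cc sp.
have [[M1 M2] [M3 M4] [M5 M6] [M7 M8]] := maxwell_frame sp.
rewrite ?(PN _ cb) ?(PN _ cd) in I0 I1 I2 I3.
have Es (x y z w : R) : x = y -> z = w -> (x +i* z)%C = (y +i* w)%C by move=> -> ->.
move: k; apply: I4_ind; apply: Es.
- by rewrite R0 -M1; field; rewrite r0 s0.
- by rewrite I0 (_ : - (_ + _ + _) = sin (p 0 i2) * partial i0 B p); [field; rewrite r0 s0|rewrite M3; ring].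
- by rewrite R1 -M2; field; rewrite r0 s0 f0.
- by rewrite I1 (_ : - (_ + _ + _) = sin (p 0 i2) * (lapse2 M (p 0 i1) * partial i1 B p)); [field; rewrite r0 s0 f0|rewrite M4; ring].
- by rewrite R2 M5; field; rewrite r0 f0.
- rewrite I2 (_ : _ - _ = - (partial i0 b p - lapse2 M (p 0 i1) * partial i1 d p)); last by ring.
  by rewrite M7; field; rewrite r0 f0.
- rewrite R3 [X in _ * X](_ : _ = - (lapse2 M (p 0 i1) / p 0 i1 ^+ 2) * partial i3 E p / sin (p 0 i2)); last first.
    by apply: (mulfI s0); rewrite M6; field; rewrite s0 r0.
  by field; rewrite r0 s0 f0.
- rewrite I3 [X in _ * X](_ : _ = - (lapse2 M (p 0 i1) / p 0 i1 ^+ 2) * partial i3 B p / sin (p 0 i2)); last first.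
    by apply: (mulfI s0); rewrite M8; field; rewrite s0 r0.
  by field; rewrite r0 s0 f0.
Qed.

End Frame.
End Orbital.

(** * The frame components of a smooth field *)

Section FrameFields.
Variables (R : realType) (M : R).
Hypothesis hM : 0 < M.
Implicit Types (p q : 'rV[R]_4).

(** The Cartesian components of the vectors d/dt, d/dr, (1/r) d/dth and
    (1/(r sin th)) d/dph. *)
Definition ehat (k : nat) q (c : nat) : R :=
  let s := sin (q 0 i2) in let co := cos (q 0 i2) in
  let sp := sin (q 0 i3) in let cp := cos (q 0 i3) in
  nth 0 (nth [::] [:: [:: 1; 0; 0; 0]; [:: 0; s * cp; s * sp; co];
    [:: 0; co * cp; co * sp; - s]; [:: 0; - sp; cp; 0]] k) c.

Definition wt (k : nat) q : R :=
  nth 0 [:: 1; 1; q 0 i1; q 0 i1 * sin (q 0 i2)] k.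

Lemma cartesianE q :
  [/\ cartesian q 0 i0 = q 0 i0,
      cartesian q 0 i1 = q 0 i1 * sin (q 0 i2) * cos (q 0 i3),
      cartesian q 0 i2 = q 0 i1 * sin (q 0 i2) * sin (q 0 i3) &
      cartesian q 0 i3 = q 0 i1 * cos (q 0 i2)].
Proof. by rewrite /cartesian; split; rewrite mxE. Qed.

Lemma ck_cartesian n j : ck (chart M) n (fun q => cartesian q 0 j).
Proof.
have oc := @open_chart R M.
have [cs cc] := (ck_sincos oc n i2, ck_sincos oc n i3).
have r := ck_coord oc n i1.
move: j; apply: I4_ind.
- apply: (ck_ext oc _ (ck_coord oc n i0)) => q _; by case: (cartesianE q) => ->.
- apply: (ck_ext oc _ (ckM oc (ckM oc r cs.1) cc.2)) => q _; by case: (cartesianE q) => _ ->.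
- apply: (ck_ext oc _ (ckM oc (ckM oc r cs.1) cc.1)) => q _; by case: (cartesianE q) => _ _ ->.
- apply: (ck_ext oc _ (ckM oc r cs.2)) => q _; by case: (cartesianE q) => _ _ _ ->.
Qed.

Lemma partial_cartesian p a c :
  partial a (fun q => cartesian q 0 c) p = wt a p * ehat a p c.
Proof.
have D0 := @partial_fun1 R id 1 i0 a p (is_derive_id (p 0 i0) 1).
have D1 := @partial_fun1 R id 1 i1 a p (is_derive_id (p 0 i1) 1).
have Ds2 := @partial_fun1 R sin _ i2 a p (is_derive_sin (p 0 i2)).
have Dc2 := @partial_fun1 R cos _ i2 a p (is_derive_cos (p 0 i2)).
have Ds3 := @partial_fun1 R sin _ i3 a p (is_derive_sin (p 0 i3)).
have Dc3 := @partial_fun1 R cos _ i3 a p (is_derive_cos (p 0 i3)).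
move: D0 D1 Ds2 Dc2 Ds3 Dc3 => [d0 D0] [d1 D1] [ds2 Ds2] [dc2 Dc2] [ds3 Ds3] [dc3 Dc3].
have M2 (f g : 'rV[R]_4 -> R) : derivable f p (delta_mx 0 a) -> derivable g p (delta_mx 0 a) ->
    derivable (fun q => f q * g q) p (delta_mx 0 a) by exact: derivableM.
move: c; apply: I4_ind.
- have -> : (fun q => cartesian q 0 i0) = (fun q : 'rV[R]_4 => id (q 0 i0)).
    by apply/funext => q; case: (cartesianE q).
  rewrite D0; move: a {D0 D1 Ds2 Dc2 Ds3 Dc3 d0 d1 ds2 dc2 ds3 dc3 M2}; apply: I4_ind;
  by rewrite /wt /ehat /= ?mulr1 ?mulr0.
- have -> : (fun q => cartesian q 0 i1) = (fun q : 'rV[R]_4 => id (q 0 i1) * sin (q 0 i2) * cos (q 0 i3)).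
    by apply/funext => q; case: (cartesianE q).
  rewrite (partialM (M2 _ _ d1 ds2) dc3) (partialM d1 ds2) D1 Ds2 Dc3.
  move: a {D0 D1 Ds2 Dc2 Ds3 Dc3 d0 d1 ds2 dc2 ds3 dc3 M2}; apply: I4_ind;
  by rewrite /wt /ehat /=; ring.
- have -> : (fun q => cartesian q 0 i2) = (fun q : 'rV[R]_4 => id (q 0 i1) * sin (q 0 i2) * sin (q 0 i3)).
    by apply/funext => q; case: (cartesianE q).
  rewrite (partialM (M2 _ _ d1 ds2) ds3) (partialM d1 ds2) D1 Ds2 Ds3.
  move: a {D0 D1 Ds2 Dc2 Ds3 Dc3 d0 d1 ds2 dc2 ds3 dc3 M2}; apply: I4_ind;
  by rewrite /wt /ehat /=; ring.
- have -> : (fun q => cartesian q 0 i3) = (fun q : 'rV[R]_4 => id (q 0 i1) * cos (q 0 i2)).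
    by apply/funext => q; case: (cartesianE q).
  rewrite (partialM d1 dc2) D1 Dc2.
  move: a {D0 D1 Ds2 Dc2 Ds3 Dc3 d0 d1 ds2 dc2 ds3 dc3 M2}; apply: I4_ind;
  by rewrite /wt /ehat /=; ring.
Qed.

Lemma exterior_cartesian p : chart M p -> exterior M (cartesian p).
Proof.
move=> cp; rewrite /exterior/=; have [_ -> -> ->] := cartesianE p.
have r0 := chart_r_gt0 hM cp.
have c3 := cos2Dsin2 (p 0 i3); have c2 := cos2Dsin2 (p 0 i2).
rewrite (_ : _ + _ = p 0 i1 ^+ 2); first by rewrite sqrtr_sqr gtr0_norm.
transitivity (p 0 i1 ^+ 2 * (cos (p 0 i2) ^+ 2 + sin (p 0 i2) ^+ 2 * (cos (p 0 i3) ^+ 2 + sin (p 0 i3) ^+ 2))).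
  by ring.
by rewrite c3 mulr1 c2 mulr1.
Qed.

Variable G : tensor2 R.
Hypothesis hG : smooth_2form M G.

Definition Gf (k l : nat) q : R :=
  \sum_(c < 4) \sum_(d < 4) ehat k q c * ehat l q d * G (cartesian q) c d.

Lemma Gf_antisym k l q : chart M q -> Gf k l q = - Gf l k q.
Proof.
move=> cq; rewrite /Gf exchange_big -sumrN; apply: eq_bigr => c _.
rewrite -sumrN; apply: eq_bigr => d _.
by rewrite (hG.2 _ c d (exterior_cartesian cq)) [ehat k q d * _]mulrC mulrN.
Qed.

Lemma pullbackE q a b : pullback G q a b = wt a q * wt b q * Gf a b q.
Proof.
rewrite /pullback /Gf mulr_sumr; apply: eq_bigr => c _.
rewrite mulr_sumr; apply: eq_bigr => d _; rewrite !partial_cartesian.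
by move: (G _ c d) => x; ring.
Qed.

Lemma ck_ehat n (k c : 'I_4) : ck (chart M) n (fun q => ehat k q c).
Proof.
have oc := @open_chart R M.
have [[s co] [sp cp]] := (ck_sincos oc n i2, ck_sincos oc n i3).
have C x := ck_cst oc n x.
move: k c; do 2![apply: I4_ind]; rewrite /ehat /=;
  by [exact: C|exact: ckM|exact: ckN|].
Qed.

Lemma ck_Gf n (k l : 'I_4) : ck (chart M) n (Gf k l).
Proof.
have oc := @open_chart R M.
apply: ck_sum => // c; apply: ck_sum => // d; apply: ckM => //.
  by apply: ckM => //; exact: ck_ehat.
have [] := @ck_comp R _ _ n (fun y => G y c d) (@cartesian R) oc exterior_cartesian (hG.1 c d) ck_cartesian.
by [].
Qed.

Definition field_E q := q 0 i1 * q 0 i1 * Gf 0 1 q.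
Definition field_B q := q 0 i1 * q 0 i1 * Gf 2 3 q.
Definition field_a q := q 0 i1 * Gf 0 2 q.
Definition field_b q := q 0 i1 * Gf 0 3 q.
Definition field_c q := lapse2 M (q 0 i1) * q 0 i1 * Gf 1 2 q.
Definition field_d q := lapse2 M (q 0 i1) * q 0 i1 * Gf 1 3 q.

Lemma frame_comps_fields :
  frame_comps M (pullback G) field_E field_B field_a field_b field_c field_d.
Proof.
move=> q sq r s f; have [r0 f0 s0] := sphericalP hM sq.
rewrite !pullbackE /wt /= /field_E /field_B /field_a /field_b /field_c /field_d.
move: (Gf 0 1 q) (Gf 2 3 q) (Gf 0 2 q) (Gf 0 3 q) (Gf 1 2 q) (Gf 1 3 q) => *.
split.
- move=> i j; rewrite !pullbackE (Gf_antisym _ _ (spherical_chart sq)).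
  by rewrite mulrN [wt i q * _]mulrC.
- by split; rewrite /r /s; field.
- by split; rewrite /r /s; field.
- by split; rewrite /r /s /f; field; exact: f0.
Qed.

Lemma ck_lapse2 n : ck (chart M) n (fun q => lapse2 M (q 0 i1)).
Proof.
have oc := @open_chart R M.
have Hr p : chart M p -> p 0 i1 != 0 by move=> /(chart_r_gt0 hM)/lt0r_neq0.
by apply: ckB => //; [exact: ck_cst|apply: ckM => //; [exact: ck_cst|exact: ck_coordV]].
Qed.

Lemma ck_fields n : [/\ ck (chart M) n field_E, ck (chart M) n field_B,
  ck (chart M) n field_a /\ ck (chart M) n field_b &
  ck (chart M) n field_c /\ ck (chart M) n field_d].
Proof.
have oc := @open_chart R M.
have r := ck_coord oc n i1; have f := ck_lapse2 n.
have H (k l : 'I_4) := ck_Gf n k l.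
have rr := ckM oc r r; have fr := ckM oc f r.
split; [exact: (ckM oc rr (H i0 i1))|exact: (ckM oc rr (H i2 i3))|split|split].
- exact: (ckM oc r (H i0 i2)).
- exact: (ckM oc r (H i0 i3)).
- exact: (ckM oc fr (H i1 i2)).
- exact: (ckM oc fr (H i1 i3)).
Qed.

End FrameFields.

Section Periodic.
Variables (R : realType) (M : R).

(** The angle ph ranges over the whole line; this is what makes integrals of
    ph-derivatives vanish. *)
Definition periodic (h : 'rV[R]_4 -> R) :=
  forall p, h ((2 * pi) *: delta_mx 0 i3 + p) = h p.

Lemma periodic_partial h k : periodic h -> periodic (partial k h).
Proof.
move=> ph p; rewrite /partial /derive; congr (lim (_ @ 0^')).
by apply/funext => x /=; rewrite ph addrCA ph.
Qed.

Lemma periodic_fields G : [/\ periodic (field_E G), periodic (field_B G),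
  periodic (field_a G) /\ periodic (field_b G) &
  periodic (field_c M G) /\ periodic (field_d M G)].
Proof.
have C (p : 'rV[R]_4) (j : 'I_4) : j != i3 -> ((2 * pi) *: delta_mx 0 i3 + p : 'rV[R]_4) 0 j = p 0 j.
  by move=> j3; rewrite !mxE/= (negbTE j3) mulr0 add0r.
have C3 (p : 'rV[R]_4) : ((2 * pi) *: delta_mx 0 i3 + p : 'rV[R]_4) 0 i3 = p 0 i3 + 2 * pi.
  by rewrite !mxE/= mulr1 addrC.
have S3 (x : R) : sin (x + 2 * pi) = sin x by rewrite mulr_natl sinD2pi.
have K3 (x : R) : cos (x + 2 * pi) = cos x by rewrite mulr_natl cosD2pi.
have Cc (p : 'rV[R]_4) : cartesian ((2 * pi) *: delta_mx 0 i3 + p) = cartesian p.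
  by rewrite /cartesian !(C p i0)// !(C p i1)// !(C p i2)// C3 S3 K3.
have Gp k l : periodic (Gf G k l).
  move=> p; rewrite /Gf Cc; apply: eq_bigr => c _; apply: eq_bigr => d _.
  by rewrite /ehat !(C p i2)// C3 S3 K3.
by split; [| |split|split] => p; rewrite /field_E /field_B /field_a /field_b /field_c /field_d ?(C p i1)// Gp.
Qed.

End Periodic.

(** * The energy density and the bulk density *)

Lemma eqN_eq0 (R : realFieldType) (x : R) : x = - x -> x = 0.
Proof. lra. Qed.

Section Densities.
Variables (R : realType) (M : R).
Hypothesis hM : 0 < M.
Implicit Types (p q : 'rV[R]_4).

Section Values.
Variables (F : tensor2 R) (E B a b c d : 'rV[R]_4 -> R).
Hypothesis Fc : frame_comps M F E B a b c d.
Hypothesis ckF : forall n, [/\ ck (chart M) n E, ck (chart M) n B,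
  ck (chart M) n a /\ ck (chart M) n b & ck (chart M) n c /\ ck (chart M) n d].
Hypothesis mF : maxwell M F.

Lemma sqmodE (x y nu : 'I_4 -> R) :
  sqmod (\sum_(k < 4) (x k +i* y k)%C * ((nu k)%:C)%C) =
  (\sum_(k < 4) x k * nu k) ^+ 2 + (\sum_(k < 4) y k * nu k) ^+ 2.
Proof.
rewrite /sqmod !sum4 /=; congr (_ ^+ 2 + _ ^+ 2);
  by rewrite ?mulr0 ?subr0 ?add0r.
Qed.

Lemma beta2E p (nu : 'I_4 -> R) : spherical M p ->
  beta2 M F p nu = ((\sum_(k < 4) partial k E p * nu k) ^+ 2 +
                    (\sum_(k < 4) partial k B p * nu k) ^+ 2) / (9 * p 0 i1 ^+ 2).
Proof.
move=> sp; have [r0 _ _] := sphericalP hM sp.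
rewrite /beta2; under eq_bigr do rewrite (beta_frame hM Fc ckF mF)//.
rewrite sqmodE !sum4.
move: (partial i0 E p) (partial i1 E p) (partial i2 E p) (partial i3 E p)
  (partial i0 B p) (partial i1 B p) (partial i2 B p) (partial i3 B p)
  (nu i0) (nu i1) (nu i2) (nu i3) => *.
by field.
Qed.

Lemma vector4_contract (u : 'I_4 -> R) (x0 x1 x2 x3 : R) :
  \sum_(k < 4) u k * vector4 x0 x1 x2 x3 k =
  u i0 * x0 + u i1 * x1 + u i2 * x2 + u i3 * x3.
Proof. by rewrite sum4. Qed.

(** Z contains the components of F with one angular index and no others. *)
Lemma Z2E p : spherical M p ->
  Z2 M F p = (a p ^+ 2 + b p ^+ 2 + c p ^+ 2 + d p ^+ 2) / 9.
Proof.
move=> sp; have [r0 f0 s0] := sphericalP hM sp.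
have f1 : 0 < lapse2 M (p 0 i1) by case: sp => h _; exact: lapse2_gt0.
have [Za [Z01 Z23] [Z02 Z03] [Z12 Z13]] := orbital_Zfield hM Fc sp.
have Z00 i : Zfield M F p i i = 0 by exact: eqN_eq0.
have W00 : Wfield M F p i0 i0 = lapse2 M (p 0 i1) * ((a p ^+ 2 + b p ^+ 2 + c p ^+ 2 + d p ^+ 2) / 9) / lapse2 M (p 0 i1).
  rewrite /Wfield !sum4 !raise_sndE// !raise2E// gE eqxx mul1r.
  rewrite (Za i1 i0) (Za i2 i0) (Za i3 i0) (Za i2 i1) (Za i3 i1) (Za i3 i2).
  rewrite !Z00 Z01 Z23 Z02 Z03 Z12 Z13 /gdiag /=.
  by field; rewrite ?r0 ?f0 ?s0.
have sq : Num.sqrt (lapse2 M (p 0 i1)) ^+ 2 = lapse2 M (p 0 i1).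
  by rewrite sqr_sqrtr// ltW.
have sq0 : Num.sqrt (lapse2 M (p 0 i1)) != 0 by rewrite sqrtr_eq0 -ltNge.
rewrite /Z2 /That !sum4 /vector4 /= !mulr0 !mul0r !addr0 W00.
have -> : (p 0 i1 - 2 * M) / p 0 i1 = lapse2 M (p 0 i1).
  by rewrite /lapse2; field.
rewrite -{1}sq; move: sq0 f0; move: (lapse2 M (p 0 i1)) (Num.sqrt (lapse2 M (p 0 i1))) => y x x0 y0.
by field; rewrite x0 y0.
Qed.

(** The integrand of the bulk term, with the factor f = dr/dx of the tortoise
    coordinate x and the factor sin th of the sphere split off. *)
Definition bulk_density p : R :=
  let r := p 0 i1 in let f := lapse2 M r in
  f * (r - 3 * M) ^+ 2 / r ^+ 5 * (partial i2 E p ^+ 2 + partial i2 B p ^+ 2 +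
     (partial i3 E p / sin (p 0 i2)) ^+ 2 + (partial i3 B p / sin (p 0 i2)) ^+ 2) +
  M * f / r ^+ 2 * ((f * partial i1 E p) ^+ 2 + (f * partial i1 B p) ^+ 2) +
  M * (r - 3 * M) ^+ 2 * f / r ^+ 4 * (partial i0 E p ^+ 2 + partial i0 B p ^+ 2) +
  2 * M * f / (25 * r ^+ 2) * (a p ^+ 2 + b p ^+ 2 + c p ^+ 2 + d p ^+ 2).

Lemma bulk_integrandE p : spherical M p ->
  (beta_deg M F p + 2 * M / (25 * p 0 i1 ^+ 4) * Z2 M F p) *
    Num.sqrt `|\det (metric M p)| =
  sin (p 0 i2) * bulk_density p / (9 * lapse2 M (p 0 i1)).
Proof.
move=> sp; have [r0 f0 s0] := sphericalP hM sp.
have f1 : 0 < lapse2 M (p 0 i1) by case: sp => h _; exact: lapse2_gt0.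
have sq : Num.sqrt (lapse2 M (p 0 i1)) ^+ 2 = lapse2 M (p 0 i1).
  by rewrite sqr_sqrtr// ltW.
have sq0 : Num.sqrt (lapse2 M (p 0 i1)) != 0 by rewrite sqrtr_eq0 -ltNge.
have rM : p 0 i1 - 2 * M = lapse2 M (p 0 i1) * p 0 i1 by rewrite /lapse2; field.
rewrite (volume_element hM sp) (Z2E sp) /beta_deg !(beta2E _ sp).
rewrite !vector4_contract /bulk_density rM.
move: (partial i0 E p) (partial i1 E p) (partial i2 E p) (partial i3 E p)
  (partial i0 B p) (partial i1 B p) (partial i2 B p) (partial i3 B p)
  (a p) (b p) (c p) (d p) => E0 E1 E2 E3 B0 B1 B2 B3 ap bp cp dp.
move: (lapse2 M (p 0 i1)) (Num.sqrt (lapse2 M (p 0 i1))) f0 sq0 sq {f1 rM} => y x f0 x0 xy.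
move: (p 0 i1) (sin (p 0 i2)) r0 s0 => r s r0 s0.
rewrite -xy; rewrite -xy in f0.
by field; rewrite r0 s0 x0.
Qed.

(** By [beta_frame], H is 1/(9 r^2) times the energy-momentum tensor of the two
    scalars E and B. *)
Lemma energy_density_E p (xi0 n0 n1 : R) : spherical M p ->
  complex.Re (\sum_(k < 4) \sum_(l < 4) Hfield M F p k l *
     ((vector4 xi0 0 0 0 l)%:C)%C * ((vector4 n0 n1 0 0 k)%:C)%C) = 
  xi0 / (9 * p 0 i1 ^+ 2) * (n0 * ((partial i0 E p ^+ 2 + partial i0 B p ^+ 2
     + (lapse2 M (p 0 i1) * partial i1 E p) ^+ 2 + (lapse2 M (p 0 i1) * partial i1 B p) ^+ 2
     + lapse2 M (p 0 i1) / p 0 i1 ^+ 2 * (partial i2 E p ^+ 2 + partial i2 B p ^+ 2 +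
     (partial i3 E p / sin (p 0 i2)) ^+ 2 + (partial i3 B p / sin (p 0 i2)) ^+ 2)) / 2)
   + n1 * (partial i0 E p * partial i1 E p + partial i0 B p * partial i1 B p)).
Proof.
move=> sp; have [r0 f0 s0] := sphericalP hM sp.
pose x k := partial k E p / (3 * p 0 i1); pose y k := partial k B p / (3 * p 0 i1).
have bE k : beta M F p k = (x k +i* y k)%C by rewrite (beta_frame hM Fc ckF mF).
have HE k l : complex.Re (Hfield M F p k l) = x k * x l + y k * y l
    - 2^-1 * g M p k l * \sum_(m < 4) (x m ^+ 2 + y m ^+ 2) / gdiag M p m.
  have S (bb : 'I_4 -> R[i]) : (forall k, bb k = (x k +i* y k)%C) ->
      \sum_(c < 4) \sum_(d < 4) ((ginv M p c d)%:C * bb c * conjc (bb d))%C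
      = ((\sum_(m < 4) (x m ^+ 2 + y m ^+ 2) / gdiag M p m)%:C)%C.
    move=> bbE; rewrite rmorph_sum; apply: eq_bigr => m _.
    rewrite (bigD1 m)//= big1 ?addr0; last first.
      by move=> j jm; rewrite ginvE// eq_sym (negbTE jm) mul0r !mul0r.
    rewrite ginvE// eqxx mul1r !bbE /=; apply/eqP; rewrite eq_complex /=.
    by apply/andP; split; apply/eqP; ring.
  rewrite /Hfield (S _ bE) !bE /=.
  by move: (x k) (x l) (y k) (y l) (g M p k l) (\sum_(m < 4) _) => *; field.
have ReM (z : R[i]) (u v : R) : complex.Re (z * (u%:C)%C * (v%:C)%C) = complex.Re z * u * v.
  by case: z => z1 z2 /=; ring.
have ReD (I : finType) (h : I -> R[i]) : complex.Re (\sum_i h i) = \sum_i complex.Re (h i).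
  by apply: big_morph => // -[? ?] [? ?].
rewrite ReD; under eq_bigr do rewrite ReD.
under eq_bigr do under eq_bigr do rewrite ReM HE.
under eq_bigr do rewrite -mulr_suml vector4_contract.
rewrite vector4_contract !mulr0 !addr0 gE eqxx (gE M p i1 i0) mul1r.
rewrite (_ : (i1 == i0) = false)// mul0r mulr0 mul0r subr0 sum4.
rewrite /x /y /gdiag /=.
move: (partial i0 E p) (partial i1 E p) (partial i2 E p) (partial i3 E p)
  (partial i0 B p) (partial i1 B p) (partial i2 B p) (partial i3 B p) => E0 E1 E2 E3 B0 B1 B2 B3.
move: (lapse2 M (p 0 i1)) f0 => f f0.
move: (p 0 i1) (sin (p 0 i2)) r0 s0 {x y bE HE} => r s r0 s0.
by field; rewrite r0 s0 f0.
Qed.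

End Values.
End Densities.

(** * Integration over the orbit spheres *)

Section SphereIntegral.
Variables (R : realType) (M : R).
Implicit Types (h : 'rV[R]_4 -> R) (t r th ph : R).

Lemma point4_move t r th ph x :
  [/\ point4 (x + t) r th ph = x *: delta_mx 0 i0 + point4 t r th ph,
      point4 t (x + r) th ph = x *: delta_mx 0 i1 + point4 t r th ph,
      point4 t r (x + th) ph = x *: delta_mx 0 i2 + point4 t r th ph &
      point4 t r th (x + ph) = x *: delta_mx 0 i3 + point4 t r th ph].
Proof.
by split; apply/matrixP => i j; rewrite (ord1 i); move: j; apply: I4_ind;
  rewrite !mxE /= ?mulr1 ?mulr0 ?add0r.
Qed.

Lemma chart_point4 t r th ph : chart M (point4 t r th ph) = (2 * M < r) :> Prop.
Proof. by rewrite /chart /= /point4 mxE. Qed.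

Lemma point4_cont (T : Type) (F : set_system T) (FF : Filter F) (x0 x1 x2 x3 : T -> R) y0 y1 y2 y3 :
  x0 @ F --> y0 -> x1 @ F --> y1 -> x2 @ F --> y2 -> x3 @ F --> y3 ->
  point4 (x0 z) (x1 z) (x2 z) (x3 z) @[z --> F] --> point4 y0 y1 y2 y3.
Proof.
move=> c0 c1 c2 c3; apply: cvg_rV; apply: I4_ind; rewrite mxE /=;
  by under eq_fun do rewrite mxE /=.
Qed.

Definition phi_integral h t r th := integ 0 (2 * pi) (fun ph => h (point4 t r th ph)).
Definition SI h t r := integ 0 pi (fun th => phi_integral h t r th).

Let pi0 : 0 <= pi :> R. Proof. exact: pi_ge0. Qed.
Let pi20 : 0 <= 2 * pi :> R. Proof. by rewrite mulr_ge0. Qed.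

Section Cont.
Variables (T : Type) (F : set_system T).
Hypothesis FF : Filter F.
Variables (x0 x1 x2 x3 : T -> R) (t r th ph : R).
Hypotheses (c0 : x0 @ F --> t) (c1 : x1 @ F --> r) (c2 : x2 @ F --> th) (c3 : x3 @ F --> ph).

Lemma cvg_point4 h : ck (chart M) 0 h -> 2 * M < r ->
  h (point4 (x0 z) (x1 z) (x2 z) (x3 z)) @[z --> F] --> h (point4 t r th ph).
Proof.
move=> /ck0 ch hr.
apply: (cvg_comp (fun z => point4 (x0 z) (x1 z) (x2 z) (x3 z)) h (point4_cont FF c0 c1 c2 c3)).
by apply: ch; rewrite chart_point4.
Qed.
End Cont.

Lemma near_r r : 2 * M < r -> \forall r' \near r, 2 * M < r'.
Proof. by move=> hr; apply: open_nbhs_nbhs; split => //; exact: open_gt. Qed.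

Lemma phi_integral_cont h t r th : ck (chart M) 0 h -> 2 * M < r ->
  {for (t, r, th), continuous (fun p : R * R * R => phi_integral h p.1.1 p.1.2 p.2)}.
Proof.
move=> ch hr.
apply: (@integ_continuous R _ (t, r, th) 0 (2 * pi) pi20
  (fun (p : R * R * R) ph => h (point4 p.1.1 p.1.2 p.2 ph))).
have N : \forall z \near ((t, r), th), 2 * M < z.1.2.
  have C : (fun z : R * R * R => z.1.2) @ (t, r, th) --> r.
    exact: (cvg_comp fst snd (@cvg_fst _ _ _ _ _) (@cvg_snd _ _ _ _ _)).
  exact: C (near_r hr).
apply: filterS N => -[[t' r'] th'] /= hr' ph _.
apply: (@cvg_point4 _ (nbhs (t', r', th', ph)) _ (fun p => p.1.1.1) (fun p => p.1.1.2) (fun p => p.1.2) (fun p => p.2)) => //.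
- exact: (cvg_comp fst (fun p => p.1.1) (@cvg_fst _ _ _ _ _) (cvg_comp fst fst (@cvg_fst _ _ _ _ _) (@cvg_fst _ _ _ _ _))).
- exact: (cvg_comp fst (fun p => p.1.2) (@cvg_fst _ _ _ _ _) (cvg_comp fst snd (@cvg_fst _ _ _ _ _) (@cvg_snd _ _ _ _ _))).
- exact: (cvg_comp fst snd (@cvg_fst _ _ _ _ _) (@cvg_snd _ _ _ _ _)).
- exact: cvg_snd.
Qed.

Section Cont.
Variables (T : Type) (F : set_system T).
Hypothesis FF : Filter F.
Variables (x0 x1 x2 : T -> R) (t r th : R).
Hypotheses (c0 : x0 @ F --> t) (c1 : x1 @ F --> r) (c2 : x2 @ F --> th).

Lemma cvg_phi h : ck (chart M) 0 h -> 2 * M < r ->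
  phi_integral h (x0 z) (x1 z) (x2 z) @[z --> F] --> phi_integral h t r th.
Proof.
move=> ch hr.
apply: (cvg_comp (fun z => (x0 z, x1 z, x2 z)) (fun p : R * R * R => phi_integral h p.1.1 p.1.2 p.2) _ (@phi_integral_cont h t r th ch hr)).
exact: (@cvg_pair _ _ _ F (nbhs (t, r)) (nbhs th) _ _ _ _ _ (@cvg_pair _ _ _ F (nbhs t) (nbhs r) _ _ _ _ _ c0 c1) c2).
Qed.
End Cont.

Lemma SI_cont h t r : ck (chart M) 0 h -> 2 * M < r ->
  {for (t, r), continuous (fun p : R * R => SI h p.1 p.2)}.
Proof.
move=> ch hr.
apply: (@integ_continuous R _ (t, r) 0 pi pi0
  (fun (p : R * R) th => phi_integral h p.1 p.2 th)).
have C : (fun z : R * R => z.2) @ (t, r) --> r by exact: cvg_snd.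
have N := C _ (near_r hr).
apply: (@filterS _ (nbhs (t, r)) _ _ _ _ N) => -[t' r'] /= hr' th _.
apply: (@cvg_phi _ (nbhs (t', r', th)) _ (fun p => p.1.1) (fun p => p.1.2) (fun p => p.2)) => //.
- exact: (cvg_comp fst fst (@cvg_fst _ _ _ _ _) (@cvg_fst _ _ _ _ _)).
- exact: (cvg_comp fst snd (@cvg_fst _ _ _ _ _) (@cvg_snd _ _ _ _ _)).
- exact: cvg_snd.
Qed.

Lemma phi_section h t r th ph : ck (chart M) 0 h -> 2 * M < r ->
  {for ph, continuous (fun ph => h (point4 t r th ph))}.
Proof.
move=> ch hr; apply: (@cvg_point4 _ (nbhs ph) _ (cst t) (cst r) (cst th) id) => //; exact: cvg_cst.
Qed.

Lemma phi_section_within h t r th : ck (chart M) 0 h -> 2 * M < r ->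
  {within `[0, 2 * pi], continuous (fun ph => h (point4 t r th ph))}.
Proof. by move=> ch hr; apply: within_of_for => ph _; exact: phi_section. Qed.

Lemma theta_section h t r th : ck (chart M) 0 h -> 2 * M < r ->
  {for th, continuous (phi_integral h t r)}.
Proof.
move=> ch hr; apply: (@cvg_phi _ (nbhs th) _ (cst t) (cst r) id) => //; exact: cvg_cst.
Qed.

Lemma theta_section_within h t r : ck (chart M) 0 h -> 2 * M < r ->
  {within `[0, pi], continuous (phi_integral h t r)}.
Proof. by move=> ch hr; apply: within_of_for => th _; exact: theta_section. Qed.

Section Linear.
Variables (t r : R) (hr : 2 * M < r).
Variables (h g : 'rV[R]_4 -> R) (ch : ck (chart M) 0 h) (cg : ck (chart M) 0 g).

Lemma SID : SI (fun p => h p + g p) t r = SI h t r + SI g t r.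
Proof.
rewrite /SI -integD; [|exact: theta_section_within|exact: theta_section_within].
apply: eq_integ => th _.
by rewrite /phi_integral integD//; exact: phi_section_within.
Qed.

Lemma SIB : SI (fun p => h p - g p) t r = SI h t r - SI g t r.
Proof.
rewrite /SI -integB; [|exact: theta_section_within|exact: theta_section_within].
apply: eq_integ => th _.
by rewrite /phi_integral integB//; exact: phi_section_within.
Qed.

Lemma SIZ (k : R -> R) : SI (fun p => k (p 0 i1) * h p) t r = k r * SI h t r.
Proof.
rewrite /SI -integZ; last exact: theta_section_within.
apply: eq_integ => th _; rewrite /phi_integral -integZ; last exact: phi_section_within.
by apply: eq_integ => ph _; rewrite mxE.
Qed.

Lemma le_SI : (forall th ph, 0 <= th <= pi -> h (point4 t r th ph) <= g (point4 t r th ph)) ->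
  SI h t r <= SI g t r.
Proof.
move=> hg; apply: le_integ; [exact: theta_section_within|exact: theta_section_within|].
move=> th thI; apply: le_integ; [exact: phi_section_within|exact: phi_section_within|].
by move=> ph _; exact: hg.
Qed.

Lemma eq_SI : (forall th ph, 0 <= th <= pi -> h (point4 t r th ph) = g (point4 t r th ph)) ->
  SI h t r = SI g t r.
Proof. by move=> hg; apply: eq_integ => th thI; apply: eq_integ => ph _; exact: hg. Qed.

(** By continuity, the poles being limits of regular points of the sphere. *)
Lemma extend_to_poles ph :
  (forall th, 0 < th < pi -> h (point4 t r th ph) = g (point4 t r th ph)) ->
  forall th, 0 <= th <= pi -> h (point4 t r th ph) = g (point4 t r th ph).
Proof.
move=> hg.
have C k : ck (chart M) 0 k -> forall th, {for th, continuous (fun th => k (point4 t r th ph))}.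
  by move=> ck' th; apply: (@cvg_point4 _ (nbhs th) _ (cst t) (cst r) id (cst ph)) => //; exact: cvg_cst.
pose D th := h (point4 t r th ph) - g (point4 t r th ph).
have cD th : {for th, continuous D} by apply: cvgB; exact: C.
have D0 th : 0 < th < pi -> D th = 0 by move=> /hg E; rewrite /D E subrr.
move=> th /andP[th0 thpi]; apply/eqP; rewrite -subr_eq0; apply/eqP; rewrite -/(D th).
have near0 : D x @[x --> 0^'+] --> 0.
  apply: cvg_near_cst; near=> x; apply: D0; apply/andP; split.
    by near: x; exact: nbhs_right_gt.
  by near: x; apply: nbhs_right_lt; exact: pi_gt0.
have nearpi : D x @[x --> pi^'-] --> 0.
  apply: cvg_near_cst; near=> x; apply: D0; apply/andP; split.
    by near: x; apply: nbhs_left_gt; exact: pi_gt0.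
  by near: x; exact: nbhs_left_lt.
have [th0'|th0'] := leP th 0.
  have -> : th = 0 by apply/eqP; rewrite eq_le th0' th0.
  have H := cvg_at_right_filter (cD 0).
  by rewrite -(cvg_lim _ H)// (cvg_lim _ near0).
have [thpi'|thpi'] := ltP th pi; first by apply: D0; rewrite th0'.
have -> : th = pi by apply/eqP; rewrite eq_le thpi thpi'.
have H := cvg_at_left_filter (cD pi).
by rewrite -(cvg_lim _ H)// (cvg_lim _ nearpi).
Unshelve. all: end_near. Qed.

End Linear.

Lemma SI_ge0 h t r : (forall th ph, 0 <= th <= pi -> 0 <= h (point4 t r th ph)) -> 0 <= SI h t r.
Proof.
by move=> h0; apply: integ_ge0 => th thI; apply: integ_ge0 => ph _; exact: h0.
Qed.

Section Derivatives.
Variables (h : 'rV[R]_4 -> R) (ch : ck (chart M) 1 h).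

Let ch0 : ck (chart M) 0 h. Proof. exact: ckW ch. Qed.
Let cp k : ck (chart M) 0 (partial k h). Proof. exact: ck_partial ch. Qed.

Lemma is_derive_coord t r th ph : 2 * M < r ->
  [/\ is_derive t 1 (fun t => h (point4 t r th ph)) (partial i0 h (point4 t r th ph)),
      is_derive r 1 (fun r => h (point4 t r th ph)) (partial i1 h (point4 t r th ph)),
      is_derive th 1 (fun th => h (point4 t r th ph)) (partial i2 h (point4 t r th ph)) &
      is_derive ph 1 (fun ph => h (point4 t r th ph)) (partial i3 h (point4 t r th ph))].
Proof.
move=> hr; have cpt : chart M (point4 t r th ph) by rewrite chart_point4.
have D k : derivable h (point4 t r th ph) (delta_mx 0 k) by exact: ckS_derivable ch cpt.
split.
- apply: (@line_is_derive _ h (fun t => point4 t r th ph) _ t _ (D i0)) => x.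
  by have [E _ _ _] := point4_move t r th ph x.
- apply: (@line_is_derive _ h (fun r => point4 t r th ph) _ r _ (D i1)) => x.
  by have [_ E _ _] := point4_move t r th ph x.
- apply: (@line_is_derive _ h (fun th => point4 t r th ph) _ th _ (D i2)) => x.
  by have [_ _ E _] := point4_move t r th ph x.
- apply: (@line_is_derive _ h (fun ph => point4 t r th ph) _ ph _ (D i3)) => x.
  by have [_ _ _ E] := point4_move t r th ph x.
Qed.

Lemma phi_integral_is_derive t r th : 2 * M < r ->
  [/\ is_derive t 1 (fun t => phi_integral h t r th) (phi_integral (partial i0 h) t r th),
      is_derive r 1 (fun r => phi_integral h t r th) (phi_integral (partial i1 h) t r th) &
      is_derive th 1 (fun th => phi_integral h t r th) (phi_integral (partial i2 h) t r th)].
Proof.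
move=> hr; split.
- apply: (@integ_is_derive R t 0 (2 * pi) (fun t ph => h (point4 t r th ph)) (fun t ph => partial i0 h (point4 t r th ph)) pi20).
  + by apply: (@nearW _ (nbhs t)) => t' ph _; exact: phi_section.
  + by apply: (@nearW _ (nbhs t)) => t' ph _; have [H _ _ _] := is_derive_coord t' th ph hr; exact: H.
  + move=> ph _; apply: (@cvg_point4 _ (nbhs (t, ph)) _ fst (cst r) (cst th) snd) => //;
      [exact: cvg_fst|exact: cvg_cst|exact: cvg_cst|exact: cvg_snd].
- have N := near_r hr.
  apply: (@integ_is_derive R r 0 (2 * pi) (fun r ph => h (point4 t r th ph)) (fun r ph => partial i1 h (point4 t r th ph)) pi20).
  + by apply: filterS N => r' hr' ph _; exact: phi_section.
  + by apply: filterS N => r' hr' ph _; have [_ H _ _] := is_derive_coord t th ph hr'; exact: H.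
  + move=> ph _; apply: (@cvg_point4 _ (nbhs (r, ph)) _ (cst t) fst (cst th) snd) => //;
      [exact: cvg_cst|exact: cvg_fst|exact: cvg_cst|exact: cvg_snd].
- apply: (@integ_is_derive R th 0 (2 * pi) (fun th ph => h (point4 t r th ph)) (fun th ph => partial i2 h (point4 t r th ph)) pi20).
  + by apply: (@nearW _ (nbhs th)) => th' ph _; exact: phi_section.
  + by apply: (@nearW _ (nbhs th)) => th' ph _; have [_ _ H _] := is_derive_coord t th' ph hr; exact: H.
  + move=> ph _; apply: (@cvg_point4 _ (nbhs (th, ph)) _ (cst t) (cst r) fst snd) => //;
      [exact: cvg_cst|exact: cvg_cst|exact: cvg_fst|exact: cvg_snd].
Qed.

Lemma SI_is_derive t r : 2 * M < r ->
  is_derive t 1 (fun t => SI h t r) (SI (partial i0 h) t r) /\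
  is_derive r 1 (fun r => SI h t r) (SI (partial i1 h) t r).
Proof.
move=> hr; split.
- apply: (@integ_is_derive R t 0 pi (fun t th => phi_integral h t r th) (fun t th => phi_integral (partial i0 h) t r th) pi0).
  + by apply: (@nearW _ (nbhs t)) => t' th _; exact: theta_section.
  + by apply: (@nearW _ (nbhs t)) => t' th _; have [H _ _] := phi_integral_is_derive t' th hr; exact: H.
  + move=> th _; apply: (@cvg_phi _ (nbhs (t, th)) _ fst (cst r) snd) => //;
      [exact: cvg_fst|exact: cvg_cst|exact: cvg_snd].
- have N := near_r hr.
  apply: (@integ_is_derive R r 0 pi (fun r th => phi_integral h t r th) (fun r th => phi_integral (partial i1 h) t r th) pi0).
  + by apply: filterS N => r' hr' th _; exact: theta_section.
  + by apply: filterS N => r' hr' th _; have [_ H _] := phi_integral_is_derive t th hr'; exact: H.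
  + move=> th _; apply: (@cvg_phi _ (nbhs (r, th)) _ (cst t) fst snd) => //;
      [exact: cvg_cst|exact: cvg_fst|exact: cvg_snd].
Qed.

(** The divergence theorem on the sphere, one coordinate at a time. *)
Lemma SI_partial_theta t r : 2 * M < r ->
  (forall ph, h (point4 t r 0 ph) = 0) -> (forall ph, h (point4 t r pi ph) = 0) ->
  SI (partial i2 h) t r = 0.
Proof.
move=> hr h0 hpi; transitivity (phi_integral h t r pi - phi_integral h t r 0).
  apply: integ_FTC2 => // th _; last exact: theta_section.
  by have [_ _ H] := phi_integral_is_derive t th hr; exact: H.
have Z (k : R -> R) : (forall ph, k ph = 0) -> integ 0 (2 * pi) k = 0.
  move=> k0; rewrite (@eq_integ _ _ _ k (fun=> 0)) ?integ_cst ?mul0r//.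
by rewrite /phi_integral !Z// subrr.
Qed.

Lemma SI_partial_phi t r : 2 * M < r -> periodic h -> SI (partial i3 h) t r = 0.
Proof.
move=> hr per.
rewrite /SI (@eq_integ _ _ _ _ (fun=> 0)) ?integ_cst ?mul0r// => th _.
have E : h (point4 t r th (2 * pi)) = h (point4 t r th 0).
  have [_ _ _ E] := point4_move t r th 0 (2 * pi).
  by rewrite -(per (point4 t r th 0)) -E addr0.
transitivity (h (point4 t r th (2 * pi)) - h (point4 t r th 0)); last by rewrite E subrr.
apply: (@integ_FTC2 _ 0 (2 * pi) (fun ph => h (point4 t r th ph))) => // ph _; last exact: phi_section.
by have [_ _ _ H] := is_derive_coord t th ph hr; exact: H.
Qed.

End Derivatives.
End SphereIntegral.

(** * Identities for the sphere integrals *)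

Section Smooth.
Variables (R : realType) (M : R).
Hypothesis hM : 0 < M.
Implicit Types (p q : 'rV[R]_4) (h u v : 'rV[R]_4 -> R).

Definition smooth h := forall n, ck (chart M) n h.

Let oc := @open_chart R M.

Lemma smoothD u v : smooth u -> smooth v -> smooth (fun q => u q + v q).
Proof. by move=> su sv n; exact: ckD. Qed.
Lemma smoothM u v : smooth u -> smooth v -> smooth (fun q => u q * v q).
Proof. by move=> su sv n; exact: ckM. Qed.
Lemma smoothN u : smooth u -> smooth (fun q => - u q).
Proof. by move=> su n; exact: ckN. Qed.
Lemma smoothB u v : smooth u -> smooth v -> smooth (fun q => u q - v q).
Proof. by move=> su sv n; exact: ckB. Qed.
Lemma smooth_partial k u : smooth u -> smooth (partial k u).
Proof. by move=> su n; apply: ck_partial; exact: su. Qed.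
Lemma smooth_cst c : smooth (fun=> c).
Proof. by move=> n; exact: ck_cst. Qed.
Lemma smooth_lapse2 : smooth (fun q => lapse2 M (q 0 i1)).
Proof. by move=> n; exact: ck_lapse2. Qed.
Lemma smooth_sin : smooth (fun q => sin (q 0 i2)).
Proof. by move=> n; case: (ck_sincos oc n i2). Qed.
Lemma smooth_cos : smooth (fun q => cos (q 0 i2)).
Proof. by move=> n; case: (ck_sincos oc n i2). Qed.
Lemma smooth_rV : smooth (fun q => (q 0 i1)^-1).
Proof.
by move=> n; apply: ck_coordV => // p /(chart_r_gt0 hM)/lt0r_neq0.
Qed.

Lemma partial_lapse2 k p : chart M p ->
  partial k (fun q => lapse2 M (q 0 i1)) p = (i1 == k)%:R * (2 * M / p 0 i1 ^+ 2).
Proof.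
move=> cp; have r0 := lt0r_neq0 (chart_r_gt0 hM cp).
by case: (@partial_fun1 R _ _ i1 k p (lapse2_is_derive M r0)).
Qed.

Lemma partial_sin k p : partial k (fun q => sin (q 0 i2)) p = (i2 == k)%:R * cos (p 0 i2).
Proof. by case: (@partial_fun1 R _ _ i2 k p (is_derive_sin (p 0 i2))). Qed.

Lemma partial_cos k p : partial k (fun q => cos (q 0 i2)) p = (i2 == k)%:R * (- sin (p 0 i2)).
Proof. by case: (@partial_fun1 R _ _ i2 k p (is_derive_cos (p 0 i2))). Qed.

Lemma smooth_derivable u k p : smooth u -> chart M p -> derivable u p (delta_mx 0 k).
Proof. by move=> su cp; exact: ckS_derivable (su 1) cp. Qed.

Lemma pdD u v k p : smooth u -> smooth v -> chart M p ->
  partial k (fun q => u q + v q) p = partial k u p + partial k v p.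
Proof. by move=> su sv cp; apply: partialD; exact: smooth_derivable. Qed.
Lemma pdM u v k p : smooth u -> smooth v -> chart M p ->
  partial k (fun q => u q * v q) p = u p * partial k v p + partial k u p * v p.
Proof. by move=> su sv cp; apply: partialM; exact: smooth_derivable. Qed.
Lemma pdN u k p : smooth u -> chart M p ->
  partial k (fun q => - u q) p = - partial k u p.
Proof. by move=> su cp; rewrite /partial [LHS](deriveN (@smooth_derivable u k p su cp)). Qed.
Lemma pdB u v k p : smooth u -> smooth v -> chart M p ->
  partial k (fun q => u q - v q) p = partial k u p - partial k v p.
Proof. by move=> su sv cp; rewrite pdD ?pdN//; exact: smoothN. Qed.
Lemma pdC u k l p : smooth u -> chart M p ->
  partial k (partial l u) p = partial l (partial k u) p.
Proof. by move=> su cp; exact: (partialC oc). Qed.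

(** The derivative along the tortoise coordinate. *)
Definition dstar h q := lapse2 M (q 0 i1) * partial i1 h q.

Lemma smooth_dx u : smooth u -> smooth (dstar u).
Proof. by move=> su; apply: smoothM; [exact: smooth_lapse2|exact: smooth_partial]. Qed.

Lemma pd_dx u k p : smooth u -> chart M p -> k != i1 ->
  partial k (dstar u) p = dstar (partial k u) p.
Proof.
move=> su cp k1; rewrite /dstar pdM ?partial_lapse2//; [|exact: smooth_lapse2|exact: smooth_partial].
by rewrite eq_sym (negbTE k1) !mul0r addr0 (pdC i1 k).
Qed.

Definition sphere_int h t r := SI (fun q => sin (q 0 i2) * h q) t r.

Lemma smooth_sinM u : smooth u -> smooth (fun q => sin (q 0 i2) * u q).
Proof. by move=> su; apply: smoothM => //; exact: smooth_sin. Qed.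

Lemma sphere_intD u v t r : smooth u -> smooth v -> 2 * M < r ->
  sphere_int (fun q => u q + v q) t r = sphere_int u t r + sphere_int v t r.
Proof.
move=> su sv hr.
rewrite /sphere_int -(SID t hr (smooth_sinM su 0) (smooth_sinM sv 0)).
by apply: eq_SI => th ph _; exact: mulrDr.
Qed.

Lemma sphere_intB u v t r : smooth u -> smooth v -> 2 * M < r ->
  sphere_int (fun q => u q - v q) t r = sphere_int u t r - sphere_int v t r.
Proof.
move=> su sv hr.
rewrite /sphere_int -(SIB t hr (smooth_sinM su 0) (smooth_sinM sv 0)).
by apply: eq_SI => th ph _; exact: mulrBr.
Qed.

Lemma sphere_intZ u (k : R -> R) t r : smooth u -> 2 * M < r ->
  sphere_int (fun q => k (q 0 i1) * u q) t r = k r * sphere_int u t r.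
Proof.
move=> su hr; rewrite /sphere_int -(SIZ t hr (smooth_sinM su 0)).
by apply: eq_SI => th ph _; exact: mulrCA.
Qed.

Lemma spherical_point4 t r th ph : 2 * M < r -> 0 < th < pi -> spherical M (point4 t r th ph).
Proof. by move=> hr hth; rewrite /spherical /= /point4 !mxE. Qed.

Lemma eq_sphere_int u v t r : smooth u -> smooth v -> 2 * M < r ->
  (forall p, spherical M p -> sin (p 0 i2) * u p = sin (p 0 i2) * v p) ->
  sphere_int u t r = sphere_int v t r.
Proof.
move=> su sv hr uv; apply: eq_SI => th ph thI.
apply: (@extend_to_poles R M t r hr (fun q => sin (q 0 i2) * u q) (fun q => sin (q 0 i2) * v q) (smooth_sinM su 0) (smooth_sinM sv 0)) => // th' th'I.
by apply: uv; exact: spherical_point4.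
Qed.

Lemma le_sphere_int u v t r : smooth u -> smooth v -> 2 * M < r ->
  (forall p, p 0 i0 = t -> p 0 i1 = r -> u p <= v p) -> sphere_int u t r <= sphere_int v t r.
Proof.
move=> su sv hr uv; apply: (le_SI hr (smooth_sinM su 0) (smooth_sinM sv 0)) => th ph thI.
apply: ler_wpM2l; last by apply: uv; rewrite mxE.
by rewrite mxE /= sin_ge0_pi.
Qed.

Lemma sphere_int_is_derive u (t r : R) : smooth u -> 2 * M < r ->
  is_derive t 1 (fun t => sphere_int u t r) (sphere_int (partial i0 u) t r) /\
  is_derive r 1 (fun r => sphere_int u t r) (sphere_int (partial i1 u) t r).
Proof.
move=> su hr; have [D0 D1] := SI_is_derive (smooth_sinM su 1) t hr.
have E k : k != i2 -> sphere_int (partial k u) t r = SI (partial k (fun q => sin (q 0 i2) * u q)) t r.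
  move=> k2; apply: eq_SI => th ph _.
  have cp : chart M (point4 t r th ph) by rewrite chart_point4.
  by rewrite pdM// ?partial_sin; [rewrite eq_sym (negbTE k2) !mul0r addr0|exact: smooth_sin].
have E0 := E i0 isT; have E1 := E i1 isT.
split; [rewrite E0|rewrite E1]; [exact: D0|exact: D1].
Qed.

Lemma sphere_int_cont u t r : smooth u -> 2 * M < r ->
  {for (t, r), continuous (fun p : R * R => sphere_int u p.1 p.2)}.
Proof. by move=> su hr; apply: (SI_cont (smooth_sinM su 0)). Qed.

(** The divergence theorem on the sphere, for k(r) times the divergence of the
    vector field with frame components U1, U2. *)
Lemma sphere_int_div h U1 U2 (k : R -> R) t r :
  smooth h -> smooth U1 -> smooth U2 -> periodic U2 -> 2 * M < r ->
  (forall p, spherical M p -> p 0 i1 = r -> sin (p 0 i2) * h p =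
     k (p 0 i1) * (sin (p 0 i2) * partial i2 U1 p + cos (p 0 i2) * U1 p + partial i3 U2 p)) ->
  sphere_int h t r = 0.
Proof.
move=> sh s1 s2 per hr hE.
pose g := fun q => partial i2 (fun q => sin (q 0 i2) * U1 q) q + partial i3 U2 q.
have sU := smooth_sinM s1.
have sg : smooth g by apply: smoothD; exact: smooth_partial.
have g0 : SI g t r = 0.
  rewrite (SID t hr (smooth_partial i2 sU 0) (smooth_partial i3 s2 0)).
  rewrite (SI_partial_phi (s2 1) t hr per) addr0.
  apply: (SI_partial_theta (sU 1)) => // ph; rewrite mxE /=.
    by rewrite sin0 mul0r.
  by rewrite sinpi mul0r.
transitivity (SI (fun q => k r * g q) t r); last first.
  by rewrite (SIZ t hr (sg 0) (fun=> k r)) g0 mulr0.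
have skg : smooth (fun q => k r * g q) by apply: smoothM => //; exact: smooth_cst.
apply: eq_SI => th ph thI.
apply: (@extend_to_poles R M t r hr (fun q => sin (q 0 i2) * h q) (fun q => k r * g q) (smooth_sinM sh 0) (skg 0)) => // th' th'I.
have sp := spherical_point4 t ph hr th'I.
have cp := spherical_chart sp.
have r1 : (point4 t r th' ph) 0 i1 = r by rewrite mxE.
rewrite hE// r1 /g pdM//; last exact: smooth_sin.
by rewrite partial_sin eqxx mul1r.
Qed.

End Smooth.

#[global] Hint Resolve smoothD smoothM smoothN smooth_partial smooth_cst smooth_lapse2
  smooth_sin smooth_cos smooth_rV smooth_dx spherical_chart : smooth.

(** * The first-order system behind each potential *)

Lemma wave_algebra (R : realFieldType) (f V s co p00 pxx x0 y1 a a' b b' p2 p22 p33 : R) :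
  s * p00 = - (s * a + co * x0 + b) -> s * pxx = - (s * a' + co * y1 + b') ->
  a - f * a' = - V * p22 -> b - f * b' = - V * p33 -> x0 - f * y1 = - V * p2 ->
  s * (p00 - f * pxx) = V * (s * p22 + co * p2 + p33).
Proof.
move=> A B /eqP; rewrite subr_eq => /eqP aE /eqP; rewrite subr_eq => /eqP bE.
move=> /eqP; rewrite subr_eq => /eqP xE.
by rewrite mulrBr mulrCA A B aE bE xE; ring.
Qed.

Lemma energy_algebra (R : realFieldType) (V s co p0 px p2 p3 p00 pxx px0 p22 p33 p20 p30 : R) :
  s * (p00 - pxx) = V * (s * p22 + co * p2 + p33) ->
  s * (2 * (p0 * p00 + px * px0) + V * (2 * (p2 * p20 + p3 * p30)) - 2 * (p0 * pxx + px0 * px)) =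
  2 * V * (s * (p0 * p22 + p20 * p2) + co * (p0 * p2) + (p0 * p33 + s * p30 * p3)).
Proof.
move=> W.
transitivity (2 * p0 * (s * (p00 - pxx)) + 2 * V * s * (p2 * p20 + p3 * p30)); first by ring.
by rewrite W; ring.
Qed.

Lemma momentum_algebra (R : realFieldType) (V s co p0 px p2 p3 p00 pxx px0 p22 p33 p2x p3x : R) :
  s * (p00 - pxx) = V * (s * p22 + co * p2 + p33) ->
  s * (2 * (p0 * px0 + px * pxx) + - V * (2 * (p2 * p2x + p3 * p3x)) - 2 * (p0 * px0 + p00 * px)) =
  - 2 * V * (s * (px * p22 + p2x * p2) + co * (px * p2) + (px * p33 + s * p3x * p3)).
Proof.
move=> W.
transitivity (- 2 * px * (s * (p00 - pxx)) - 2 * V * s * (p2 * p2x + p3 * p3x)); first by ring.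
by rewrite W; ring.
Qed.

Lemma virial_algebra (R : realFieldType) (V s co p0 px p2 p3 x1 x2 y1 y2 p20 p2x p30 p3x
    x10 x20 y1x y2x x12 x23 y12 y23 : R) :
  s * p0 = - (s * x12 + co * x1 + x23) -> s * px = - (s * y12 + co * y1 + y23) ->
  x10 - y1x = - V * p2 -> x20 - y2x = - V * p3 ->
  s * (p2 * y1x + p2x * y1 + (p3 * y2x + p3x * y2) - (p2 * x10 + p20 * x1 + (p3 * x20 + p30 * x2))
     - (1 * (px * px) + V * (p2 * p2 + p3 * p3) - 1 * (p0 * p0))) =
  1 * (s * (px * y12 + p2x * y1 - (p0 * x12 + p20 * x1)) + co * (px * y1 - p0 * x1)
    + (px * y23 + s * p3x * y2 - (p0 * x23 + s * p30 * x2))).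
Proof.
move=> A B /eqP; rewrite subr_eq => /eqP -> /eqP; rewrite subr_eq => /eqP ->.
transitivity (s * (p2x * y1 + p3x * y2 - p20 * x1 - p30 * x2) - px * (s * px) + p0 * (s * p0)).
  by ring.
by rewrite A B; ring.
Qed.

Section Comb.
Variables (R : realType) (M t r : R) (hr : 2 * M < r).
Variables (u v w : 'rV[R]_4 -> R) (k : R -> R) (l m : R).
Hypotheses (su : smooth M u) (sk : smooth M (fun q => k (q 0 i1))) (sv : smooth M v) (sw : smooth M w).

Lemma smooth_comb3 : smooth M (fun q => l * u q + k (q 0 i1) * v q - m * w q).
Proof.
exact: (smoothB (smoothD (smoothM (smooth_cst M l) su) (smoothM sk sv)) (smoothM (smooth_cst M m) sw)).
Qed.

Lemma sphere_comb3 : sphere_int (fun q => l * u q + k (q 0 i1) * v q - m * w q) t r =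
  l * sphere_int u t r + k r * sphere_int v t r - m * sphere_int w t r.
Proof.
have slu := smoothM (smooth_cst M l) su; have smw := smoothM (smooth_cst M m) sw.
have skv := smoothM sk sv.
rewrite (sphere_intB t (smoothD slu skv) smw hr) (sphere_intD t slu skv hr).
by rewrite (sphere_intZ (fun=> l) t su hr) (sphere_intZ k t sv hr) (sphere_intZ (fun=> m) t sw hr).
Qed.
End Comb.

Section System.
Variables (R : realType) (M : R).
Hypothesis hM : 0 < M.
Implicit Types (p q : 'rV[R]_4) (h u v : 'rV[R]_4 -> R).
Local Notation dx := (dstar M).
Local Notation smooth := (smooth M).

Definition potV (r : R) := lapse2 M r / r ^+ 2.

Lemma smooth_potV : smooth (fun q => potV (q 0 i1)).
Proof.
apply: smoothM; first exact: smooth_lapse2.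
have rV := smooth_rV hM; move=> n.
by apply: (@ck_ext _ _ (@open_chart R M) _ _ _ _ (smoothM rV rV n)) => q _; rewrite -expr2 exprVn.
Qed.

(** Half of the Maxwell equations, for a scalar psi on the sphere (either the
    radial electric or the radial magnetic field) and the two one-forms X, Y
    on the sphere whose divergences are its derivatives; psi3 is the frame
    component of the angular derivative along the parallels. *)
Definition psi_system psi psi3 X1 X2 Y1 Y2 :=
  [/\ smooth psi, smooth psi3, smooth X1 /\ smooth X2 & smooth Y1 /\ smooth Y2] /\
  [/\ periodic psi, periodic psi3, periodic X1 /\ periodic X2 & periodic Y1 /\ periodic Y2] /\
  forall p, spherical M p ->
  let s := sin (p 0 i2) in let co := cos (p 0 i2) in
  [/\ s * partial i0 psi p = - (s * partial i2 X1 p + co * X1 p + partial i3 X2 p),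
      s * dx psi p = - (s * partial i2 Y1 p + co * Y1 p + partial i3 Y2 p),
      partial i0 X1 p - dx Y1 p = - potV (p 0 i1) * partial i2 psi p,
      partial i0 X2 p - dx Y2 p = - potV (p 0 i1) * psi3 p &
      s * psi3 p = partial i3 psi p].

Variables psi psi3 X1 X2 Y1 Y2 : 'rV[R]_4 -> R.
Hypothesis sys : psi_system psi psi3 X1 X2 Y1 Y2.

Let sm : [/\ smooth psi, smooth psi3, smooth X1 /\ smooth X2 & smooth Y1 /\ smooth Y2] := sys.1.
Let spsi : smooth psi. Proof. by case: sm. Qed.
Let spsi3 : smooth psi3. Proof. by case: sm. Qed.
Let sX1 : smooth X1. Proof. by case: sm => _ _ []. Qed.
Let sX2 : smooth X2. Proof. by case: sm => _ _ []. Qed.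
Let sY1 : smooth Y1. Proof. by case: sm => _ _ _ []. Qed.
Let sY2 : smooth Y2. Proof. by case: sm => _ _ _ []. Qed.

Let sphE k u v p : spherical M p -> (forall q, spherical M q -> u q = v q) ->
  partial k u p = partial k v p.
Proof. by move=> sp uv; exact: (@partial_spherical_ext R M u v k p sp uv). Qed.

Let pdsin u k p : smooth u -> chart M p -> k != i2 ->
  partial k (fun q => sin (q 0 i2) * u q) p = sin (p 0 i2) * partial k u p.
Proof.
move=> su cp k2; rewrite (pdM k (@smooth_sin R M) su cp) partial_sin eq_sym (negbTE k2).
by rewrite !mul0r addr0.
Qed.

Lemma pd_psi3 k p : spherical M p -> k != i2 ->
  sin (p 0 i2) * partial k psi3 p = partial i3 (partial k psi) p.
Proof.
move=> sp k2; have cp := spherical_chart sp.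
rewrite -(pdsin spsi3 cp k2) (pdC i3 k spsi cp)//; apply: sphE => // q sq.
by case: (sys.2.2 q sq).
Qed.

Let pdiv U1 U2 k p : smooth U1 -> smooth U2 -> chart M p -> k != i2 ->
  partial k (fun q => - (sin (q 0 i2) * partial i2 U1 q + cos (q 0 i2) * U1 q + partial i3 U2 q)) p =
  - (sin (p 0 i2) * partial i2 (partial k U1) p + cos (p 0 i2) * partial k U1 p
     + partial i3 (partial k U2) p).
Proof.
move=> s1 s2 cp k2.
have a1 : smooth (fun q => sin (q 0 i2) * partial i2 U1 q) by auto with smooth.
have a2 : smooth (fun q => cos (q 0 i2) * U1 q) by auto with smooth.
have a3 : smooth (partial i3 U2) by auto with smooth.
rewrite (pdN k (smoothD (smoothD a1 a2) a3) cp) (pdD k (smoothD a1 a2) a3 cp) (pdD k a1 a2 cp).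
rewrite (pdsin (smooth_partial i2 s1) cp k2) (pdM k (@smooth_cos R M) s1 cp) partial_cos.
by rewrite [i2 == k]eq_sym (negbTE k2) !mul0r addr0 (pdC k i2 s1 cp) (pdC k i3 s2 cp).
Qed.

Lemma partial_radialM (phi : R -> R) u k p : smooth u -> chart M p -> k != i1 ->
  partial k (fun q => phi (q 0 i1) * u q) p = phi (p 0 i1) * partial k u p.
Proof.
move=> su cp k1; rewrite /partial /derive.
have E : (fun h : R => h^-1 *: (((fun q : 'rV[R]_4 => phi (q 0 i1) * u q) \o shift p) (h *: delta_mx 0 k) - phi (p 0 i1) * u p)) =
    (fun h : R => phi (p 0 i1) *: (h^-1 *: ((u \o shift p) (h *: delta_mx 0 k) - u p))).
  apply/funext => h /=; rewrite !mxE eq_sym (negbTE k1) mulr0 add0r.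
  by rewrite -mulrBr; exact: mulrCA.
by rewrite E; exact: (limZr _ (@smooth_derivable _ _ u k p su cp)).
Qed.

(** The wave equation, the integrability condition of the first-order system. *)
Lemma wave p : spherical M p ->
  sin (p 0 i2) * (partial i0 (partial i0 psi) p - dx (dx psi) p) =
  potV (p 0 i1) * (sin (p 0 i2) * partial i2 (partial i2 psi) p +
     cos (p 0 i2) * partial i2 psi p + partial i3 psi3 p).
Proof.
move=> sp; have cp := spherical_chart sp.
have A : sin (p 0 i2) * partial i0 (partial i0 psi) p = _ :=
  etrans (esym (pdsin (smooth_partial i0 spsi) cp (isT : i0 != i2)))
  (etrans (sphE i0 sp (fun q sq => let: And5 e _ _ _ _ := sys.2.2 q sq in e))
    (pdiv sX1 sX2 cp (isT : i0 != i2))).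
have B : sin (p 0 i2) * partial i1 (dx psi) p = _ :=
  etrans (esym (pdsin (smooth_dx hM spsi) cp (isT : i1 != i2)))
  (etrans (sphE i1 sp (fun q sq => let: And5 _ e _ _ _ := sys.2.2 q sq in e))
    (pdiv sY1 sY2 cp (isT : i1 != i2))).
have C := @sphE i2 (fun q => partial i0 X1 q - dx Y1 q) (fun q => - potV (q 0 i1) * partial i2 psi q) p sp (fun q sq => let: And5 _ _ e _ _ := sys.2.2 q sq in e).
have D := @sphE i3 (fun q => partial i0 X2 q - dx Y2 q) (fun q => - potV (q 0 i1) * psi3 q) p sp (fun q sq => let: And5 _ _ _ e _ := sys.2.2 q sq in e).
have V r : - potV r = - (lapse2 M r / r ^+ 2) by [].
rewrite (pdB i2 (smooth_partial i0 sX1) (smooth_dx hM sY1) cp) (partial_radialM (fun r => - potV r) (smooth_partial i2 spsi) cp)// (pd_dx hM sY1 cp)// in C.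
rewrite (pdB i3 (smooth_partial i0 sX2) (smooth_dx hM sY2) cp) (partial_radialM (fun r => - potV r) spsi3 cp)// (pd_dx hM sY2 cp)// in D.
have [_ _ C' _ _] := sys.2.2 p sp.
rewrite /dstar (pdC i1 i2 sY1 cp) in C; rewrite /dstar (pdC i1 i3 sY2 cp) in D.
exact: (wave_algebra A B C D C').
Qed.

(** ** Balance laws *)

Lemma dxM u v p : smooth u -> smooth v -> chart M p ->
  dx (fun q => u q * v q) p = u p * dx v p + dx u p * v p.
Proof.
by move=> su sv cp; rewrite /dstar (pdM i1 su sv cp) mulrDr mulrCA [X in _ + X]mulrA.
Qed.

Lemma dxD u v p : smooth u -> smooth v -> chart M p ->
  dx (fun q => u q + v q) p = dx u p + dx v p.
Proof. by move=> su sv cp; rewrite /dstar (pdD i1 su sv cp) mulrDr. Qed.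

Definition kinetic q := partial i0 psi q * partial i0 psi q + dx psi q * dx psi q.
Definition angular q := partial i2 psi q * partial i2 psi q + psi3 q * psi3 q.
Definition flux q := partial i0 psi q * dx psi q.
Definition work_t q := partial i2 psi q * X1 q + psi3 q * X2 q.
Definition work_x q := partial i2 psi q * Y1 q + psi3 q * Y2 q.

Let sp0 : smooth (partial i0 psi). Proof. exact: smooth_partial. Qed.
Let sp2 : smooth (partial i2 psi). Proof. exact: smooth_partial. Qed.
Let sdx : smooth (dx psi). Proof. exact: smooth_dx. Qed.

Lemma smooth_kinetic : smooth kinetic. Proof. exact: (smoothD (smoothM sp0 sp0) (smoothM sdx sdx)). Qed.
Lemma smooth_angular : smooth angular. Proof. exact: (smoothD (smoothM sp2 sp2) (smoothM spsi3 spsi3)). Qed.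
Lemma smooth_flux : smooth flux. Proof. exact: (smoothM sp0 sdx). Qed.
Lemma smooth_work_t : smooth work_t. Proof. exact: (smoothD (smoothM sp2 sX1) (smoothM spsi3 sX2)). Qed.
Lemma smooth_work_x : smooth work_x. Proof. exact: (smoothD (smoothM sp2 sY1) (smoothM spsi3 sY2)). Qed.

Let per : [/\ periodic psi, periodic psi3, periodic X1 /\ periodic X2 & periodic Y1 /\ periodic Y2] := sys.2.1.
Let perpsi : periodic psi. Proof. by case: per. Qed.
Let per3 : periodic psi3. Proof. by case: per. Qed.
Let perX2 : periodic X2. Proof. by case: per => _ _ []. Qed.
Let perY2 : periodic Y2. Proof. by case: per => _ _ _ []. Qed.

Let periodicM u v : periodic u -> periodic v -> periodic (fun q => u q * v q).
Proof. by move=> pu pv q; rewrite pu pv. Qed.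

Let per_dx : periodic (dx psi).
Proof.
by move=> q; rewrite /dstar (periodic_partial i1 perpsi) !mxE mulr0 add0r.
Qed.

Let psi3_0 p : spherical M p -> sin (p 0 i2) * partial i0 psi3 p = partial i3 (partial i0 psi) p.
Proof. by move=> sp; exact: pd_psi3. Qed.

Let psi3_x p : spherical M p -> sin (p 0 i2) * dx psi3 p = partial i3 (dx psi) p.
Proof.
move=> sp; have cp := spherical_chart sp.
have H := pd_psi3 sp (isT : i1 != i2).
rewrite (pd_dx hM spsi cp (isT : i3 != i1)) /dstar (pdC i1 i3 spsi cp) -H.
exact: mulrCA.
Qed.

Let kin0 p : chart M p -> partial i0 kinetic p =
  2 * (partial i0 psi p * partial i0 (partial i0 psi) p + dx psi p * dx (partial i0 psi) p).
Proof.
move=> cp; rewrite /kinetic (pdD i0 (smoothM sp0 sp0) (smoothM sdx sdx) cp).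
rewrite (pdM i0 sp0 sp0 cp) (pdM i0 sdx sdx cp) (pd_dx hM spsi cp)//.
by move: (partial i0 _ p) (dx _ p) (dx _ p) => *; ring.
Qed.

Let kinx p : chart M p -> dx kinetic p =
  2 * (partial i0 psi p * dx (partial i0 psi) p + dx psi p * dx (dx psi) p).
Proof.
move=> cp; rewrite /kinetic (dxD (smoothM sp0 sp0) (smoothM sdx sdx) cp).
rewrite (dxM sp0 sp0 cp) (dxM sdx sdx cp).
by move: (partial i0 _ p) (dx (partial i0 psi) p) (dx psi p) (dx _ p) => *; ring.
Qed.

Let ang0 p : chart M p -> partial i0 angular p =
  2 * (partial i2 psi p * partial i2 (partial i0 psi) p + psi3 p * partial i0 psi3 p).
Proof.
move=> cp; rewrite /angular (pdD i0 (smoothM sp2 sp2) (smoothM spsi3 spsi3) cp).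
rewrite (pdM i0 sp2 sp2 cp) (pdM i0 spsi3 spsi3 cp) (pdC i0 i2 spsi cp).
by move: (partial i2 psi p) (partial i2 _ p) (psi3 p) (partial i0 _ p) => *; ring.
Qed.

Let angx p : chart M p -> dx angular p =
  2 * (partial i2 psi p * partial i2 (dx psi) p + psi3 p * dx psi3 p).
Proof.
move=> cp; rewrite /angular (dxD (smoothM sp2 sp2) (smoothM spsi3 spsi3) cp).
rewrite (dxM sp2 sp2 cp) (dxM spsi3 spsi3 cp) (pd_dx hM spsi cp)//.
by move: (partial i2 psi p) (dx _ p) (psi3 p) (dx _ p) => *; ring.
Qed.

(** Multiply the wave equation by the time derivative of psi: what is left after the
    divergence on the orbit space is a divergence on the sphere. *)
Lemma energy_balance t r : 2 * M < r ->
  sphere_int (partial i0 kinetic) t r + potV r * sphere_int (partial i0 angular) t r =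
  2 * sphere_int (dx flux) t r.
Proof.
move=> hr; have sk := smooth_partial i0 smooth_kinetic.
have sa := smooth_partial i0 smooth_angular.
have sf := smooth_dx hM smooth_flux.
have Z : sphere_int (fun q => 1 * partial i0 kinetic q + potV (q 0 i1) * partial i0 angular q
    - 2 * dx flux q) t r = 0.
  have sU1 := smoothM sp0 sp2; have sU2 := smoothM sp0 spsi3.
  apply: (sphere_int_div (k := fun r => 2 * potV r) t (smooth_comb3 1 2 sk smooth_potV sa sf) sU1 sU2) => //.
    exact: (periodicM (periodic_partial i0 perpsi)).
  move=> p sp _; have cp := spherical_chart sp.
  rewrite kin0// ang0// /flux (dxM sp0 sdx cp) mul1r.
  rewrite (pdM i2 sp0 sp2 cp) (pdM i3 sp0 spsi3 cp).
  have W := wave sp; have E0 := psi3_0 sp.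
  rewrite -E0; exact: energy_algebra W.
rewrite (sphere_comb3 t hr 1 2 sk smooth_potV sa sf) in Z.
by move/eqP: Z; rewrite subr_eq0 mul1r => /eqP.
Qed.

(** Multiply the wave equation by the derivative of psi along the tortoise
    coordinate. *)
Lemma momentum_balance t r : 2 * M < r ->
  sphere_int (dx kinetic) t r - potV r * sphere_int (dx angular) t r =
  2 * sphere_int (partial i0 flux) t r.
Proof.
move=> hr; have sk := smooth_dx hM smooth_kinetic.
have sa := smooth_dx hM smooth_angular.
have sf := smooth_partial i0 smooth_flux.
have sV := smoothN smooth_potV.
have Z : sphere_int (fun q => 1 * dx kinetic q + (- potV (q 0 i1)) * dx angular q
    - 2 * partial i0 flux q) t r = 0.
  have sU1 := smoothM sdx sp2; have sU2 := smoothM sdx spsi3.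
  apply: (sphere_int_div (k := fun r => - 2 * potV r) t (smooth_comb3 (k := fun r => - potV r) 1 2 sk sV sa sf) sU1 sU2) => //.
    exact: (periodicM per_dx).
  move=> p sp _; have cp := spherical_chart sp.
  rewrite kinx// angx// /flux (pdM i0 sp0 sdx cp) (pd_dx hM spsi cp (isT : i0 != i1)) mul1r.
  rewrite (pdM i2 sdx sp2 cp) (pdM i3 sdx spsi3 cp).
  have W := wave sp; have Ex := psi3_x sp.
  rewrite -Ex; exact: momentum_algebra W.
rewrite (sphere_comb3 (k := fun r => - potV r) t hr 1 2 sk sV sa sf) in Z.
by move/eqP: Z; rewrite subr_eq0 mul1r mulNr => /eqP.
Qed.

(** Contract the two equations for X and Y with the angular gradient of psi. The
    divergences of X and Y being the derivatives of psi, an integration by parts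
    on the sphere turns the work into kinetic terms. *)
Lemma virial_balance t r : 2 * M < r ->
  sphere_int (dx work_x) t r - sphere_int (partial i0 work_t) t r =
  potV r * sphere_int angular t r + sphere_int (fun q => dx psi q * dx psi q) t r
    - sphere_int (fun q => partial i0 psi q * partial i0 psi q) t r.
Proof.
move=> hr; have sx := smooth_dx hM smooth_work_x; have st := smooth_partial i0 smooth_work_t.
have sa := smooth_angular; have s00 := smoothM sp0 sp0; have sxx := smoothM sdx sdx.
pose lhs q := dx work_x q - partial i0 work_t q.
pose rhs q := 1 * (dx psi q * dx psi q) + potV (q 0 i1) * angular q - 1 * (partial i0 psi q * partial i0 psi q).
have slhs : smooth lhs := smoothB sx st.
have srhs : smooth rhs.
  exact: (smoothB (smoothD (smoothM (smooth_cst M 1) sxx) (smoothM smooth_potV sa)) (smoothM (smooth_cst M 1) s00)).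
have Z : sphere_int (fun q => lhs q - rhs q) t r = 0.
  have sU1 := smoothB (smoothM sdx sY1) (smoothM sp0 sX1).
  have sU2 := smoothB (smoothM sdx sY2) (smoothM sp0 sX2).
  apply: (sphere_int_div (k := fun=> 1) t (smoothB slhs srhs) sU1 sU2) => //.
    move=> q; congr (_ - _); first exact: (periodicM per_dx).
    exact: (periodicM (periodic_partial i0 perpsi)).
  move=> p sp _; have cp := spherical_chart sp; rewrite /lhs /rhs /work_x /work_t /angular.
  rewrite (dxD (smoothM sp2 sY1) (smoothM spsi3 sY2) cp) (dxM sp2 sY1 cp) (dxM spsi3 sY2 cp).
  rewrite (pdD i0 (smoothM sp2 sX1) (smoothM spsi3 sX2) cp) (pdM i0 sp2 sX1 cp) (pdM i0 spsi3 sX2 cp).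
  rewrite (pdB i2 (smoothM sdx sY1) (smoothM sp0 sX1) cp) (pdM i2 sdx sY1 cp) (pdM i2 sp0 sX1 cp).
  rewrite (pdB i3 (smoothM sdx sY2) (smoothM sp0 sX2) cp) (pdM i3 sdx sY2 cp) (pdM i3 sp0 sX2 cp).
  rewrite (pdC i0 i2 spsi cp) (pd_dx hM spsi cp (isT : i2 != i1)).
  have [A B C D _] := sys.2.2 p sp.
  have E0 := psi3_0 sp; have Ex := psi3_x sp; rewrite -E0 -Ex.
  exact: virial_algebra A B C D.
rewrite (sphere_intB t slhs srhs hr) (sphere_intB t sx st hr) in Z.
have S1 := sphere_comb3 (k := potV) t hr 1 1 sxx smooth_potV sa s00.
rewrite !mul1r in S1; move/eqP: Z; rewrite subr_eq0 => /eqP ->; rewrite S1.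
by congr (_ - _); exact: addrC.
Qed.

End System.

(** * The Poincare inequality for one-forms on the sphere *)

Section Poincare.
Variables (R : realType) (M : R).
Hypothesis hM : 0 < M.
Local Notation smooth := (smooth M).

Lemma poincare_square (a2 b2 D K : R) :
  4 * (a2 * (D - a2) + b2 * (K - b2)) <= D * D + K * K.
Proof.
rewrite -subr_ge0.
have -> : D * D + K * K - 4 * (a2 * (D - a2) + b2 * (K - b2)) =
  (2 * a2 - D) ^+ 2 + (2 * b2 - K) ^+ 2 by ring.
by rewrite addr_ge0 ?sqr_ge0.
Qed.

Lemma poincare_algebra (s co a b a2 b2 a3 b3 a23 b23 D K : R) :
  s * D = s * a2 + co * a + b3 -> s * K = s * b2 + co * b - a3 ->
  s * (4 * (a2 * (D - a2) + b2 * (K - b2))) =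
  2 * ((co * (a * a2 + a2 * a + (b * b2 + b2 * b)) + - s * (a * a + b * b))
       - (a3 * b2 + a23 * b - (b3 * a2 + b23 * a)))
  + 2 * (a2 * b3 + a23 * b - (b2 * a3 + b23 * a))
  + s * (2 * (a * a + b * b)).
Proof.
move=> DE KE.
transitivity (4 * (a2 * (s * D - s * a2) + b2 * (s * K - s * b2))); first by ring.
by rewrite DE KE; ring.
Qed.

Lemma poincare_pole (co a b a3 b3 : R) : co * co = 1 ->
  0 = co * a + b3 -> 0 = co * b - a3 -> 2 * (co * (a * a + b * b) - (a3 * b - b3 * a)) = 0.
Proof.
move=> c1 bE aE.
have -> : a3 = co * b by rewrite (rwP eqP) -subr_eq0 -oppr_eq0 opprB -aE.
have -> : b3 = - (co * a) by apply/eqP; rewrite -subr_eq0 opprK addrC -bE.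
by ring.
Qed.

Variables a b D K : 'rV[R]_4 -> R.
Hypotheses (sa : smooth a) (sb : smooth b) (sD : smooth D) (sK : smooth K).
Hypotheses (pa : periodic a) (pb : periodic b).
Hypothesis abD : forall p, spherical M p -> sin (p 0 i2) * D p =
  sin (p 0 i2) * partial i2 a p + cos (p 0 i2) * a p + partial i3 b p.
Hypothesis abK : forall p, spherical M p -> sin (p 0 i2) * K p =
  sin (p 0 i2) * partial i2 b p + cos (p 0 i2) * b p - partial i3 a p.

Let aa := smoothM sa sa.
Let bb := smoothM sb sb.
Let a2 := smooth_partial i2 sa.
Let b2 := smooth_partial i2 sb.
Let a3 := smooth_partial i3 sa.
Let b3 := smooth_partial i3 sb.

Let Uth (q : 'rV[R]_4) := 2 * (cos (q 0 i2) * (a q * a q + b q * b q) - (partial i3 a q * b q - partial i3 b q * a q)).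
Let Wph (q : 'rV[R]_4) := 2 * (partial i2 a q * b q - partial i2 b q * a q).

Let sU0 := smoothB (smoothM (@smooth_cos R M) (smoothD aa bb)) (smoothB (smoothM a3 sb) (smoothM b3 sa)).
Let sW0 := smoothB (smoothM a2 sb) (smoothM b2 sa).
Let sU : smooth Uth. Proof. exact: (smoothM (smooth_cst M 2) sU0). Qed.
Let sW : smooth Wph. Proof. exact: (smoothM (smooth_cst M 2) sW0). Qed.

Let pd2 k u p : smooth u -> chart M p -> partial k (fun q => 2 * u q) p = 2 * partial k u p.
Proof. by move=> su cp; rewrite (pdM k (smooth_cst M 2) su cp) partial_cst mul0r addr0. Qed.

Let partialU p : chart M p -> partial i2 Uth p =
  2 * ((cos (p 0 i2) * (a p * partial i2 a p + partial i2 a p * a p + (b p * partial i2 b p + partial i2 b p * b p))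
        + - sin (p 0 i2) * (a p * a p + b p * b p))
       - (partial i3 a p * partial i2 b p + partial i2 (partial i3 a) p * b p
          - (partial i3 b p * partial i2 a p + partial i2 (partial i3 b) p * a p))).
Proof.
move=> cp; rewrite /Uth (pd2 i2 sU0 cp).
rewrite (pdB i2 (smoothM (@smooth_cos R M) (smoothD aa bb)) (smoothB (smoothM a3 sb) (smoothM b3 sa)) cp).
rewrite (pdM i2 (@smooth_cos R M) (smoothD aa bb) cp) partial_cos eqxx mul1r.
rewrite (pdD i2 aa bb cp) (pdM i2 sa sa cp) (pdM i2 sb sb cp).
by rewrite (pdB i2 (smoothM a3 sb) (smoothM b3 sa) cp) (pdM i2 a3 sb cp) (pdM i2 b3 sa cp).
Qed.

Let partialW p : chart M p -> partial i3 Wph p =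
  2 * (partial i2 a p * partial i3 b p + partial i2 (partial i3 a) p * b p
       - (partial i2 b p * partial i3 a p + partial i2 (partial i3 b) p * a p)).
Proof.
move=> cp; rewrite /Wph (pd2 i3 sW0 cp) (pdB i3 (smoothM a2 sb) (smoothM b2 sa) cp).
by rewrite (pdM i3 a2 sb cp) (pdM i3 b2 sa cp) (pdC i3 i2 sa cp) (pdC i3 i2 sb cp).
Qed.

(** The frame identities hold up to the poles, where they force a boundary term
    to vanish. *)
Let U_pole t r th ph : 2 * M < r -> sin th = 0 -> 0 <= th <= pi -> Uth (point4 t r th ph) = 0.
Proof.
move=> hr s0 thI.
have sD' := smooth_sinM sD; have sK' := smooth_sinM sK.
have cb := smoothD (smoothD (smoothM (@smooth_sin R M) a2) (smoothM (@smooth_cos R M) sa)) b3.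
have ca := smoothB (smoothD (smoothM (@smooth_sin R M) b2) (smoothM (@smooth_cos R M) sb)) a3.
have E1 := extend_to_poles (t := t) (ph := ph) hr (sD' 0) (cb 0)
  (fun th h => abD (spherical_point4 t ph hr h)) thI.
have E2 := extend_to_poles (t := t) (ph := ph) hr (sK' 0) (ca 0)
  (fun th h => abK (spherical_point4 t ph hr h)) thI.
move: E1 E2; rewrite /= {1 3}/point4 mxE /= s0 !mul0r !add0r.
rewrite /Uth (_ : (point4 t r th ph) 0 i2 = th); last by rewrite mxE.
move=> E1 E2.
apply: poincare_pole => //.
by have := cos2Dsin2 th; rewrite s0 expr0n addr0 expr2.
Qed.

(** Completing a square bounds |D|^2 + |K|^2 from below by the quadratic form g, and
    the excess of g over 2 (|a|^2 + |b|^2) is a divergence on the sphere. The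
    constant is sharp: gradients of spherical harmonics of degree one give
    equality. *)
Lemma poincare t r : 2 * M < r ->
  2 * sphere_int (fun q => a q * a q + b q * b q) t r <=
  sphere_int (fun q => D q * D q + K q * K q) t r.
Proof.
move=> hr.
pose g q := 4 * (partial i2 a q * (D q - partial i2 a q) + partial i2 b q * (K q - partial i2 b q)).
have sg0 := smoothD (smoothM a2 (smoothB sD a2)) (smoothM b2 (smoothB sK b2)).
have sg : smooth g by exact: (smoothM (smooth_cst M 4) sg0).
have sDK := smoothD (smoothM sD sD) (smoothM sK sK).
have le1 : sphere_int g t r <= sphere_int (fun q => D q * D q + K q * K q) t r.
  by apply: (le_sphere_int sg sDK hr) => p _ _; exact: poincare_square.
apply: le_trans le1; rewrite le_eqVlt; apply/orP; left; apply/eqP; apply/esym.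
have dU := smooth_partial i2 sU; have dW := smooth_partial i3 sW.
have s2 : smooth (fun q => 2 * (a q * a q + b q * b q)) by exact: (smoothM (smooth_cst M 2) (smoothD aa bb)).
have := @SID R M t r hr (fun q => partial i2 Uth q + partial i3 Wph q) _ (smoothD dU dW 0) (smooth_sinM s2 0).
rewrite (SID t hr (dU 0) (dW 0)).
rewrite (SI_partial_theta (sU 1) hr); [|by move=> ph; apply: U_pole; rewrite ?sin0 ?lexx ?pi_ge0|by move=> ph; apply: U_pole; rewrite ?sinpi ?lexx ?pi_ge0].
rewrite (SI_partial_phi (sW 1) t hr) ?add0r; last first.
  by move=> q; rewrite /Wph (periodic_partial i2 pa) (periodic_partial i2 pb) pa pb.
have -> : SI (fun q => sin (q 0 i2) * (2 * (a q * a q + b q * b q))) t r =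
    2 * sphere_int (fun q => a q * a q + b q * b q) t r.
  exact: (sphere_intZ (fun=> 2) t (smoothD aa bb) hr).
move=> <-; apply: eq_SI => th ph thI.
apply: (extend_to_poles hr (smooth_sinM sg 0) ((smoothD (smoothD dU dW) (smooth_sinM s2)) 0)) thI => th' th'I.
have sp := spherical_point4 t ph hr th'I; have cp := spherical_chart sp.
rewrite (partialU cp) (partialW cp) /g.
exact: poincare_algebra (abD sp) (abK sp).
Qed.

End Poincare.

(** * The two potentials of a Maxwell field *)

Section Inverse.
Variables (R : realType) (M : R).
Hypothesis hM : 0 < M.

Lemma smooth_inv u : smooth M u -> (forall p, chart M p -> u p != 0) ->
  smooth M (fun q => (u q)^-1).
Proof.
move=> su u0; have oc := @open_chart R M.
have D k p : chart M p -> derivable (fun q => (u q)^-1) p (delta_mx 0 k) /\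
    partial k (fun q => (u q)^-1) p = - (partial k u p * ((u p)^-1 * (u p)^-1)).
  move=> cp; have d := @smooth_derivable _ _ u k p su cp.
  split; first exact: derivableV (u0 p cp) d.
  rewrite /partial [LHS](deriveV (u0 p cp) d) -exprVn expr2 [_ *: _]mulNr.
  by congr (- _); exact: mulrC.
have C p : chart M p -> (fun q => (u q)^-1) @ p --> (u p)^-1.
  by move=> cp; have := su 0%N => /ck0 H; exact: (cvgV (u0 p cp) (H p cp)).
elim=> [|n IH]; first by apply/ck0.
apply/ckS; split => //; first by move=> k p cp; case: (D k p cp).
move=> k; apply: (@ck_ext _ _ oc n (fun q => - (partial k u q * ((u q)^-1 * (u q)^-1)))).
  by move=> p cp; case: (D k p cp).
by apply: ckN => //; apply: ckM => //; [exact: (smooth_partial k su n)|exact: ckM].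
Qed.
End Inverse.

Section TwoSystems.
Variables (R : realType) (M : R).
Hypothesis hM : 0 < M.
Local Notation smooth := (smooth M).
Local Notation dx := (dstar M).
Variables (F : tensor2 R) (E B a b c d : 'rV[R]_4 -> R).
Hypothesis Fc : frame_comps M F E B a b c d.
Hypothesis ckF : forall n, [/\ ck (chart M) n E, ck (chart M) n B,
  ck (chart M) n a /\ ck (chart M) n b & ck (chart M) n c /\ ck (chart M) n d].
Hypothesis mF : maxwell M F.
Hypothesis perF : [/\ periodic E, periodic B, periodic a /\ periodic b & periodic c /\ periodic d].

Let sE : smooth E. Proof. by move=> n; case: (ckF n). Qed.
Let sB : smooth B. Proof. by move=> n; case: (ckF n). Qed.
Let sa : smooth a. Proof. by move=> n; case: (ckF n) => _ _ []. Qed.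
Let sb : smooth b. Proof. by move=> n; case: (ckF n) => _ _ []. Qed.
Let sc : smooth c. Proof. by move=> n; case: (ckF n) => _ _ _ []. Qed.
Let sd : smooth d. Proof. by move=> n; case: (ckF n) => _ _ _ []. Qed.
Let pE : periodic E. Proof. by case: perF. Qed.
Let pB : periodic B. Proof. by case: perF. Qed.
Let pa : periodic a. Proof. by case: perF => _ _ []. Qed.
Let pb : periodic b. Proof. by case: perF => _ _ []. Qed.
Let pc : periodic c. Proof. by case: perF => _ _ _ []. Qed.
Let pd : periodic d. Proof. by case: perF => _ _ _ []. Qed.

Lemma potV_gt0 r : 2 * M < r -> 0 < potV M r.
Proof.
move=> hr; rewrite /potV divr_gt0 ?lapse2_gt0// exprn_gt0//.
by move: hr hM; lra.
Qed.

Let V0 p : chart M p -> potV M (p 0 i1) != 0.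
Proof. by move=> cp; apply: lt0r_neq0; exact: potV_gt0. Qed.

(** The angular derivatives along the parallels, divided by sin th, are read off
    from the field equations, which shows that they are smooth at the poles. *)
Definition angular_E q := (dx b q - partial i0 d q) * (potV M (q 0 i1))^-1.
Definition angular_B q := (dx c q - partial i0 a q) * (potV M (q 0 i1))^-1.

Let sV1 : smooth (fun q => (potV M (q 0 i1))^-1).
Proof. by apply: smooth_inv => //; exact: smooth_potV. Qed.

Lemma smooth_angular_E : smooth angular_E.
Proof. exact: (smoothM (smoothB (smooth_dx hM sb) (smooth_partial i0 sd)) sV1). Qed.
Lemma smooth_angular_B : smooth angular_B.
Proof. exact: (smoothM (smoothB (smooth_dx hM sc) (smooth_partial i0 sa)) sV1). Qed.

Let per_ang u v : periodic u -> periodic v ->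
  periodic (fun q => (dx u q - partial i0 v q) * (potV M (q 0 i1))^-1).
Proof.
move=> pu pv q; rewrite /dstar (periodic_partial i1 pu) (periodic_partial i0 pv).
by rewrite !mxE mulr0 add0r.
Qed.

Let angular_algebra (s x y v e : R) : v != 0 -> s * (y - x) = - v * e -> s * ((x - y) * v^-1) = e.
Proof. by move=> v0 h; rewrite mulrA -opprB mulrN h [- v * _]mulNr opprK mulrAC mulfV// mul1r. Qed.

Lemma angular_E_eq p : spherical M p -> sin (p 0 i2) * angular_E p = partial i3 E p.
Proof.
move=> sp; have [_ _ [_ e] _] := maxwell_frame hM Fc ckF mF sp.
exact: angular_algebra (V0 (spherical_chart sp)) e.
Qed.

Lemma angular_B_eq p : spherical M p -> sin (p 0 i2) * angular_B p = partial i3 B p.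
Proof.
move=> sp; have [_ _ _ [_ e]] := maxwell_frame hM Fc ckF mF sp.
exact: angular_algebra (V0 (spherical_chart sp)) e.
Qed.

Let scaleV (x v : R) : v != 0 -> - v * (x * v^-1) = - x.
Proof. by move=> v0; rewrite mulrCA mulNr mulfV// mulrN1. Qed.

Lemma electric_system : psi_system M E angular_E c d a b.
Proof.
split; first by split => //; exact: smooth_angular_E.
split; first by split => //; exact: per_ang.
move=> p sp s co; have [[M1 M2] _ [M3 _] _] := maxwell_frame hM Fc ckF mF sp.
have v0 := V0 (spherical_chart sp).
split; [exact: M1|exact: M2|exact: M3|rewrite /angular_E scaleV ?opprB//|exact: angular_E_eq].
Qed.

Lemma magnetic_system : psi_system M B angular_B (fun q => - b q) a (fun q => - d q) c.
Proof.
have [sb' sd'] := (smoothN sb, smoothN sd).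
split; first by split => //; exact: smooth_angular_B.
split.
  split => //; first exact: per_ang.
    by split => // q; rewrite pb.
  by split => // q; rewrite pd.
move=> p sp s co; have cp := spherical_chart sp.
have [_ [M1 M2] _ [M3 _]] := maxwell_frame hM Fc ckF mF sp.
have v0 := V0 cp.
rewrite !(pdN _ sb cp) /dstar !(pdN _ sd cp); split.
- by rewrite [LHS]M1 /s /co; move: (partial i2 b p) (partial i3 a p) => *; ring.
- by rewrite [LHS]M2 /s /co; move: (partial i2 d p) (partial i3 c p) => *; ring.
- by rewrite mulrN -opprD [X in - X]M3 mulNr.
- by rewrite /angular_B scaleV ?opprB.
- exact: angular_B_eq.
Qed.

End TwoSystems.

(** * Multipliers *)

Section Orbit.
Variables (R : realType) (M : R).
Hypothesis hM : 0 < M.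
Implicit Types (t r : R).

(** The partial derivatives are part of the data, so that those of the sphere
    integrals can be read off in closed form. *)
Definition C1 (u ut ur : R -> R -> R) := forall t r, 2 * M < r ->
  [/\ is_derive t 1 (u ^~ r) (ut t r), is_derive r 1 (u t) (ur t r),
      {for (t, r), continuous (fun z : R * R => u z.1 z.2)},
      {for (t, r), continuous (fun z : R * R => ut z.1 z.2)} &
      {for (t, r), continuous (fun z : R * R => ur z.1 z.2)}].

Definition radial (phi dphi : R -> R) := forall r, 2 * M < r ->
  is_derive r 1 phi (dphi r) /\ {for r, continuous dphi}.

Lemma radialD phi dphi psi dpsi : radial phi dphi -> radial psi dpsi ->
  radial (fun r => phi r + psi r) (fun r => dphi r + dpsi r).
Proof.
move=> H K r hr; have [[a b] [c d]] := (H r hr, K r hr).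
by split; [exact: derive1_add|apply: cvgD].
Qed.

Lemma radialM phi dphi psi dpsi : radial phi dphi -> radial psi dpsi ->
  radial (fun r => phi r * psi r) (fun r => dphi r * psi r + phi r * dpsi r).
Proof.
move=> H K r hr; have [[a b] [c d]] := (H r hr, K r hr).
split; first exact: derive1_mul.
by apply: cvgD; apply: cvgM => //; exact: is_derive_continuous.
Qed.

Lemma radial_cst c : radial (fun=> c) (fun=> 0).
Proof. by move=> r _; split; [exact: is_derive_cst|exact: cvg_cst]. Qed.

Lemma radialZ c phi dphi : radial phi dphi -> radial (fun r => c * phi r) (fun r => c * dphi r).
Proof.
move=> H r hr; have [a b] := H r hr; split; first exact: derive1_scale.
by apply: cvgM => //; exact: cvg_cst.
Qed.

Lemma r_neq0 r : 2 * M < r -> r != 0.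
Proof. by move=> hr; apply: lt0r_neq0; move: hr hM; lra. Qed.

Lemma radial_y : radial (fun r => M / r) (fun r => - ((M / r) * (M / r)) / M).
Proof.
move=> r hr; have r0 := r_neq0 hr; have D := derive1_inv r0 (is_derive_id r 1).
have Dy := derive1_scale D M.
have Cy : {for r, continuous (fun r => M / r)} by exact: is_derive_continuous Dy.
split; last by apply: cvgM; [apply: cvgN; exact: cvgM|exact: cvg_cst].
apply: (derive1_eq Dy); move: (lt0r_neq0 hM) r0; move: M => m m0 r0.
by field; rewrite r0 m0.
Qed.

Lemma C1D u ut ur v vt vr : C1 u ut ur -> C1 v vt vr ->
  C1 (fun t r => u t r + v t r) (fun t r => ut t r + vt t r) (fun t r => ur t r + vr t r).
Proof.
move=> H K t r hr; have [[a b c d e] [a' b' c' d' e']] := (H t r hr, K t r hr).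
by split; [exact: derive1_add|exact: derive1_add|apply: cvgD|apply: cvgD|apply: cvgD].
Qed.

Lemma radial_cont phi dphi t r : radial phi dphi -> 2 * M < r ->
  {for (t, r), continuous (fun z : R * R => phi z.2)} /\
  {for (t, r), continuous (fun z : R * R => dphi z.2)}.
Proof.
move=> H hr; have [a b] := H r hr.
have C (g : R -> R) : {for r, continuous g} -> {for (t, r), continuous (fun z : R * R => g z.2)}.
  by move=> gr; exact: (cvg_comp snd g (@cvg_snd _ _ _ _ _) gr).
by split; apply: C => //; exact: is_derive_continuous a.
Qed.

Lemma C1_radial phi dphi u ut ur : radial phi dphi -> C1 u ut ur ->
  C1 (fun t r => phi r * u t r) (fun t r => phi r * ut t r)
     (fun t r => dphi r * u t r + phi r * ur t r).
Proof.
move=> H K t r hr; have [[a b c d e] [a' b']] := (K t r hr, H r hr).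
have [p1 p2] := radial_cont t H hr.
split; [exact: derive1_scale|exact: derive1_mul|exact: cvgM|exact: cvgM|].
by apply: cvgD; exact: cvgM.
Qed.

Lemma C1_sphere u : smooth M u ->
  C1 (sphere_int u) (sphere_int (partial i0 u)) (sphere_int (partial i1 u)).
Proof.
move=> su t r hr; have [a b] := sphere_int_is_derive t su hr.
split; [exact: a|exact: b|exact: (@sphere_int_cont R M u t r su hr)|exact: (@sphere_int_cont R M _ t r (smooth_partial i0 su) hr)|].
exact: (@sphere_int_cont R M _ t r (smooth_partial i1 su) hr).
Qed.

Lemma sphere_dx u t r : smooth M u -> 2 * M < r ->
  sphere_int (dstar M u) t r = lapse2 M r * sphere_int (partial i1 u) t r.
Proof. by move=> su hr; exact: (sphere_intZ (lapse2 M) t (smooth_partial i1 su) hr). Qed.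

(** With x the tortoise coordinate, the current of the vector field A d/dx is
    corrected by the weight q in front of the work of the one-forms and by h in
    front of their norm; h is such that dq/dx + 2hV = 0, which removes the
    indefinite cross term.  A changes sign at the photon sphere r = 3M. *)
Definition wA r := 5 * (1 - 3 * (M / r)).
Definition kappa (y : R) := 45 / 2 * (1 - 2 * y) * y ^+ 3 * (2 - 3 * y).
Definition wq r := kappa (M / r) / M.
Definition wh r := 45 / 4 * (M / r) ^+ 2 * (6 - 28 * (M / r) + 30 * (M / r) ^+ 2).

Definition dwA r := 15 * (M / r) ^+ 2 / M.
Definition dwq r := - (2 * wh r * ((M / r) ^+ 2 / M ^+ 2)).
Definition dwh r := (45 / 4 * (12 * (M / r) - 84 * (M / r) ^+ 2 + 120 * (M / r) ^+ 3)) * (- (M / r) ^+ 2 / M).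
Definition dpotV r := (2 * (M / r) - 6 * (M / r) ^+ 2) / M ^+ 2 * (- (M / r) ^+ 2 / M).

Lemma radial_eq phi dphi phi' dphi' : radial phi dphi ->
  (forall r, 2 * M < r -> phi r = phi' r) -> (forall r, 2 * M < r -> dphi r = dphi' r) ->
  radial phi' dphi'.
Proof.
move=> H E E' r hr; have [a b] := H r hr.
have N := near_r hr.
have N1 : {near r, phi =1 phi'} by apply: filterS N => x; exact: E.
split; last first.
  by rewrite /prop_for /continuous_at -E'//; apply: cvg_trans b; apply: near_eq_cvg; apply: filterS N => x; exact: E'.
rewrite -E'//; case: a => d D; split; first exact: near_eq_derivable N1 d.
by rewrite -D; apply/esym/near_eq_derive.
Qed.

Lemma radial_pow n : radial (fun r => (M / r) ^+ n.+1) (fun r => n.+1%:R * (M / r) ^+ n * (- (M / r) ^+ 2 / M)).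
Proof.
elim: n => [|n IH].
  by apply: radial_eq radial_y _ _ => r _; rewrite ?expr1// expr0 !mulr1 mul1r expr2.
apply: radial_eq (radialM radial_y IH) _ _ => r _; first by rewrite -exprS.
rewrite [in RHS]exprS -[n.+2]addn1 natrD; move: (M / r) => y.
by rewrite [y ^+ n.+1]exprS; ring.
Qed.

Lemma radial_wA : radial wA dwA.
Proof.
apply: radial_eq (radialD (radial_cst 5) (radialZ (- 15) (radial_pow 0))) _ _ => r _;
  rewrite /wA /dwA; move: (M / r) (M^-1) => y m; ring.
Qed.

Lemma radial_wq : radial wq dwq.
Proof.
apply: radial_eq (radialZ (45 / 2 / M) (radialD (radialZ 2 (radial_pow 2))
  (radialD (radialZ (- 7) (radial_pow 3)) (radialZ 6 (radial_pow 4))))) _ _ => r _.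
  by rewrite /wq /kappa; move: (M / r) (M^-1) => y m; field.
rewrite /dwq /wh; have m0 := lt0r_neq0 hM; move: (M / r) => y; move: M m0 => m m0.
by field.
Qed.

Lemma radial_wh : radial wh dwh.
Proof.
apply: radial_eq (radialZ (45 / 4) (radialD (radialZ 6 (radial_pow 1))
  (radialD (radialZ (- 28) (radial_pow 2)) (radialZ 30 (radial_pow 3))))) _ _ => r _;
  by rewrite /wh /dwh; move: (M / r) (M^-1) => y m; field.
Qed.

Lemma potVE r : 2 * M < r -> potV M r = (1 - 2 * (M / r)) * (M / r) ^+ 2 / M ^+ 2.
Proof.
move=> hr; have r0 := r_neq0 hr; have m0 := lt0r_neq0 hM.
by rewrite /potV /lapse2; move: M m0 {hr} => m m0; field; rewrite r0 m0.
Qed.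

Lemma radial_potV : radial (potV M) dpotV.
Proof.
apply: radial_eq (radialZ (M ^- 2) (radialD (radial_pow 1) (radialZ (- 2) (radial_pow 2)))) _ _ => r hr.
  by rewrite potVE//; move: (M / r) (M ^- 2) => y m; ring.
by rewrite /dpotV; move: (M / r) (M ^- 2) (M^-1) => y m m'; ring.
Qed.

End Orbit.

(** ** Positivity of the bulk term and control of the boundary terms *)

Section Inequalities.
Variable R : realFieldType.
Implicit Types y : R.

(** The cubic is (13/2)(1 - 3y)^2 plus half of the amount by which the coefficient
    of w in [bulk_algebra] exceeds 2/25. *)
Lemma multiplier_cubic y : 0 <= y <= 2^-1 -> 0 <= 323 / 50 - 213 / 2 * y + 531 * y ^+ 2 - 675 * y ^+ 3 :> R.
Proof.
move=> /andP[y0 y1].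
(* 27/200 is close to the minimum of the cubic on the interval. *)
have h : 0 <= (y - 27 / 200) ^+ 2 * (1395 / 4 - 675 * y).
  by apply: mulr_ge0; [exact: sqr_ge0|lra].
by move: h; lra.
Qed.

(** The coefficient of w may be negative; w is then absorbed by the kinetic
    terms through the Poincare inequality. *)
Lemma bulk_algebra y tt xx ang w : 0 <= y <= 2^-1 -> 0 <= tt -> 0 <= xx -> 0 <= ang ->
  0 <= w -> 2 * w <= tt + xx ->
  (1 - 3 * y) ^+ 2 * tt + xx + (1 - 3 * y) ^+ 2 * ang + 2 / 25 * w <=
  15 / 2 * (1 - 3 * y) ^+ 2 * tt + (15 / 2 + 45 * y - 135 / 2 * y ^+ 2) * xx
  + (5 - 15 / 2 * y * (1 - 2 * y)) * (1 - 3 * y) ^+ 2 * ang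
  - 135 * y * (1 - 2 * y) * (1 - 5 * y) * w.
Proof.
move=> yI tt0 xx0 ang0 w0 wle; have c := multiplier_cubic yI.
have /andP[y0 y1] := yI.
have y2 : 0 <= y * (1 - 2 * y) by apply: mulr_ge0; lra.
have y3 : 0 <= y * (2 - 3 * y) by apply: mulr_ge0; lra.
have sq : 0 <= (1 - 3 * y) ^+ 2 by exact: sqr_ge0.
have y4 : y * (1 - 2 * y) <= 8^-1.
  have -> : y * (1 - 2 * y) = 8^-1 - 2 * (y - 4^-1) ^+ 2 by field.
  by rewrite lerBlDr lerDl mulr_ge0// sqr_ge0.
pose eta := - 135 * y * (1 - 2 * y) * (1 - 5 * y) - 2 / 25.
pose ct := 13 / 2 * (1 - 3 * y) ^+ 2.
pose cx := 13 / 2 + 45 * y - 135 / 2 * y ^+ 2.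
have ctx : ct <= cx.
  rewrite /ct /cx -subr_ge0.
  have -> : 13 / 2 + 45 * y - 135 / 2 * y ^+ 2 - 13 / 2 * (1 - 3 * y) ^+ 2 = 42 * (y * (2 - 3 * y)) by field.
  by rewrite mulr_ge0.
have cte : 0 <= ct + eta / 2.
  apply: le_trans c _; rewrite le_eqVlt; apply/orP; left; apply/eqP.
  by rewrite /ct /eta; field.
have ang1 : 0 <= (4 - 15 / 2 * y * (1 - 2 * y)) * ((1 - 3 * y) ^+ 2 * ang).
  by apply: mulr_ge0; [move: y4; lra|exact: mulr_ge0].
have ct0 : 0 <= ct by rewrite /ct mulr_ge0.
have K : 0 <= ct * tt + cx * xx + eta * w.
  have [e0|e0] := leP 0 eta.
    by rewrite !addr_ge0// mulr_ge0// (le_trans ct0).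
  have h1 : 0 <= (- eta) * (tt + xx - 2 * w) by apply: mulr_ge0; [lra|lra].
  have h2 : 0 <= (ct + eta / 2) * (tt + xx) by apply: mulr_ge0 => //; exact: addr_ge0.
  have h3 : 0 <= (cx - ct) * xx by apply: mulr_ge0 => //; rewrite subr_ge0.
  have -> : ct * tt + cx * xx + eta * w =
    (ct + eta / 2) * (tt + xx) + (- eta) * (tt + xx - 2 * w) / 2 + (cx - ct) * xx by field.
  by rewrite !addr_ge0// mulr_ge0// invr_ge0.
rewrite -subr_ge0.
rewrite (_ : _ - _ = ct * tt + cx * xx + eta * w + (4 - 15 / 2 * y * (1 - 2 * y)) * ((1 - 3 * y) ^+ 2 * ang)).
  exact: addr_ge0.
by rewrite /ct /cx /eta; field.
Qed.

Definition polyA y : R := 5 * (1 - 3 * y).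
Definition polyh y : R := 45 / 4 * y ^+ 2 * (6 - 28 * y + 30 * y ^+ 2).
(** q^2/V as a polynomial in y. *)
Definition polyq2V y : R := (45 / 2) ^+ 2 * (1 - 2 * y) * y ^+ 4 * (2 - 3 * y) ^+ 2.

Lemma multiplier_bounds y : 0 <= y <= 2^-1 ->
  [/\ `|polyA y| <= 5, `|polyA y| + `|polyh y| <= 5, 0 <= polyq2V y & polyq2V y <= 11 / 5].
Proof.
move=> /andP[y0 y1].
have hE : polyh y = 135 / 2 * y ^+ 2 * ((1 - 3 * y) * (1 - 5 / 3 * y)) by rewrite /polyh; field.
have sq : 0 <= y ^+ 2 by exact: sqr_ge0.
split.
- by rewrite ler_norml /polyA; apply/andP; split; lra.
- have [y3|y3] := leP y (3^-1).
    have A0 : 0 <= polyA y by rewrite /polyA; lra.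
    have h0 : 0 <= polyh y by rewrite hE !mulr_ge0//; lra.
    rewrite (ger0_norm A0) (ger0_norm h0) /polyA hE.
    have h1 : 0 <= (1 - 3 * y) * y by apply: mulr_ge0; lra.
    have h2 : (1 - 3 * y) * y <= 12^-1.
      have -> : (1 - 3 * y) * y = 12^-1 - 3 * (y - 6^-1) ^+ 2 by field.
      by rewrite lerBlDr lerDl mulr_ge0// sqr_ge0.
    have h3 : (1 - 3 * y) * y * (1 - 5 / 3 * y) <= 12^-1 * 1 by apply: ler_pM => //; lra.
    have h4 : y * ((1 - 3 * y) * y * (1 - 5 / 3 * y)) <= y * (12^-1 * 1) by exact: ler_wpM2l.
    have -> : 135 / 2 * y ^+ 2 * ((1 - 3 * y) * (1 - 5 / 3 * y)) =
      135 / 2 * (y * ((1 - 3 * y) * y * (1 - 5 / 3 * y))) by ring.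
    by move: h4; lra.
  have A0 : polyA y <= 0 by rewrite /polyA; lra.
  have k0 : 0 <= (3 * y - 1) * (1 - 5 / 3 * y) by apply: mulr_ge0; lra.
  have h0 : polyh y <= 0.
    rewrite hE -oppr_ge0 -mulrN -mulNr opprB mulr_ge0//; lra.
  rewrite (ler0_norm A0) (ler0_norm h0) /polyA hE.
  have k1 : (3 * y - 1) * (1 - 5 / 3 * y) <= 4 / 45.
    have -> : (3 * y - 1) * (1 - 5 / 3 * y) = 4 / 45 - 5 * (y - 7 / 15) ^+ 2 by field.
    by rewrite lerBlDr lerDl mulr_ge0// sqr_ge0.
  have k2 : y ^+ 2 <= 2^-1 * 2^-1 by rewrite expr2; apply: ler_pM.
  have k3 : y ^+ 2 * ((3 * y - 1) * (1 - 5 / 3 * y)) <= 2^-1 * 2^-1 * (4 / 45) by apply: ler_pM.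
  have -> : - (135 / 2 * y ^+ 2 * ((1 - 3 * y) * (1 - 5 / 3 * y))) =
      135 / 2 * (y ^+ 2 * ((3 * y - 1) * (1 - 5 / 3 * y))) by ring.
  by move: k3; lra.
- by rewrite /polyq2V !mulr_ge0 ?exprn_ge0//; lra.
- have a1 : 0 <= y * (2 - 3 * y) <= 3^-1.
    apply/andP; split; first by apply: mulr_ge0; lra.
    have -> : y * (2 - 3 * y) = 3^-1 - 3 * (y - 3^-1) ^+ 2 by field.
    by rewrite lerBlDr lerDl mulr_ge0// sqr_ge0.
  have a2 : 0 <= y ^+ 2 * (1 - 2 * y) <= 27^-1.
    apply/andP; split; first by apply: mulr_ge0 => //; lra.
    have -> : y ^+ 2 * (1 - 2 * y) = 27^-1 - (y - 3^-1) ^+ 2 * (2 * y + 3^-1) by field.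
    by rewrite lerBlDr lerDl mulr_ge0 ?sqr_ge0//; lra.
  have -> : polyq2V y = (45 / 2) ^+ 2 * ((y ^+ 2 * (1 - 2 * y)) * ((y * (2 - 3 * y)) * (y * (2 - 3 * y)))).
    by rewrite /polyq2V; ring.
  move: a1 a2; move: (y * (2 - 3 * y)) (y ^+ 2 * (1 - 2 * y)) => u v /andP[u0 u1] /andP[v0 v1].
  have uu : u * u <= 3^-1 * 3^-1 by exact: ler_pM.
  have uv : v * (u * u) <= 27^-1 * (3^-1 * 3^-1) by apply: ler_pM => //; exact: mulr_ge0.
  by move: uv; lra.
Qed.

End Inequalities.

Section BoundaryAlgebra.
Variable R : realFieldType.

(** 36/5 = 5 + 11/5, where 5 bounds |A| + |h| and 11/5 bounds the factor q^2/V from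
    Young's inequality for the work term. G is half the kinetic
    part and D half the angular part of e + p or e - p; W is the norm of the
    one-forms, bounded by G through the Poincare inequality. *)
Lemma boundary_algebra (A h c G D W X : R) : `|A| <= 5 -> `|A| + `|h| <= 5 ->
  0 <= c -> c <= 11 / 5 -> 0 <= G -> 0 <= D -> 0 <= W -> W <= G -> `|X| <= D + c * G ->
  `|A * (G - D) + h * W| + `|X| <= 36 / 5 * (G + D).
Proof.
move=> A5 Ah c0 c1 G0 D0 W0 WG XB.
have h1 : `|A * (G - D)| <= `|A| * (G + D).
  rewrite normrM ler_wpM2l// (le_trans (ler_normB _ _))//.
  by rewrite (ger0_norm G0) (ger0_norm D0).
have h2 : `|h * W| <= `|h| * G by rewrite normrM (ger0_norm W0) ler_wpM2l.
have h3 := ler_normD (A * (G - D)) (h * W).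
have h4 : 0 <= (5 - (`|A| + `|h|)) * G by apply: mulr_ge0 => //; rewrite subr_ge0.
have h5 : 0 <= (5 - `|A|) * D by apply: mulr_ge0 => //; rewrite subr_ge0.
have h6 : 0 <= (11 / 5 - c) * G by apply: mulr_ge0 => //; rewrite subr_ge0.
move: h1 h2 h3 h4 h5 h6 XB; move: `|A * (G - D)| `|h * W| `|A * (G - D) + h * W| `|X|.
by move: `|A| `|h| => u v x1 x2 x3 x4; nra.
Qed.

Lemma young (c V x2 x3 u v : R) : 0 < V ->
  - (V * (x2 * x2 + x3 * x3) + c * c / V * (u * u + v * v)) <= 2 * c * (x2 * u + x3 * v) <=
  V * (x2 * x2 + x3 * x3) + c * c / V * (u * u + v * v).
Proof.
move=> V0; have Vn := lt0r_neq0 V0.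
have S (s : R) : s * s = 1 -> 0 <= V * (x2 * x2 + x3 * x3) + c * c / V * (u * u + v * v) + s * (2 * c * (x2 * u + x3 * v)).
  move=> ss.
  have -> : V * (x2 * x2 + x3 * x3) + c * c / V * (u * u + v * v) + s * (2 * c * (x2 * u + x3 * v)) =
     V * ((x2 + s * c / V * u) ^+ 2 + (x3 + s * c / V * v) ^+ 2)
     + (1 - s * s) * (c * c / V * (u * u + v * v)) by field.
  rewrite ss subrr mul0r addr0; apply: mulr_ge0; first exact: ltW.
  by apply: addr_ge0; exact: sqr_ge0.
have := S 1 (mulr1 1); have := S (-1) _; rewrite mulrNN mulr1 => /(_ erefl).
rewrite mulN1r mul1r => h1 h2; apply/andP; split; first by rewrite lerNl -subr_ge0 opprK addrC addrC.
by rewrite -subr_ge0.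
Qed.

End BoundaryAlgebra.


(** * The currents of a Maxwell field *)

Section CurrentAlgebra.
Variable R : realFieldType.
Implicit Types a b c d s co sg V : R.

Lemma norm_algebra a b c d ax bx cx dx a0 b0 c0 d0 V E2 E3 B2 B3 :
  c0 - ax = - V * E2 -> d0 - bx = - V * E3 -> - b0 - - dx = - V * B2 -> a0 - cx = - V * B3 ->
  a * ax + ax * a + (b * bx + bx * b) + (c * cx + cx * c + (d * dx + dx * d))
  - 2 * (a * c0 + a0 * c + (b * d0 + b0 * d)) =
  2 * V * (E2 * a + E3 * b + (B2 * - d + B3 * c)).
Proof.
move=> e1 e2 e3 e4.
transitivity (- 2 * (a * (c0 - ax) + b * (d0 - bx) + d * - (- b0 - - dx) + c * (a0 - cx))); first by ring.
by rewrite e1 e2 e3 e4; ring.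
Qed.

Lemma normsg_algebra sg a b c d : sg * sg = 1 ->
  (c + sg * a) * (c + sg * a) + (d + sg * b) * (d + sg * b) =
  a * a + b * b + (c * c + d * d) + sg * (2 * (a * c + b * d)).
Proof.
move=> s1; transitivity (sg * sg * (a * a + b * b) + (c * c + d * d) + sg * (2 * (a * c + b * d))); first by ring.
by rewrite s1 mul1r.
Qed.

Lemma dual_algebra sg a b c d : sg * sg = 1 ->
  (- b + sg * - d) * (- b + sg * - d) + (a + sg * c) * (a + sg * c) =
  (c + sg * a) * (c + sg * a) + (d + sg * b) * (d + sg * b).
Proof.
move=> s1; rewrite normsg_algebra//.
transitivity (a * a + b * b + sg * sg * (c * c + d * d) + sg * (2 * (a * c + b * d))); first by ring.
by rewrite s1 mul1r.
Qed.

Lemma kinsg_algebra sg e0 b0 ex bx : sg * sg = 1 ->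
  - (e0 + sg * ex) * - (e0 + sg * ex) + (bx + sg * b0) * (bx + sg * b0) =
  e0 * e0 + ex * ex + (b0 * b0 + bx * bx) + 2 * sg * (e0 * ex + b0 * bx).
Proof.
move=> s1; transitivity (e0 * e0 + sg * sg * (ex * ex + b0 * b0) + bx * bx + 2 * sg * (e0 * ex + b0 * bx)); first by ring.
by rewrite s1; ring.
Qed.

Lemma div_algebra s co sg e0 ex c2 c d3 a2 a b3 b :
  s * e0 = - (s * c2 + co * c + d3) -> s * ex = - (s * a2 + co * a + b3) ->
  s * - (e0 + sg * ex) =
  s * (c2 + (sg * a2 + 0 * a)) + co * (c + sg * a) + (d3 + (sg * b3 + 0 * b)).
Proof.
move=> h1 h2; transitivity (- (s * e0) - sg * (s * ex)); first by ring.
by rewrite h1 h2; ring.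
Qed.

Lemma curl_algebra s co sg b0 bx d2 d c3 b2 b a3 a :
  s * b0 = s * b2 + co * b - a3 -> s * bx = s * d2 + co * d - c3 ->
  s * (bx + sg * b0) =
  s * (d2 + (sg * b2 + 0 * b)) + co * (d + sg * b) - (c3 + (sg * a3 + 0 * a)).
Proof.
move=> h1 h2; transitivity (s * bx + sg * (s * b0)); first by ring.
by rewrite h1 h2; ring.
Qed.
Lemma conserved_algebra x1 x2 x3 x4 x5 x6 f V :
  x1 + V * x2 = 2 * (f * x3) -> x4 + V * x5 = 2 * (f * x6) ->
  2^-1 * (x1 + x4) + 2^-1 * V * (x2 + x5) = f * (x3 + x6).
Proof.
move=> h1 h2; transitivity (2^-1 * (x1 + V * x2 + (x4 + V * x5))); first by ring.
by rewrite h1 h2; field.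
Qed.

(** The four balance laws combined; the cross term wx drops out because of the
    equation between q and h. *)
Lemma divergence_algebra f V A dA q dq h dh dV kin kinr ang angr wx wxr wtt nrm nrmr dott flt tt xx :
  f * kinr - V * (f * angr) = 2 * flt -> f * wxr - wtt = V * ang + xx - tt ->
  f * nrmr - dott = 2 * V * wx -> f * dq = - 2 * h * V ->
  f * (2^-1 * dA * kin + 2^-1 * A * kinr + (((- 2^-1 * dA) * V + (- 2^-1 * A) * dV) * ang + (- 2^-1 * A) * V * angr)
    + (dq * wx + q * wxr) + (dh * nrm + h * nrmr)) - (A * flt + q * wtt + h * dott) =
  f * (2^-1 * dA * kin - 2^-1 * (dA * V + A * dV) * ang + dh * nrm) + q * (V * ang + xx - tt).
Proof.
move=> e1 e2 e3 e4.
transitivity (2^-1 * A * (f * kinr - V * (f * angr)) - A * flt + q * (f * wxr - wtt) + h * (f * nrmr - dott)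
  + f * dq * wx + f * (2^-1 * dA * kin - 2^-1 * (dA * V + A * dV) * ang + dh * nrm)); first by ring.
by rewrite e1 e2 e3 e4; field.
Qed.

Lemma sum_algebra f V x1 x2 x3 x4 x5 x6 :
  f * x1 - V * (f * x2) = 2 * x3 -> f * x4 - V * (f * x5) = 2 * x6 ->
  f * (x1 + x4) - V * (f * (x2 + x5)) = 2 * (x3 + x6).
Proof.
move=> h1 h2; transitivity (f * x1 - V * (f * x2) + (f * x4 - V * (f * x5))); first by ring.
by rewrite h1 h2; ring.
Qed.

Lemma virial_sum_algebra f V x1 x2 x3 x4 x5 y1 y2 y3 y4 y5 :
  f * x1 - x2 = V * x3 + x4 - x5 -> f * y1 - y2 = V * y3 + y4 - y5 ->
  f * (x1 + y1) - (x2 + y2) = V * (x3 + y3) + (x4 + y4) - (x5 + y5).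
Proof.
move=> h1 h2; transitivity (f * x1 - x2 + (f * y1 - y2)); first by ring.
by rewrite h1 h2; ring.
Qed.

Lemma norm_double (q x c : R) : `|2 * q * x| <= c -> 2 * `|q * x| <= c.
Proof. by rewrite -mulrA [`|2 * _|]normrM (ger0_norm (ler0n R 2)). Qed.

Lemma half_ge0 (n k : R) : 0 <= n -> 2 * n <= k -> 0 <= 2^-1 * k /\ n <= 2^-1 * k.
Proof. by move=> *; split; lra. Qed.

Lemma dwq_algebra (y h m : R) : (1 - 2 * y) * - (2 * h * (y ^+ 2 * m)) = - 2 * h * ((1 - 2 * y) * y ^+ 2 * m).
Proof. ring. Qed.

Lemma young_algebra (x V D c n G : R) : 2 * x <= V * D + c * (2 * n) -> c * n <= c * G ->
  x <= 2^-1 * V * D + c * G.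
Proof. by rewrite -(mulrA 2^-1); move: (V * D) => v; lra. Qed.

Lemma bulk_ge0 (y tt xx ang n : R) : 0 <= tt -> 0 <= xx -> 0 <= ang -> 0 <= n ->
  0 <= (1 - 3 * y) ^+ 2 * tt + xx + (1 - 3 * y) ^+ 2 * ang + 2 / 25 * n.
Proof. by move=> *; rewrite !addr_ge0// mulr_ge0// ?sqr_ge0// divr_ge0. Qed.

Lemma dominated_plus A h q V K L X N W J D (C := 36 / 5) :
  `|A * (2^-1 * (K + 2 * 1 * L) - 2^-1 * V * D) + h * (N + 1 * J)| + `|q * (X + 1 * W)| <=
    C * (2^-1 * (K + 2 * 1 * L) + 2^-1 * V * D) ->
  `|A * L + q * X + h * J + (2^-1 * A * K + (- 2^-1 * A) * V * D + q * W + h * N)| <=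
    C * (2^-1 * K + 2^-1 * V * D + L).
Proof.
move=> H.
have -> : 2^-1 * K + 2^-1 * V * D + L = 2^-1 * (K + 2 * 1 * L) + 2^-1 * V * D by field.
apply: le_trans H; apply: le_trans (ler_normD _ _); rewrite le_eqVlt; apply/orP; left; apply/eqP.
by congr (`|_|); field.
Qed.

Lemma dominated_minus A h q V K L X N W J D (C := 36 / 5) :
  `|A * (2^-1 * (K + 2 * -1 * L) - 2^-1 * V * D) + h * (N + -1 * J)| + `|q * (X + -1 * W)| <=
    C * (2^-1 * (K + 2 * -1 * L) + 2^-1 * V * D) ->
  `|A * L + q * X + h * J - (2^-1 * A * K + (- 2^-1 * A) * V * D + q * W + h * N)| <=
    C * (2^-1 * K + 2^-1 * V * D - L).
Proof.
move=> H.
have -> : 2^-1 * K + 2^-1 * V * D - L = 2^-1 * (K + 2 * -1 * L) + 2^-1 * V * D by field.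
apply: le_trans H; apply: le_trans (ler_normB _ _); rewrite distrC le_eqVlt; apply/orP; left; apply/eqP.
by congr (`|_|); field.
Qed.

Lemma bulk_coefficients (y M tt xx ang nrm : R) : M != 0 ->
  (1 - 2 * y) * (2^-1 * (15 * y ^+ 2 / M) * (tt + xx)
    - 2^-1 * (15 * y ^+ 2 / M * ((1 - 2 * y) * y ^+ 2 / M ^+ 2)
      + 5 * (1 - 3 * y) * ((2 * y - 6 * y ^+ 2) / M ^+ 2 * (- y ^+ 2 / M))) * ang
    + 45 / 4 * (12 * y - 84 * y ^+ 2 + 120 * y ^+ 3) * (- y ^+ 2 / M) * nrm)
  + 45 / 2 * (1 - 2 * y) * y ^+ 3 * (2 - 3 * y) / M * ((1 - 2 * y) * y ^+ 2 / M ^+ 2 * ang + xx - tt) =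
  (1 - 2 * y) * y ^+ 2 / M * (15 / 2 * (1 - 3 * y) ^+ 2 * tt + (15 / 2 + 45 * y - 135 / 2 * y ^+ 2) * xx
  + (5 - 15 / 2 * y * (1 - 2 * y)) * (1 - 3 * y) ^+ 2 * (y / M ^+ 2 * ang)
  - 135 * y * (1 - 2 * y) * (1 - 5 * y) * nrm).
Proof. by move=> m0; field. Qed.
End CurrentAlgebra.

Section Currents.
Variables (R : realType) (M : R).
Hypothesis hM : 0 < M.

Lemma work_bound (u2 u3 F1 F2 : 'rV[R]_4 -> R) (c V t r : R) : 0 < V -> 2 * M < r ->
  smooth M u2 -> smooth M u3 -> smooth M F1 -> smooth M F2 ->
  `|2 * c * sphere_int (fun q => u2 q * F1 q + u3 q * F2 q) t r| <=
  V * sphere_int (fun q => u2 q * u2 q + u3 q * u3 q) t r +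
  c * c / V * sphere_int (fun q => F1 q * F1 q + F2 q * F2 q) t r.
Proof.
move=> V0 hr s2 s3 s1' s2'.
have sA := smoothD (smoothM s2 s2) (smoothM s3 s3).
have sF := smoothD (smoothM s1' s1') (smoothM s2' s2').
have sW := smoothD (smoothM s2 s1') (smoothM s3 s2').
have K x u : smooth M u -> sphere_int (fun q => x * u q) t r = x * sphere_int u t r.
  by move=> su; exact: (sphere_intZ (fun=> x) t su hr).
have sVA := smoothM (smooth_cst M V) sA; have scF := smoothM (smooth_cst M (c * c / V)) sF.
have sR := smoothD sVA scF; have sL := smoothM (smooth_cst M (2 * c)) sW.
rewrite -(K V _ sA) -(K (c * c / V) _ sF) -(K (2 * c) _ sW).
rewrite -(sphere_intD t sVA scF hr) ler_norml; apply/andP; split.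
  rewrite -mulN1r -(K (-1) _ sR).
  apply: (le_sphere_int (smoothM (smooth_cst M (-1)) sR) sL hr) => p _ _.
  by rewrite mulN1r; have /andP[] := young c (u2 p) (u3 p) (F1 p) (F2 p) V0.
apply: (le_sphere_int sL sR hr) => p _ _.
by have /andP[] := young c (u2 p) (u3 p) (F1 p) (F2 p) V0.
Qed.

(** What remains of the field equations on the orbit space: a conserved energy
    current (e, p) and a current (j, k) dominated by it, whose divergence
    dominates the density T. *)
Definition morawetz_currents (e p T : R -> R -> R) :=
  exists et er pt pr j jt jr k kt kr : R -> R -> R,
  [/\ C1 M e et er, C1 M p pt pr, C1 M j jt jr & C1 M k kt kr] /\
  (forall t r, 2 * M < r -> {for (t, r), continuous (fun z : R * R => T z.1 z.2)}) /\
  forall t r, 2 * M < r ->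
  [/\ et t r = lapse2 M r * pr t r, 0 <= T t r,
      T t r <= lapse2 M r * kr t r - jt t r,
      `|j t r + k t r| <= 36 / 5 * (e t r + p t r) &
      `|j t r - k t r| <= 36 / 5 * (e t r - p t r)].

Variables (F : tensor2 R) (E B a b c d : 'rV[R]_4 -> R).
Hypothesis Fc : frame_comps M F E B a b c d.
Hypothesis ckF : forall n, [/\ ck (chart M) n E, ck (chart M) n B,
  ck (chart M) n a /\ ck (chart M) n b & ck (chart M) n c /\ ck (chart M) n d].
Hypothesis mF : maxwell M F.
Hypothesis perF : [/\ periodic E, periodic B, periodic a /\ periodic b & periodic c /\ periodic d].

Let sysE := electric_system hM Fc ckF mF perF.
Let sysB := magnetic_system hM Fc ckF mF perF.
Local Notation E3 := (angular_E M b d).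
Local Notation B3 := (angular_B M a c).
Local Notation smooth := (smooth M).
Local Notation dx := (dstar M).

Let sE : smooth E. Proof. by move=> n; case: (ckF n). Qed.
Let sB : smooth B. Proof. by move=> n; case: (ckF n). Qed.
Let sa : smooth a. Proof. by move=> n; case: (ckF n) => _ _ []. Qed.
Let sb : smooth b. Proof. by move=> n; case: (ckF n) => _ _ []. Qed.
Let sc : smooth c. Proof. by move=> n; case: (ckF n) => _ _ _ []. Qed.
Let sd : smooth d. Proof. by move=> n; case: (ckF n) => _ _ _ []. Qed.

Definition norm2 (q : 'rV[R]_4) := a q * a q + b q * b q + (c q * c q + d q * d q).
Definition dot2 (q : 'rV[R]_4) := 2 * (a q * c q + b q * d q).

Let sn : smooth norm2.
Proof. exact: (smoothD (smoothD (smoothM sa sa) (smoothM sb sb)) (smoothD (smoothM sc sc) (smoothM sd sd))). Qed.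
Let sdot : smooth dot2.
Proof. exact: (smoothM (smooth_cst M 2) (smoothD (smoothM sa sc) (smoothM sb sd))). Qed.

Let pdN2 k u p : smooth u -> spherical M p -> partial k (fun q => - u q) p = - partial k u p.
Proof. by move=> su sp; apply: pdN => //; exact: spherical_chart. Qed.

(** The equations for X and Y that are missing from one system are found in the
    other one. *)
Let norm_pointwise p : spherical M p -> dx norm2 p - partial i0 dot2 p =
  2 * potV M (p 0 i1) * (work_x E E3 a b p + work_x B B3 (fun q => - d q) c p).
Proof.
move=> sp; have cp := spherical_chart sp.
have [_ _ e1 e2 _] := sysE.2.2 p sp; have [_ _ e3' e4 _] := sysB.2.2 p sp.
have e3 : - partial i0 b p - - dx d p = - potV M (p 0 i1) * partial i2 B p.
  by rewrite -e3' (pdN2 i0 sb sp) /dstar (pdN2 i1 sd sp) mulrN.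
rewrite /norm2 (dxD (smoothD (smoothM sa sa) (smoothM sb sb)) (smoothD (smoothM sc sc) (smoothM sd sd)) cp).
rewrite (dxD (smoothM sa sa) (smoothM sb sb) cp) (dxD (smoothM sc sc) (smoothM sd sd) cp).
rewrite (dxM sa sa cp) (dxM sb sb cp) (dxM sc sc cp) (dxM sd sd cp).
rewrite /dot2 (pdM i0 (smooth_cst M 2) (smoothD (smoothM sa sc) (smoothM sb sd)) cp) partial_cst mul0r addr0.
rewrite (pdD i0 (smoothM sa sc) (smoothM sb sd) cp) (pdM i0 sa sc cp) (pdM i0 sb sd cp) /work_x.
exact: norm_algebra e1 e2 e3 e4.
Qed.

Lemma norm_balance t r : 2 * M < r ->
  sphere_int (dx norm2) t r - sphere_int (partial i0 dot2) t r =
  2 * potV M r * (sphere_int (work_x E E3 a b) t r + sphere_int (work_x B B3 (fun q => - d q) c) t r).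
Proof.
move=> hr; have sx := smooth_dx hM sn; have s0 := smooth_partial i0 sdot.
have w1 := smooth_work_x sysE; have w2 := smooth_work_x sysB.
have w12 := smoothD w1 w2.
have sV : smooth (fun q => 2 * potV M (q 0 i1)) := smoothM (smooth_cst M 2) (smooth_potV hM).
rewrite -(sphere_intB t sx s0 hr) -(sphere_intD t w1 w2 hr).
rewrite -(sphere_intZ (fun r => 2 * potV M r) t w12 hr).
apply: (eq_sphere_int t (smoothB sx s0) (smoothM sV w12) hr) => p sp.
by rewrite norm_pointwise.
Qed.

(** *** The sphere integrals of the two potentials together *)

Definition Kin t r := sphere_int (kinetic M E) t r + sphere_int (kinetic M B) t r.
Definition Ang t r := sphere_int (angular E E3) t r + sphere_int (angular B B3) t r.
Definition Flux t r := sphere_int (flux M E) t r + sphere_int (flux M B) t r.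
Definition Wt t r := sphere_int (work_t E E3 c d) t r + sphere_int (work_t B B3 (fun q => - b q) a) t r.
Definition Wx t r := sphere_int (work_x E E3 a b) t r + sphere_int (work_x B B3 (fun q => - d q) c) t r.
Definition TT t r := sphere_int (fun q => partial i0 E q * partial i0 E q) t r +
  sphere_int (fun q => partial i0 B q * partial i0 B q) t r.
Definition XX t r := sphere_int (fun q => dx E q * dx E q) t r + sphere_int (fun q => dx B q * dx B q) t r.
Definition Norm t r := sphere_int norm2 t r.
Definition Dot t r := sphere_int dot2 t r.

Let sph u (su : smooth u) := C1_sphere su.
Let C_kin := C1D (sph (smooth_kinetic hM sysE)) (sph (smooth_kinetic hM sysB)).
Let C_ang := C1D (sph (smooth_angular sysE)) (sph (smooth_angular sysB)).
Let C_flux := C1D (sph (smooth_flux hM sysE)) (sph (smooth_flux hM sysB)).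
Let C_wt := C1D (sph (smooth_work_t sysE)) (sph (smooth_work_t sysB)).
Let C_wx := C1D (sph (smooth_work_x sysE)) (sph (smooth_work_x sysB)).
Let C_norm := sph sn.
Let C_dot := sph sdot.
Let st (u : 'rV[R]_4 -> R) (su : smooth u) := smoothM (smooth_partial i0 su) (smooth_partial i0 su).
Let sx (u : 'rV[R]_4 -> R) (su : smooth u) := smoothM (smooth_dx hM su) (smooth_dx hM su).
Let C_TT := C1D (sph (st sE)) (sph (st sB)).
Let C_XX := C1D (sph (sx sE)) (sph (sx sB)).

Let KinE t r : 2 * M < r -> Kin t r = TT t r + XX t r.
Proof.
move=> hr; rewrite /Kin /TT /XX /kinetic.
rewrite (sphere_intD t (st sE) (sx sE) hr) (sphere_intD t (st sB) (sx sB) hr).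
exact: addrACA.
Qed.

Let sq_ge0 u t r : 0 <= sphere_int (fun q => u q * u q) t r :> R.
Proof.
apply: SI_ge0 => th ph thI; apply: mulr_ge0; last by rewrite -expr2 sqr_ge0.
by rewrite mxE /= sin_ge0_pi.
Qed.

Let TT_ge0 t r : 0 <= TT t r. Proof. exact: addr_ge0. Qed.
Let XX_ge0 t r : 0 <= XX t r. Proof. exact: addr_ge0. Qed.
Let Ang_ge0 t r : 2 * M < r -> 0 <= Ang t r.
Proof.
move=> hr; have [_ s3 _ _] := sysE.1; have [_ s4 _ _] := sysB.1.
have e2 := smooth_partial i2 sE; have b2 := smooth_partial i2 sB.
rewrite /Ang /angular (sphere_intD t (smoothM e2 e2) (smoothM s3 s3) hr).
by rewrite (sphere_intD t (smoothM b2 b2) (smoothM s4 s4) hr) !addr_ge0.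
Qed.

Section Sign.
Variables (sg : R) (sg1 : sg * sg = 1) (t r : R) (hr : 2 * M < r).

Let sX u v (su : smooth u) (sv : smooth v) : smooth (fun q => u q + sg * v q).
Proof. exact: (smoothD su (smoothM (smooth_cst M sg) sv)). Qed.

Let normsg : sphere_int (fun q => (c q + sg * a q) * (c q + sg * a q) + (d q + sg * b q) * (d q + sg * b q)) t r
  = Norm t r + sg * Dot t r.
Proof.
have s1 := smoothM (smooth_cst M sg) sdot.
rewrite /Norm /Dot -(sphere_intZ (fun=> sg) t sdot hr) -(sphere_intD t sn s1 hr).
apply: (eq_sphere_int t (smoothD (smoothM (sX sc sa) (sX sc sa)) (smoothM (sX sd sb) (sX sd sb))) (smoothD sn s1) hr).
move=> p _; congr (_ * _); rewrite /norm2 /dot2; move: (a p) (b p) (c p) (d p) => a' b' c' d'.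
exact: normsg_algebra.
Qed.

Lemma NormDot_ge0 : 0 <= Norm t r + sg * Dot t r.
Proof.
rewrite -normsg (sphere_intD t (smoothM (sX sc sa) (sX sc sa)) (smoothM (sX sd sb) (sX sd sb)) hr).
exact: addr_ge0.
Qed.

(** The Poincare inequality for the null components X + sg Y, whose divergence and
    curl are the null derivatives of the two scalars. *)
Lemma NormDot_le : 2 * (Norm t r + sg * Dot t r) <= Kin t r + 2 * sg * Flux t r.
Proof.
have e0 := smooth_partial i0 sE; have b0 := smooth_partial i0 sB.
have ex := smooth_dx hM sE; have bx := smooth_dx hM sB.
pose D q := - (partial i0 E q + sg * dx E q).
pose K q := dx B q + sg * partial i0 B q.
have sD : smooth D := smoothN (sX e0 ex); have sK : smooth K := sX bx b0.
have H := poincare (sX sc sa) (sX sd sb) sD sK.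
rewrite -normsg; apply: le_trans (H _ _ _ _ t r hr) _.
- by move=> q; case: perF => _ _ [-> _] [-> _].
- by move=> q; case: perF => _ _ [_ ->] [_ ->].
- move=> p sp; have cp := spherical_chart sp.
  have [e1 e2 _ _ _] := sysE.2.2 p sp.
  rewrite (pdD i2 sc (smoothM (smooth_cst M sg) sa) cp) (pdM i2 (smooth_cst M sg) sa cp) partial_cst.
  rewrite (pdD i3 sd (smoothM (smooth_cst M sg) sb) cp) (pdM i3 (smooth_cst M sg) sb cp) partial_cst.
  exact: div_algebra e1 e2.
- move=> p sp; have cp := spherical_chart sp.
  have [_ [e1 e2] _ _] := maxwell_frame hM Fc ckF mF sp.
  rewrite (pdD i2 sd (smoothM (smooth_cst M sg) sb) cp) (pdM i2 (smooth_cst M sg) sb cp) partial_cst.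
  rewrite (pdD i3 sc (smoothM (smooth_cst M sg) sa) cp) (pdM i3 (smooth_cst M sg) sa cp) partial_cst.
  exact: curl_algebra e1 e2.
have kE := smooth_kinetic hM sysE; have kB := smooth_kinetic hM sysB.
have fE := smooth_flux hM sysE; have fB := smooth_flux hM sysB.
have kk := smoothD kE kB; have ff := smoothM (smooth_cst M (2 * sg)) (smoothD fE fB).
rewrite /Kin /Flux -(sphere_intD t kE kB hr) -(sphere_intD t fE fB hr).
rewrite -(sphere_intZ (fun=> 2 * sg) t (smoothD fE fB) hr) -(sphere_intD t kk ff hr).
apply: (le_sphere_int (smoothD (smoothM sD sD) (smoothM sK sK)) (smoothD kk ff) hr) => p _ _.
rewrite le_eqVlt; apply/orP; left; apply/eqP; rewrite /D /K /kinetic /flux.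
move: (partial i0 E p) (partial i0 B p) (dx E p) (dx B p) => *; exact: kinsg_algebra.
Qed.

Lemma Work_le (q V : R) : 0 < V ->
  `|2 * q * (Wt t r + sg * Wx t r)| <= V * Ang t r + q * q / V * (2 * (Norm t r + sg * Dot t r)).
Proof.
move=> V0; have [_ s3 _ _] := sysE.1; have [_ s4 _ _] := sysB.1.
have e2 := smooth_partial i2 sE; have b2 := smooth_partial i2 sB.
have HE := work_bound q t V0 hr e2 s3 (sX sc sa) (sX sd sb).
have HB := work_bound q t V0 hr b2 s4 (sX (smoothN sb) (smoothN sd)) (sX sa sc).
have LE : sphere_int (fun p => partial i2 E p * (c p + sg * a p) + E3 p * (d p + sg * b p)) t r =
    sphere_int (work_t E E3 c d) t r + sg * sphere_int (work_x E E3 a b) t r.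
  have w1 := smooth_work_t sysE; have w2 := smooth_work_x sysE.
  rewrite -(sphere_intZ (fun=> sg) t w2 hr) -(sphere_intD t w1 (smoothM (smooth_cst M sg) w2) hr).
  apply: (eq_sphere_int t (smoothD (smoothM e2 (sX sc sa)) (smoothM s3 (sX sd sb))) (smoothD w1 (smoothM (smooth_cst M sg) w2)) hr).
  move=> p _; congr (_ * _); rewrite /work_t /work_x; move: (partial i2 E p) (E3 p) (a p) (b p) (c p) (d p) => *; ring.
have LB : sphere_int (fun p => partial i2 B p * (- b p + sg * - d p) + B3 p * (a p + sg * c p)) t r =
    sphere_int (work_t B B3 (fun q => - b q) a) t r + sg * sphere_int (work_x B B3 (fun q => - d q) c) t r.
  have w1 := smooth_work_t sysB; have w2 := smooth_work_x sysB.
  rewrite -(sphere_intZ (fun=> sg) t w2 hr) -(sphere_intD t w1 (smoothM (smooth_cst M sg) w2) hr).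
  apply: (eq_sphere_int t (smoothD (smoothM b2 (sX (smoothN sb) (smoothN sd))) (smoothM s4 (sX sa sc))) (smoothD w1 (smoothM (smooth_cst M sg) w2)) hr).
  move=> p _; congr (_ * _); rewrite /work_t /work_x; move: (partial i2 B p) (B3 p) (a p) (b p) (c p) (d p) => *; ring.
have NB : sphere_int (fun p => (- b p + sg * - d p) * (- b p + sg * - d p) + (a p + sg * c p) * (a p + sg * c p)) t r =
    Norm t r + sg * Dot t r.
  rewrite -normsg; apply: (eq_sphere_int t _ _ hr).
  - exact: (smoothD (smoothM (sX (smoothN sb) (smoothN sd)) (sX (smoothN sb) (smoothN sd))) (smoothM (sX sa sc) (sX sa sc))).
  - exact: (smoothD (smoothM (sX sc sa) (sX sc sa)) (smoothM (sX sd sb) (sX sd sb))).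
  move=> p _; congr (_ * _); move: (a p) (b p) (c p) (d p) => *; exact: dual_algebra.
rewrite LE normsg in HE; rewrite LB NB in HB.
rewrite /Wt /Wx /Ang.
set x1 := sphere_int (work_t E _ _ _) t r in HE *; set x2 := sphere_int (work_x E _ _ _) t r in HE *.
set y1 := sphere_int (work_t B _ _ _) t r in HB *; set y2 := sphere_int (work_x B _ _ _) t r in HB *.
have -> : 2 * q * (x1 + y1 + sg * (x2 + y2)) = 2 * q * (x1 + sg * x2) + 2 * q * (y1 + sg * y2) by ring.
apply: le_trans (ler_normD _ _) _; apply: le_trans (lerD HE HB) _.
rewrite -/(angular E E3) -/(angular B B3) le_eqVlt; apply/orP; left; apply/eqP.
rewrite /angular; move: (sphere_int _ t r) (sphere_int _ t r) (q * q / V) (Norm t r + sg * Dot t r) => *; ring.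
Qed.

End Sign.

Definition energy_density t r := 2^-1 * Kin t r + 2^-1 * potV M r * Ang t r.
Definition bulk_sphere t r :=
  lapse2 M r * (r - 3 * M) ^+ 2 / r ^+ 5 * Ang t r + M * lapse2 M r / r ^+ 2 * XX t r +
  M * (r - 3 * M) ^+ 2 * lapse2 M r / r ^+ 4 * TT t r +
  2 * M * lapse2 M r / (25 * r ^+ 2) * Norm t r.

Let rA2 := radialZ (2^-1) (radial_wA hM).
Let rAV := radialM (radialZ (- 2^-1) (radial_wA hM)) (radial_potV hM).
Let C_e := C1D (C1_radial (@radial_cst R M (2^-1)) C_kin) (C1_radial (radialZ (2^-1) (radial_potV hM)) C_ang).
Let C_j := C1D (C1D (C1_radial (radial_wA hM) C_flux) (C1_radial (radial_wq hM) C_wt)) (C1_radial (radial_wh hM) C_dot).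
Let C_k := C1D (C1D (C1D (C1_radial rA2 C_kin) (C1_radial rAV C_ang)) (C1_radial (radial_wq hM) C_wx)) (C1_radial (radial_wh hM) C_norm).

Let y_itv r : 2 * M < r -> 0 <= M / r <= 2^-1.
Proof.
move=> hr; have r0 : 0 < r by move: hr hM; lra.
rewrite divr_ge0 ?(ltW hM) ?(ltW r0)//= ler_pdivrMr//; move: hr; lra.
Qed.

Let bulkE t r : 2 * M < r -> bulk_sphere t r = (1 - 2 * (M / r)) * (M / r) ^+ 2 / M *
  ((1 - 3 * (M / r)) ^+ 2 * TT t r + XX t r + (1 - 3 * (M / r)) ^+ 2 * ((M / r) / M ^+ 2 * Ang t r) + 2 / 25 * Norm t r).
Proof.
move=> hr; have r0 := r_neq0 hM hr; have m0 := lt0r_neq0 hM.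
rewrite /bulk_sphere /lapse2; move: (Ang t r) (XX t r) (TT t r) (Norm t r) => *.
by move: M m0 {hr} => m m0; field; rewrite r0 m0.
Qed.

Let Norm_ge0 t r : 2 * M < r -> 0 <= Norm t r /\ 2 * Norm t r <= Kin t r.
Proof.
move=> hr; have n1 := NormDot_ge0 (mulr1 1) t hr.
have m11 : (-1) * (-1) = 1 :> R by rewrite mulrNN mulr1.
have n2 := NormDot_ge0 m11 t hr; have n3 := NormDot_le (mulr1 1) t hr; have n4 := NormDot_le m11 t hr.
by move: n1 n2 n3 n4; move: (Norm t r) (Dot t r) (Kin t r) (Flux t r) => *; split; lra.
Qed.

Let conserved t r : 2 * M < r ->
  2^-1 * (sphere_int (partial i0 (kinetic M E)) t r + sphere_int (partial i0 (kinetic M B)) t r)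
  + 2^-1 * potV M r * (sphere_int (partial i0 (angular E E3)) t r + sphere_int (partial i0 (angular B B3)) t r) =
  lapse2 M r * (sphere_int (partial i1 (flux M E)) t r + sphere_int (partial i1 (flux M B)) t r).
Proof.
move=> hr; have E1 := energy_balance hM sysE t hr; have B1 := energy_balance hM sysB t hr.
rewrite (sphere_dx t (smooth_flux hM sysE) hr) in E1.
rewrite (sphere_dx t (smooth_flux hM sysB) hr) in B1.
exact: conserved_algebra E1 B1.
Qed.

Let dominated sg t r : sg * sg = 1 -> 2 * M < r ->
  `|wA M r * (2^-1 * (Kin t r + 2 * sg * Flux t r) - 2^-1 * potV M r * Ang t r)
    + wh M r * (Norm t r + sg * Dot t r)| + `|wq M r * (Wt t r + sg * Wx t r)| <=
  36 / 5 * (2^-1 * (Kin t r + 2 * sg * Flux t r) + 2^-1 * potV M r * Ang t r).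
Proof.
move=> s1 hr; have V0 := potV_gt0 hM hr; have [b1 b2 b3 b4] := multiplier_bounds (y_itv hr).
have r0 := r_neq0 hM hr; have m0 := lt0r_neq0 hM; have f0 := lapse2_neq0 hM hr.
have y0 : M / r != 0 by rewrite mulf_neq0// invr_neq0.
have q2 : wq M r * wq M r / potV M r = polyq2V (M / r).
  rewrite potVE// /wq /kappa /polyq2V.
  have : 1 - 2 * (M / r) != 0 by move: f0; rewrite /lapse2 mulrA.
  by move: y0; move: (M / r) => y y0 f0'; move: M m0 {hr V0 r0 f0} => m m0; field; rewrite m0 y0 f0'.
have W := Work_le s1 t hr (wq M r) V0; rewrite q2 in W.
have n0 := NormDot_ge0 s1 t hr; have n1 := NormDot_le s1 t hr.
have a0 := Ang_ge0 t hr.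
have i2 : 0 <= 2^-1 :> R by rewrite invr_ge0.
have D0 : 0 <= 2^-1 * potV M r * Ang t r := mulr_ge0 (mulr_ge0 i2 (ltW V0)) a0.
have [G0 NG] := half_ge0 n0 n1.
apply: (boundary_algebra b1 b2 b3 b4 G0 D0 n0 NG).
have W2 : 2 * `|wq M r * (Wt t r + sg * Wx t r)| <= potV M r * Ang t r + polyq2V (M / r) * (2 * (Norm t r + sg * Dot t r)).
  exact: norm_double.
have := ler_wpM2l b3 NG; move: W2.
exact: young_algebra.
Qed.

Let ry := radial_y hM.
Let r1y c := radialD (@radial_cst R M 1) (radialZ c ry).
Let rw := radialZ M^-1 (radialM (r1y (- 2)) (radialM ry ry)).
Let r3 := radialM (r1y (- 3)) (r1y (- 3)).
Let C_T := C1_radial rw (C1D (C1D (C1D (C1_radial r3 C_TT) C_XX)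
  (C1_radial (radialM r3 (radialZ (M ^- 2) ry)) C_ang)) (C1_radial (@radial_cst R M (2 / 25)) C_norm)).

Let bulk_cont t r : 2 * M < r -> {for (t, r), continuous (fun z : R * R => bulk_sphere z.1 z.2)}.
Proof.
move=> hr; have [_ _ H _ _] := C_T t hr.
have C : (fun z : R * R => z.2) @ (t, r) --> r by exact: cvg_snd.
have N := C _ (near_r hr).
have TE (z : R * R) : 2 * M < z.2 -> M^-1 * ((1 + - 2 * (M / z.2)) * (M / z.2 * (M / z.2))) *
  ((1 + - 3 * (M / z.2)) * (1 + - 3 * (M / z.2)) * TT z.1 z.2 + XX z.1 z.2 +
    (1 + - 3 * (M / z.2)) * (1 + - 3 * (M / z.2)) * (M ^- 2 * (M / z.2)) * Ang z.1 z.2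
    + 2 / 25 * Norm z.1 z.2) = bulk_sphere z.1 z.2.
  move=> hz; rewrite bulkE//; move: (M / z.2) (M^-1) (M ^- 2) => y m m2; ring.
rewrite /prop_for /continuous_at /= -(TE (t, r))//.
apply: cvg_trans H; apply: near_eq_cvg.
by apply: (@filterS _ (nbhs (t, r)) _ _ _ _ N) => z hz; rewrite /= -(TE z hz).
Qed.

Theorem currents : morawetz_currents energy_density Flux bulk_sphere.
Proof.
do 10 eexists; split; first by split; [exact: C_e|exact: C_flux|exact: C_j|exact: C_k].
split; first exact: bulk_cont.
move=> t r hr.
have r0 := r_neq0 hM hr; have m0 := lt0r_neq0 hM; have V0 := potV_gt0 hM hr.
have [n0 n1] := Norm_ge0 t hr; have a0 := Ang_ge0 t hr; have yI := y_itv hr.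
have fE : lapse2 M r = 1 - 2 * (M / r) by rewrite /lapse2 mulrA.
have f0 := lapse2_gt0 hM hr.
have c0 : 0 <= (1 - 2 * (M / r)) * (M / r) ^+ 2 / M.
  rewrite -fE; apply: mulr_ge0; last by rewrite invr_ge0 ltW.
  by apply: mulr_ge0; [exact: ltW|exact: sqr_ge0].
have ang0 : 0 <= (M / r) / M ^+ 2 * Ang t r.
  by have /andP[y0 _] := yI; rewrite mulr_ge0// mulr_ge0// invr_ge0 sqr_ge0.
split.
- exact: conserved.
- rewrite (bulkE t hr); apply: mulr_ge0 c0 _.
  exact: bulk_ge0 (TT_ge0 t r) (XX_ge0 t r) ang0 n0.
- have E2 := momentum_balance hM sysE t hr; have B2 := momentum_balance hM sysB t hr.
  have E4 := virial_balance hM sysE t hr; have B4 := virial_balance hM sysB t hr.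
  have N := norm_balance t hr.
  rewrite (sphere_dx t (smooth_kinetic hM sysE) hr) (sphere_dx t (smooth_angular sysE) hr) in E2.
  rewrite (sphere_dx t (smooth_kinetic hM sysB) hr) (sphere_dx t (smooth_angular sysB) hr) in B2.
  rewrite (sphere_dx t (smooth_work_x sysE) hr) in E4.
  rewrite (sphere_dx t (smooth_work_x sysB) hr) in B4.
  rewrite (sphere_dx t sn hr) in N.
  have wqE : lapse2 M r * dwq M r = - 2 * wh M r * potV M r.
    by rewrite /dwq (potVE hM hr) fE; exact: dwq_algebra.
  have E2' := sum_algebra E2 B2; have E4' := virial_sum_algebra E4 B4.
  rewrite (divergence_algebra _ _ _ _ _ _ _ E2' E4' N wqE).
  suff K : bulk_sphere t r <= lapse2 M r * (2^-1 * dwA M r * Kin t r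
      - 2^-1 * (dwA M r * potV M r + wA M r * dpotV M r) * Ang t r + dwh M r * Norm t r)
      + wq M r * (potV M r * Ang t r + XX t r - TT t r) by exact: K.
  rewrite (KinE t hr) (bulkE t hr).
  rewrite (KinE t hr) in n1.
  rewrite /wA /dwA /wq /kappa /dwh /dpotV (potVE hM hr) fE (bulk_coefficients _ _ _ _ _ m0).
  exact: ler_wpM2l c0 _ _ (bulk_algebra yI (TT_ge0 t r) (XX_ge0 t r) ang0 n0 n1).
- exact: dominated_plus (dominated t (mulr1 1) hr).
- have m11 : (-1) * (-1) = 1 :> R by rewrite mulrNN mulr1.
  exact: dominated_minus (dominated t m11 hr).
Qed.

End Currents.

(** * Energy and bulk integral on the orbit space *)

Lemma normal_flux_algebra (R : realFieldType) (f r s sg r' t' n0 n1 w e0 b0 e1 b1 e2 b2 e3 b3 : R) :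
  f != 0 -> r != 0 -> n0 * w = sg * r' / f -> n1 * w = sg * t' * f ->
  1 / (9 * r ^+ 2) * (n0 * ((e0 ^+ 2 + b0 ^+ 2 + (f * e1) ^+ 2 + (f * b1) ^+ 2
      + f / r ^+ 2 * (e2 ^+ 2 + b2 ^+ 2 + e3 ^+ 2 + b3 ^+ 2)) / 2)
    + n1 * (e0 * e1 + b0 * b1)) * (w * (r ^+ 2 * s)) =
  s * (sg / 9 * r' / f * 2^-1 * (e0 * e0 + f * e1 * (f * e1) + (b0 * b0 + f * b1 * (f * b1)))
     + sg / 9 * r' / f * 2^-1 * (f / r ^+ 2) * (e2 * e2 + e3 * e3 + (b2 * b2 + b3 * b3))
     + sg / 9 * t' * (e0 * (f * e1) + b0 * (f * b1))).
Proof.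
move=> f0 r0 h0 h1.
transitivity (s / 9 * ((n0 * w) * ((e0 ^+ 2 + b0 ^+ 2 + (f * e1) ^+ 2 + (f * b1) ^+ 2
      + f / r ^+ 2 * (e2 ^+ 2 + b2 ^+ 2 + e3 ^+ 2 + b3 ^+ 2)) / 2)
    + (n1 * w) * (e0 * e1 + b0 * b1))); first by field.
by rewrite h0 h1; field; rewrite f0 r0.
Qed.

Lemma collect_flux_algebra (R : realFieldType) (f sg r' t' V x y z : R) : f != 0 ->
  sg / 9 * r' / f * 2^-1 * x + sg / 9 * r' / f * 2^-1 * V * y + sg / 9 * t' * z =
  sg / 9 * (r' * ((2^-1 * x + 2^-1 * V * y) / f) + t' * z).
Proof. by move=> f0; field. Qed.

Section SurfaceGeometry.
Variables (R : realType) (M : R).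
Hypothesis hM : 0 < M.
Implicit Types S : sph_surface R.

Lemma innerE p v w : spherical M p -> inner M p v w = \sum_(k < 4) gdiag M p k * v k * w k.
Proof.
move=> sp; apply: eq_bigr => k _; rewrite (bigD1 k)//= big1 ?addr0.
  by rewrite gE eqxx mul1r.
by move=> j jk; rewrite gE eq_sym (negbTE jk) !mul0r.
Qed.

Lemma spherical_embed S s th ph : 2 * M < curve_r S s -> 0 < th < pi -> spherical M (embed S s th ph).
Proof. exact: spherical_point4. Qed.

Section OneSurface.
Variable S : sph_surface R.
Hypothesis hS : spacelike_surface M S.
Local Notation t := (curve_t S).
Local Notation r := (curve_r S).
Local Notation t' := (derive1 (curve_t S)).
Local Notation r' := (derive1 (curve_r S)).

Lemma surface_r s : 2 * M < r s. Proof. by case: hS. Qed.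

Lemma surface_derive (s : R) : is_derive s 1 t (t' s) /\ is_derive s 1 r (r' s).
Proof.
have [st sr _ _] := hS.
by split; split; [exact: (st 0%N)|rewrite derive1E|exact: (sr 0%N)|rewrite derive1E].
Qed.

Lemma surface_cont (s : R) : {for s, continuous t'} /\ {for s, continuous r'}.
Proof.
have [st sr _ _] := hS.
split; apply: differentiable_continuous; apply/derivable1_diffP; [exact: (st 1%N)|exact: (sr 1%N)].
Qed.

Let th0 : 0 < (pi / 2 : R) < pi.
Proof. by have := @pi_gt0 R => pi0; apply/andP; split; [exact: divr_gt0|lra]. Qed.

Let tangent_inner s th ph (i j : 'I_3) : 0 < th < pi ->
  inner M (embed S s th ph) (tangent S s i) (tangent S s j) =
  (i == j)%:R * nth 0 [:: lapse2 M (r s) * t' s ^+ 2 - r' s ^+ 2 / lapse2 M (r s);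
     - r s ^+ 2; - (r s ^+ 2 * sin th ^+ 2)] i.
Proof.
move=> thI; rewrite innerE; last exact: spherical_embed (surface_r s) thI.
rewrite sum4 /gdiag /embed /point4 /tangent !mxE /=.
case: i => [[|[|[|?]]] ?] //; case: j => [[|[|[|?]]] ?] //=;
  rewrite /vector4 /= ?mulr0 ?mul0r ?mulr1 ?addr0 ?add0r ?mul1r//.
by rewrite !expr2; ring.
Qed.

Lemma surface_spacelike s : lapse2 M (r s) * t' s ^+ 2 < r' s ^+ 2 / lapse2 M (r s).
Proof.
have [_ _ _ /(_ s (pi / 2) 0 (delta_mx 0 ord0) th0)] := hS.
rewrite -rowE trmx_delta -colE !mxE /= tangent_inner// eqxx mul1r /= subr_lt0; apply.
by apply/eqP => /matrixP/(_ 0 ord0); rewrite !mxE !eqxx /= => /eqP; rewrite oner_eq0.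
Qed.

Lemma surface_r'_neq0 s : r' s != 0.
Proof.
apply: contraTneq (surface_spacelike s) => ->.
rewrite expr0n mul0r -leNgt mulr_ge0 ?sqr_ge0//; apply: ltW; exact: lapse2_gt0 (surface_r s).
Qed.

Lemma surface_det s th ph : 0 < th < pi ->
  Num.sqrt `|\det (induced_metric M S s th ph)| =
  Num.sqrt (r' s ^+ 2 / lapse2 M (r s) - lapse2 M (r s) * t' s ^+ 2) * (r s ^+ 2 * sin th).
Proof.
move=> thI; set D := r' s ^+ 2 / _ - _.
have D0 : 0 < D by rewrite subr_gt0 surface_spacelike.
have s0 : 0 < sin th by exact: sin_gt0_pi.
pose d : 'rV[R]_3 := \row_(i < 3) [:: - D; - r s ^+ 2; - (r s ^+ 2 * sin th ^+ 2)]`_i.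
have -> : induced_metric M S s th ph = diag_mx d.
  apply/matrixP => i j; rewrite !mxE tangent_inner// /D opprB.
  by case: eqP => [->|_]; rewrite ?mul1r ?mulr1n ?mul0r ?mulr0n.
rewrite det_diag !big_ord_recl big_ord0 !mxE /= mulr1.
have -> : - D * (- r s ^+ 2 * - (r s ^+ 2 * sin th ^+ 2)) = - (D * (r s ^+ 2 * sin th) ^+ 2).
  by move: (r s) (sin th) => x y; ring.
rewrite normrN ger0_norm; last by rewrite mulr_ge0 ?sqr_ge0// ltW.
rewrite sqrtrM ?(ltW D0)// sqrtr_sqr ger0_norm//.
by rewrite mulr_ge0 ?sqr_ge0// ltW.
Qed.

Lemma normal_components N s th ph : future_unit_normal M S N -> 0 < th < pi ->
  exists n0 n1, [/\ N s th ph = vector4 n0 n1 0 0, 0 < n0,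
    lapse2 M (r s) * n0 * t' s = n1 * r' s / lapse2 M (r s) &
    lapse2 M (r s) * n0 ^+ 2 - n1 ^+ 2 / lapse2 M (r s) = 1].
Proof.
move=> hN thI; have sp := spherical_embed ph (surface_r s) thI.
have [r0 f0 s0] := sphericalP hM sp.
have e1 : (embed S s th ph) 0 i1 = r s by rewrite mxE.
have e2 : (embed S s th ph) 0 i2 = th by rewrite mxE.
rewrite e1 in r0 f0; rewrite e2 in s0.
have [u o fut] := hN s th ph thI; move: u fut (o ord0) (o (lift ord0 ord0)) (o ord_max).
rewrite !(innerE _ _ sp) !sum4 /gdiag /xi /tangent /= e1 e2 /vector4 /=.
rewrite !mulr0 !mulr1 !addr0 !add0r.
move=> u fut o0 o1 o2.
have N2 : N s th ph i2 = 0.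
  by apply/eqP; move/eqP: o1; rewrite mulf_eq0 oppr_eq0 expf_eq0 /= (negbTE r0).
have N3 : N s th ph i3 = 0.
  by apply/eqP; move/eqP: o2; rewrite mulf_eq0 oppr_eq0 mulf_eq0 !expf_eq0 /= (negbTE r0) (negbTE s0).
exists (N s th ph i0), (N s th ph i1); split.
- by apply/funext; apply: I4_ind; rewrite /vector4 /=.
- by move: fut; rewrite pmulr_rgt0// lapse2_gt0// surface_r.
- apply/eqP; rewrite -subr_eq0; apply/eqP; rewrite -[RHS]o0.
  by move: (N s th ph i0) (N s th ph i1) (t' s) (r' s) (lapse2 M (r s)) => *; ring.
- rewrite -u N2 N3 !mulr0 !addr0 !expr2.
  by move: (N s th ph i0) (N s th ph i1) (lapse2 M (r s)) => *; ring.
Qed.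

End OneSurface.

(** The unit normal, weighted by the length element of the curve, is the curve's
    tangent rotated by the orbit metric. *)
Lemma weighted_normal (f t' r' n0 n1 : R) : 0 < f -> r' != 0 -> 0 < n0 ->
  f * t' ^+ 2 < r' ^+ 2 / f ->
  f * n0 * t' = n1 * r' / f -> f * n0 ^+ 2 - n1 ^+ 2 / f = 1 ->
  n0 * Num.sqrt (r' ^+ 2 / f - f * t' ^+ 2) = Num.sg r' * r' / f /\
  n1 * Num.sqrt (r' ^+ 2 / f - f * t' ^+ 2) = Num.sg r' * t' * f.
Proof.
move=> f0 r0 n00 sl o u; have fn := lt0r_neq0 f0; have nn := lt0r_neq0 n00.
have D0 : 0 < r' ^+ 2 / f - f * t' ^+ 2 by rewrite subr_gt0.
have tE : t' = n1 * r' / (f * f * n0).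
  apply: (mulfI (mulf_neq0 fn nn)); rewrite o; move: r0 fn nn {o u sl D0} => r0 fn nn.
  by field; rewrite fn nn.
have h0 : n0 * Num.sqrt (r' ^+ 2 / f - f * t' ^+ 2) = Num.sg r' * r' / f.
  rewrite -normrEsg; apply/eqP; rewrite -(@eqrXn2 _ 2)//; last 2 first.
  - by rewrite mulr_ge0 ?sqrtr_ge0// ltW.
  - by rewrite divr_ge0// ltW.
  rewrite exprMn sqr_sqrtr; last exact: ltW.
  rewrite expr_div_n real_normK ?num_real//; apply/eqP.
  transitivity (r' ^+ 2 / f ^+ 2 * (f * n0 ^+ 2 - n1 ^+ 2 / f)); last by rewrite u mulr1.
  rewrite tE; move: fn nn {o u tE sl D0} => fn nn.
  by field; rewrite fn nn.
split => //; apply: (mulfI r0).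
transitivity (f * f * t' * (n0 * Num.sqrt (r' ^+ 2 / f - f * t' ^+ 2))).
  have : n1 * r' = f * f * n0 * t' by rewrite -[LHS](divfK fn) -o; ring.
  by move: (Num.sqrt _) => w h; rewrite mulrCA mulrA h; ring.
by rewrite h0; move: (Num.sg r') fn {tE o u sl D0 h0} => x fn; field.
Qed.

End SurfaceGeometry.

Section Reduction.
Variables (R : realType) (M : R).
Hypothesis hM : 0 < M.
Local Notation mu := (@lebesgue_measure R).

Lemma sphere_intE (u : 'rV[R]_4 -> R) (h : R -> R -> R) t r : smooth M u -> 2 * M < r ->
  (forall th ph, 0 < th < pi -> h th ph = sin th * u (point4 t r th ph)) ->
  (\int[mu]_(th in `]0%R, pi[%classic) \int[mu]_(ph in `[0%R, (2 * pi)%R[%classic) (h th ph)%:E)%E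
  = (sphere_int u t r)%:E.
Proof.
move=> su hr hE; have sU := smooth_sinM su 0.
pose g (q : 'rV[R]_4) := sin (q 0 i2) * u q.
have gE th ph : sin th * u (point4 t r th ph) = g (point4 t r th ph) by rewrite /g mxE.
have inner th : 0 < th < pi ->
    (\int[mu]_(ph in `[0%R, (2 * pi)%R[%classic) (h th ph)%:E)%E = (phi_integral g t r th)%:E.
  move=> thI; rewrite /phi_integral integ_EFin; last exact: phi_section_within sU hr.
  rewrite -(@integral_itv_bndo_bndc R _ (2 * pi)).
    by apply: eq_integral => ph _; rewrite hE// gE.
  apply/measurable_EFinP; apply: (@measurable_funS _ _ _ _ `[0, 2 * pi]) => //.
    by move=> x /=; rewrite !in_itv/= => /andP[-> /ltW].
  apply: subspace_continuous_measurable_fun => //.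
  exact: phi_section_within sU hr.
rewrite /sphere_int /SI integ_EFin; last exact: theta_section_within sU hr.
transitivity (\int[mu]_(th in `]0%R, pi[%classic) (phi_integral g t r th)%:E)%E.
  by apply: eq_integral => th; rewrite inE /= in_itv/=; exact: inner.
apply/esym/(@integral_itv_bndoo R 0 pi _ true false).
apply/measurable_EFinP; apply: (@measurable_funS _ _ _ _ `[0, pi]) => //.
  by move=> x /=; rewrite !in_itv/= => /andP[/ltW -> /ltW ->].
apply: subspace_continuous_measurable_fun => //.
exact: theta_section_within sU hr.
Qed.

Variables (F : tensor2 R) (E B a b c d : 'rV[R]_4 -> R).
Hypothesis Fc : frame_comps M F E B a b c d.
Hypothesis ckF : forall n, [/\ ck (chart M) n E, ck (chart M) n B,
  ck (chart M) n a /\ ck (chart M) n b & ck (chart M) n c /\ ck (chart M) n d].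
Hypothesis mF : maxwell M F.
Hypothesis perF : [/\ periodic E, periodic B, periodic a /\ periodic b & periodic c /\ periodic d].
Let sysE := electric_system hM Fc ckF mF perF.
Let sysB := magnetic_system hM Fc ckF mF perF.
Local Notation E3 := (angular_E M b d).
Local Notation B3 := (angular_B M a c).
Local Notation smooth := (smooth M).
Let sE : smooth E. Proof. by move=> n; case: (ckF n). Qed.
Let sB : smooth B. Proof. by move=> n; case: (ckF n). Qed.
Let sa : smooth a. Proof. by move=> n; case: (ckF n) => _ _ []. Qed.
Let sb : smooth b. Proof. by move=> n; case: (ckF n) => _ _ []. Qed.
Let sc : smooth c. Proof. by move=> n; case: (ckF n) => _ _ _ []. Qed.
Let sd : smooth d. Proof. by move=> n; case: (ckF n) => _ _ _ []. Qed.
Let sn : smooth (norm2 a b c d).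
Proof. exact: (smoothD (smoothD (smoothM sa sa) (smoothM sb sb)) (smoothD (smoothM sc sc) (smoothM sd sd))). Qed.
Let st (u : 'rV[R]_4 -> R) (su : smooth u) := smoothM (smooth_partial i0 su) (smooth_partial i0 su).
Let sx (u : 'rV[R]_4 -> R) (su : smooth u) := smoothM (smooth_dx hM su) (smooth_dx hM su).
Let sAng := smoothD (smooth_angular sysE) (smooth_angular sysB).
Let sKin := smoothD (smooth_kinetic hM sysE) (smooth_kinetic hM sysB).
Let sFlux := smoothD (smooth_flux hM sysE) (smooth_flux hM sysB).

Let sphere_cst k u t r : smooth u -> 2 * M < r ->
  sphere_int (fun q => k * u q) t r = k * sphere_int u t r.
Proof. by move=> su hr; exact: (sphere_intZ (fun=> k) t su hr). Qed.

Let E3E p : spherical M p -> partial i3 E p / sin (p 0 i2) = E3 p.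
Proof.
move=> sp; have [_ _ s0] := sphericalP hM sp.
by rewrite -(angular_E_eq hM Fc ckF mF sp) mulrAC mulfV// mul1r.
Qed.

Let B3E p : spherical M p -> partial i3 B p / sin (p 0 i2) = B3 p.
Proof.
move=> sp; have [_ _ s0] := sphericalP hM sp.
by rewrite -(angular_B_eq hM Fc ckF mF sp) mulrAC mulfV// mul1r.
Qed.

Local Notation bulk_sphere := (bulk_sphere M E B a b c d).
Local Notation energy_density := (energy_density M E B a b c d).
Local Notation Flux := (Flux M E B).

Lemma bulkE Omega : Omega `<=` [set q | 2 * M < q.2] ->
  bulk M F Omega = (\int[mu]_t \int[mu]_(r in xsection Omega t)
    (bulk_sphere t r / (9 * lapse2 M r))%:E)%E.
Proof.
move=> OM; apply: eq_integral => t _; apply: eq_integral => r; rewrite inE /= => /xsectionP Otr.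
have hr : 2 * M < r := OM _ Otr; have f0 := lapse2_neq0 hM hr.
pose k := (9 * lapse2 M r)^-1.
pose c1 := lapse2 M r * (r - 3 * M) ^+ 2 / r ^+ 5; pose c2 := M * lapse2 M r / r ^+ 2.
pose c3 := M * (r - 3 * M) ^+ 2 * lapse2 M r / r ^+ 4; pose c4 := 2 * M * lapse2 M r / (25 * r ^+ 2).
have s1 := smoothM (smooth_cst M c1) sAng; have s2 := smoothM (smooth_cst M c2) (smoothD (sx sE) (sx sB)).
have s3 := smoothM (smooth_cst M c3) (smoothD (st sE) (st sB)); have s4 := smoothM (smooth_cst M c4) sn.
have s12 := smoothD s1 s2; have s123 := smoothD s12 s3; have s1234 := smoothD s123 s4.
have sk := smoothM (smooth_cst M k) s1234.
rewrite (sphere_intE (t := t) sk hr); last first.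
  move=> th ph thI; have sp := spherical_point4 t ph hr thI.
  rewrite /=; have r1 : (point4 t r th ph) 0 i1 = r by rewrite mxE.
  have := bulk_integrandE hM Fc ckF mF sp; rewrite /bulk_density (E3E sp) (B3E sp) r1 => ->.
  rewrite (_ : (point4 t r th ph) 0 i2 = th); last by rewrite mxE.
  rewrite -mulrA -/k; congr (_ * _); rewrite mulrC; congr (_ * _).
  rewrite /angular /dstar r1 /norm2 -/c1 -/c2 -/c3 -/c4 !expr2.
  by congr (_ * _ + _ * _ + _ * _ + _ * _); ring.
rewrite (sphere_cst k t s1234 hr) (sphere_intD t s123 s4 hr) (sphere_intD t s12 s3 hr) (sphere_intD t s1 s2 hr).
rewrite (sphere_cst c1 t sAng hr) (sphere_cst c2 t (smoothD (sx sE) (sx sB)) hr).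
rewrite (sphere_cst c3 t (smoothD (st sE) (st sB)) hr) (sphere_cst c4 t sn hr).
rewrite (sphere_intD t (smooth_angular sysE) (smooth_angular sysB) hr).
rewrite (sphere_intD t (sx sE) (sx sB) hr) (sphere_intD t (st sE) (st sB) hr).
by rewrite mulrC.
Qed.

Lemma energyE S N : spacelike_surface M S -> future_unit_normal M S N ->
  energy M F S N = (\int[mu]_s (Num.sg (derive1 (curve_r S) s) / 9 *
    (derive1 (curve_r S) s * (energy_density (curve_t S s) (curve_r S s) / lapse2 M (curve_r S s))
     + derive1 (curve_t S) s * Flux (curve_t S s) (curve_r S s)))%:E)%E.
Proof.
move=> hS hN; apply: eq_integral => s _.
have hr := surface_r hS s; set r := curve_r S s in hr *; set t := curve_t S s.
set r' := derive1 _ s; set t' := derive1 _ s.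
have f0 := lapse2_gt0 hM hr; have fn := lt0r_neq0 f0; have r0 := r_neq0 hM hr.
pose k1 := Num.sg r' / 9 * r' / lapse2 M r * 2^-1.
pose k2 := Num.sg r' / 9 * r' / lapse2 M r * 2^-1 * potV M r.
pose k3 := Num.sg r' / 9 * t'.
have s1 := smoothM (smooth_cst M k1) sKin; have s2 := smoothM (smooth_cst M k2) sAng.
have s3 := smoothM (smooth_cst M k3) sFlux; have s12 := smoothD s1 s2; have s123 := smoothD s12 s3.
rewrite (sphere_intE (t := t) s123 hr); last first.
  move=> th ph thI; have sp := spherical_embed ph hr thI.
  have [n0 [n1 [NE n00 o u]]] := @normal_components R M hM S hS N s th ph hN thI.
  have [w0 w1] := weighted_normal f0 (@surface_r'_neq0 R M hM S hS s) n00 (surface_spacelike hS s) o u.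
  rewrite NE (energy_density_E hM Fc ckF mF _ _ _ sp) (surface_det hS s ph thI).
  rewrite -/(embed S s th ph) (E3E sp) (B3E sp) -/r -/r' -/t'.
  have e1 : (embed S s th ph) 0 i1 = r by rewrite mxE.
  rewrite /kinetic /angular /flux /dstar e1 -/(embed S s th ph).
  exact: normal_flux_algebra fn r0 w0 w1.
rewrite (sphere_intD t s12 s3 hr) (sphere_intD t s1 s2 hr).
rewrite (sphere_cst k1 t sKin hr) (sphere_cst k2 t sAng hr) (sphere_cst k3 t sFlux hr).
rewrite (sphere_intD t (smooth_kinetic hM sysE) (smooth_kinetic hM sysB) hr).
rewrite (sphere_intD t (smooth_angular sysE) (smooth_angular sysB) hr).
rewrite (sphere_intD t (smooth_flux hM sysE) (smooth_flux hM sysB) hr).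
congr (_%:E); rewrite /k1 /k2 /k3 /energy_density /Kin /Ang /Flux.
exact: collect_flux_algebra fn.
Qed.

End Reduction.

(** * The orbit space *)

Section OrientedIntegral.
Context {R : realType}.
Implicit Types (f : R -> R) (a b c x y z : R).

Lemma near_itv a b x : a < x < b -> \forall y \near x, a < y < b.
Proof.
move=> xI; have o : open_nbhs x `]a, b[%classic by split; [exact: itv_open|rewrite /= in_itv].
by apply: filterS (open_nbhs_nbhs o) => y; rewrite /= in_itv.
Qed.

Lemma derive1_cst c x : is_derive x 1 (fun=> c) 0.
Proof. exact: is_derive_cst. Qed.

Lemma derive_ge0_le a b f df : a <= b ->
  (forall x, a <= x <= b -> is_derive x 1 f (df x)) ->
  (forall x, a <= x <= b -> 0 <= df x) -> f a <= f b.
Proof.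
move=> ab fd d0; rewrite -subr_ge0.
have cf : {within `[a, b], continuous f}.
  by apply: within_of_for => x; rewrite /= in_itv/= => /fd/is_derive_continuous.
have [c cI ->] := MVT_segment ab (fun x xI => fd x (subset_itv_oo_cc xI)) cf.
by rewrite mulr_ge0 ?subr_ge0//; apply: d0; move: cI; rewrite in_itv.
Qed.

(** Lebesgue integrals carry no orientation; primitives are needed on both sides of
    their base point. *)
Definition oint a z f : R := if a <= z then integ a z f else - integ z a f.

Lemma oint_primitive a z f (g : R -> R) :
  (forall x, Num.min a z <= x <= Num.max a z -> is_derive x 1 g (f x)) ->
  (forall x, Num.min a z <= x <= Num.max a z -> {for x, continuous f}) ->
  oint a z f = g z - g a.
Proof.
move=> gd cf; rewrite /oint; case: (leP a z) => az.
  move: gd cf; rewrite (min_idPl az) (max_idPr az) => gd cf.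
  exact: integ_FTC2.
move: gd cf; rewrite (min_idPr (ltW az)) (max_idPl (ltW az)) => gd cf.
by rewrite (@integ_FTC2 _ z a g f (ltW az) gd cf) opprB.
Qed.

Lemma oint_is_derive a z f b c : b < a < c -> b < z < c ->
  (forall x, b <= x <= c -> {for x, continuous f}) ->
  is_derive z 1 (fun z => oint a z f) (f z).
Proof.
move=> /andP[ba ac] /andP[bz zc] cf.
have D y : b < y < c -> is_derive y 1 (fun z => integ b z f) (f y).
  by move=> yI; exact: integ_FTC1 yI cf.
have E y : b < y < c -> oint a y f = integ b y f - integ b a f.
  move=> /andP[by_ yc]; apply: (oint_primitive (g := fun z => integ b z f)) => x /andP[x1 x2].
    apply: D; apply/andP; split.
      by apply: lt_le_trans x1; rewrite lt_min ba.
    by apply: le_lt_trans x2 _; rewrite gt_max ac.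
  apply: cf; apply/andP; split.
    by apply: le_trans x1; rewrite le_min !ltW.
  by apply: le_trans x2 _; rewrite ge_max !ltW.
have zI : b < z < c by rewrite bz.
have [d1 d2] : is_derive z 1 (fun y => integ b y f - integ b a f) (f z).
  by rewrite -[f z]subr0; exact: derive1_sub (D z zI) (derive1_cst _ _).
have N : {near z, (fun y => oint a y f) =1 (fun y => integ b y f - integ b a f)}.
  by apply: filterS (near_itv zI) => y; exact: E.
split; first by apply: near_eq_derivable d1; apply: filterS N => y ->.
by rewrite -d2; exact: near_eq_derive.
Qed.

End OrientedIntegral.

Section Tortoise.
Variables (R : realType) (M : R).
Hypothesis hM : 0 < M.
Implicit Types r x : R.

Lemma tortoise_is_derive r : 2 * M < r -> is_derive r 1 (tortoise M) (lapse2 M r)^-1.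
Proof.
move=> hr; have M2 : 0 < 2 * M by rewrite mulr_gt0.
have m0 := lt0r_neq0 hM; have r0 := r_neq0 hM hr.
have p0 : 0 < r / (2 * M) - 1 by rewrite subr_gt0 ltr_pdivlMr// mul1r.
have D1 : is_derive r 1 (fun r => r / (2 * M) - 1) (2 * M)^-1.
  have := derive1_sub (derive1_mul (is_derive_id r 1) (derive1_cst (2 * M)^-1 r)) (derive1_cst 1 r).
  by rewrite mulr0 addr0 subr0 mul1r.
have D2 := @derive1_comp _ (@ln R) (fun r => r / (2 * M) - 1) r _ _ (is_derive1_ln p0) D1.
have D := derive1_add (is_derive_id r 1) (derive1_scale D2 (2 * M)).
apply: (derive1_eq D).
have q0 : r - 2 * M != 0 by rewrite subr_eq0 gt_eqF.
have q1 := lt0r_neq0 p0.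
rewrite /lapse2; move: m0 r0 q0 q1 {hr M2 p0 D1 D2 D}; move: M => m m0 r0 q0 q1.
have m20 : 2 * m != 0 by rewrite mulf_neq0.
have e1 : r / (2 * m) - 1 = (r - 2 * m) / (2 * m) by rewrite mulrBl divff.
have e2 : 1 - 2 * m / r = (r - 2 * m) / r by rewrite mulrBl divff.
by rewrite e1 e2; field; rewrite r0 m0 q0.
Qed.

Lemma tortoise_lt : {in [pred r | 2 * M < r] &, {homo tortoise M : r1 r2 / r1 < r2}}.
Proof.
move=> r1 r2; rewrite !inE => h1 h2 r12; have M2 : 0 < 2 * M by rewrite mulr_gt0.
rewrite /tortoise ltrD// ltr_pM2l// ltr_ln ?posrE.
- by rewrite ltrBlDr subrK ltr_pM2r// invr_gt0.
- by rewrite subr_gt0 ltr_pdivlMr// mul1r.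
- by rewrite subr_gt0 ltr_pdivlMr// mul1r.
Qed.

Lemma tortoise_ltE r1 r2 : 2 * M < r1 -> 2 * M < r2 -> (tortoise M r1 < tortoise M r2) = (r1 < r2).
Proof.
move=> h1 h2; have [r12|r21|->] := ltgtP r1 r2; last by rewrite ltxx.
  by rewrite tortoise_lt// inE.
by apply/negbTE; rewrite -leNgt ltW// tortoise_lt// inE.
Qed.

Lemma tortoise_inj r1 r2 : 2 * M < r1 -> 2 * M < r2 -> tortoise M r1 = tortoise M r2 -> r1 = r2.
Proof.
by move=> h1 h2 E; have := tortoise_ltE h1 h2; have := tortoise_ltE h2 h1; rewrite E ltxx; case: ltgtP.
Qed.

Lemma tortoise_surj x : exists r, 2 * M < r /\ tortoise M r = x.
Proof.
have M2 : 0 < 2 * M by rewrite mulr_gt0.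
have m2 := lt0r_neq0 M2.
pose d := expR (Num.min 0 ((x - 4 * M) / (2 * M))).
have d0 : 0 < d by exact: expR_gt0.
have d1 : d <= 1 by rewrite /d -[leRHS]expR0 ler_expR ge_min lexx.
pose r1 := 2 * M * (1 + d); pose r2 := Num.max x (4 * M).
have h1 : 2 * M < r1 by rewrite /r1 ltr_pMr// ltrDl.
have x1 : tortoise M r1 <= x.
  have -> : tortoise M r1 = r1 + 2 * M * Num.min 0 ((x - 4 * M) / (2 * M)).
    rewrite /tortoise (_ : r1 / (2 * M) - 1 = d) ?expRK//.
    by rewrite /r1 [2 * M * _]mulrC mulfK// addrAC subrr add0r.
  apply: (@le_trans _ _ (4 * M + 2 * M * ((x - 4 * M) / (2 * M)))).
    apply: lerD; first by rewrite /r1; move: d1 hM; nra.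
    by rewrite ler_pM2l// ge_min lexx orbT.
  by rewrite [2 * M * (_ / _)]mulrC divfK// addrCA subrr addr0.
have r24 : 4 * M <= r2 by rewrite le_max lexx orbT.
have h2 : 2 * M < r2 by move: r24 hM; lra.
have x2 : x <= tortoise M r2.
  rewrite /tortoise; apply: (@le_trans _ _ r2); first by rewrite le_max lexx.
  rewrite lerDl mulr_ge0//; first exact: ltW.
  by apply: ln_ge0; rewrite lerBrDr ler_pdivlMr//; move: r24; lra.
have r12 : r1 <= r2.
  by rewrite /r1; move: r24 d1 hM; nra.
have cT : {within `[r1, r2], continuous (tortoise M)}.
  apply: within_of_for => r /=; rewrite in_itv/= => /andP[rr _].
  exact: is_derive_continuous (tortoise_is_derive (lt_le_trans h1 rr)).
have [|r rI <-] := @IVT _ (tortoise M) r1 r2 x r12 cT.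
  by rewrite ge_min x1 le_max x2 orbT.
by exists r; split=> //; move: rI; rewrite in_itv/= => /andP[+ _]; exact: lt_le_trans.
Qed.

(** The area radius as a function of the tortoise coordinate. *)
Definition area_radius x := xget 0 [set r | 2 * M < r /\ tortoise M r = x].

Lemma area_radiusP x : 2 * M < area_radius x /\ tortoise M (area_radius x) = x.
Proof.
rewrite /area_radius; case: xgetP => [r _ //|H].
by have [r hr] := tortoise_surj x; have := H r.
Qed.

Lemma area_radiusK r : 2 * M < r -> area_radius (tortoise M r) = r.
Proof. by move=> hr; have [h E] := area_radiusP (tortoise M r); exact: tortoise_inj. Qed.

Lemma area_radius_lt x1 x2 : (area_radius x1 < area_radius x2) = (x1 < x2).
Proof.
have [h1 E1] := area_radiusP x1; have [h2 E2] := area_radiusP x2.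
by rewrite -(tortoise_ltE h1 h2) E1 E2.
Qed.

Lemma area_radius_cont x : {for x, continuous area_radius}.
Proof.
have [h E] := area_radiusP x; apply/cvgrPdist_lt => eps e0.
set r := area_radius x in h E *.
pose d := Num.min eps (r - 2 * M) / 2.
have d0 : 0 < d by rewrite divr_gt0// lt_min e0 subr_gt0.
have de : d < eps.
  by rewrite /d ltr_pdivrMr// (@le_lt_trans _ _ eps)// ?ge_min ?lexx// ltr_pMr// ltr1n.
have dr : d < r - 2 * M.
  have : Num.min eps (r - 2 * M) <= r - 2 * M by rewrite ge_min lexx orbT.
  by rewrite /d; move: h; lra.
have l1 : 2 * M < r - d by lra.
have l2 : 2 * M < r + d by lra.
have a1 : tortoise M (r - d) < x by rewrite -E tortoise_ltE//; lra.
have a2 : x < tortoise M (r + d) by rewrite -E tortoise_ltE//; lra.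
have xI : tortoise M (r - d) < x < tortoise M (r + d) by rewrite a1.
apply: filterS (near_itv xI) => y /andP[y1 y2].
have b1 : r - d < area_radius y by rewrite -(area_radiusK l1) area_radius_lt.
have b2 : area_radius y < r + d by rewrite -(area_radiusK l2) area_radius_lt.
by rewrite ltr_distlC; apply/andP; split; lra.
Qed.

End Tortoise.

(** ** The energy potential *)

Lemma density_algebra (R : realFieldType) (sg E P f r1 t1 : R) : sg * sg = 1 -> 0 < sg * r1 -> 0 < f ->
  f * t1 ^+ 2 < r1 ^+ 2 / f -> `|P| <= E -> 0 <= sg * (r1 * (E / f) + t1 * P).
Proof.
move=> s1 sr f0 sl PE; have E0 := le_trans (normr_ge0 _) PE.
have h : (f * t1) ^+ 2 < (sg * r1) ^+ 2.
  have : f * (f * t1 ^+ 2) < f * (r1 ^+ 2 / f) by rewrite ltr_pM2l.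
  rewrite [f * (_ / f)]mulrC divfK ?lt0r_neq0//.
  have -> : (sg * r1) ^+ 2 = r1 ^+ 2 by rewrite exprMn expr2 s1 mul1r.
  by rewrite exprMn [f ^+ 2]expr2 mulrA.
have h2 : `|f * t1| < sg * r1.
  rewrite ltNge; apply/negP => le.
  by have := ler_pM (ltW sr) (ltW sr) le le; rewrite -!expr2 real_normK ?num_real// leNgt h.
have h3 : `|f * t1 * P| <= sg * r1 * E by rewrite normrM; apply: ler_pM => //; exact: ltW.
have -> : sg * (r1 * (E / f) + t1 * P) = (sg * r1 * E + sg * (f * t1 * P)) / f.
  by rewrite mulrDl !mulrDr; congr (_ + _); [ring|field; exact: lt0r_neq0].
rewrite divr_ge0 ?(ltW f0)//.
have n1 : `|sg| = 1.
  by apply/eqP; rewrite -(@eqrXn2 _ 2)// expr1n real_normK ?num_real// expr2 s1.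
have : `|sg * (f * t1 * P)| <= sg * r1 * E by rewrite normrM n1 mul1r.
by rewrite ler_norml => /andP[+ _]; rewrite -subr_ge0 opprK addrC.
Qed.

Section Potential.
Variables (R : realType) (M : R).
Hypothesis hM : 0 < M.
Implicit Types t r : R.

Definition time_int (k : R -> R -> R) t r := oint 0 t (k ^~ r).

Section TimeIntegral.
Variables k kt kr : R -> R -> R.
Hypothesis Ck : C1 M k kt kr.

Let section_t (h : R -> R -> R) t r : {for (t, r), continuous (fun z : R * R => h z.1 z.2)} ->
  {for t, continuous (h ^~ r)} /\ {for r, continuous (h t)}.
Proof.
move=> ch; have [c1 c2] := section_continuous (f := fun t r => h t r) ch.
by split.
Qed.

Let bounds t : exists b c : R, [/\ b < 0 < c & b < t < c].
Proof.
exists (- `|t| - 1), (`|t| + 1); have := ler_norm t; have := ler_norm (- t); have := normr_ge0 t.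
by rewrite normrN => *; split; apply/andP; split; lra.
Qed.

Lemma time_int_dt t r : 2 * M < r -> is_derive t 1 (fun t => time_int k t r) (k t r).
Proof.
move=> hr; have [b [c [z0 zt]]] := bounds t.
apply: (oint_is_derive z0 zt) => x _.
by have [_ _ ck _ _] := Ck x hr; case: (section_t ck).
Qed.

Lemma time_int_dr t r : 2 * M < r -> is_derive r 1 (time_int k t) (time_int kr t r).
Proof.
move=> hr; have N := near_r hr.
have D a b : a <= b -> is_derive r 1 (fun r => integ a b (k ^~ r)) (integ a b (kr ^~ r)).
  move=> ab; apply: (@integ_is_derive R r a b (fun r t => k t r) (fun r t => kr t r) ab).
  - apply: filterS N => r' hr' y _.
    by have [_ _ ck _ _] := Ck y hr'; case: (section_t ck).
  - by apply: filterS N => r' hr' y _; have [_ d _ _ _] := Ck y hr'.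
  - move=> y _; have [_ _ _ _ ck] := Ck y hr.
    apply: (@continuous_comp _ _ _ (fun z : R * R => (z.2, z.1)) (fun z => kr z.1 z.2)) => //.
    exact: (@cvg_pair _ _ _ (nbhs (r, y)) (nbhs y) (nbhs r) _ _ _ snd fst (@cvg_snd _ _ _ _ _) (@cvg_fst _ _ _ _ _)).
rewrite /time_int /oint; case: (leP 0 t) => t0; first exact: D.
by apply: derive1_opp; apply: D; exact: ltW.
Qed.

Lemma time_int_primitive t r : 2 * M < r -> time_int kt t r = k t r - k 0 r.
Proof.
move=> hr; apply: (oint_primitive (g := k ^~ r)) => x _; have [d _ _ ck _] := Ck x hr.
  exact: d.
by case: (section_t ck).
Qed.

Lemma time_int_curve (t r : R -> R) (s dt dr : R) : 2 * M < r s ->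
  is_derive s 1 t dt -> is_derive s 1 r dr ->
  is_derive s 1 (fun s => time_int k (t s) (r s)) (k (t s) (r s) * dt + time_int kr (t s) (r s) * dr).
Proof.
move=> hr dtE drE; have [_ _ ck _ _] := Ck (t s) hr.
apply: (@chain2 R (time_int k) k (time_int kr) t r s dt dr [set z : R * R | 2 * M < z.2]) => //.
- rewrite (_ : [set z : R * R | 2 * M < z.2] = snd @^-1` [set x | 2 * M < x])//.
  by apply: open_comp; [move=> z _; exact: cvg_snd|exact: open_gt].
- by move=> x y hy; exact: time_int_dt.
- exact: time_int_dr.
Qed.
End TimeIntegral.

Variables e p T : R -> R -> R.
Hypothesis cur : morawetz_currents M e p T.

(** The function with differential p dt + e dx, where x is the tortoise coordinate
    and f dx = dr; it exists because e_t = f p_r. It is integrated along r at t = 0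
    and then along t, and 3M is an arbitrary base point in the exterior. *)
Definition potential t r := oint (3 * M) r (fun r => e 0 r / lapse2 M r) + time_int p t r.

Lemma cont_lapse2V r : 2 * M < r -> {for r, continuous (fun r => (lapse2 M r)^-1)}.
Proof.
move=> hr; have d := derive1_inv (lapse2_neq0 hM hr) (lapse2_is_derive M (r_neq0 hM hr)).
exact: is_derive_continuous d.
Qed.

Lemma potential_derive t r : 2 * M < r ->
  [/\ is_derive t 1 (fun t => potential t r) (p t r),
      is_derive r 1 (potential t) (e t r / lapse2 M r) &
      {for (t, r), continuous (fun z : R * R => p z.1 z.2)}].
Proof.
move=> hr; have [et [er [pt [pr [j [jt [jr [k [kt [kr [[Ce Cp _ _] [_ H]]]]]]]]]]]] := cur.
have [_ _ cp _ _] := Cp t r hr; split => //.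
  by rewrite -[p t r]add0r; exact: (derive1_add (derive1_cst _ t) (time_int_dt Cp t hr)).
have M3 : 2 * M < 3 * M by move: hM; lra.
have E : time_int pr t r = (e t r - e 0 r) / lapse2 M r.
  rewrite -(time_int_primitive Ce t hr) mulrC /time_int /oint.
  have f0 := lapse2_neq0 hM hr.
  have cw a b : {within `[a, b], continuous (et ^~ r)}.
    apply: within_of_for => x _; have [_ _ _ ck _] := Ce x r hr.
    exact: (section_continuous (f := et) ck).2.
  have eE a b : integ a b (pr ^~ r) = (lapse2 M r)^-1 * integ a b (et ^~ r).
    rewrite -integZ//; apply: eq_integ => x _; have [-> _ _ _ _] := H x r hr.
    by rewrite mulrA mulVf// mul1r.
  by case: (leP 0 t) => _; rewrite eE// mulrN.
have -> : e t r / lapse2 M r = e 0 r / lapse2 M r + time_int pr t r.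
  by rewrite E mulrBl addrC subrK.
apply: derive1_add; last exact: time_int_dr Cp _ _ hr.
pose b := (2 * M + Num.min r (3 * M)) / 2; pose c := Num.max r (3 * M) + 1.
have m1 : 2 * M < Num.min r (3 * M) by rewrite lt_min hr.
have b1 : 2 * M < b by rewrite /b; move: m1; lra.
have b2 : b < Num.min r (3 * M) by rewrite /b; move: m1; lra.
move: b2; rewrite lt_min => /andP[br b3].
have : Num.max r (3 * M) < c by rewrite /c ltrDl.
rewrite gt_max => /andP[rc c3].
apply: (@oint_is_derive R (3 * M) r (fun r => e 0 r / lapse2 M r) b c); rewrite ?br ?b3//.
move=> x /andP[bx _]; have hx := lt_le_trans b1 bx.
apply: cvgM; last exact: cont_lapse2V.
by have [_ d _ _ _] := Ce 0 x hx; exact: is_derive_continuous d.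
Qed.

(** The flux of the energy current through a curve is the increment of the
    potential. *)
Lemma potential_curve (t r : R -> R) (s dt dr : R) : 2 * M < r s ->
  is_derive s 1 t dt -> is_derive s 1 r dr ->
  is_derive s 1 (fun s => potential (t s) (r s))
    (p (t s) (r s) * dt + e (t s) (r s) / lapse2 M (r s) * dr).
Proof.
move=> hr dtE drE; have [_ d cp] := potential_derive (t s) hr.
apply: (@chain2 R potential p (fun t r => e t r / lapse2 M r) t r s dt dr [set z : R * R | 2 * M < z.2]) => //.
- rewrite (_ : [set z : R * R | 2 * M < z.2] = snd @^-1` [set x | 2 * M < x])//.
  by apply: open_comp; [move=> z _; exact: cvg_snd|exact: open_gt].
- by move=> x y hy; case: (potential_derive x hy).
Qed.

Lemma flux_le_density t r : 2 * M < r -> `|p t r| <= e t r.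
Proof.
move=> hr; have [et [er [pt [pr [j [jt [jr [k [kt [kr [_ [_ H]]]]]]]]]]]] := cur.
have [_ _ _ h1 h2] := H t r hr.
have := le_trans (normr_ge0 _) h1; have := le_trans (normr_ge0 _) h2.
rewrite !pmulr_rge0 ?divr_gt0// => *; rewrite ler_norml; apply/andP; split; lra.
Qed.

(** The derivative along an outgoing or ingoing null line is e + p or e - p. *)
Lemma potential_null (sg c r1 r2 : R) : `|sg| <= 1 -> 2 * M < r1 -> r1 <= r2 ->
  potential (c + sg * tortoise M r1) r1 <= potential (c + sg * tortoise M r2) r2.
Proof.
move=> sg1 h1 r12.
pose g r := potential (c + sg * tortoise M r) r.
have D r : 2 * M < r -> is_derive r 1 g ((sg * p (c + sg * tortoise M r) r + e (c + sg * tortoise M r) r) / lapse2 M r).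
  move=> hr; have dt := derive1_add (derive1_cst c r) (derive1_scale (tortoise_is_derive hM hr) sg).
  apply: (derive1_eq (potential_curve hr dt (is_derive_id r 1))).
  by rewrite add0r; move: (p _ _) (e _ _) (lapse2 M r)^-1 => *; ring.
apply: (derive_ge0_le (f := g) r12) => r /andP[hr1 _]; have hr := lt_le_trans h1 hr1.
  exact: D.
have := flux_le_density (c + sg * tortoise M r) hr; set P := p _ _; set E := e _ _ => PE.
rewrite divr_ge0//; last exact: ltW (lapse2_gt0 hM hr).
have : `|sg * P| <= E by rewrite normrM (le_trans _ PE)// ler_piMl.
by rewrite ler_norml => /andP[+ _]; rewrite -subr_ge0 opprK addrC.
Qed.

(** Moving along one null line and then along the other. *)
Lemma potential_spacelike (q q' : R * R) : 2 * M < q.2 -> 2 * M < q'.2 ->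
  null_u M q' <= null_u M q -> null_v M q <= null_v M q' ->
  potential q.1 q.2 <= potential q'.1 q'.2.
Proof.
case: q q' => [t r] [t' r']; rewrite /null_u /null_v /= => hr hr' uu vv.
pose x := (t' + tortoise M r' - (t - tortoise M r)) / 2.
have [h E] := area_radiusP hM x; set rho := area_radius M x in h E.
have rr : r <= rho.
  by rewrite leNgt -(tortoise_ltE hM h hr) E -leNgt /x; lra.
have rr' : rho <= r'.
  by rewrite leNgt -(tortoise_ltE hM hr' h) E -leNgt /x; lra.
have n1 : `|1 : R| <= 1 by rewrite normr1.
have n2 : `|-1 : R| <= 1 by rewrite normrN normr1.
have := potential_null (t - tortoise M r) n1 hr rr.
have := potential_null (t' + tortoise M r') n2 h rr'.
rewrite !mul1r !mulN1r subrK addrK E => h2 h1; apply: le_trans h1 _.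
apply: le_trans h2; rewrite le_eqVlt; apply/orP; left; apply/eqP.
by congr (potential _ _); rewrite /x; lra.
Qed.

(** *** The energy of a surface *)

Section SurfaceEnergy.
Variable S : sph_surface R.
Hypothesis hS : spacelike_surface M S.
Local Notation t := (curve_t S).
Local Notation r := (curve_r S).
Local Notation t' := (derive1 (curve_t S)).
Local Notation r' := (derive1 (curve_r S)).
Local Notation mu := (@lebesgue_measure R).

Definition surface_potential s := potential (t s) (r s).

(** The spacelike condition f t'^2 < r'^2 / f excludes r' = 0. *)
Lemma surface_sign : exists sg : R, sg * sg = 1 /\ forall s, 0 < sg * r' s /\ Num.sg (r' s) = sg.
Proof.
have H s s' : 0 < r' s -> 0 < r' s'.
  move=> h; rewrite lt_neqAle eq_sym (surface_r'_neq0 hM hS) /= leNgt; apply/negP => h'.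
  have c a b : {within `[a, b], continuous r'}.
    by apply: within_of_for => x _; case: (surface_cont hS x).
  have [ss|ss] := leP s s'.
    have [|x _ /eqP] := @IVT _ r' s s' 0 ss (c _ _); last by rewrite (negbTE (surface_r'_neq0 hM hS x)).
    by rewrite ge_min le_max (ltW h) (ltW h') orbT.
  have [|x _ /eqP] := @IVT _ r' s' s 0 (ltW ss) (c _ _); last by rewrite (negbTE (surface_r'_neq0 hM hS x)).
  by rewrite ge_min le_max (ltW h) (ltW h') orbT.
have [h|h] := ltP 0 (r' 0).
  exists 1; split; first by rewrite mul1r.
  by move=> s; have := H 0 s h; rewrite mul1r => h'; rewrite gtr0_sg.
exists (-1); split; first by rewrite mulrNN mul1r.
move=> s; have h' : r' s < 0.
  rewrite lt_neqAle (surface_r'_neq0 hM hS) /= leNgt; apply/negP => h'.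
  by have := H s 0 h'; rewrite ltNge h.
by rewrite mulN1r oppr_gt0 ltr0_sg.
Qed.

Lemma surface_potential_is_derive (s : R) :
  is_derive s 1 surface_potential (r' s * (e (t s) (r s) / lapse2 M (r s)) + t' s * p (t s) (r s)).
Proof.
have [dt dr] := surface_derive hS s.
apply: (derive1_eq (potential_curve (surface_r hS s) dt dr)).
by rewrite addrC mulrC [p _ _ * _]mulrC.
Qed.

Let density s := r' s * (e (t s) (r s) / lapse2 M (r s)) + t' s * p (t s) (r s).

Let density_ge0 sg s : sg * sg = 1 -> 0 < sg * r' s -> 0 <= sg * density s.
Proof.
move=> s1 sr; have hr := surface_r hS s; have f0 := lapse2_gt0 hM hr.
have sl := surface_spacelike hS s; have pe := flux_le_density (t s) hr.
rewrite /density; move: (e _ _) (p _ _) (lapse2 M (r s)) (r' s) (t' s) f0 sl pe sr => E P f r1 t1 f0 sl pe sr.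
exact: density_algebra s1 sr f0 sl pe.
Qed.

Let density_cont s : {for s, continuous density}.
Proof.
have hr := surface_r hS s; have [ct cr] := surface_cont hS s.
have [et [er [pt [pr [j [jt [jr [k [kt [kr [[Ce Cp _ _] _]]]]]]]]]]] := cur.
have [dt dr] := surface_derive hS s.
have C (h : R -> R -> R) : {for (t s, r s), continuous (fun z : R * R => h z.1 z.2)} ->
    {for s, continuous (fun s => h (t s) (r s))}.
  move=> ch; apply: (@continuous_comp _ _ _ (fun s => (t s, r s)) (fun z => h z.1 z.2)) => //.
  exact: (@cvg_pair _ _ _ (nbhs s) (nbhs (t s)) (nbhs (r s)) _ _ _ _ _ (is_derive_continuous dt) (is_derive_continuous dr)).
have [_ _ ce _ _] := Ce (t s) (r s) hr; have [_ _ cp _ _] := Cp (t s) (r s) hr.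
apply: cvgD; apply: cvgM => //; [|exact: C].
apply: cvgM; first exact: C.
exact: (@continuous_comp _ _ _ r (fun r => (lapse2 M r)^-1) s (is_derive_continuous dr) (cont_lapse2V hr)).
Qed.

Variable Energy : \bar R.
Hypothesis EnergyE : Energy = (\int[mu]_s (Num.sg (r' s) / 9 * density s)%:E)%E.
Variable sg : R.
Hypotheses (sg1 : sg * sg = 1) (sgr : forall s, 0 < sg * r' s /\ Num.sg (r' s) = sg).

Let c9 : R := sg / 9.

Let int_seg a b : a <= b -> (\int[mu]_(s in `[a, b]) (c9 * density s)%:E)%E =
  (c9 * (surface_potential b - surface_potential a))%:E.
Proof.
move=> ab; have cd : {within `[a, b], continuous density} by apply: within_of_for => s _.
rewrite -integ_EFin; last by move=> s; apply: cvgM; [exact: cvg_cst|exact: cd].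
rewrite integZ//; congr (_ * _)%:E; apply: integ_FTC2 => // s _; exact: surface_potential_is_derive.
Qed.

Let d0 s : 0 <= c9 * density s.
Proof. by rewrite /c9 mulrAC divr_ge0//; apply: density_ge0 => //; case: (sgr s). Qed.

Let md : measurable_fun [set: R] (fun s => (c9 * density s)%:E).
Proof.
apply/measurable_EFinP; apply: continuous_measurable_fun => s.
by apply: cvgM; [exact: cvg_cst|exact: density_cont].
Qed.

Let EE : Energy = (\int[mu]_s (c9 * density s)%:E)%E.
Proof. by rewrite EnergyE; apply: eq_integral => s _; have [_ ->] := sgr s. Qed.

(** The energy is the supremum of the increments of the potential over segments of
    the curve, since its density is nonnegative; infinite energy is allowed. *)
Lemma energy_ge a b : ((c9 * (surface_potential b - surface_potential a))%:E <= Energy)%E.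
Proof.
have [ab|ba] := leP a b.
  rewrite -int_seg// EE; apply: ge0_subset_integral => //.
  by move=> s _; rewrite lee_fin.
apply: (@le_trans _ _ 0%E); last by rewrite EE integral_ge0// => s _; rewrite lee_fin.
rewrite lee_fin -oppr_ge0 -mulrN opprB -lee_fin -(int_seg (ltW ba)).
by apply: integral_ge0 => s _; rewrite lee_fin.
Qed.

Lemma energy_le (y : \bar R) :
  (forall a b, a <= b -> ((c9 * (surface_potential b - surface_potential a))%:E <= y)%E) ->
  (Energy <= y)%E.
Proof.
move=> H; rewrite EE.
pose F n := `[- n%:R, n%:R]%classic : set R.
have FU : \bigcup_n F n = [set: R].
  apply/seteqP; split => // x _; exists (Num.truncn `|x|).+1 => //.
  rewrite /F /= in_itv/= -ler_norml; exact: ltW (truncnS_gt _).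
have nF : nondecreasing_seq F.
  move=> m n mn; apply/subsetPset => x; rewrite /F /= !in_itv/= => /andP[x1 x2].
  have mnR : (m%:R : R) <= n%:R by rewrite ler_nat.
  by apply/andP; split; [apply: le_trans x1; rewrite lerN2|apply: le_trans x2 _].
rewrite -FU.
have C : (\int[mu]_(s in F n) (c9 * density s)%:E)%E @[n --> \oo] -->
    (\int[mu]_(s in \bigcup_n F n) (c9 * density s)%:E)%E.
  apply: ge0_nondecreasing_set_cvg_integral => //.
  - by move=> i; exact: measurable_itv.
  - by move=> i; apply: measurable_funTS; exact: md.
  - by move=> i s _; rewrite lee_fin.
rewrite -(cvg_lim _ C)//; apply: lime_le; first by apply/cvg_ex; eexists; exact: C.
apply: nearW => n; rewrite /F int_seg; first by apply: H; rewrite -subr_ge0 opprK addr_ge0.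
by rewrite -subr_ge0 opprK addr_ge0.
Qed.

End SurfaceEnergy.

End Potential.

(** * Causal structure of the region *)

Lemma mulr1_eq1N (R : realFieldType) (sg : R) : sg * sg = 1 -> sg = 1 \/ sg = -1.
Proof.
by move=> /eqP; rewrite -expr2 sqrf_eq1 => /orP[/eqP|/eqP]; [left|right].
Qed.

Lemma null_algebra (R : realFieldType) (sg f r1 t1 : R) : sg * sg = 1 -> 0 < sg * r1 -> 0 < f ->
  f * t1 ^+ 2 < r1 ^+ 2 / f -> sg * (t1 - f^-1 * r1) < 0 /\ 0 < sg * (t1 + f^-1 * r1).
Proof.
move=> s1 sr f0 sl; have fn := lt0r_neq0 f0.
pose a := sg * (f^-1 * r1); have a0 : 0 < a by rewrite /a mulrCA mulr_gt0 ?invr_gt0.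
pose b := sg * t1.
have ab : b ^+ 2 < a ^+ 2.
  have -> : b ^+ 2 = f^-1 * (f * t1 ^+ 2) by rewrite /b exprMn expr2 s1 mul1r mulrA mulVf// mul1r.
  have -> : a ^+ 2 = f^-1 * (r1 ^+ 2 / f) by rewrite /a exprMn expr2 s1 mul1r exprMn; field.
  by rewrite ltr_pM2l ?invr_gt0.
have ba : `|b| < a.
  rewrite ltNge; apply/negP => le.
  by have := ler_pM (ltW a0) (ltW a0) le le; rewrite -!expr2 real_normK ?num_real// leNgt ab.
move: ba; rewrite ltr_norml => /andP[b1 b2]; rewrite mulrBr mulrDr -/a -/b; split; lra.
Qed.

Lemma height_algebra (R : realFieldType) (x y : R * R) e : (x.1 - y.1) * (x.2 - y.2) <= 0 ->
  `|x.2 - x.1 - (y.2 - y.1)| <= e -> `|x.2 + x.1 - (y.2 + y.1)| <= e.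
Proof.
case: x y => [u v] [u' v'] /= h; apply: le_trans; rewrite leNgt; apply/negP => lt.
have := ltr_pM (normr_ge0 _) (normr_ge0 _) lt lt.
by rewrite -!expr2 !real_normK ?num_real//; nra.
Qed.

Lemma ball_algebra (R : realType) (a b c d x y l1 l2 e : R) :
  `|b - a - (y + l1 - (x + l1))| <= e / 2 -> `|d - c - (y + l2 - (x + l2))| <= e / 2 ->
  `|b + a - (y + l1 + (x + l1))| <= e / 2 -> `|d + c - (y + l2 + (x + l2))| <= e / 2 -> 0 < e ->
  ball ((a + c) / 2, (b + d) / 2) e (x + (l1 + l2) / 2, y + (l1 + l2) / 2).
Proof.
rewrite !ler_norml => /andP[? ?] /andP[? ?] /andP[? ?] /andP[? ?] e0.
by split; rewrite /ball /= ltr_norml; apply/andP; split; lra.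
Qed.

Lemma beyond_algebra (R : realFieldType) (sg u v u' v' x y : R) :
  0 < sg * (u - u') -> 0 < sg * (v' - v) -> sg * (v' - u') <= sg * (y - x) ->
  (x - u') * (y - v') <= 0 -> 0 < sg * (u - x) /\ 0 < sg * (y - v).
Proof.
move=> h1 h2 h3 h4.
have h5 : (sg * (x - u')) * (sg * (y - v')) <= 0.
  by rewrite mulrACA -expr2 mulr_ge0_le0 ?sqr_ge0.
have h6 : sg * (x - u') <= sg * (y - v') by move: h3; rewrite !mulrBr; lra.
move: h5 h6 h1 h2; rewrite !mulrBr => h5 h6 h1 h2.
by split; nra.
Qed.

Lemma outward_algebra (R : realFieldType) (sg a b e : R) : sg * sg = 1 -> 0 < e ->
  sg * (b + sg * e - (a - sg * e)) <= sg * (b - a) -> False.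
Proof.
move=> s1 e0; rewrite (_ : sg * (b + _ - _) = sg * (b - a) + sg * sg * (2 * e)); last by ring.
by rewrite s1; lra.
Qed.

Section Region.
Variables (R : realType) (M : R).
Hypothesis hM : 0 < M.
Implicit Types (z q x y : R * R) (S : sph_surface R).
Local Notation pen := (penrose M).

Definition square : set (R * R) := [set z | - (pi / 2) < z.1 < pi / 2 /\ - (pi / 2) < z.2 < pi / 2].

Definition penrose_inv z : R * R :=
  ((tan z.1 + tan z.2) / 2, area_radius M ((tan z.2 - tan z.1) / 2)).

Lemma penrose_square q : square (pen q).
Proof. by split; rewrite /= atan_gtNpi2 atan_ltpi2. Qed.

Lemma penrose_invK z : square z -> pen (penrose_inv z) = z.
Proof.
move=> [z1 z2]; have [_ E] := area_radiusP hM ((tan z.2 - tan z.1) / 2).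
rewrite /penrose /null_u /null_v /penrose_inv /= E -mulrDl -mulrBl.
rewrite (_ : _ + _ - (_ - _) = 2 * tan z.1); last by ring.
rewrite (_ : _ + _ + (_ - _) = 2 * tan z.2); last by ring.
by rewrite ![2 * _]mulrC !mulfK// !tanK ?in_itv//; case: z z1 z2 {E}.
Qed.

Lemma penroseK q : 2 * M < q.2 -> penrose_inv (pen q) = q.
Proof.
case: q => [t r] /= hr; rewrite /penrose_inv /penrose /null_u /null_v /= !atanK.
rewrite (_ : _ + _ = t * 2); last by ring.
rewrite (_ : _ + _ - _ = tortoise M r * 2) ?mulfK// ?area_radiusK//.
by ring.
Qed.

Lemma penrose_inv_cont z : square z -> {for z, continuous penrose_inv}.
Proof.
move=> [z1 z2]; have c1 : {for z.1, continuous (@tan R)} by apply: continuous_tan; rewrite gt_eqF// cos_gt0_pihalf.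
have c2 : {for z.2, continuous (@tan R)} by apply: continuous_tan; rewrite gt_eqF// cos_gt0_pihalf.
have C1 : {for z, continuous (fun z : R * R => tan z.1)} by exact: (cvg_comp fst (@tan R) (@cvg_fst _ _ _ _ _) c1).
have C2 : {for z, continuous (fun z : R * R => tan z.2)} by exact: (cvg_comp snd (@tan R) (@cvg_snd _ _ _ _ _) c2).
apply: (@cvg_pair _ _ _ (nbhs z) (nbhs ((tan z.1 + tan z.2) / 2)) (nbhs (area_radius M ((tan z.2 - tan z.1) / 2))) _ _ _ (fun z => (tan z.1 + tan z.2) / 2) (fun z => area_radius M ((tan z.2 - tan z.1) / 2))).
  by apply: cvgM; [exact: cvgD|exact: cvg_cst].
apply: (@cvg_comp _ _ _ (fun z : R * R => (tan z.2 - tan z.1) / 2) (area_radius M)); last exact: area_radius_cont.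
by apply: cvgM; [exact: cvgB|exact: cvg_cst].
Qed.

Lemma open_square : open square.
Proof.
rewrite (_ : square = fst @^-1` `]- (pi / 2), pi / 2[ `&` snd @^-1` `]- (pi / 2), pi / 2[).
  by apply: openI; apply: open_comp; [|exact: itv_open| |exact: itv_open] => z _; [exact: cvg_fst|exact: cvg_snd].
by apply/seteqP; split => z; rewrite /square /= !in_itv.
Qed.

Section OpenImage.
Variable Omega : set (R * R).
Hypotheses (oO : open Omega) (OM : Omega `<=` [set q | 2 * M < q.2]).

Lemma penrose_open : open (pen @` Omega).
Proof.
rewrite openE => z [q Oq <-]; have sq := penrose_square q.
have N : nbhs (pen q) (penrose_inv @^-1` Omega).
  by apply: (penrose_inv_cont sq); rewrite penroseK; [exact: open_nbhs_nbhs|exact: OM].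
have N2 : nbhs (pen q) square by apply: open_nbhs_nbhs; split => //; exact: open_square.
apply: (@filterS2 _ (nbhs (pen q)) _ _ _ _ _ N N2) => y yO ys.
by exists (penrose_inv y) => //; exact: penrose_invK.
Qed.
End OpenImage.

(** ** Spacelike curves *)

(** In the coordinates (atan u, atan v), two points of a spacelike curve differ by
    increments of opposite signs. The weak inequality passes to the closure. *)
Definition achronal (A : set (R * R)) :=
  forall x y, A x -> A y -> (x.1 - y.1) * (x.2 - y.2) <= 0.

Lemma achronal_closure A : achronal A -> achronal (closure A).
Proof.
have clos (c1 c2 : R) : closed [set z : R * R | (z.1 - c1) * (z.2 - c2) <= 0].
  rewrite (_ : mkset _ = (fun z : R * R => (z.1 - c1) * (z.2 - c2)) @^-1` [set t | t <= 0])//.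
  apply: closed_comp; last exact: closed_le.
  by move=> z _; apply: cvgM; apply: cvgB; [exact: cvg_fst|exact: cvg_cst|exact: cvg_snd|exact: cvg_cst].
move=> aA.
have H x y : closure A x -> A y -> (x.1 - y.1) * (x.2 - y.2) <= 0.
  move=> clx Ay; have := clos y.1 y.2; rewrite closure_id => E.
  have : closure [set z : R * R | (z.1 - y.1) * (z.2 - y.2) <= 0] x.
    by apply: (closureS _ clx) => z Az; exact: aA.
  by rewrite -E.
move=> x y clx cly; have := clos x.1 x.2; rewrite closure_id => E.
have : closure [set z : R * R | (z.1 - x.1) * (z.2 - x.2) <= 0] y.
  by apply: (closureS _ cly) => z Az; rewrite /= -mulrNN !opprB; exact: H.
by rewrite -E /= -mulrNN !opprB.
Qed.

Lemma atan_ltE (a b : R) : (atan a < atan b) = (a < b).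
Proof.
apply/idP/idP; last exact: lt_atan.
by apply: contraTT; rewrite -!leNgt; exact: le_atan.
Qed.

Lemma atan_leE (a b : R) : (atan a <= atan b) = (a <= b).
Proof. by rewrite !leNgt atan_ltE. Qed.

Section Curve.
Variable S : sph_surface R.
Hypothesis hS : spacelike_surface M S.
Local Notation P := (pen \o curve S).

Lemma null_derivatives (sg s : R) : sg * sg = 1 -> 0 < sg * derive1 (curve_r S) s ->
  exists du dv, [/\ is_derive s 1 (fun s => null_u M (curve S s)) du,
    is_derive s 1 (fun s => null_v M (curve S s)) dv, sg * du < 0 & 0 < sg * dv].
Proof.
move=> s1 sr; have [dt dr] := surface_derive hS s; have hr := surface_r hS s.
have dx := derive1_comp (tortoise_is_derive hM hr) dr.
have f0 := lapse2_gt0 hM hr.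
exists (derive1 (curve_t S) s - (lapse2 M (curve_r S s))^-1 * derive1 (curve_r S) s).
exists (derive1 (curve_t S) s + (lapse2 M (curve_r S s))^-1 * derive1 (curve_r S) s).
have [h1 h2] := null_algebra s1 sr f0 (surface_spacelike hS s).
by split; [exact: derive1_sub dt dx|exact: derive1_add dt dx| |].
Qed.

Lemma null_monotone sg (s s' : R) : sg * sg = 1 -> (forall s, 0 < sg * derive1 (curve_r S) s) -> s < s' ->
  0 < sg * (null_u M (curve S s) - null_u M (curve S s')) /\
  0 < sg * (null_v M (curve S s') - null_v M (curve S s)).
Proof.
move=> s1 sr ss.
have D (x : R) : exists duv : R * R, [/\ is_derive x 1 (fun s => null_u M (curve S s)) duv.1,
    is_derive x 1 (fun s => null_v M (curve S s)) duv.2, sg * duv.1 < 0 & 0 < sg * duv.2].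
  by have [du [dv H]] := null_derivatives s1 (sr x); exists (du, dv).
have [duv H] := choice D.
have cu (g : R -> R) (dg : R -> R) : (forall x : R, is_derive x 1 g (dg x)) -> {within `[s, s'], continuous g}.
  by move=> gd; apply: within_of_for => x _; exact: is_derive_continuous (gd x).
split.
  have d (x : R) : is_derive x 1 (fun s => null_u M (curve S s)) (duv x).1 by case: (H x).
  have [c _ E] := @MVT _ _ _ s s' ss (fun c _ => d c) (cu _ _ d).
  have [_ _ h _] := H c; rewrite -opprB E mulrN -mulNr mulrA mulr_gt0 ?subr_gt0//.
  by rewrite mulNr oppr_gt0.
have d (x : R) : is_derive x 1 (fun s => null_v M (curve S s)) (duv x).2 by case: (H x).
have [c _ E] := @MVT _ _ _ s s' ss (fun c _ => d c) (cu _ _ d).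
by have [_ _ _ h] := H c; rewrite E mulrA mulr_gt0 ?subr_gt0.
Qed.

Lemma sign_atan (sg a b : R) : sg * sg = 1 -> (0 < sg * (atan a - atan b)) = (0 < sg * (a - b)).
Proof.
move=> s1; have := mulr1_eq1N s1.
case=> ->; rewrite ?mul1r ?mulN1r ?oppr_gt0 ?subr_gt0 ?subr_lt0.
  exact: atan_ltE.
exact: atan_ltE.
Qed.

Lemma curve_monotone sg (s s' : R) : sg * sg = 1 -> (forall s, 0 < sg * derive1 (curve_r S) s) -> s < s' ->
  0 < sg * ((P s).1 - (P s').1) /\ 0 < sg * ((P s').2 - (P s).2).
Proof.
by move=> s1 sr ss; have [h1 h2] := null_monotone s1 sr ss; rewrite /penrose /= !sign_atan.
Qed.

Lemma curve_achronal : achronal (range P).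
Proof.
have [sg [s1 sr]] := surface_sign hM hS.
have H s s' : s < s' -> ((P s).1 - (P s').1) * ((P s).2 - (P s').2) <= 0.
  move=> ss; have [h1 h2] := curve_monotone s1 (fun s => (sr s).1) ss.
  rewrite -oppr_ge0 -mulrN opprB -[X in 0 <= X]mul1r -s1 mulrACA.
  by apply: mulr_ge0; exact: ltW.
move=> _ _ [s _ <-] [s' _ <-]; have [ss|ss|->] := ltgtP s s'; first exact: H.
  by rewrite -mulrNN !opprB; exact: H.
by rewrite subrr mul0r.
Qed.

(** The parameter runs over the whole line, so the curve has no last point. *)
Lemma curve_next sg (s : R) : sg * sg = 1 -> exists s',
  0 < sg * ((P s).1 - (P s').1) /\ 0 < sg * ((P s').2 - (P s).2).
Proof.
move=> sg1; have [sS [s1 sr]] := surface_sign hM hS.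
have c1 s0 s2 : s0 < s2 -> _ := @curve_monotone sS s0 s2 s1 (fun s => (sr s).1).
case: (mulr1_eq1N s1) => E; case: (mulr1_eq1N sg1) => E'; rewrite E' ; rewrite E in c1.
- by exists (s + 1); apply: c1; rewrite ltrDl.
- exists (s - 1); have [|h1 h2] := c1 (s - 1) s; first by rewrite ltrBlDr ltrDl.
  by move: h1 h2; rewrite !mul1r !mulN1r !opprB.
- exists (s - 1); have [|h1 h2] := c1 (s - 1) s; first by rewrite ltrBlDr ltrDl.
  by move: h1 h2; rewrite !mul1r !mulN1r !opprB.
- by exists (s + 1); apply: c1; rewrite ltrDl.
Qed.

End Curve.

(** ** The boundary of the region *)

Section Boundary.
Variables (O : set (R * R)) (S1 S2 : sph_surface R).
Hypotheses (hS1 : spacelike_surface M S1) (hS2 : spacelike_surface M S2).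
Local Notation C1 := (closure (range (pen \o curve S1))).
Local Notation C2 := (closure (range (pen \o curve S2))).
Hypotheses (oO : open O) (Osq : O `<=` square).
Hypothesis bO : closure O `\` O = C1 `|` C2.

Let a1 : achronal C1. Proof. exact: achronal_closure (curve_achronal hS1). Qed.
Let a2 : achronal C2. Proof. exact: achronal_closure (curve_achronal hS2). Qed.

Definition shift_point z (d l : R) : R * R := (z.1 + d * l, z.2 + d * l).

Let shift_cont z d l : {for l, continuous (shift_point z d)}.
Proof.
have c (a : R) : {for l, continuous (fun l : R => a + d * l)}.
  by apply: cvgD; [exact: cvg_cst|apply: cvgM; [exact: cvg_cst|exact: cvg_id]].
exact: (@cvg_pair _ _ _ (nbhs l) (nbhs (z.1 + d * l)) (nbhs (z.2 + d * l)) _ _ _ _ _ (c z.1) (c z.2)).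
Qed.

(** A vertical ray leaves the bounded square; it first leaves the region at the
    supremum of the parameters up to which it has stayed inside. *)
Lemma vertical_exit q d : O q -> d * d = 1 -> exists l,
  [/\ 0 < l, (closure O `\` O) (shift_point q d l) &
      forall m, 0 <= m < l -> O (shift_point q d m)].
Proof.
move=> Oq d1.
pose A := [set l : R | 0 <= l /\ forall m, 0 <= m <= l -> O (shift_point q d m)].
have q0 : shift_point q d 0 = q by rewrite /shift_point !mulr0 !addr0; case: q {Oq A}.
have A0 : A 0.
  by split => // m /andP[m0 m1]; rewrite (_ : m = 0) ?q0//; apply/eqP; rewrite eq_le m1.
have ubA : ubound A (2 * pi).
  move=> l [l0 /(_ l)]; rewrite lexx l0 => /(_ isT)/Osq[].
  have [] := Osq Oq; rewrite /shift_point /=; move: (q.1) (q.2) pi l0 => x y p l0.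
  by case: (mulr1_eq1N d1) => ->; move=> /andP[? ?] /andP[? ?] /andP[? ?] /andP[? ?]; lra.
have sA : has_sup A by split; [exists 0|exists (2 * pi)].
pose l := sup A.
have l0 : 0 <= l by apply: sup_upper_bound.
have near_pt m : O (shift_point q d m) -> exists2 e : R, 0 < e & forall m', `|m - m'| < e -> O (shift_point q d m').
  move=> Om; have N : nbhs m (shift_point q d @^-1` O).
    by apply: (@shift_cont q d m); exact: open_nbhs_nbhs.
  by have [e /= e0 H] := N; exists e => // m' h; apply: H.
have below m : 0 <= m < l -> O (shift_point q d m).
  move=> /andP[m0 ml]; have lm : 0 < l - m by rewrite subr_gt0.
  have [x [x0 Ax] mx] := sup_adherent lm sA.
  by apply: Ax; rewrite m0 ltW//; move: mx; rewrite subKr.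
have nO : ~ O (shift_point q d l).
  move=> /near_pt[e e0 H]; have : A (l + e / 2).
    split; first by rewrite addr_ge0// divr_ge0// ltW.
    move=> m /andP[m0 m1]; have [ml|lm] := ltP m l; first by apply: below; rewrite m0.
    apply: H; rewrite ler0_norm ?subr_le0// opprB; move: m1 e0; lra.
  by move=> /(sup_upper_bound sA); rewrite -/l; move: e0; lra.
have lp : 0 < l.
  by rewrite lt_neqAle l0 andbT; apply/eqP => l00; apply: nO; rewrite -l00 q0.
exists l; split => //; split => //.
move=> B /(@shift_cont q d l)[e /= e0 H].
pose m := Num.max 0 (l - e / 2).
have ml : 0 <= m < l by rewrite le_max lexx /= gt_max lp ltrBlDr ltrDl divr_gt0.
exists (shift_point q d m); split; first exact: below.
apply: H => /=; rewrite ger0_norm ?subr_ge0; last by case/andP: ml => _ /ltW.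
have : l - e / 2 <= m by rewrite le_max lexx orbT.
move: e0; lra.
Qed.

(** The two exit points are joined by a vertical, hence timelike, segment, and so do
    not lie on the same achronal surface. *)
Lemma exits q : O q -> exists l l' : R, [/\ 0 < l, 0 < l',
  forall m, - l' < m < l -> O (shift_point q 1 m) &
  (C1 (shift_point q 1 (- l')) /\ C2 (shift_point q 1 l)) \/
  (C2 (shift_point q 1 (- l')) /\ C1 (shift_point q 1 l))].
Proof.
move=> Oq; have [l [l0 bl Ol]] := vertical_exit Oq (mulr1 1).
have m11 : (-1) * (-1) = 1 :> R by rewrite mulrNN mulr1.
have [l' [l0' bl' Ol']] := vertical_exit Oq m11.
have sh m : shift_point q (-1) m = shift_point q 1 (- m).
  by rewrite /shift_point !mulN1r !mul1r.
have pos : 0 < ((shift_point q 1 l).1 - (shift_point q 1 (- l')).1) *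
  ((shift_point q 1 l).2 - (shift_point q 1 (- l')).2).
  rewrite /shift_point /= !mul1r; move: (q.1) (q.2) => x y.
  by rewrite !opprD !addrA ![_ + l - _]addrAC !subrr !add0r !opprK -expr2 exprn_gt0// addr_gt0.
exists l, l'; split => //.
  move=> m /andP[m1 m2]; have [m0|m0] := leP 0 m; first by apply: Ol; rewrite m0.
  by rewrite -[m]opprK -sh; apply: Ol'; rewrite oppr_ge0 ltW//= ltrNl.
move: bl bl'; rewrite bO sh => -[h|h] [h'|h'].
- by have := a1 h h'; rewrite leNgt pos.
- by right.
- by left.
- by have := a2 h h'; rewrite leNgt pos.
Qed.

Let C1_cl x : C1 x -> closure O x.
Proof. by move=> h; have : (C1 `|` C2) x by [left]; rewrite -bO => -[]. Qed.
Let C2_cl x : C2 x -> closure O x.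
Proof. by move=> h; have : (C1 `|` C2) x by [right]; rewrite -bO => -[]. Qed.

Let C1_ne : C1 !=set0.
Proof. by exists (pen (curve S1 0)); apply: subset_closure; exists 0. Qed.
Let C2_ne : C2 !=set0.
Proof. by exists (pen (curve S2 0)); apply: subset_closure; exists 0. Qed.

Let sub_box : closure O `<=` `[- (pi / 2), pi / 2] `*` `[- (pi / 2), pi / 2].
Proof.
have cB : closed (`[- (pi / 2 : R), pi / 2] `*` `[- (pi / 2 : R), pi / 2]).
  rewrite (_ : _ `*` _ = fst @^-1` `[- (pi / 2 : R), pi / 2] `&` snd @^-1` `[- (pi / 2 : R), pi / 2]).
    by apply: closedI; apply: closed_comp; [move=> z _; exact: cvg_fst|exact: itv_closed|move=> z _; exact: cvg_snd|exact: itv_closed].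
  by apply/seteqP; split.
rewrite closure_id in cB; rewrite cB; apply: closureS => z /Osq[/andP[/ltW z1 /ltW z2] /andP[/ltW z3 /ltW z4]].
by split; rewrite /= in_itv/= ?z1 ?z2 ?z3 ?z4.
Qed.

Let compact_sub (A : set (R * R)) : A `<=` closure O -> closed A -> compact A.
Proof.
move=> AO cA; apply: (subclosed_compact cA _ (subset_trans AO sub_box)).
by apply: compact_setX; exact: segment_compact.
Qed.

Let xi_cont (sg : R) : continuous (fun z : R * R => sg * (z.2 - z.1)).
Proof. by move=> z; apply: cvgM; [exact: cvg_cst|apply: cvgB; [exact: cvg_snd|exact: cvg_fst]]. Qed.

Let argmax sg (A : set (R * R)) : A !=set0 -> A `<=` closure O -> closed A ->
  exists2 m, A m & forall x, A x -> sg * (x.2 - x.1) <= sg * (m.2 - m.1).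
Proof.
move=> A0 AO cA.
have [m Am H] := @compact_EVT_max _ _ (fun z : R * R => sg * (z.2 - z.1)) A A0 (compact_sub AO cA)
  (continuous_subspaceT (xi_cont (sg := sg))).
by exists m => [|x Ax]; [exact/set_mem|apply: H; exact/mem_set].
Qed.

(** Achronality bounds the height by the width. *)
Let height A x y e : achronal A -> A x -> A y -> `|x.2 - x.1 - (y.2 - y.1)| <= e ->
  `|x.2 + x.1 - (y.2 + y.1)| <= e.
Proof.
move=> aA Ax Ay; have := aA x y Ax Ay; exact: height_algebra.
Qed.

Section FarPoint.
Variable sg : R.
Hypothesis sg1 : sg * sg = 1.
Let xi z := sg * (z.2 - z.1).

Let xiN : forall x y e, `|xi x - xi y| <= e -> `|x.2 - x.1 - (y.2 - y.1)| <= e.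
Proof.
move=> x y e; rewrite /xi -mulrBr normrM (_ : `|sg| = 1) ?mul1r//.
by case: (mulr1_eq1N sg1) => ->; rewrite ?normrN normr1.
Qed.

(** Neither surface can end before the other, because the region has no other
    boundary. Points q of the region close to the supremum X of xi have exit points
    on both surfaces on their vertical line, so xi reaches X on the closures of
    both, at points m1 and m2. By achronality the exit points tend to m1 and m2,
    and so the segment between them tends to the one from m1 to m2; its middle z
    is in the closure of the region. As xi is maximal at z, z is on the boundary,
    hence on one of the surfaces; achronality identifies it with m1 or m2, and
    then m1 = m2. *)
Lemma far_point : exists m, [/\ C1 m, C2 m & forall x, closure O x -> xi x <= xi m].
Proof.
have clO : closed (closure O) := @closed_closure _ O.
have [m0 m0O m0max] := argmax sg (ex_intro _ _ (C1_cl (subset_closure (imageT _ 0)))) (@subset_refl _ _) clO.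
have [m1 C1m1 max1] := argmax sg C1_ne C1_cl (@closed_closure _ _).
have [m2 C2m2 max2] := argmax sg C2_ne C2_cl (@closed_closure _ _).
pose X := xi m0.
have nearX e : 0 < e -> exists2 q, O q & X - e < xi q.
  move=> e0; have N : nbhs m0 (fun z => X - e < xi z).
    have c := @xi_cont sg m0; apply: (c [set y | X - e < y]).
    by apply: open_nbhs_nbhs; split; [exact: open_gt|rewrite /= -/(xi m0) -/X ltrBlDr ltrDl].
  by have [q [Oq h]] := m0O _ N; exists q.
have xish q l : xi (shift_point q 1 l) = xi q.
  by rewrite /xi /shift_point /= mul1r opprD addrACA subrr addr0.
have ex q : O q -> exists l1 l2 : R, [/\ C1 (shift_point q 1 l1), C2 (shift_point q 1 l2) &
    O (shift_point q 1 ((l1 + l2) / 2))].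
  move=> Oq; have [l [l' [l0 l0' Ol H]]] := exits Oq.
  by case: H => -[h h']; [exists (- l'), l|exists l, (- l')]; split => //; apply: Ol; apply/andP; split; lra.
have lower (Y : R) : (forall e, 0 < e -> X - e <= Y) -> X <= Y.
  by move=> h; apply/ler_addgt0Pr => e e0; rewrite -lerBlDr; exact: h.
have x1 : xi m1 = X.
  apply/eqP; rewrite eq_le (m0max _ (C1_cl C1m1)); apply: lower => e /nearX[q Oq qe].
  have [l1 [l2 [h _ _]]] := ex q Oq; apply: le_trans (ltW qe) _.
  by rewrite -(xish q l1); exact: max1.
have x2 : xi m2 = X.
  apply/eqP; rewrite eq_le (m0max _ (C2_cl C2m2)); apply: lower => e /nearX[q Oq qe].
  have [l1 [l2 [_ h _]]] := ex q Oq; apply: le_trans (ltW qe) _.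
  by rewrite -(xish q l2); exact: max2.
pose z : R * R := ((m1.1 + m2.1) / 2, (m1.2 + m2.2) / 2).
have xz : xi z = X.
  by move: x1 x2; rewrite /xi /z /= => e1 e2; rewrite -[RHS](_ : (X + X) / 2 = X); [rewrite -{1}e1 -e2|]; field.
have zO : closure O z.
  move=> B /nbhs_ballP[e /= e0 Be].
  have e20 : 0 < e / 2 by rewrite divr_gt0.
  have [q Oq qe] := nearX _ e20; have [l1 [l2 [h1 h2 Om]]] := ex q Oq.
  exists (shift_point q 1 ((l1 + l2) / 2)); split => //; apply: Be.
  have qX : xi q <= X by apply: m0max; exact: subset_closure.
  have d1 : `|xi m1 - xi (shift_point q 1 l1)| <= e / 2.
    by rewrite xish x1 ger0_norm ?subr_ge0//; move: qe; lra.
  have d2 : `|xi m2 - xi (shift_point q 1 l2)| <= e / 2.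
    by rewrite xish x2 ger0_norm ?subr_ge0//; move: qe; lra.
  have w1 := xiN d1; have w2 := xiN d2.
  have t1 := height a1 C1m1 h1 w1; have t2 := height a2 C2m2 h2 w2.
  move: w1 w2 t1 t2 e0; rewrite /shift_point /z /= !mul1r.
  move: (m1.1) (m1.2) (m2.1) (m2.2) (q.1) (q.2) => a b c d x y; exact: ball_algebra.
have zM : forall x, closure O x -> xi x <= xi z by move=> x /m0max; rewrite xz.
have zn : ~ O z.
  move=> Oz; have : nbhs (0 : R) (fun l => O (z.1 - sg * l, z.2 + sg * l)).
    have c : {for (0 : R), continuous (fun l : R => (z.1 - sg * l, z.2 + sg * l))}.
      have c1 (u : R) : {for (0 : R), continuous (fun l : R => u - sg * l)}.
        by apply: cvgB; [exact: cvg_cst|apply: cvgM; [exact: cvg_cst|exact: cvg_id]].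
      have c2 (u : R) : {for (0 : R), continuous (fun l : R => u + sg * l)}.
        by apply: cvgD; [exact: cvg_cst|apply: cvgM; [exact: cvg_cst|exact: cvg_id]].
      exact: (@cvg_pair _ _ _ (nbhs (0 : R)) (nbhs (z.1 - sg * 0)) (nbhs (z.2 + sg * 0)) _ _ _ _ _ (c1 z.1) (c2 z.2)).
    apply: (c O); rewrite mulr0 subr0 addr0; apply: open_nbhs_nbhs; split => //.
  move=> [e /= e0 He]; have e20 : 0 < e / 2 by rewrite divr_gt0.
  have := He (e / 2); rewrite /= sub0r normrN gtr0_norm// => /(_ _)/subset_closure.
  rewrite ltr_pdivrMr// ltr_pMr// ltr1n => /(_ isT)/zM; rewrite /xi /=.
  exact: outward_algebra.
have : (C1 `|` C2) z by rewrite -bO.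
have eqm (m : R * R) A : achronal A -> A z -> A m -> xi m = X -> m = z.
  move=> aA Az Am xm; have d : `|xi m - xi z| <= 0 by rewrite xm xz subrr normr0.
  have w := xiN d; have t := height aA Am Az w; move: w t; rewrite !normr_le0 !subr_eq0 => /eqP w /eqP t.
  by case: m z {Am Az xm d aA xz zO zM zn} w t => [u v] [u' v'] /= w t; congr pair; lra.
have half (m m' : R * R) : m = ((m.1 + m'.1) / 2, (m.2 + m'.2) / 2) -> m = m'.
  by case: m m' => [u v] [u' v'] /= [e1 e2]; congr pair; [move: e1|move: e2]; lra.
case=> h.
- have E := eqm m1 _ a1 h C1m1 x1; have E' := half _ _ E.
  by exists m1; split => //; [rewrite E'|move=> x /m0max; rewrite x1].
- have E := eqm m2 _ a2 h C2m2 x2.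
  have E' : m2 = m1 by apply: half; rewrite {1}E /z addrC [m1.2 + _]addrC.
  by exists m1; split => //; [rewrite -E'|move=> x /m0max; rewrite x1].
Qed.

(** A surface has a further point beyond any of its points, and that one is no
    further than the end point. *)
Lemma beyond S m s : spacelike_surface M S -> closure (range (pen \o curve S)) m ->
  (forall x, closure (range (pen \o curve S)) x -> xi x <= xi m) ->
  0 < sg * ((pen (curve S s)).1 - m.1) /\ 0 < sg * (m.2 - (pen (curve S s)).2).
Proof.
move=> hS Cm mmax; have [s' [h1 h2]] := curve_next hS s sg1.
have Cs' : closure (range (pen \o curve S)) (pen (curve S s')) by apply: subset_closure; exists s'.
have := achronal_closure (curve_achronal hS) Cm Cs'; have := mmax _ Cs'.
move: h1 h2; rewrite /xi /=; move: (pen (curve S s)) (pen (curve S s')) m {Cm mmax Cs'} => [u v] [u' v'] [x y] /=.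
exact: beyond_algebra.
Qed.

Lemma reach S S' m s : spacelike_surface M S -> closure (range (pen \o curve S)) m ->
  (forall x, closure (range (pen \o curve S)) x -> xi x <= xi m) ->
  closure (range (pen \o curve S')) m ->
  exists s', 0 < sg * ((pen (curve S s)).1 - (pen (curve S' s')).1) /\
    0 < sg * ((pen (curve S' s')).2 - (pen (curve S s)).2).
Proof.
move=> hS Cm mmax Cm'; have [h1 h2] := beyond s hS Cm mmax.
have c1 : {for m, continuous (fun z : R * R => sg * ((pen (curve S s)).1 - z.1))}.
  by apply: cvgM; [exact: cvg_cst|apply: cvgB; [exact: cvg_cst|exact: cvg_fst]].
have c2 : {for m, continuous (fun z : R * R => sg * (z.2 - (pen (curve S s)).2))}.
  by apply: cvgM; [exact: cvg_cst|apply: cvgB; [exact: cvg_snd|exact: cvg_cst]].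
have N1 : nbhs m (fun z => 0 < sg * ((pen (curve S s)).1 - z.1)).
  by apply: (c1 [set y | 0 < y]); apply: open_nbhs_nbhs; split => //; exact: open_gt.
have N2 : nbhs m (fun z => 0 < sg * (z.2 - (pen (curve S s)).2)).
  by apply: (c2 [set y | 0 < y]); apply: open_nbhs_nbhs; split => //; exact: open_gt.
by have [z [[s' _ <-] [h h']]] := Cm' _ (filterI N1 N2); exists s'.
Qed.

Lemma reach_both : (forall s1, exists s2,
    0 < sg * (null_u M (curve S1 s1) - null_u M (curve S2 s2)) /\
    0 < sg * (null_v M (curve S2 s2) - null_v M (curve S1 s1))) /\
  (forall s2, exists s1,
    0 < sg * (null_u M (curve S2 s2) - null_u M (curve S1 s1)) /\
    0 < sg * (null_v M (curve S1 s1) - null_v M (curve S2 s2))).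
Proof.
have [m [m1 m2 mm]] := far_point.
split=> s.
  have [s' [h1 h2]] := reach s hS1 m1 (fun x h => mm x (C1_cl h)) m2.
  by exists s'; move: h1 h2; rewrite /penrose /= !sign_atan.
have [s' [h1 h2]] := reach s hS2 m2 (fun x h => mm x (C2_cl h)) m1.
by exists s'; move: h1 h2; rewrite /penrose /= !sign_atan.
Qed.
End FarPoint.

Let nbhs_below x y : x.1 < y.1 -> x.2 < y.2 -> nbhs x (fun z => z.1 < y.1 /\ z.2 < y.2).
Proof.
move=> h1 h2; have c1 : (fun z : R * R => z.1) @ x --> x.1 by exact: cvg_fst.
have c2 : (fun z : R * R => z.2) @ x --> x.2 by exact: cvg_snd.
apply: filterI; [apply: (c1 [set t | t < y.1])|apply: (c2 [set t | t < y.2])];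
  by apply: open_nbhs_nbhs; split => //; exact: open_lt.
Qed.

Let nbhs_above x y : y.1 < x.1 -> y.2 < x.2 -> nbhs x (fun z => y.1 < z.1 /\ y.2 < z.2).
Proof.
move=> h1 h2; have c1 : (fun z : R * R => z.1) @ x --> x.1 by exact: cvg_fst.
have c2 : (fun z : R * R => z.2) @ x --> x.2 by exact: cvg_snd.
apply: filterI; [apply: (c1 [set t | y.1 < t])|apply: (c2 [set t | y.2 < t])];
  by apply: open_nbhs_nbhs; split => //; exact: open_gt.
Qed.

Hypothesis hfut : in_future M S1 S2.

(** The exits on the vertical line through q are on different surfaces, and only the
    upper one can be on the surface that lies in the future. *)
Lemma between q : O (pen q) ->
  (exists s1, null_u M (curve S1 s1) < null_u M q /\ null_v M (curve S1 s1) < null_v M q) /\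
  (exists s2, null_u M q < null_u M (curve S2 s2) /\ null_v M q < null_v M (curve S2 s2)).
Proof.
move=> Oq; have [l [l' [l0 l0' _ H]]] := exits Oq.
have below m : 0 < m -> nbhs (shift_point (pen q) 1 (- m)) (fun z => z.1 < (pen q).1 /\ z.2 < (pen q).2).
  by move=> m0; apply: nbhs_below; rewrite /shift_point /= mul1r gtrBl.
have above m : 0 < m -> nbhs (shift_point (pen q) 1 m) (fun z => (pen q).1 < z.1 /\ (pen q).2 < z.2).
  by move=> m0; apply: nbhs_above; rewrite /shift_point /= mul1r ltrDl.
have [H1 H2] : C1 (shift_point (pen q) 1 (- l')) /\ C2 (shift_point (pen q) 1 l).
  case: H => // -[h2 h1]; exfalso.
  have [_ [[s2 _ <-] [y1 y2]]] := h2 _ (below _ l0').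
  have [s1 [u1 v1]] := hfut s2.
  have := a1 h1 (subset_closure (imageT _ s1)); apply/negP; rewrite -ltNge.
  apply: mulr_gt0; rewrite /shift_point /= mul1r subr_gt0.
    apply: le_lt_trans (lt_trans y1 _); first by rewrite /= atan_leE.
    by rewrite ltrDl.
  apply: le_lt_trans (lt_trans y2 _); first by rewrite /= atan_leE.
  by rewrite ltrDl.
split.
  have [_ [[s1 _ <-] /=[h1 h2]]] := H1 _ (below _ l0').
  by rewrite !atan_ltE in h1 h2; exists s1.
have [_ [[s2 _ <-] /=[h1 h2]]] := H2 _ (above _ l0).
by rewrite !atan_ltE in h1 h2; exists s2.
Qed.

End Boundary.
End Region.

(** * Integration over open sets of the plane *)

Section PlaneIntegrals.
Context {R : realType}.
Local Notation mu := (@lebesgue_measure R).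
Implicit Types (O A : set (R * R)) (g : R * R -> R).

(** The integral of a nonnegative function is a supremum over the simple functions
    below it. *)
Lemma ge0_integral_le d (T : measurableType d) (m : {measure set T -> \bar R}) (f1 f2 : T -> \bar R) :
  (forall x, 0 <= f1 x)%E -> (forall x, f1 x <= f2 x)%E ->
  (\int[m]_x f1 x <= \int[m]_x f2 x)%E.
Proof.
move=> f10 f12; have f20 x : (0 <= f2 x)%E by apply: le_trans (f12 x).
rewrite !ge0_integralTE//; apply: le_ereal_sup => _ [h hf <-]; exists h => //= x.
exact: le_trans (hf x) (f12 x).
Qed.

(** An open set is the union of its rational boxes. *)
Lemma open_measurable2 O : open O -> measurable O.
Proof.
move=> oO.
pose box (a b c d : rat) : set (R * R) := `]ratr a, ratr b[%classic `*` `]ratr c, ratr d[%classic.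
pose F a b c d := if `[< box a b c d `<=` O >] then box a b c d else set0.
have -> : O = \bigcup_a \bigcup_b \bigcup_c \bigcup_d F a b c d.
  apply/seteqP; split => [[x y] Oxy|z [a _ [b _ [c _ [d _]]]]]; last first.
    by rewrite /F; case: asboolP => // h; exact: h.
  have [[A B] [/= Ax By] AB] := open_nbhs_nbhs (conj oO Oxy : open_nbhs (x, y) O).
  have rat_itv (w : R) (D : set R) : nbhs w D -> exists a b : rat, ratr a < w < ratr b /\ `]ratr a, ratr b[%classic `<=` D.
    move=> [e /= e0 De].
    have we : w - e < w by rewrite ltrBlDr ltrDl.
    have ew : w < w + e by rewrite ltrDl.
    have [a] := rat_in_itvoo we; rewrite in_itv/= => /andP[a1 a2].
    have [b] := rat_in_itvoo ew; rewrite in_itv/= => /andP[b1 b2].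
    exists a, b; split; first by rewrite a2.
    move=> v /=; rewrite in_itv/= => /andP[v1 v2]; apply: De => /=.
    by rewrite ltr_distlC (lt_trans a1 v1) (lt_trans v2 b2).
  have [a [b [abx sA]]] := rat_itv _ _ Ax; have [c [d [cdy sB]]] := rat_itv _ _ By.
  exists a => //; exists b => //; exists c => //; exists d => //.
  rewrite /F; case: asboolP => [_|[]]; first by split; rewrite /= in_itv.
  by move=> [u v] [/= /sA u1 /sB v1]; apply: AB.
apply: bigcupT_measurable_rat => a; apply: bigcupT_measurable_rat => b.
apply: bigcupT_measurable_rat => c; apply: bigcupT_measurable_rat => d.
rewrite /F; case: asboolP => // _; apply: measurableX; exact: measurable_itv.
Qed.

Lemma open_restrict_measurable O g : open O -> (forall z, O z -> {for z, continuous g}) ->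
  measurable_fun [set: R * R] ((EFin \o g) \_ O).
Proof.
move=> oO cg; have mO := open_measurable2 oO.
apply/(measurable_restrictT (EFin \o g) mO).
apply/measurable_EFinP.
apply: (@measurability _ _ _ _ O g _ (RGenOInfty.measurableE R)) => _ [_ [c ->] <-].
apply: open_measurable2; rewrite openE => z [Oz /=]; rewrite in_itv/= andbT => cgz.
have N1 : nbhs z O by apply: open_nbhs_nbhs.
have N2 : nbhs z (fun z => c < g z).
  by apply: (cg z Oz [set y | c < y]); apply: open_nbhs_nbhs; split => //; exact: open_gt.
apply: (@filterS2 _ (nbhs z) _ _ _ _ _ N1 N2) => y Oy cy; split => //=.
by rewrite in_itv/= cy.
Qed.

(** By monotone convergence in the plane, the order of integration is exchanged on
    the sets of the exhaustion only. *)
Lemma tonelli_exhaustion (A : nat -> set (R * R)) g (C : \bar R) :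
  (forall n, open (A n)) -> nondecreasing_seq A ->
  (forall n z, A n z -> {for z, continuous g}) -> (forall n z, A n z -> 0 <= g z) ->
  (forall n, \int[mu]_y \int[mu]_x (((EFin \o g) \_ (A n)) (x, y)) <= C)%E ->
  (\int[mu]_x \int[mu]_y (((EFin \o g) \_ (\bigcup_n A n)) (x, y)) <= C)%E.
Proof.
move=> oA nA cg g0 H; set B := \bigcup_n A n.
have oB : open B by apply: bigcup_open.
have pos (D : set (R * R)) : (forall z, D z -> 0 <= g z) -> forall z, (0 <= ((EFin \o g) \_ D) z)%E.
  by move=> gD z; rewrite patchE; case: ifPn => // /set_mem/gD; rewrite /= lee_fin.
have cB z : B z -> {for z, continuous g} by move=> [n _]; exact: cg.
have B0 z : B z -> 0 <= g z by move=> [n _]; exact: g0.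
have mB := open_restrict_measurable oB cB.
have mA n := open_restrict_measurable (oA n) (cg n).
have -> : (\int[mu]_x \int[mu]_y (((EFin \o g) \_ B) (x, y)) = \int[mu \x mu]_z (((EFin \o g) \_ B) z))%E.
  exact: esym (@fubini_tonelli1 _ _ _ _ R mu mu _ mB (pos _ B0)).
rewrite -integral_mkcond.
have cv : (\int[mu \x mu]_(z in A n) (EFin \o g) z)%E @[n --> \oo] -->
    (\int[mu \x mu]_(z in \bigcup_n A n) (EFin \o g) z)%E.
  apply: ge0_nondecreasing_set_cvg_integral.
  - by move=> m n mn; exact: nA.
  - by move=> n; exact: open_measurable2.
  - by move=> n; have mO := open_measurable2 (oA n); apply/(measurable_restrictT (EFin \o g) mO); exact: mA.
  - by move=> n z /g0; rewrite /= lee_fin.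
rewrite -(cvg_lim _ cv)//; apply: lime_le; first by apply/cvg_ex; eexists; exact: cv.
apply: nearW => n; apply: le_trans (H n).
by rewrite integral_mkcond (@fubini_tonelli2 _ _ _ _ R mu mu _ (mA n) (pos _ (g0 n))).
Qed.

End PlaneIntegrals.

(** * Spacelike curves as graphs over the radius *)

Section RadialCurve.
Variables (R : realType) (M : R).
Hypothesis hM : 0 < M.
Variable S : sph_surface R.
Hypothesis hS : spacelike_surface M S.
Implicit Types s rho : R.
Local Notation r := (curve_r S).
Local Notation r' := (derive1 (curve_r S)).
Local Notation t' := (derive1 (curve_t S)).

(** The null coordinates vary strictly and in opposite directions along the curve, so
    the radius orders its points whichever way it is parametrized. *)
Lemma surface_order s s' : r s <= r s' ->
  null_u M (curve S s') <= null_u M (curve S s) /\ null_v M (curve S s) <= null_v M (curve S s').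
Proof.
have [sg [s1 sr]] := surface_sign hM hS.
have mono x y : x < y -> _ := @null_monotone R M hM S hS sg x y s1 (fun s => (sr s).1).
have hr := surface_r hS s; have hr' := surface_r hS s'.
rewrite leNgt -(tortoise_ltE hM hr' hr) -leNgt.
have [ss|ss|->] := ltgtP s s'; last by [].
  have := mono _ _ ss; case: (mulr1_eq1N s1) => ->; rewrite /null_u /null_v /=; lra.
have := mono _ _ ss; case: (mulr1_eq1N s1) => ->; rewrite /null_u /null_v /=; lra.
Qed.

Lemma curve_r_inj : injective r.
Proof.
move=> s s' E; have [sg [s1 sr]] := surface_sign hM hS.
have mono x y : x < y -> _ := @null_monotone R M hM S hS sg x y s1 (fun s => (sr s).1).
have [ss|ss|//] := ltgtP s s'.
  have := mono _ _ ss; case: (mulr1_eq1N s1) => ->; rewrite /null_u /null_v /= E; lra.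
have := mono _ _ ss; case: (mulr1_eq1N s1) => ->; rewrite /null_u /null_v /= E; lra.
Qed.

Definition at_radius rho := xget 0 [set s | r s = rho].

Lemma at_radiusK s : at_radius (r s) = s.
Proof.
rewrite /at_radius; case: xgetP => [s' _ /= /curve_r_inj//|H].
by case: (H s).
Qed.

Lemma at_radius_is_derive s : is_derive (r s) 1 at_radius (r' s)^-1.
Proof.
apply: (@is_derive_inverse R r at_radius (r' s) s).
- by apply: (@nearW _ (nbhs s)) => x; exact: at_radiusK.
- by apply: (@nearW _ (nbhs s)) => x; exact: is_derive_continuous (surface_derive hS x).2.
- exact: (surface_derive hS s).2.
- exact: surface_r'_neq0 hM S hS s.
Qed.

Lemma radius_surj s1 s2 rho : r s1 <= rho <= r s2 -> exists s, r s = rho.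
Proof.
move=> rI; have c a b : {within `[a, b], continuous r}.
  by apply: within_of_for => x _; exact: is_derive_continuous (surface_derive hS x).2.
have [ss|/ltW ss] := leP s1 s2.
  have [|x _ <-] := @IVT _ r s1 s2 rho ss (c _ _); last by exists x.
  by case/andP: rI => h1 h2; rewrite ge_min le_max h1 h2 orbT.
have [|x _ <-] := @IVT _ r s2 s1 rho ss (c _ _); last by exists x.
by case/andP: rI => h1 h2; rewrite ge_min le_max h1 h2 orbT.
Qed.

Definition graph rho := curve_t S (at_radius rho).
Definition dgraph rho := t' (at_radius rho) / r' (at_radius rho).

Lemma graph_curve s : graph (r s) = curve_t S s.
Proof. by rewrite /graph at_radiusK. Qed.

Lemma graph_is_derive s : is_derive (r s) 1 graph (dgraph (r s)).
Proof.
have d := at_radius_is_derive s; have dt := (surface_derive hS s).1.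
have -> : dgraph (r s) = t' s * (r' s)^-1 by rewrite /dgraph at_radiusK.
by apply: (@derive1_comp _ (curve_t S) at_radius); rewrite ?at_radiusK.
Qed.

Lemma dgraph_cont s : {for r s, continuous dgraph}.
Proof.
have c := is_derive_continuous (at_radius_is_derive s); have [ct cr] := surface_cont hS s.
have C (h : R -> R) : {for s, continuous h} -> {for r s, continuous (h \o at_radius)}.
  by move=> ch; apply: continuous_comp => //; rewrite at_radiusK.
apply: (@cvgM _ _ _ _ (t' \o at_radius) (fun rho => (r' (at_radius rho))^-1)); first exact: C.
apply: (@cvgV _ _ _ _ (r' \o at_radius)); last exact: C.
by rewrite at_radiusK; exact: surface_r'_neq0 hM S hS s.
Qed.

Lemma dgraph_lt1 s : `|lapse2 M (r s) * dgraph (r s)| <= 1.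
Proof.
have hr := surface_r hS s; have f0 := lapse2_gt0 hM hr; have sl := surface_spacelike hS s.
have r0 := surface_r'_neq0 hM hS s.
rewrite -[leRHS]normr1 -ler_sqr ?nnegrE// !real_normK ?num_real// expr1n /dgraph at_radiusK.
move: f0 sl r0; move: (lapse2 _ _) (t' s) (r' s) => f a b f0 sl r0.
have b0 : 0 < b ^+ 2 by rewrite exprn_even_gt0.
rewrite mulrA expr_div_n ler_pdivrMr// mul1r exprMn expr2 -mulrA.
by move: sl; rewrite ltr_pdivlMr// => /ltW; rewrite mulrC.
Qed.

End RadialCurve.

(** j + w k is a convex combination of j + k and j - k. *)
Lemma flux_algebra (R : realFieldType) (w j k C e p : R) : `|w| <= 1 ->
  `|j + k| <= C * (e + p) -> `|j - k| <= C * (e - p) -> j + w * k <= C * (e + w * p).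
Proof.
rewrite !ler_norml => /andP[w1 w2] /andP[_ h1] /andP[_ h2].
have a1 : 0 <= (1 + w) * (C * (e + p) - (j + k)) by rewrite mulr_ge0// ?subr_ge0//; lra.
have a2 : 0 <= (1 - w) * (C * (e - p) - (j - k)) by rewrite mulr_ge0// ?subr_ge0//; lra.
lra.
Qed.

Section TimeIntegralContinuity.
Variables (R : realType) (M : R) (h : R -> R -> R).
Hypothesis ch : forall t r : R, 2 * M < r -> {for (t, r), continuous (fun z : R * R => h z.1 z.2)}.

(** On a fixed interval of integration, joint continuity is that of an integral
    depending on a parameter. *)
Lemma time_int_rescale (t r : R) : 2 * M < r -> time_int h t r = integ 0 1 (fun l => h (l * t) r * t).
Proof.
move=> hr; have c1 x : {for x, continuous (h ^~ r)}.
  by have [_ c] := section_continuous (f := fun t r => h t r) (@ch x r hr).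
have d (x : R) : is_derive x 1 (time_int h ^~ r) (h x r).
  apply: (@oint_is_derive R 0 x (h ^~ r) (- `|x| - 1) (`|x| + 1)) => //.
    by have := normr_ge0 x => ?; apply/andP; split; lra.
  by have := ler_norm x; have := ler_norm (- x); rewrite normrN => *; apply/andP; split; lra.
have z : time_int h 0 r = 0.
  have := @oint_primitive R 0 0 (h ^~ r) (time_int h ^~ r).
  by rewrite subrr; apply.
have D (l : R) : is_derive l 1 (fun l => time_int h (l * t) r) (h (l * t) r * t).
  have dl := derive1_mul (is_derive_id l 1) (derive1_cst t l).
  rewrite mul1r mulr0 addr0 in dl.
  exact: (@derive1_comp _ (time_int h ^~ r) (fun l => l * t) l _ _ (d (l * t)) dl).
rewrite (@integ_FTC2 R 0 1 (fun l => time_int h (l * t) r)) ?ler01//.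
  by rewrite mul1r mul0r z subr0.
move=> l _; apply: cvgM; last exact: cvg_cst.
have cl : {for l, continuous (fun l : R => l * t)} by apply: cvgM; [exact: cvg_id|exact: cvg_cst].
exact: (cvg_comp (fun l : R => l * t) (h ^~ r) cl (c1 (l * t))).
Qed.

Lemma time_int_cont (t r : R) : 2 * M < r -> {for (t, r), continuous (fun z : R * R => time_int h z.1 z.2)}.
Proof.
move=> hr; have C : (fun z : R * R => z.2) @ (t, r) --> r by exact: cvg_snd.
have N : \forall z \near (t, r), 2 * M < z.2 := C _ (near_r hr).
have H : {for (t, r), continuous (fun z : R * R => integ 0 1 (fun l => h (l * z.1) z.2 * z.1))}.
  apply: (@integ_continuous R _ (t, r) 0 1 (@ler01 R) (fun z l => h (l * z.1) z.2 * z.1)).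
  apply: (@filterS _ (nbhs (t, r)) _ _ _ _ N) => -[t1 r1] /= hr1 l _.
  have c1 : {for ((t1, r1), l), continuous (fun q : (R * R) * R => q.1.1)}.
    exact: (cvg_comp fst fst (@cvg_fst _ _ _ _ _) (@cvg_fst _ _ _ _ _)).
  have c2 : {for ((t1, r1), l), continuous (fun q : (R * R) * R => q.1.2)}.
    exact: (cvg_comp fst snd (@cvg_fst _ _ _ _ _) (@cvg_snd _ _ _ _ _)).
  apply: cvgM; last exact: c1.
  apply: (@continuous_comp _ _ _ (fun q : (R * R) * R => (q.2 * q.1.1, q.1.2)) (fun z : R * R => h z.1 z.2)); last exact: ch.
  apply: (@cvg_pair _ _ _ (nbhs ((t1, r1), l)) (nbhs (l * t1)) (nbhs r1) _ _ _ (fun q : (R * R) * R => q.2 * q.1.1) (fun q => q.1.2)); last exact: c2.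
  by apply: cvgM; [exact: cvg_snd|exact: c1].
rewrite /prop_for /continuous_at /= (time_int_rescale t hr).
apply: cvg_trans H; apply: near_eq_cvg.
by apply: (@filterS _ (nbhs (t, r)) _ _ _ _ N) => z hz; rewrite -(time_int_rescale z.1 hz).
Qed.

End TimeIntegralContinuity.

(** * The energy estimate on triangles *)

Lemma column_algebra (R : realFieldType) (C f sg a K1 K2 j1 j2 k1 k2 e1 e2 p1 p2 : R) : 0 < f ->
  - j1 + sg * - k1 <= C * (e1 + sg * p1) -> j2 + f * a * k2 <= C * (e2 + f * a * p2) ->
  (K1 - K2 - (j1 - j2) / f) / 9 <=
  (k1 * (sg * f^-1) + K1 - (k2 * a + K2) + C * (p1 * (sg * f^-1) + e1 / f) + C * (p2 * a + e2 / f)) / 9.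
Proof.
move=> f0 h1 h2; have i0 : 0 <= f^-1 by rewrite invr_ge0 ltW.
have fi : f^-1 * f = 1 by rewrite mulVf// lt0r_neq0.
have := ler_wpM2l i0 h1; have := ler_wpM2l i0 h2.
rewrite (_ : f^-1 * (j2 + _) = f^-1 * j2 + (f^-1 * f) * (a * k2)); last by ring.
rewrite (_ : f^-1 * (C * (e2 + _)) = C * (f^-1 * e2 + (f^-1 * f) * (a * p2))); last by ring.
rewrite fi !mul1r ler_pM2r// => a1 a2.
rewrite -subr_ge0.
move: a1; rewrite -subr_ge0 => a1; move: a2; rewrite -subr_ge0 => a2.
by apply: le_trans (addr_ge0 a1 a2) _; rewrite le_eqVlt; apply/orP; left; apply/eqP; ring.
Qed.

Section Bulk.
Variables (R : realType) (M : R).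
Hypothesis hM : 0 < M.
Implicit Types (t r rho s : R).
Variables e et er p pt pr j jt jr k kt kr T : R -> R -> R.
Hypotheses (Ce : C1 M e et er) (Cp : C1 M p pt pr) (Cj : C1 M j jt jr) (Ck : C1 M k kt kr).
Hypothesis cT : forall t r, 2 * M < r -> {for (t, r), continuous (fun z : R * R => T z.1 z.2)}.
Hypothesis H : forall t r, 2 * M < r -> [/\ et t r = lapse2 M r * pr t r, 0 <= T t r,
  T t r <= lapse2 M r * kr t r - jt t r,
  `|j t r + k t r| <= 36 / 5 * (e t r + p t r) & `|j t r - k t r| <= 36 / 5 * (e t r - p t r)].
Local Notation mu := (@lebesgue_measure R).
Local Notation Q := (potential M e p).
Local Notation C := (36 / 5).

Let cur : morawetz_currents M e p T.
Proof. by exists et, er, pt, pr, j, jt, jr, k; exists kt, kr. Qed.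

Definition reduced_bulk (z : R * R) : R := T z.1 z.2 / (9 * lapse2 M z.2).

Lemma reduced_bulk_ge0 z : 2 * M < z.2 -> 0 <= reduced_bulk z.
Proof.
move=> hr; have [_ T0 _ _ _] := H z.1 hr; rewrite divr_ge0// mulr_ge0//.
exact: ltW (lapse2_gt0 hM hr).
Qed.

Lemma reduced_bulk_cont z : 2 * M < z.2 -> {for z, continuous reduced_bulk}.
Proof.
case: z => t r /= hr; have f0 := lapse2_neq0 hM hr.
have cf : {for r, continuous (lapse2 M)} := is_derive_continuous (lapse2_is_derive M (r_neq0 hM hr)).
have cf2 : {for (t, r), continuous (fun z : R * R => 9 * lapse2 M z.2)}.
  apply: cvgM; first exact: cvg_cst.
  exact: (cvg_comp snd (lapse2 M) (@cvg_snd _ _ _ _ _) cf).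
apply: (@cvgM _ _ _ _ (fun z : R * R => T z.1 z.2) (fun z => (9 * lapse2 M z.2)^-1)); first exact: cT.
by apply: (@cvgV _ _ _ _ (fun z : R * R => 9 * lapse2 M z.2)) => //=; rewrite mulf_neq0.
Qed.

(** The time derivative of j integrates to its values at the ends, and the radial
    derivative of k to that of the primitive of k, which is differentiated along
    the sides of the triangle in [lateral_primitive]. *)
Lemma column t1 t2 r : 2 * M < r -> t1 <= t2 ->
  (\int[mu]_(t in `[t1, t2]) (reduced_bulk (t, r))%:E <=
   ((time_int kr t2 r - time_int kr t1 r - (j t2 r - j t1 r) / lapse2 M r) / 9)%:E)%E.
Proof.
move=> hr t12; have f0 := lapse2_gt0 hM hr; have fn := lt0r_neq0 f0.
have sec (h : R -> R -> R) t : {for (t, r), continuous (fun z : R * R => h z.1 z.2)} -> {for t, continuous (h ^~ r)}.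
  by move=> ch; have [_ c] := section_continuous (f := fun t r => h t r) ch.
have cg : {within `[t1, t2], continuous (fun t => reduced_bulk (t, r))}.
  apply: within_of_for => t _; apply: (sec (fun t r => reduced_bulk (t, r))).
  rewrite (_ : (fun z : R * R => reduced_bulk (z.1, z.2)) = reduced_bulk); first exact: reduced_bulk_cont.
  by apply/funext => -[].
have ckr t : {for t, continuous (kr ^~ r)} by apply: sec; have [] := Ck t hr.
have cjt t : {for t, continuous (jt ^~ r)} by apply: sec; have [] := Cj t hr.
pose d t := (kr t r - jt t r * (lapse2 M r)^-1) * 9^-1.
have cd t : {for t, continuous d}.
  apply: cvgM; last exact: cvg_cst.
  by apply: cvgB; [exact: ckr|apply: cvgM; [exact: cjt|exact: cvg_cst]].
have D t : is_derive t 1 (fun t => (time_int kr t r - j t r * (lapse2 M r)^-1) * 9^-1) (d t).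
  have dk : is_derive t 1 (time_int kr ^~ r) (kr t r).
    apply: (@oint_is_derive R 0 t (kr ^~ r) (- `|t| - 1) (`|t| + 1)) => //.
      by have := normr_ge0 t => ?; apply/andP; split; lra.
    by have := ler_norm t; have := ler_norm (- t); rewrite normrN => *; apply/andP; split; lra.
  have dj : is_derive t 1 (j ^~ r) (jt t r) by have [] := Cj t hr.
  have sc (c : R) (f : R -> R) (df : R) : is_derive t 1 f df -> is_derive t 1 (fun t => f t * c) (df * c).
    by move=> df'; have := derive1_mul df' (derive1_cst c t); rewrite mulr0 addr0.
  exact: sc (derive1_sub dk (sc _ _ _ dj)).
rewrite -integ_EFin// lee_fin.
have -> : (time_int kr t2 r - time_int kr t1 r - (j t2 r - j t1 r) / lapse2 M r) / 9 = integ t1 t2 d.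
  by rewrite (integ_FTC2 t12 (fun t _ => D t) (fun t _ => cd t)); ring.
apply: le_integ => //; first by apply: within_of_for => t _.
move=> t _; have [_ _ h _ _] := H t hr.
rewrite /reduced_bulk /d /= invfM [9^-1 / _]mulrC mulrA ler_pM2r ?invr_gt0// ler_pdivrMr//.
by rewrite mulrBl divfK// [kr t r * _]mulrC.
Qed.

Section Piece.
Variables (sg c : R) (tau dtau : R -> R).
Hypothesis sg1 : sg * sg = 1.

Definition cone r := c + sg * tortoise M r.

Definition lateral_flux r :=
  (k (cone r) r * (sg * (lapse2 M r)^-1) + time_int kr (cone r) r
   - (k (tau r) r * dtau r + time_int kr (tau r) r)
   + C * (p (cone r) r * (sg * (lapse2 M r)^-1) + e (cone r) r / lapse2 M r)
   + C * (p (tau r) r * dtau r + e (tau r) r / lapse2 M r)) / 9.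

(** The column over the radius r extends from the curve tau to the null line cone.
    With the primitive K of k in time, K is taken at the top minus the bottom, and
    the potential of the energy current, times the constant by which it dominates
    (j, k), at the top plus the bottom. The terms in K cancel where the null line
    meets the curve and agree where two null lines meet, so that only the
    potential survives on the whole triangle. *)
Definition lateral_primitive r :=
  (time_int k (cone r) r - time_int k (tau r) r + C * Q (cone r) r + C * Q (tau r) r) / 9.

Variables a b : R.
Hypotheses (ab : a <= b) (ha : 2 * M < a).
Hypothesis tauE : forall r, a <= r <= b -> [/\ is_derive r 1 tau (dtau r),
  {for r, continuous dtau}, `|lapse2 M r * dtau r| <= 1 & tau r <= cone r].

Let cone_is_derive r : 2 * M < r -> is_derive r 1 cone (sg * (lapse2 M r)^-1).
Proof.
move=> hr; apply: (derive1_eq (derive1_add (derive1_cst c r) (derive1_scale (tortoise_is_derive hM hr) sg))).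
by rewrite add0r.
Qed.

Lemma lateral_primitive_is_derive r : a <= r <= b -> is_derive r 1 lateral_primitive (lateral_flux r).
Proof.
move=> rI; have [dt _ _ _] := tauE rI; have hr : 2 * M < r by case/andP: rI => + _; exact: lt_le_trans.
have dc := cone_is_derive hr; have di := is_derive_id r (1 : R).
have h1 := time_int_curve Ck hr dc di; have h2 := time_int_curve Ck hr dt di.
have h3 := potential_curve hM cur hr dc di; have h4 := potential_curve hM cur hr dt di.
have h := derive1_add (derive1_add (derive1_sub h1 h2) (derive1_scale h3 C)) (derive1_scale h4 C).
have := derive1_mul h (derive1_cst (9^-1 : R) r).
rewrite !mulr1 mulr0 addr0; exact.
Qed.

Lemma lateral_flux_cont r : a <= r <= b -> {for r, continuous lateral_flux}.
Proof.
move=> rI; have [dt cdt _ _] := tauE rI; have hr : 2 * M < r by case/andP: rI => + _; exact: lt_le_trans.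
have dc := cone_is_derive hr.
have comp (h : R -> R -> R) (x : R -> R) : {for (x r, r), continuous (fun z : R * R => h z.1 z.2)} ->
    {for r, continuous x} -> {for r, continuous (fun r => h (x r) r)}.
  move=> ch cx; apply: (@continuous_comp _ _ _ (fun r => (x r, r)) (fun z : R * R => h z.1 z.2)) => //.
  exact: (@cvg_pair _ _ _ (nbhs r) (nbhs (x r)) (nbhs r) _ _ _ x id cx cvg_id).
have cc := is_derive_continuous dc; have ct := is_derive_continuous dt.
have ci := cont_lapse2V hM hr.
have csi : {for r, continuous (fun r => sg * (lapse2 M r)^-1)} by apply: cvgM => //; exact: cvg_cst.
have cK x : {for (x, r), continuous (fun z : R * R => time_int kr z.1 z.2)}.
  by apply: time_int_cont hr => t' r' hr'; have [] := Ck t' hr'.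
have ck x : {for (x, r), continuous (fun z : R * R => k z.1 z.2)} by have [] := Ck x hr.
have ce x : {for (x, r), continuous (fun z : R * R => e z.1 z.2)} by have [] := Ce x hr.
have cp x : {for (x, r), continuous (fun z : R * R => p z.1 z.2)} by have [] := Cp x hr.
have k1 := comp _ _ (ck _) cc; have k2 := comp _ _ (ck _) ct.
have K1 := comp _ _ (cK _) cc; have K2 := comp _ _ (cK _) ct.
have e1 := comp _ _ (ce _) cc; have e2 := comp _ _ (ce _) ct.
have p1 := comp _ _ (cp _) cc; have p2 := comp _ _ (cp _) ct.
have fC (u : R -> R) : {for r, continuous u} -> {for r, continuous (fun r => C * u r)}.
  by move=> cu; apply: cvgM => //; exact: cvg_cst.
have fM (u v : R -> R) : {for r, continuous u} -> {for r, continuous v} -> {for r, continuous (fun r => u r * v r)}.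
  by move=> cu cv; exact: cvgM.
have fD (u v : R -> R) : {for r, continuous u} -> {for r, continuous v} -> {for r, continuous (fun r => u r + v r)}.
  by move=> cu cv; exact: cvgD.
have fB (u v : R -> R) : {for r, continuous u} -> {for r, continuous v} -> {for r, continuous (fun r => u r - v r)}.
  by move=> cu cv; exact: cvgB.
apply: cvgM; last exact: cvg_cst.
apply: (fD _ _ (fD _ _ (fB _ _ (fD _ _ (fM _ _ k1 csi) K1) (fD _ _ (fM _ _ k2 cdt) K2)) (fC _ _)) (fC _ _)).
  exact: fD _ _ (fM _ _ p1 csi) (fM _ _ e1 ci).
exact: fD _ _ (fM _ _ p2 cdt) (fM _ _ e2 ci).
Qed.

(** The three sides of the triangle are null or spacelike, which is where the flux of
    (j, k) is dominated by that of the energy. *)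
Lemma column_le_lateral r : a <= r <= b ->
  (\int[mu]_(t in `[tau r, cone r]) (reduced_bulk (t, r))%:E <= (lateral_flux r)%:E)%E.
Proof.
move=> rI; have [_ _ slope tc] := tauE rI; have hr : 2 * M < r by case/andP: rI => + _; exact: lt_le_trans.
apply: (le_trans (column hr tc)); rewrite lee_fin.
apply: (@column_algebra _ _ _ sg (dtau r) _ _ _ _ _ _ _ _ _ _ (lapse2_gt0 hM hr)).
  have [_ _ _ h1 h2] := H (cone r) hr; apply: flux_algebra.
  - by case: (mulr1_eq1N sg1) => ->; rewrite ?normrN normr1.
  - by rewrite -opprD normrN.
  - by rewrite -opprD normrN.
by have [_ _ _ h1 h2] := H (tau r) hr; exact: flux_algebra.
Qed.

Lemma lateral_flux_ge0 r : a <= r <= b -> 0 <= lateral_flux r.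
Proof.
move=> rI; rewrite -lee_fin; apply: le_trans (column_le_lateral rI).
apply: integral_ge0 => t _; rewrite lee_fin; apply: reduced_bulk_ge0.
by case/andP: rI => + _; exact: lt_le_trans.
Qed.

Lemma lateral_flux_integral :
  (\int[mu]_(r in `[a, b]) (lateral_flux r)%:E)%E = (lateral_primitive b - lateral_primitive a)%:E.
Proof.
rewrite -integ_EFin; last by apply: within_of_for => r; rewrite /= in_itv/=; exact: lateral_flux_cont.
by rewrite (integ_FTC2 ab lateral_primitive_is_derive lateral_flux_cont).
Qed.

End Piece.


Variable S : sph_surface R.
Hypothesis hS : spacelike_surface M S.
Local Notation P s := (curve S s).

(** Its sides are the piece of the surface between sL and sR and two null lines that
    start at the ends of the piece and meet at an apex. *)
Definition triangle sL sR : set (R * R) := [set z | 2 * M < z.2 /\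
  [/\ exists s, null_u M (P s) < null_u M z /\ null_v M (P s) < null_v M z,
      null_u M z < null_u M (P sL) & null_v M z < null_v M (P sR)]].

Lemma triangle_column sL sR t r : triangle sL sR (t, r) ->
  [/\ curve_r S sL <= r <= curve_r S sR, graph S r <= t,
    t <= null_u M (P sL) + 1 * tortoise M r & t <= null_v M (P sR) + (-1) * tortoise M r].
Proof.
move=> [/= hr [[s [us vs]] uL vR]].
have hL := surface_r hS sL; have hR := surface_r hS sR.
have oL : null_v M (P sL) <= null_v M (P s).
  by have [/(surface_order hM hS)[_ //]|/ltW/(surface_order hM hS)[h _]] := leP (curve_r S sL) (curve_r S s); lra.
have oR : null_u M (P sR) <= null_u M (P s).
  by have [/(surface_order hM hS)[//]|/ltW/(surface_order hM hS)[_ h]] := leP (curve_r S s) (curve_r S sR); lra.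
have rL : curve_r S sL <= r.
  rewrite leNgt -(tortoise_ltE hM hr hL) -leNgt; move: us vs uL vR oL oR.
  by rewrite /null_u /null_v /=; lra.
have rR : r <= curve_r S sR.
  rewrite leNgt -(tortoise_ltE hM hR hr) -leNgt; move: us vs uL vR oL oR.
  by rewrite /null_u /null_v /=; lra.
split; first by rewrite rL.
- have [s0 E] : exists s0, curve_r S s0 = r by apply: (@radius_surj R M S hS sL sR); rewrite rL.
  rewrite -E (graph_curve hM hS) leNgt; apply/negP => lt.
  move: us vs; rewrite /null_u /null_v /= -E.
  by have [/(surface_order hM hS)|/ltW/(surface_order hM hS)] := leP (curve_r S s) (curve_r S s0);
    rewrite /null_u /null_v /=; lra.
- by move: uL; rewrite /null_u /=; lra.
- by move: vR; rewrite /null_v /=; lra.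
Qed.

Lemma triangle_bound sL sR : curve_r S sL <= curve_r S sR ->
  (\int[mu]_r \int[mu]_t (((EFin \o reduced_bulk) \_ (triangle sL sR)) (t, r)) <=
   (2 * C / 9 * (surface_potential M e p S sR - surface_potential M e p S sL))%:E)%E.
Proof.
move=> rLR; have hL := surface_r hS sL; have hR := surface_r hS sR.
pose uL := null_u M (P sL); pose vR := null_v M (P sR).
(* The radius of the apex, where u = uL and v = vR. *)
have [hm xm] := area_radiusP hM ((vR - uL) / 2); set rm := area_radius _ _ in hm xm.
have [oL oR] := surface_order hM hS rLR.
have rLm : curve_r S sL <= rm.
  rewrite leNgt -(tortoise_ltE hM hm hL) -leNgt xm; move: oR; rewrite /uL /vR /null_u /null_v /=; lra.
have rmR : rm <= curve_r S sR.
  rewrite leNgt -(tortoise_ltE hM hR hm) -leNgt xm; move: oL; rewrite /uL /vR /null_u /null_v /=; lra.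
pose tau : R -> R := graph S; pose dtau : R -> R := dgraph S.
have on_graph (rho : R) : curve_r S sL <= rho <= curve_r S sR -> [/\ is_derive rho 1 tau (dtau rho),
    {for rho, continuous dtau}, `|lapse2 M rho * dtau rho| <= 1,
    tau rho <= uL + 1 * tortoise M rho & tau rho <= vR + (-1) * tortoise M rho].
  move=> rI; have [s E] := radius_surj hS rI; move: rI; rewrite -E => /andP[r1 r2]; split.
  - exact: (graph_is_derive hM hS s).
  - exact: (@dgraph_cont R M hM S hS s).
  - exact: (@dgraph_lt1 R M hM S hS s).
  - have [h _] := surface_order hM hS r1; rewrite /tau (graph_curve hM hS).
    by move: h; rewrite /uL /null_u /=; lra.
  - have [_ h] := surface_order hM hS r2; rewrite /tau (graph_curve hM hS).
    by move: h; rewrite /vR /null_v /=; lra.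
have T1 (rho : R) : curve_r S sL <= rho <= rm -> [/\ is_derive rho 1 tau (dtau rho),
    {for rho, continuous dtau}, `|lapse2 M rho * dtau rho| <= 1 & tau rho <= cone 1 uL rho].
  by move=> /andP[r1 r2]; have [|h1 h2 h3 h4 _] := on_graph rho; [rewrite r1 (le_trans r2)|split].
have T2 (rho : R) : rm <= rho <= curve_r S sR -> [/\ is_derive rho 1 tau (dtau rho),
    {for rho, continuous dtau}, `|lapse2 M rho * dtau rho| <= 1 & tau rho <= cone (-1) vR rho].
  by move=> /andP[r1 r2]; have [|h1 h2 h3 _ h4] := on_graph rho; [rewrite r2 (le_trans rLm)|split].
have m11 : (-1) * (-1) = 1 :> R by rewrite mulrNN mulr1.
have I1 := lateral_flux_integral rLm hL T1.
have I2 := lateral_flux_integral rmR hm T2.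
pose D1 := ((EFin \o lateral_flux 1 uL tau dtau) \_ `[curve_r S sL, rm]) : R -> \bar R.
pose D2 := ((EFin \o lateral_flux (-1) vR tau dtau) \_ `[rm, curve_r S sR]) : R -> \bar R.
have p1 rho : (0 <= D1 rho)%E.
  rewrite /D1 patchE; case: ifPn => // /set_mem /=; rewrite in_itv/= lee_fin.
  by move=> rI; exact: (lateral_flux_ge0 (mulr1 1) hL T1 rI).
have p2 rho : (0 <= D2 rho)%E.
  rewrite /D2 patchE; case: ifPn => // /set_mem /=; rewrite in_itv/= lee_fin.
  by move=> rI; exact: (lateral_flux_ge0 m11 hm T2 rI).
have m1 : measurable_fun [set: R] D1.
  apply/(measurable_restrictT _ (measurable_itv _)); apply/measurable_EFinP.
  apply: subspace_continuous_measurable_fun => //; apply: within_of_for => rho; rewrite /= in_itv/=.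
  by move=> rI; exact: (lateral_flux_cont hL T1 rI).
have m2 : measurable_fun [set: R] D2.
  apply/(measurable_restrictT _ (measurable_itv _)); apply/measurable_EFinP.
  apply: subspace_continuous_measurable_fun => //; apply: within_of_for => rho; rewrite /= in_itv/=.
  by move=> rI; exact: (lateral_flux_cont hm T2 rI).
have g0 t rho : (0 <= ((EFin \o reduced_bulk) \_ (triangle sL sR)) (t, rho))%E.
  by rewrite patchE; case: ifPn => // /set_mem[hr _]; rewrite lee_fin reduced_bulk_ge0.
have K rho : (\int[mu]_t (((EFin \o reduced_bulk) \_ (triangle sL sR)) (t, rho)) <= D1 rho + D2 rho)%E.
  have col (x : R) : (forall t, triangle sL sR (t, rho) -> graph S rho <= t <= x) -> 2 * M < rho ->
      (\int[mu]_t (((EFin \o reduced_bulk) \_ (triangle sL sR)) (t, rho)) <=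
       \int[mu]_(t in `[tau rho, x]) (reduced_bulk (t, rho))%:E)%E.
    move=> tx hr; rewrite [leRHS]integral_mkcond; apply: ge0_integral_le => // t.
    rewrite !patchE; case: ifPn => [/set_mem/tx h|_].
      by rewrite mem_set// /= in_itv.
    by case: ifPn => // _; rewrite lee_fin reduced_bulk_ge0.
  have [rI|rI] := boolP (curve_r S sL <= rho <= curve_r S sR); last first.
    rewrite integral0_eq ?adde_ge0// => t _; rewrite patchE; case: ifPn => // /set_mem/triangle_column[h].
    by rewrite h in rI.
  have /andP[r1 r2] := rI; have hr := lt_le_trans hL r1.
  have [rm1|/ltW rm1] := leP rho rm.
    have rI1 : curve_r S sL <= rho <= rm by rewrite r1.
    apply: (le_trans (col (cone 1 uL rho) _ hr)).
      by move=> t /triangle_column[_ h1 h2 _]; rewrite h1.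
    apply: (le_trans (column_le_lateral (mulr1 1) hL T1 rI1)).
    by rewrite /D1 patchE mem_set ?leeDl// /= in_itv.
  have rI1 : rm <= rho <= curve_r S sR by rewrite rm1.
  apply: (le_trans (col (cone (-1) vR rho) _ hr)).
    by move=> t /triangle_column[_ h1 _ h2]; rewrite h1.
  apply: (le_trans (column_le_lateral m11 hm T2 rI1)).
  by rewrite /D2 patchE mem_set ?leeDr// /= in_itv.
apply: (@le_trans _ _ (\int[mu]_rho (D1 rho + D2 rho))%E).
  by apply: ge0_integral_le => // rho; apply: integral_ge0.
rewrite ge0_integralD// -!integral_mkcond I1 I2 lee_fin.
rewrite /lateral_primitive /cone xm mul1r mulN1r.
have e1 : uL + tortoise M (curve_r S sL) = curve_t S sL by rewrite /uL /null_u /= subrK.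
have e2 : vR - tortoise M (curve_r S sR) = curve_t S sR by rewrite /vR /null_v /= addrK.
have e3 : vR - (vR - uL) / 2 = uL + (vR - uL) / 2 by lra.
rewrite !mul1r !mulN1r e1 e2 e3 /tau !(graph_curve hM hS) /surface_potential.
by rewrite le_eqVlt; apply/orP; left; apply/eqP; ring.
Qed.

End Bulk.

(** * Comparison of the two surfaces *)

Section Conclusion.
Variables (R : realType) (M : R).
Hypothesis hM : 0 < M.
Variables (e p T : R -> R -> R).
Hypothesis cur : morawetz_currents M e p T.
Local Notation mu := (@lebesgue_measure R).
Local Notation Pot := (surface_potential M e p).

Definition surface_energy (S : sph_surface R) : \bar R :=
  (\int[mu]_s (Num.sg (derive1 (curve_r S) s) / 9 *
    (derive1 (curve_r S) s * (e (curve_t S s) (curve_r S s) / lapse2 M (curve_r S s))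
     + derive1 (curve_t S) s * p (curve_t S s) (curve_r S s)))%:E)%E.

(** sg = 1 stands for the outward direction and sg = -1 for the inward one. *)
Definition reaches (S S' : sph_surface R) := forall sg : R, sg * sg = 1 -> forall s, exists s',
  0 < sg * (null_u M (curve S s) - null_u M (curve S' s')) /\
  0 < sg * (null_v M (curve S' s') - null_v M (curve S s)).

Lemma surface_energy_ge (S : sph_surface R) x y : spacelike_surface M S ->
  ((9^-1 * (Pot S y - Pot S x))%:E <= surface_energy S)%E.
Proof.
move=> hS; have [sg [s1 sr]] := surface_sign hM hS.
have ge a b := @energy_ge R M hM e p T cur S hS (surface_energy S) erefl sg s1 sr a b.
case: (mulr1_eq1N s1) => E; rewrite E in ge; last first.
  by have := ge y x; rewrite mulNr mul1r mulNr -mulrN opprB.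
by have := ge x y; rewrite mul1r.
Qed.

(** The potential is monotone towards either end, so the increment over a piece of S
    is at most the one over a longer piece of S'. *)
Lemma surface_energy_le (S S' : sph_surface R) : spacelike_surface M S -> spacelike_surface M S' ->
  reaches S S' -> (surface_energy S <= surface_energy S')%E.
Proof.
move=> hS hS' reach; have [sg [s1 sr]] := surface_sign hM hS.
apply: (@energy_le R M hM e p T cur S hS (surface_energy S) erefl sg s1 sr) => a b _.
have m11 : (-1) * (-1) = 1 :> R by rewrite mulrNN mulr1.
have H x y : ((9^-1 * (Pot S y - Pot S x))%:E <= surface_energy S')%E.
  have [y' [uy vy]] := reach 1 (mulr1 1) y; have [x' [ux vx]] := reach (-1) m11 x.
  apply: le_trans (surface_energy_ge x' y' hS'); rewrite lee_fin ler_pM2l ?invr_gt0//.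
  have pos1 (c d : R) : 0 < 1 * (c - d) -> d <= c by rewrite mul1r subr_gt0 => /ltW.
  have posN (c d : R) : 0 < -1 * (c - d) -> c <= d by rewrite mulN1r opprB subr_gt0 => /ltW.
  move/pos1: uy => uy; move/pos1: vy => vy; move/posN: ux => ux; move/posN: vx => vx.
  have hy := potential_spacelike hM cur (q := curve S y) (q' := curve S' y') (surface_r hS y) (surface_r hS' y') uy vy.
  have hx := potential_spacelike hM cur (q := curve S' x') (q' := curve S x) (surface_r hS' x') (surface_r hS x) ux vx.
  exact: lerB.
case: (mulr1_eq1N s1) => ->; first by rewrite mul1r; exact: H.
by rewrite mulNr mul1r mulNr -mulrN opprB; exact: H.
Qed.

Section Exhaustion.
Variables S1 S2 : sph_surface R.
Hypotheses (hS1 : spacelike_surface M S1) (hS2 : spacelike_surface M S2).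
Hypothesis reach : reaches S2 S1.

Lemma null_cont z : 2 * M < z.2 -> {for z, continuous (null_u M)} /\ {for z, continuous (null_v M)}.
Proof.
move=> hr; have c := is_derive_continuous (tortoise_is_derive hM hr).
have c1 : {for z, continuous (fun z : R * R => z.1)} by exact: cvg_fst.
have c2 : {for z, continuous (fun z : R * R => tortoise M z.2)}.
  exact: (cvg_comp snd (tortoise M) (@cvg_snd _ _ _ _ _) c).
by split; [exact: cvgB|exact: cvgD].
Qed.

Lemma open_triangle sL sR : open (triangle M S1 sL sR).
Proof.
rewrite openE => z [hr [[s [us vs]] uL vR]]; have [cu cv] := null_cont hr.
have gt (f : R * R -> R) c : {for z, continuous f} -> c < f z -> nbhs z (fun y => c < f y).
  by move=> cf h; apply: (cf [set y | c < y]); apply: open_nbhs_nbhs; split => //; exact: open_gt.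
have lt (f : R * R -> R) c : {for z, continuous f} -> f z < c -> nbhs z (fun y => f y < c).
  by move=> cf h; apply: (cf [set y | y < c]); apply: open_nbhs_nbhs; split => //; exact: open_lt.
have c2 : {for z, continuous (fun z : R * R => z.2)} by exact: cvg_snd.
have N1 : nbhs z (fun y => null_u M (curve S1 s) < null_u M y /\ null_v M (curve S1 s) < null_v M y).
  exact: filterI (gt _ _ cu us) (gt _ _ cv vs).
have N2 : nbhs z (fun y => null_u M y < null_u M (curve S1 sL) /\ null_v M y < null_v M (curve S1 sR)).
  exact: filterI (lt _ _ cu uL) (lt _ _ cv vR).
have N3 := gt _ _ c2 hr.
apply: (@filterS3 _ (nbhs z) _ _ _ _ _ _ N3 N1 N2) => y h0 h1 [h2 h3]; split => //.
by split => //; exists s.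
Qed.

Lemma surface_monotone (sg s s' : R) : sg * sg = 1 -> (forall s, 0 < sg * derive1 (curve_r S1) s) ->
  sg * s <= sg * s' -> curve_r S1 s <= curve_r S1 s'.
Proof.
move=> s1 sr ss; have hr := surface_r hS1 s; have hr' := surface_r hS1 s'.
rewrite leNgt -(tortoise_ltE hM hr' hr) -leNgt.
have mono x y : x < y -> _ := @null_monotone R M hM S1 hS1 sg x y s1 sr.
have [lt|lt|->] := ltgtP s s'; last by [].
  have := mono _ _ lt; move: ss; case: (mulr1_eq1N s1) => ->; rewrite /null_u /null_v /=; lra.
have := mono _ _ lt; move: ss; case: (mulr1_eq1N s1) => ->; rewrite /null_u /null_v /=; lra.
Qed.

Variable Omega : set (R * R).
Hypothesis OM : Omega `<=` [set q | 2 * M < q.2].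
Hypothesis btw : forall q, Omega q ->
  (exists s1, null_u M (curve S1 s1) < null_u M q /\ null_v M (curve S1 s1) < null_v M q) /\
  (exists s2, null_u M q < null_u M (curve S2 s2) /\ null_v M q < null_v M (curve S2 s2)).

(** The triangles over longer and longer pieces of the first surface cover the
    region, because no point of the second surface lies beyond the first. *)
Lemma triangle_cover : exists sL sR : nat -> R, [/\
  forall n, curve_r S1 (sL n) <= curve_r S1 (sR n),
  nondecreasing_seq (fun n => triangle M S1 (sL n) (sR n)) &
  Omega `<=` \bigcup_n triangle M S1 (sL n) (sR n)].
Proof.
have [sg [s1 sr]] := surface_sign hM hS1.
have mono s s' := @surface_monotone sg s s' s1 (fun s => (sr s).1).
have sgK (x : R) : sg * (sg * x) = x by rewrite mulrA s1 mul1r.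
exists (fun n => sg * - n%:R), (fun n => sg * n%:R); split.
- by move=> n; apply: mono; rewrite !sgK -subr_ge0 opprK addr_ge0.
- move=> m n mn; apply/subsetPset => z [hz [hs uL vR]]; split => //; split => //.
    apply: lt_le_trans uL _; apply: (surface_order hM hS1 _).1; apply: mono.
    by rewrite !sgK lerN2 ler_nat.
  apply: lt_le_trans vR _; apply: (surface_order hM hS1 _).2; apply: mono.
  by rewrite !sgK ler_nat.
move=> q Oq; have [hs [s2 [u2 v2]]] := btw Oq.
have m11 : (-1) * (-1) = 1 :> R by rewrite mulrNN mulr1.
have [sR [_ vR]] := reach (mulr1 1) s2; have [sL [uL _]] := reach m11 s2.
have nL : `|sL| <= `|sL| + `|sR| by rewrite lerDl.
have nR : `|sR| <= `|sL| + `|sR| by rewrite lerDr.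
move: vR uL; rewrite mul1r mulN1r opprB !subr_gt0 => vR uL.
pose n := (Num.truncn (`|sL| + `|sR|)).+1.
have hn : `|sL| + `|sR| <= n%:R by exact: ltW (truncnS_gt _).
have n1 (x : R) : `|x| <= `|sL| + `|sR| -> - n%:R <= sg * x <= n%:R.
  move=> xn; rewrite -ler_norml normrM (_ : `|sg| = 1) ?mul1r ?(le_trans xn)//.
  by case: (mulr1_eq1N s1) => ->; rewrite ?normrN normr1.
exists n => //; split; first exact: OM.
split => //.
  apply: lt_trans u2 (lt_le_trans uL _); apply: (surface_order hM hS1 _).1; apply: mono.
  by rewrite sgK; have /andP[] := n1 sL nL.
apply: lt_trans v2 (lt_le_trans vR _); apply: (surface_order hM hS1 _).2; apply: mono.
by rewrite sgK; have /andP[] := n1 sR nR.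
Qed.

Lemma bulk_le_energy :
  (\int[mu]_t \int[mu]_(r in xsection Omega t) (T t r / (9 * lapse2 M r))%:E <=
   (72 / 5)%:E * surface_energy S1)%E.
Proof.
have [et [er [pt [pr [j [jt [jr [k [kt [kr [[Ce Cp Cj Ck] [cT H]]]]]]]]]]]] := cur.
have [sL [sR [rLR nA cov]]] := triangle_cover.
pose A n := triangle M S1 (sL n) (sR n); pose g := reduced_bulk M T.
have g0 z : 2 * M < z.2 -> 0 <= g z by exact: (reduced_bulk_ge0 hM H).
have pos (D : set (R * R)) : D `<=` [set q | 2 * M < q.2] -> forall z, (0 <= ((EFin \o g) \_ D) z)%E.
  by move=> DM z; rewrite patchE; case: ifPn => // /set_mem/DM hz; rewrite lee_fin g0.
have AM n : A n `<=` [set q | 2 * M < q.2] by move=> z [].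
have UM : \bigcup_n A n `<=` [set q | 2 * M < q.2] by move=> z [n _]; exact: AM.
apply: (@le_trans _ _ (\int[mu]_t \int[mu]_r (((EFin \o g) \_ (\bigcup_n A n)) (t, r)))%E).
  have i0 t r : (0 <= ((fun r => (T t r / (9 * lapse2 M r))%:E) \_ (xsection Omega t)) r)%E.
    rewrite patchE; case: ifPn => // /set_mem; rewrite /xsection /= => /set_mem/OM hr.
    by rewrite lee_fin; exact: (g0 (t, r)).
  apply: ge0_integral_le => t; rewrite integral_mkcond; first exact: integral_ge0.
  apply: ge0_integral_le => // r; rewrite [leLHS]patchE; case: ifPn => [/set_mem|_]; last exact: pos.
  by rewrite /xsection /= => /set_mem/cov h; rewrite patchE mem_set.
apply: tonelli_exhaustion => //.
- by move=> n; exact: open_triangle.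
- by move=> n z /AM hz; exact: (reduced_bulk_cont hM cT).
- by move=> n z /AM; exact: g0.
move=> n; apply: (le_trans (triangle_bound hM Ce Cp Cj Ck cT H hS1 (rLR n))).
rewrite (_ : 2 * (36 / 5) / 9 * _ = 72 / 5 * (9^-1 * (Pot S1 (sR n) - Pot S1 (sL n)))); last by field.
rewrite EFinM; apply: lee_wpmul2l; first by rewrite lee_fin.
exact: surface_energy_ge.
Qed.

Lemma energy_and_bulk (E1 E2 B : \bar R) : reaches S1 S2 -> E1 = surface_energy S1 -> E2 = surface_energy S2 ->
  B = (\int[mu]_t \int[mu]_(r in xsection Omega t) (T t r / (9 * lapse2 M r))%:E)%E ->
  E2 = E1 /\ (B <= (72 / 5)%:E * E1)%E.
Proof.
move=> reach' -> -> ->; split; last exact: bulk_le_energy.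
by apply/eqP; rewrite eq_le !surface_energy_le.
Qed.

End Exhaustion.
End Conclusion.

Theorem theorem2 (R : realType) (M : R) (hM : 0 < M)
  (S1 S2 : sph_surface R)
  (hS1 : spacelike_surface M S1) (hS2 : spacelike_surface M S2)
  (N1 N2 : R -> R -> R -> 'I_4 -> R)
  (hN1 : future_unit_normal M S1 N1) (hN2 : future_unit_normal M S2 N2)
  (hfut : in_future M S1 S2)
  (Omega : set (R * R)) (hOmega : region_between M Omega S1 S2)
  (G : tensor2 R) (hG : smooth_2form M G)
  (F : tensor2 R) (hF : F = pullback G)
  (hmax : maxwell M F) :
  energy M F S2 N2 = energy M F S1 N1 /\
  (bulk M F Omega <= ((72 / 5)%R)%:E * energy M F S1 N1)%E.
Proof.
have [oO OM bO] := hOmega.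
have Fc : frame_comps M F (field_E G) (field_B G) (field_a G) (field_b G) (field_c M G) (field_d M G).
  by rewrite hF; exact: (@frame_comps_fields R M hM G hG).
have ckF n := @ck_fields R M hM G hG n.
have perF := periodic_fields M G.
have cur := currents hM Fc ckF hmax perF.
have oP := penrose_open hM oO OM.
have sP : penrose M @` Omega `<=` @square R by move=> _ [q _ <-]; exact: penrose_square.
have bP : closure (penrose M @` Omega) `\` (penrose M @` Omega) =
    closure (range (penrose M \o curve S1)) `|` closure (range (penrose M \o curve S2)).
  by rewrite -bO; congr (_ `\` _); exact: esym (proj1 (interior_id _) oP).
have reach sg (s1 : sg * sg = 1) := reach_both hM hS1 hS2 oP sP bP s1.
have r12 : reaches M S1 S2 by move=> sg s1; case: (reach sg s1).
have r21 : reaches M S2 S1 by move=> sg s1; case: (reach sg s1).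
have E1 := energyE hM Fc ckF hmax perF hS1 hN1.
have E2 := energyE hM Fc ckF hmax perF hS2 hN2.
apply: (energy_and_bulk hM cur hS1 hS2 r21 OM _ r12 E1 E2 (bulkE hM Fc ckF hmax perF OM)) => q Oq.
by apply: (between hM hS1 hS2 oP sP bP hfut); exists q.
Qed.
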